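(* For every $p\in[1,\infty)$ there exist a sequence $S=\{a_k\}_{k\in\mathbb{N}}$ of points in the unit ball $\mathbb{B}$ of $\mathbb{C}^2$ and a constant $C>0$ such that: for every disc $(\sigma,\phi)$ passing through $S$, the sequence $\sigma$ is interpolating for $A^p(\mathbb{D})$ with constant $C$; but $S$ is not an interpolating sequence for $H^p(\mathbb{B})$.
   Context: $\mathbb{D}$ is the open unit disc of $\mathbb{C}$, $\mathbb{B}$ the open unit ball of $\mathbb{C}^2$, $\lambda$ is Lebesgue area measure on $\mathbb{D}$, and $d\sigma$ (below) is Lebesgue (surface) measure on $\partial\mathbb{B}$. $H^p(\mathbb{B})$ is the space of holomorphic $f$ on $\mathbb{B}$ with $\|f\|_{H^p(\mathbb{B})}^p:=\sup_{r<1}\int_{\partial\mathbb{B}}|f(r\zeta)|^p\,d\sigma(\zeta)<\infty$. $A^p(\mathbb{D})$ is the space of holomorphic $g$ on $\mathbb{D}$ with $\|g\|_{A^p(\mathbb{D})}^p:=\int_{\mathbb{D}}|g|^p\,d\lambda<\infty$. A disc passing through $S=\{a_k\}_{k\in\mathbb{N}}\subset\mathbb{B}$ is a pair $(\sigma,\phi)$ where $\sigma=\{\alpha_k\}_{k\in\mathbb{N}}$ is a sequence in $\mathbb{D}$ and $\phi:\mathbb{D}\to\mathbb{B}$ is holomorphic with $\phi(\alpha_k)=a_k$ for all $k$. The sequence $S=\{a_k\}$ in $\mathbb{B}\subset\mathbb{C}^2$ is interpolating for $H^p(\mathbb{B})$ with constant $C$ if for every complex sequence $\lambda=\{\lambda_k\}$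 with $\|\lambda\|_{H,p}^p:=\sum_k|\lambda_k|^p(1-|a_k|^2)^2<\infty$ there is $f\in H^p(\mathbb{B})$ with $f(a_k)=\lambda_k$ for all $k$ and $\|f\|_{H^p(\mathbb{B})}\le C\|\lambda\|_{H,p}$; it is interpolating for $H^p(\mathbb{B})$ if this holds for some $C$. The sequence $\sigma=\{\alpha_k\}$ in $\mathbb{D}$ is interpolating for $A^p(\mathbb{D})$ with constant $C$ if for every complex sequence $\lambda=\{\lambda_k\}$ with $\|\lambda\|_{A,p}^p:=\sum_k|\lambda_k|^p(1-|\alpha_k|^2)^2<\infty$ there is $g\in A^p(\mathbb{D})$ with $g(\alpha_k)=\lambda_k$ for all $k$ and $\|g\|_{A^p(\mathbb{D})}\le C\|\lambda\|_{A,p}$. *)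

(* Defs.v *)
From HB Require Import structures.
From mathcomp Require Import all_boot all_order all_algebra.
From mathcomp Require Import complex.
From mathcomp Require Import all_classical all_reals all_analysis.
From mathcomp Require Import measurable_realfun.

Set Implicit Arguments.
Unset Strict Implicit.
Unset Printing Implicit Defensive.

Import Order.TTheory GRing.Theory Num.Theory.
Import numFieldNormedType.Exports.
Import Normc.

Local Open Scope classical_set_scope.
Local Open Scope ring_scope.
Local Open Scope complex_scope.

                                                                    
                                                                        
                                                               
                        
Notation Cplx R := ((complex R)^o).
Notation Cplx2 R := (Cplx R * Cplx R)%type.

                                                                               
                                                                               
Notation Real2 R := (measurableTypeR R * measurableTypeR R)%type.
Notation Real4 R := (Real2 R * Real2 R)%type.

                                                                         
                                                                        
Lemma product_sigma_finite (d1 d2 : measure_display) (T1 : measurableType d1)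
    (T2 : measurableType d2) (R : realType)
    (m1 : {sigma_finite_measure set T1 -> \bar R})
    (m2 : {sigma_finite_measure set T2 -> \bar R}) :
  sigma_finite setT (m1 \x m2)%E.
Proof.
have /sigma_finiteP[F [TF ndF Foo]] := sigma_finiteT m1.
have /sigma_finiteP[G [TG ndG Goo]] := sigma_finiteT m2.
exists (fun n => F n `*` G n).
  rewrite -setXTT TF TG predeqE => -[x y]; split.
    move=> [/= [n _ Fnx] [k _ Gky]]; exists (maxn n k) => //; split.
    - by move: x Fnx; exact/subsetPset/ndF/leq_maxl.
    - by move: y Gky; exact/subsetPset/ndG/leq_maxr.
  by move=> [n _ []/= ? ?]; split; exists n.
move=> k; have [? ?] := Foo k; have [? ?] := Goo k.
split; first exact: measurableX.
by rewrite product_measure1E// lte_mul_pinfty// ge0_fin_numE.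
Qed.

Definition leb (R : realType) :
  {sigma_finite_measure set (measurableTypeR R) -> \bar R} := @lebesgue_measure R.

Section Definitions.
Context {R : realType}.

Definition holomorphic {V W : normedModType R[i]} (U : set V) (f : V -> W) :=
  forall z, U z -> differentiable f z.

                                                                            
Definition disc : set (Cplx R) := [set z | normc z < 1].

                                                                               
                                                                 
Definition norm2 (z : Cplx2 R) : R :=
  Num.sqrt (normc z.1 ^+ 2 + normc z.2 ^+ 2).

Definition ball2 : set (Cplx2 R) := [set z | norm2 z < 1].

Definition sphere2 : set (Cplx2 R) := [set z | norm2 z = 1].

Definition ofR2 (x : Real2 R) : Cplx R := x.1 +i* x.2.

Definition ofR4 (x : Real4 R) : Cplx2 R := (ofR2 x.1, ofR2 x.2).

Definition area : set (Real2 R) -> \bar R :=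
  (leb R \x leb R)%E.

HB.instance Definition _ := Measure.copy area
  (product_measure1 (leb R) (leb R)).

Let area_sigma_finite : sigma_finite setT area.
Proof. exact: (product_sigma_finite (leb R) (leb R)). Qed.

HB.instance Definition _ :=
  Measure_isSigmaFinite.Build _ _ _ area area_sigma_finite.

Definition volume : set (Real4 R) -> \bar R := (area \x area)%E.

HB.instance Definition _ := Measure.copy volume (product_measure1 area area).

Let volume_sigma_finite : sigma_finite setT volume.
Proof. exact: product_sigma_finite. Qed.

HB.instance Definition _ :=
  Measure_isSigmaFinite.Build _ _ _ volume volume_sigma_finite.

                         
Definition radial (x : Real4 R) : Real4 R :=
  let t := (norm2 (ofR4 x))^-1 in
  ((t * x.1.1, t * x.1.2), (t * x.2.1, t * x.2.2)).

                                                                               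
                                                                              
                                                   
Definition surface (A : set (Real4 R)) : \bar R :=
  (4%:E * volume [set x | ball2 (ofR4 x) /\ A (radial x)])%E.

Lemma measurable_norm2_ofR4 :
  measurable_fun [set: Real4 R] (fun x => norm2 (ofR4 x) : R).
Proof.
have h1 : measurable_fun [set: Real4 R] (fun x : Real4 R => x.1.1 : R).
  by apply: (measurableT_comp measurable_fst).
have h2 : measurable_fun [set: Real4 R] (fun x : Real4 R => x.1.2 : R).
  by apply: (measurableT_comp measurable_snd).
have h3 : measurable_fun [set: Real4 R] (fun x : Real4 R => x.2.1 : R).
  by apply: (measurableT_comp measurable_fst).
have h4 : measurable_fun [set: Real4 R] (fun x : Real4 R => x.2.2 : R).
  by apply: (measurableT_comp measurable_snd).
rewrite (_ : (fun x => _) = (fun x : Real4 R => Num.sqrt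
   (x.1.1 ^+ 2 + x.1.2 ^+ 2 + (x.2.1 ^+ 2 + x.2.2 ^+ 2)))); last first.
  apply/funext => -[[a b] [c d]]; rewrite /norm2 /=.
  by rewrite !sqr_sqrtr ?addr_ge0 ?sqr_ge0.
have hs : measurable_fun [set: R] (@Num.sqrt R).
  by apply: continuous_measurable_fun; exact: sqrt_continuous.
apply: (measurableT_comp hs).
by do 2! apply: measurable_funD; exact: measurable_funX.
Qed.


Lemma measurable_radial : measurable_fun [set: Real4 R] radial.
Proof.
have ht : measurable_fun [set: Real4 R] (fun x => (norm2 (ofR4 x))^-1 : R).
  under eq_fun do rewrite -powR_inv1 ?sqrtr_ge0//.
  exact: (measurableT_comp (measurable_powR _) measurable_norm2_ofR4).
by apply/measurable_fun_pairP; split; apply/measurable_fun_pairP; split;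
  apply: measurable_funM => //; do ?[exact: (measurableT_comp measurable_fst)
  | exact: (measurableT_comp measurable_snd)].
Qed.

Lemma measurable_ball2 : measurable [set x : Real4 R | ball2 (ofR4 x)].
Proof.
rewrite (_ : mkset _ = (fun x => norm2 (ofR4 x)) @^-1` `]-oo, 1[); last first.
  by apply/seteqP; split => x; rewrite /ball2/= in_itv.
by rewrite -[X in measurable X]setTI; exact: measurable_norm2_ofR4.
Qed.


Let surface_measure : {measure set (Real4 R) -> \bar R} :=
  mscale 4%:nng
    (measure_function_pushforward__canonical__measure_function_Measure
      (mrestr volume measurable_ball2) measurable_radial).

Let surfaceE : surface = surface_measure.
Proof.
apply/funext => A; rewrite /surface_measure/= /mscale/= /pushforward /mrestr.
by rewrite /surface; congr (_ * volume _)%E; rewrite setIC.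
Qed.

Let surface0 : surface set0 = 0%E.
Proof. by rewrite surfaceE measure0. Qed.

Let surface_ge0 A : (0 <= surface A)%E.
Proof. by rewrite surfaceE. Qed.

Let surface_sigma_additive : semi_sigma_additive surface.
Proof. by rewrite surfaceE; exact: measure_semi_sigma_additive. Qed.

HB.instance Definition _ := isMeasure.Build _ _ _ surface
  surface0 surface_ge0 surface_sigma_additive.

Definition Hp_norm (p : R) (f : Cplx2 R -> Cplx R) : \bar R :=
  poweR (ereal_sup
    [set (\int[surface]_(x in [set x : Real4 R | sphere2 (ofR4 x)])
            (normc (f (r%:C *: ofR4 x)) `^ p)%:E)%E
      | r in [set r : R | 0 <= r < 1]]) p^-1.

Definition Hp (p : R) (f : Cplx2 R -> Cplx R) :=
  holomorphic ball2 f /\ (Hp_norm p f < +oo)%E.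

Definition Ap_norm (p : R) (g : Cplx R -> Cplx R) : \bar R :=
  poweR (\int[area]_(x in [set x : Real2 R | disc (ofR2 x)])
           (normc (g (ofR2 x)) `^ p)%:E)%E p^-1.

Definition Ap (p : R) (g : Cplx R -> Cplx R) :=
  holomorphic disc g /\ (Ap_norm p g < +oo)%E.

Definition disc_through (a : nat -> Cplx2 R)
    (sigma : nat -> Cplx R) (phi : Cplx R -> Cplx2 R) :=
  [/\ forall k, disc (sigma k), holomorphic disc phi,
      forall z, disc z -> ball2 (phi z) & forall k, phi (sigma k) = a k].

Definition seqH_norm (p : R) (a : nat -> Cplx2 R) (lam : nat -> Cplx R) :
    \bar R :=
  poweR (\sum_(0 <= k <oo)
    (normc (lam k) `^ p * (1 - norm2 (a k) ^+ 2) ^+ 2)%:E)%E p^-1.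

Definition seqA_norm (p : R) (alpha : nat -> Cplx R) (lam : nat -> Cplx R) :
    \bar R :=
  poweR (\sum_(0 <= k <oo)
    (normc (lam k) `^ p * (1 - normc (alpha k) ^+ 2) ^+ 2)%:E)%E p^-1.

Definition Hp_interpolating_with (p : R) (a : nat -> Cplx2 R) (C : R) :=
  forall lam : nat -> Cplx R, (seqH_norm p a lam < +oo)%E ->
    exists f, [/\ Hp p f, forall k, f (a k) = lam k
                & (Hp_norm p f <= C%:E * seqH_norm p a lam)%E].

Definition Hp_interpolating (p : R) (a : nat -> Cplx2 R) :=
  exists C : R, Hp_interpolating_with p a C.

Definition Ap_interpolating_with (p : R) (alpha : nat -> Cplx R) (C : R) :=
  forall lam : nat -> Cplx R, (seqA_norm p alpha lam < +oo)%E ->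
    exists g, [/\ Ap p g, forall k, g (alpha k) = lam k
                & (Ap_norm p g <= C%:E * seqA_norm p alpha lam)%E].

End Definitions.

(* Main.v *)
Require Import Defs.
From HB Require Import structures.
From mathcomp Require Import all_boot all_order all_algebra.
From mathcomp Require Import complex.
From mathcomp Require Import all_classical all_reals all_analysis.
From mathcomp Require Import measurable_realfun ring lra.

(** The sequence is a net in the ball, for the pseudo-hyperbolic metric. With
    P = 1 - (pseudo-hyperbolic distance)^2 ([pB] in the ball, [pD] in the disc),
    its points satisfy P(a_j, a_k) <= eta for j <> k, whereas every point z of the
    ball has P(z, a_k) >= c for some k > 0 ([separated_net]). Discs only see the first property, and the second
    one is incompatible with interpolation in H^p.

    Discs. By the Schwarz-Pick lemma ([schwarz_pick]) the points alpha_k of a disc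
    through the net satisfy P(alpha_j, alpha_k) <= P(a_j, a_k) <= eta. If eta is
    small, depending on p only, this makes them interpolating for A^p
    ([bergman_interpolation]). Put A_j = 1 - |alpha_j|^2 and look for
    f = sum_j mu_j g_j with g_j(z) = (A_j / (1 - conj(alpha_j) z))^3. Since
    g_j(alpha_j) = 1, the conditions f(alpha_k) = lam_k read mu + G mu = lam,
    where G has the off-diagonal entries g_j(alpha_k). Schur's test with the
    weights A_j^(-1/(4p)) shows that G contracts the weighted l^p space, so that
    mu exists ([neumann]), and the same test bounds the norm of f
    ([bergman_norm]). The sums in the test are compared, over disjoint squares
    around the alpha_j, with the integrals
    int (1 - |w|^2)^(-1/2) |1 - conj(w) z|^(-3/2 - g) dw = O((1 - |z|^2)^(-g))
    ([bkernel_integral], [discrete_sum]); a small eta yields a small factor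
    ([term_gain]).

    Ball. Interpolating the data 1, 0, 0, ... gives f in H^p with f(a_0) = 1, where
    a_0 = 0, and f(a_k) = 0 for k > 0. The means M(s) of |f| over the spheres of
    radius s are bounded. For a unit vector zeta, compose f with the automorphism
    of the ball that takes 0 to s zeta: the new function has a zero within a fixed
    distance from 0, because the net comes close to s zeta. A zero improves the
    mean value inequality by a definite factor, hence (1 + gam) |f(s zeta)| is at
    most the mean modulus of the new function over a ball ([ball_gain]). Averaging
    over zeta, the right-hand side becomes an average of values of M, by the
    invariance of the sphere under multiplication by unit quaternions
    ([qmul_mean]). So (1 + gam) M(s) <= sup M for all s, hence sup M = 0, while
    M(0) > 0 ([gain_absurd]).

    Both halves rest on Cauchy's formula for circles, which is derived from
    Goursat's theorem applied in polar coordinates. *)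

Set Implicit Arguments.
Unset Strict Implicit.
Unset Printing Implicit Defensive.

Import Order.TTheory GRing.Theory Num.Theory.
Import numFieldNormedType.Exports.
Import Normc.

Local Open Scope classical_set_scope.
Local Open Scope ring_scope.
Local Open Scope complex_scope.

Local Notation Re := (@complex.Re _).
Local Notation Im := (@complex.Im _).

(** * Moduli and complex derivatives *)

Section ComplexBasics.
Context {R : realType}.
Implicit Types z w : R[i].

Lemma normc_ge0 z : 0 <= normc z.
Proof. by case: z => a b; rewrite sqrtr_ge0. Qed.

Lemma normr_normc z : `|z| = ((normc z)%:C)%C.
Proof. by rewrite normc_def; case: z. Qed.

Lemma sqr_normcE z : normc z ^+ 2 = Re z ^+ 2 + Im z ^+ 2.
Proof. by case: z => a b /=; rewrite sqr_sqrtr // addr_ge0 // sqr_ge0. Qed.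

Lemma normc_conj z : normc (conjc z) = normc z.
Proof. by case: z => a b /=; rewrite sqrrN. Qed.

Lemma normc_real (x : R) : normc (x%:C)%C = `|x|.
Proof. by rewrite /= expr0n/= addr0 sqrtr_sqr. Qed.

Lemma normcDle z w : normc (z + w) <= normc z + normc w.
Proof. exact: le_normcD. Qed.

Lemma normc_opp z : normc (- z) = normc z.
Proof. exact: normcN. Qed.

Lemma normc_sub z w : normc (z - w) = normc (w - z).
Proof. by rewrite -normc_opp opprB. Qed.

Lemma normc_tri z w : `|normc z - normc w| <= normc (z - w).
Proof.
rewrite ler_norml; apply/andP; split.
  rewrite lerNl opprB lerBlDr normc_sub.
  by rewrite -[X in normc X <= _](subrK z); apply: normcDle.
by rewrite lerBlDr -[X in normc X <= _](subrK w); apply: normcDle.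
Qed.

Lemma Re_le_normc z : `|Re z| <= normc z.
Proof.
case: z => a b /=; rewrite -sqrtr_sqr ler_wsqrtr// lerDl sqr_ge0//.
Qed.

Lemma Im_le_normc z : `|Im z| <= normc z.
Proof.
case: z => a b /=; rewrite -sqrtr_sqr ler_wsqrtr// lerDr sqr_ge0//.
Qed.

Lemma normc_le_ReIm z : normc z <= `|Re z| + `|Im z|.
Proof.
rewrite -(@ler_pXn2r _ 2)// ?nnegrE ?normc_ge0 ?addr_ge0//.
rewrite sqr_normcE sqrrD !real_normK ?num_real//.
by rewrite lerD2r lerDl mulrn_wge0// mulr_ge0.
Qed.

Lemma normcX z n : normc (z ^+ n) = normc z ^+ n.
Proof.
elim: n => [|n ih]; first by rewrite !expr0 normc1.
by rewrite !exprS normcM ih.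
Qed.

Lemma normc_eq0 z : (normc z == 0) = (z == 0).
Proof. by apply/eqP/eqP => [/eq0_normc|->//]; rewrite ?normc0. Qed.

Lemma normc_gt0 z : (0 < normc z) = (z != 0).
Proof. by rewrite lt_neqAle eq_sym normc_ge0 andbT normc_eq0. Qed.

Lemma mulcJ z : z * conjc z = ((normc z ^+ 2)%:C)%C.
Proof. by rewrite sqr_normcE; case: z => a b; simpc; congr (Complex _ _); ring. Qed.

Lemma cReD z w : Re (z + w) = Re z + Re w. Proof. by case: z; case: w. Qed.
Lemma cReB z w : Re (z - w) = Re z - Re w. Proof. by case: z; case: w. Qed.
Lemma cImD z w : Im (z + w) = Im z + Im w. Proof. by case: z; case: w. Qed.
Lemma cImB z w : Im (z - w) = Im z - Im w. Proof. by case: z; case: w. Qed.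
Lemma cReM z w : Re (z * w) = Re z * Re w - Im z * Im w.
Proof. by case: z; case: w. Qed.
Lemma cImM z w : Im (z * w) = Re z * Im w + Im z * Re w.
Proof. by case: z; case: w. Qed.

Lemma normc_phase z : exists2 b : R[i], normc b = 1 & b * z = ((normc z)%:C)%C.
Proof.
have [->|z0] := eqVneq z 0; first by exists 1; rewrite ?normc1// mulr0 normc0.
have nz : normc z != 0 by rewrite normc_eq0.
exists (conjc z / (normc z)%:C)%C.
  by rewrite normcM normcV normc_conj normc_real ger0_norm ?normc_ge0// divff.
rewrite mulrAC mulrC [conjc z * z]mulrC mulcJ -rmorphV ?unitfE//= -rmorphM/=.
by congr ((_)%:C)%C; rewrite expr2 mulKf.
Qed.

End ComplexBasics.

Section Differentiability.
Context {R : realType}.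
Notation CC := (Cplx R).

Lemma differentiable_near (V W : normedModType R[i]) (f : V -> W) (z : V) :
  differentiable f z -> forall e : R, 0 < e -> exists2 d : R, 0 < d &
    forall w, `|w - z| < (d%:C)%C ->
      `|f w - f z - 'd f z (w - z)| <= (e%:C)%C * `|w - z|.
Proof.
move=> df e e0; have /eqaddoP H := diff_locally df.
have ec0 : 0 < (e%:C)%C :> R[i] by rewrite ltcR.
have /nbhs_ballP[d /= d0 hd] := H _ ec0.
have dR : (Re d)%:C%C = d by apply: RRe_real; exact: gtr0_real.
exists (Re d); first by rewrite -ltcR dR.
move=> w; rewrite dR => wd.
have := hd (w - z); rewrite -ball_normE /= sub0r normrN => /(_ wd).
by rewrite !fctE /= subrK opprD addrA.
Qed.

(** Fixes the normed module structures on source and target. *)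
Definition cdiff (f : CC -> CC) (z : CC) := differentiable f z.

(** Differentiability in terms of the real-valued modulus; the norm of R[i]
    takes complex values. *)
Lemma near_cdiff (f : CC -> CC) (z : CC) (c : R[i]) :
  (forall e : R, 0 < e -> exists2 d : R, 0 < d &
    forall w : R[i], normc (w - z) < d ->
      normc (f w - f z - c * (w - z)) <= e * normc (w - z)) ->
  cdiff f z.
Proof.
move=> H; apply/(@derivable1_diffP); apply/cvg_ex; exists (c : CC).
apply/cvgrPdist_le => e e0.
have eR : (Re e)%:C%C = e by apply: RRe_real; exact: gtr0_real.
have [|d d0 hd] := H (Re e); first by rewrite -ltcR eR.
exists (d%:C)%C => /=; first by rewrite ltcR.
move=> h; rewrite /ball_/= sub0r normrN normr_normc ltcR => hlt h0.
have := hd (h + z); rewrite addrK => /(_ hlt) hh.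
rewrite -[h *: 1]/(h * 1) mulr1 normr_normc -eR lecR.
have hp : 0 < normc h by rewrite normc_gt0.
have -> : c - h^-1 *: (f (h + z) - f z) = - (h^-1 * (f (h + z) - f z - c * h)).
  rewrite mulrBr [c * h]mulrC mulKf// opprB.
  by [].
by rewrite normc_opp normcM normcV mulrC ler_pdivrMr.
Qed.

Lemma cdiff_eps (f : CC -> CC) (z : CC) : cdiff f z ->
  exists c : R[i], forall e : R, 0 < e -> exists2 d : R, 0 < d &
    forall w : R[i], normc (w - z) < d ->
      normc (f w - f z - c * (w - z)) <= e * normc (w - z).
Proof.
move=> df; exists ('d f z (1 : CC)) => e e0.
have [d d0 hd] := differentiable_near df e0; exists d => // w wd.
have := hd w; rewrite (normr_normc (w - z)) ltcR => /(_ wd).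
have -> : 'd f z (w - z) = 'd f z (1 : CC) * (w - z).
  have {1}-> : w - z = (w - z) *: (1 : CC) by rewrite -[RHS]/(_ * _) mulr1.
  by rewrite linearZ /= -[LHS]/(_ * _) mulrC.
by rewrite normr_normc -rmorphM/= lecR.
Qed.

Lemma differentiable2_eps (f : Cplx2 R -> CC) (z : Cplx2 R) :
  differentiable f z -> forall e : R, 0 < e -> exists2 d : R, 0 < d &
    forall w : Cplx2 R, normc (w.1 - z.1) < d -> normc (w.2 - z.2) < d ->
      normc (f w - f z) <= e.
Proof.
move=> df e e0; have cf := differentiable_continuous df.
have /cvgrPdist_lt/(_ (e%:C)%C) := cf.
rewrite ltcR => /(_ e0)/nbhs_ballP[d /= d0 hd].
have dR : (Re d)%:C%C = d by apply: RRe_real; exact: gtr0_real.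
exists (Re d); first by rewrite -ltcR dR.
move=> w w1 w2; have := hd w.
rewrite normr_normc ltcR normc_sub => h; apply/ltW/h; split => /=.
  by rewrite -ball_normE/= normr_normc -dR ltcR normc_sub.
by rewrite -ball_normE/= normr_normc -dR ltcR normc_sub.
Qed.

End Differentiability.

(** * Goursat's theorem for divergence-free fields *)

Section SegmentIntegral.
Context {R : realType}.
Implicit Types (f g : R -> R) (a b c d k e : R).

(** Riemann integrals of continuous functions, taken as Lebesgue integrals
    over a closed segment. *)
Definition segint f a b : R := (\int[@lebesgue_measure R]_(x in `[a, b]) f x)%R.

Definition cont_on f a b := forall x, a <= x <= b -> {for x, continuous f}.

Lemma cont_on_integrable f a b : cont_on f a b ->
  (@lebesgue_measure R).-integrable `[a, b] (EFin \o f).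
Proof.
move=> cf; apply: continuous_compact_integrable; first exact: segment_compact.
apply: continuous_in_subspaceT => x; rewrite inE/= in_itv/= => xab.
exact: cf.
Qed.

Lemma cont_onS f a b c d : a <= c -> d <= b -> cont_on f a b -> cont_on f c d.
Proof.
move=> ac db cf x /andP[cx xd]; apply: cf.
by rewrite (le_trans ac cx) (le_trans xd db).
Qed.

Lemma cont_onD f g a b : cont_on f a b -> cont_on g a b ->
  cont_on (fun x => f x + g x) a b.
Proof. by move=> cf cg x xab; apply: continuousD; [exact: cf|exact: cg]. Qed.

Lemma cont_onB f g a b : cont_on f a b -> cont_on g a b ->
  cont_on (fun x => f x - g x) a b.
Proof. by move=> cf cg x xab; apply: continuousB; [exact: cf|exact: cg]. Qed.

Lemma cont_on_cst k a b : cont_on (fun=> k) a b.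
Proof. by move=> x _; exact: cst_continuous. Qed.

Lemma segintD f g a b : cont_on f a b -> cont_on g a b ->
  segint (fun x => f x + g x) a b = segint f a b + segint g a b.
Proof. by move=> cf cg; rewrite /segint RintegralD//; exact: cont_on_integrable. Qed.

Lemma segintB f g a b : cont_on f a b -> cont_on g a b ->
  segint (fun x => f x - g x) a b = segint f a b - segint g a b.
Proof. by move=> cf cg; rewrite /segint RintegralB//; exact: cont_on_integrable. Qed.

Lemma segintZ k f a b : cont_on f a b ->
  segint (fun x => k * f x) a b = k * segint f a b.
Proof. by move=> cf; rewrite /segint RintegralZl//; exact: cont_on_integrable. Qed.

Lemma segint_cst k a b : a <= b -> segint (fun=> k) a b = k * (b - a).
Proof.
move=> ab; rewrite /segint Rintegral_cst//= lebesgue_measure_itv/=.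
move: ab; rewrite le_eqVlt => /predU1P[->|ab]; first by rewrite lte_fin ltxx subrr.
by rewrite lte_fin ab.
Qed.

Lemma le_segint f g a b : cont_on f a b -> cont_on g a b ->
  (forall x, a <= x <= b -> f x <= g x) -> segint f a b <= segint g a b.
Proof.
move=> cf cg fg; rewrite /segint le_Rintegral//; exact: cont_on_integrable.
Qed.

Lemma eq_segint f g a b : (forall x, a <= x <= b -> f x = g x) ->
  segint f a b = segint g a b.
Proof.
move=> fg; apply: eq_Rintegral => x; rewrite inE/= in_itv/=; exact: fg.
Qed.

Lemma segint_near f a b k e : a <= b -> cont_on f a b ->
  (forall x, a <= x <= b -> `|f x - k| <= e) ->
  `|segint f a b - k * (b - a)| <= e * (b - a).
Proof.
move=> ab cf fk; rewrite ler_norml; apply/andP; split.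
  rewrite lerBrDr -mulNr -mulrDl -segint_cst//; apply: le_segint => //.
    exact: cont_on_cst.
  by move=> x /fk; rewrite ler_norml lerBrDr => /andP[].
rewrite lerBlDr -mulrDl -segint_cst//; apply: le_segint => //.
  exact: cont_on_cst.
by move=> x /fk; rewrite ler_norml lerBlDr => /andP[].
Qed.

Lemma segint_split f a c b : a <= c <= b -> cont_on f a b ->
  segint f a b = segint f a c + segint f c b.
Proof.
move=> /andP[ac cb] cf; have If := cont_on_integrable cf.
rewrite /segint -(@Rintegral_itv_obnd_cbnd _ c); last first.
  by apply: integrableS If => //; apply: subset_itvr; rewrite bnd_simp.
have <- := Rintegral_itvB If (x := c); rewrite ?bnd_simp//.
by rewrite addrC subrK.
Qed.

End SegmentIntegral.

Section Goursat.
Context {R : realType}.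
Variables (P Q : R -> R -> R).

(** The outward flux of the field (P, Q) through the boundary of the rectangle
    [a, b] x [c, d]. *)
Definition flux a b c d : R :=
  segint (fun y => P b y - P a y) c d + segint (fun x => Q x d - Q x c) a b.

(** The pointwise form of a vanishing divergence, which is what complex
    differentiability provides. *)
Definition divfree_at (x0 y0 : R) := exists px py qy qx : R, px + qy = 0 /\
  forall e, 0 < e -> exists2 d, 0 < d & forall x y,
    `|x - x0| < d -> `|y - y0| < d ->
    `|P x y - P x0 y0 - px * (x - x0) - py * (y - y0)|
       <= e * (`|x - x0| + `|y - y0|) /\
    `|Q x y - Q x0 y0 - qx * (x - x0) - qy * (y - y0)|
       <= e * (`|x - x0| + `|y - y0|).

Lemma divfree_cont x0 y0 : divfree_at x0 y0 ->
  [/\ {for x0, continuous (P ^~ y0)}, {for y0, continuous (P x0)},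
      {for x0, continuous (Q ^~ y0)} & {for y0, continuous (Q x0)}].
Proof.
have aux (f : R -> R) (t0 p : R) : (exists2 d, 0 < d & forall t, `|t - t0| < d ->
    `|f t - f t0 - p * (t - t0)| <= `|t - t0|) -> {for t0, continuous f}.
  move=> [d d0 H]; apply/cvgrPdist_le => e e0.
  have p0 : 0 < 1 + `|p| by rewrite ltr_pwDl.
  exists (Num.min d (e / (1 + `|p|))) => /=; first by rewrite lt_min d0 divr_gt0.
  move=> t /=; rewrite distrC lt_min => /andP[td te].
  rewrite distrC -[f t - f t0](subrK (p * (t - t0))).
  apply: le_trans (ler_normD _ _) _; rewrite normrM.
  apply: le_trans (lerD (H _ td) (lexx _)) _.
  rewrite -{1}[`|t - t0|]mul1r -mulrDl mulrC.
  by apply/ltW; rewrite -ltr_pdivlMr.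
move=> [px [py [qy [qx [_ H]]]]]; have [d d0 hd] := H _ ltr01.
split.
- apply: (aux _ _ px); exists d => // t td.
  have [|+ _] := hd t y0 td; first by rewrite subrr normr0.
  by rewrite !subrr !normr0 mulr0 subr0 addr0 mul1r.
- apply: (aux _ _ py); exists d => // t td.
  have [|+ _] := hd x0 t _ td; first by rewrite subrr normr0.
  by rewrite !subrr !normr0 mulr0 subr0 add0r mul1r.
- apply: (aux _ _ qx); exists d => // t td.
  have [|_] := hd t y0 td; first by rewrite subrr normr0.
  by rewrite !subrr !normr0 mulr0 subr0 addr0 mul1r.
- apply: (aux _ _ qy); exists d => // t td.
  have [|_] := hd x0 t _ td; first by rewrite subrr normr0.
  by rewrite !subrr !normr0 mulr0 subr0 add0r mul1r.
Qed.

Definition divfree_on a b c d :=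
  forall x y, a <= x <= b -> c <= y <= d -> divfree_at x y.

Lemma divfree_onS a b c d a' b' c' d' : a <= a' -> b' <= b -> c <= c' -> d' <= d ->
  divfree_on a b c d -> divfree_on a' b' c' d'.
Proof.
move=> aa bb cc dd H x y /andP[? ?] /andP[? ?]; apply: H.
  by rewrite (le_trans aa)//= (le_trans _ bb).
by rewrite (le_trans cc)//= (le_trans _ dd).
Qed.

(** Continuity along the two directions is what additivity of the flux
    requires; it still holds on rectangles with a singular point inside. *)
Definition sepcont_on a b c d := forall x y, a <= x <= b -> c <= y <= d ->
  [/\ {for x, continuous (P ^~ y)}, {for y, continuous (P x)},
      {for x, continuous (Q ^~ y)} & {for y, continuous (Q x)}].


Lemma divfree_sepcont a b c d : divfree_on a b c d -> sepcont_on a b c d.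
Proof. by move=> H x y xab ycd; exact/divfree_cont/H. Qed.

Lemma flux_splitx a m b c d : a <= m <= b -> c <= d -> sepcont_on a b c d ->
  flux a b c d = flux a m c d + flux m b c d.
Proof.
move=> /andP[am mb] cd S; have ab := le_trans am mb.
have cP t : a <= t <= b -> cont_on (P t) c d by move=> tab y ycd; case: (S t y tab ycd).
have cQ t : c <= t <= d -> cont_on (Q ^~ t) a b.
  by move=> tcd x xab; case: (S x t xab tcd).
have [Pa Pm Pb] : [/\ cont_on (P a) c d, cont_on (P m) c d & cont_on (P b) c d].
  by split; apply: cP; rewrite ?lexx ?ab ?am ?mb.
have Qcd : cont_on (fun x => Q x d - Q x c) a b.
  by apply: cont_onB; apply: cQ; rewrite ?lexx ?cd.
have [Qc Qd] : cont_on (Q ^~ c) a b /\ cont_on (Q ^~ d) a b.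
  by split; apply: cQ; rewrite ?lexx ?cd.
rewrite /flux (segint_split (c := m) _ Qcd) ?am// !segintB//; first by ring.
all: by do [exact: cont_onS Qc|exact: cont_onS Qd].
Qed.

Lemma flux_splity a b c m d : a <= b -> c <= m <= d -> sepcont_on a b c d ->
  flux a b c d = flux a b c m + flux a b m d.
Proof.
move=> ab /andP[cm md] S; have cd := le_trans cm md.
have cP t : a <= t <= b -> cont_on (P t) c d by move=> tab y ycd; case: (S t y tab ycd).
have cQ t : c <= t <= d -> cont_on (Q ^~ t) a b.
  by move=> tcd x xab; case: (S x t xab tcd).
have [Qc Qm Qd] : [/\ cont_on (Q ^~ c) a b, cont_on (Q ^~ m) a b & cont_on (Q ^~ d) a b].
  by split; apply: cQ; rewrite ?lexx ?cd ?cm ?md.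
have Pab : cont_on (fun y => P b y - P a y) c d.
  by apply: cont_onB; apply: cP; rewrite ?lexx ?ab.
have [Pa Pb] : cont_on (P a) c d /\ cont_on (P b) c d.
  by split; apply: cP; rewrite ?lexx ?ab.
rewrite /flux (segint_split (c := m) _ Pab) ?cm// !segintB//; first by ring.
all: by do [exact: cont_onS Pa|exact: cont_onS Pb].
Qed.

Lemma sepcont_onS a b c d a' b' c' d' : a <= a' -> b' <= b -> c <= c' -> d' <= d ->
  sepcont_on a b c d -> sepcont_on a' b' c' d'.
Proof.
move=> aa bb cc dd H x y /andP[? ?] /andP[? ?]; apply: H.
  by rewrite (le_trans aa)//= (le_trans _ bb).
by rewrite (le_trans cc)//= (le_trans _ dd).
Qed.

(** To first order the flux of a differentiable field is its divergence times
    the area, so that it is small compared with the squared perimeter. *)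
Lemma flux_local x0 y0 : divfree_at x0 y0 -> forall e, 0 < e ->
  exists2 r, 0 < r & forall a b c d, a <= x0 <= b -> c <= y0 <= d ->
    b - a + (d - c) < r -> sepcont_on a b c d ->
    `|flux a b c d| <= e * (b - a + (d - c)) ^+ 2.
Proof.
move=> [px [py [qy [qx [div0 H]]]]] e e0.
have [|r r0 hr] := H (e / 2); first by rewrite divr_gt0.
exists r => // a b c d /andP[ax xb] /andP[cy yd] small S.
have ab : a <= b := le_trans ax xb; have cd : c <= d := le_trans cy yd.
have wx t : a <= t <= b -> `|t - x0| <= b - a.
  by move=> /andP[at' tb]; rewrite ler_norml; apply/andP; split; lra.
have wy t : c <= t <= d -> `|t - y0| <= d - c.
  by move=> /andP[at' tb]; rewrite ler_norml; apply/andP; split; lra.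
have bnd x y : a <= x <= b -> c <= y <= d ->
   `|P x y - P x0 y0 - px * (x - x0) - py * (y - y0)| <= e / 2 * (b - a + (d - c)) /\
   `|Q x y - Q x0 y0 - qx * (x - x0) - qy * (y - y0)| <= e / 2 * (b - a + (d - c)).
  move=> xab ycd; have hx := wx _ xab; have hy := wy _ ycd.
  have [||h1 h2] := hr x y; [lra|lra|].
  have h3 : e / 2 * (`|x - x0| + `|y - y0|) <= e / 2 * (b - a + (d - c)).
    by rewrite ler_pM2l ?divr_gt0// lerD.
  by split; [exact: le_trans h1 h3|exact: le_trans h2 h3].
have cP t : a <= t <= b -> cont_on (P t) c d by move=> tab y ycd; case: (S t y tab ycd).
have cQ t : c <= t <= d -> cont_on (Q ^~ t) a b.
  by move=> tcd x xab; case: (S x t xab tcd).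
have aab : a <= a <= b by rewrite lexx. have bab : a <= b <= b by rewrite lexx ab.
have ccd : c <= c <= d by rewrite lexx. have dcd : c <= d <= d by rewrite lexx cd.
have F1 : `|segint (fun y => P b y - P a y) c d - px * (b - a) * (d - c)|
    <= e * (b - a + (d - c)) * (d - c).
  apply: segint_near => //; first by apply: cont_onB; exact: cP.
  move=> y ycd; have [+ _] := bnd b y bab ycd; have [+ _] := bnd a y aab ycd.
  clear; rewrite !ler_norml => /andP[u1 u2] /andP[v1 v2].
  by apply/andP; split; lra.
have F2 : `|segint (fun x => Q x d - Q x c) a b - qy * (d - c) * (b - a)|
    <= e * (b - a + (d - c)) * (b - a).
  apply: segint_near => //; first by apply: cont_onB; exact: cQ.
  move=> x xab; have [_ +] := bnd x d xab dcd; have [_ +] := bnd x c xab ccd.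
  clear; rewrite !ler_norml => /andP[u1 u2] /andP[v1 v2].
  by apply/andP; split; lra.
have -> : flux a b c d =
   (segint (fun y => P b y - P a y) c d - px * (b - a) * (d - c)) +
   (segint (fun x => Q x d - Q x c) a b - qy * (d - c) * (b - a)).
  have -> : px = - qy by apply/eqP; rewrite -addr_eq0; apply/eqP.
  by rewrite /flux; ring.
apply: le_trans (ler_normD _ _) _; apply: le_trans (lerD F1 F2) _.
by rewrite -mulrDr expr2 mulrA [d - c + _]addrC.
Qed.

(** Bisection: if the flux through the whole rectangle were nonzero, the quarter
    carrying the most flux could be selected again and again, and the point on
    which the selected rectangles close down would contradict [flux_local]. *)
Lemma goursat a b c d : a <= b -> c <= d -> divfree_on a b c d -> flux a b c d = 0.
Proof.
move=> ab cd D; set L := b - a; set H := d - c.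
have L0 : 0 <= L by rewrite subr_ge0. have H0 : 0 <= H by rewrite subr_ge0.
pose h n : R := (2 ^+ n)^-1.
have h0 n : 0 < h n by rewrite invr_gt0 exprn_gt0.
have hS n : h n = h n.+1 + h n.+1.
  by rewrite /h exprS invfM; lra.
pose F n (p : R * R) := flux p.1 (p.1 + L * h n) p.2 (p.2 + H * h n).
pose inside n (p : R * R) :=
  [/\ a <= p.1, p.1 + L * h n <= b, c <= p.2 & p.2 + H * h n <= d].
pose next n (p q : R * R) := [/\ p.1 <= q.1, q.1 + L * h n.+1 <= p.1 + L * h n,
   p.2 <= q.2, q.2 + H * h n.+1 <= p.2 + H * h n & `|F n p| / 4 <= `|F n.+1 q|].
have step n (p : R * R) : exists q : R * R, inside n p -> next n p q.
  have [|] := pselect (inside n p); last by move=> NI; exists p.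
  case: p => x y I; have [/= ax xb cy yd] := I.
  have LS : L * h n = L * h n.+1 + L * h n.+1 by rewrite {1}hS mulrDr.
  have HS : H * h n = H * h n.+1 + H * h n.+1 by rewrite {1}hS mulrDr.
  have l0 : 0 <= L * h n.+1 by rewrite mulr_ge0// ltW.
  have k0 : 0 <= H * h n.+1 by rewrite mulr_ge0// ltW.
  set l := L * h n.+1 in LS l0; set k := H * h n.+1 in HS k0.
  have S : sepcont_on x (x + l + l) y (y + k + k).
    apply: divfree_sepcont; apply: divfree_onS D => //.
      by rewrite -addrA -LS.
    by rewrite -addrA -HS.
  have E : F n (x, y) = F n.+1 (x, y) + F n.+1 (x, y + k) + F n.+1 (x + l, y)
                        + F n.+1 (x + l, y + k).
    have mid (t u : R) : 0 <= u -> (t <= t + u <= t + u + u) /\ t <= t + u + u.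
      by move=> u0; rewrite -addrA lerD2l !lerDl u0 addr_ge0.
    have [xm xx] := mid x _ l0; have [ym yy] := mid y _ k0.
    have /andP[x1 x2] := xm.
    rewrite /F/= LS HS -/l -/k !addrA (flux_splitx xm yy S).
    rewrite (flux_splity x1 ym (sepcont_onS (lexx _) x2 (lexx _) (lexx _) S)).
    rewrite (flux_splity x2 ym (sepcont_onS x1 (lexx _) (lexx _) (lexx _) S)).
    by rewrite !addrA.
  have [q [q1 q2 q3]] : exists q : R * R, [/\ q.1 = x \/ q.1 = x + l,
      q.2 = y \/ q.2 = y + k & `|F n (x, y)| / 4 <= `|F n.+1 q|].
    have [|h1] := leP (`|F n (x, y)| / 4) (`|F n.+1 (x, y)|).
      by move=> ?; exists (x, y); split => //=; left.
    have [|h2] := leP (`|F n (x, y)| / 4) (`|F n.+1 (x, y + k)|).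
      by move=> ?; exists (x, y + k); split => //=; [left|right].
    have [|h3] := leP (`|F n (x, y)| / 4) (`|F n.+1 (x + l, y)|).
      by move=> ?; exists (x + l, y); split => //=; [right|left].
    have [|h4] := leP (`|F n (x, y)| / 4) (`|F n.+1 (x + l, y + k)|).
      by move=> ?; exists (x + l, y + k); split => //=; right.
    exfalso; have := ler_normD (F n.+1 (x, y) + F n.+1 (x, y + k) + F n.+1 (x + l, y))
                               (F n.+1 (x + l, y + k)).
    rewrite -E; have := ler_normD (F n.+1 (x, y) + F n.+1 (x, y + k)) (F n.+1 (x + l, y)).
    have := ler_normD (F n.+1 (x, y)) (F n.+1 (x, y + k)).
    move: h1 h2 h3 h4; clear; lra.
  exists q => _; split => //=; rewrite ?LS ?HS -/l -/k.
  - by case: q1 => ->; rewrite ?lerDl.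
  - by case: q1 => ->; rewrite addrA ?lerD2r ?lerDl.
  - by case: q2 => ->; rewrite ?lerDl.
  - by case: q2 => ->; rewrite addrA ?lerD2r ?lerDl.
pose s := fix s n : R * R := if n is m.+1 then sval (cid (step m (s m))) else (a, c).
have sI n : inside n (s n).
  elim: n => [|n ih]; first by rewrite /inside /= /h expr0 invr1 !mulr1; split => //; rewrite /L /H; lra.
  have [u1 u2 u3 u4 _] := svalP (cid (step n (s n))) ih.
  rewrite /= in u1 u2 u3 u4 *; case: ih => i1 i2 i3 i4.
  split; [exact: le_trans u1|exact: le_trans i2|exact: le_trans u3|exact: le_trans i4].
have sN n : next n (s n) (s n.+1) by exact: (svalP (cid (step n (s n))) (sI n)).
have big n : `|F 0 (a, c)| / 4 ^+ n <= `|F n (s n)|.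
  elim: n => [|n ih]; first by rewrite expr0 divr1.
  have [_ _ _ _] := sN n; apply: le_trans.
  by rewrite exprSr invfM mulrA ler_pM2r ?invr_gt0.
have mono1 m n : (m <= n)%N -> (s m).1 <= (s n).1 /\ (s n).1 + L * h n <= (s m).1 + L * h m.
  elim: n => [|n ih]; first by rewrite leqn0 => /eqP ->.
  rewrite leq_eqVlt => /predU1P[->//|]; rewrite ltnS => /ih[i1 i2].
  have [u1 u2 _ _ _] := sN n.
  by split; [exact: le_trans i1 u1|exact: le_trans u2 i2].
have mono2 m n : (m <= n)%N -> (s m).2 <= (s n).2 /\ (s n).2 + H * h n <= (s m).2 + H * h m.
  elim: n => [|n ih]; first by rewrite leqn0 => /eqP ->.
  rewrite leq_eqVlt => /predU1P[->//|]; rewrite ltnS => /ih[i1 i2].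
  have [_ _ u1 u2 _] := sN n.
  by split; [exact: le_trans i1 u1|exact: le_trans u2 i2].
have nested (u : nat -> R) (K : R) : 0 <= K ->
    (forall m n, (m <= n)%N -> u m <= u n /\ u n + K * h n <= u m + K * h m) ->
    exists x, forall n, u n <= x <= u n + K * h n.
  move=> K0 mono.
  have ub n : ubound (range u) (u n + K * h n).
    move=> _ [m _ <-]; have [mn|/ltnW nm] := leqP m n.
      have [h1 _] := mono _ _ mn; apply: (le_trans h1); rewrite lerDl mulr_ge0//.
      exact: ltW.
    have [_ h2] := mono _ _ nm; apply: le_trans h2; rewrite lerDl mulr_ge0//.
    exact: ltW.
  exists (sup (range u)) => n; apply/andP; split.
    apply: ub_le_sup; first by exists (u n + K * h n); exact: ub.
    by exists n.
  by apply: ge_sup; [exists (u 0%N); exists 0%N|exact: ub].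
have [x0 hx] := nested (fun n => (s n).1) L L0 mono1.
have [y0 hy] := nested (fun n => (s n).2) H H0 mono2.
have /flux_local loc : divfree_at x0 y0.
  apply: D.
    have /andP[h1 h2] := hx 0%N; apply/andP; split => //.
    by apply: (le_trans h2); rewrite /= /h expr0 invr1 mulr1 /L; lra.
  have /andP[h1 h2] := hy 0%N; apply/andP; split => //.
  by apply: (le_trans h2); rewrite /= /h expr0 invr1 mulr1 /H; lra.
have -> : flux a b c d = F 0 (a, c).
  rewrite /F /= /h expr0 invr1 !mulr1.
  by congr (flux _ _ _ _); rewrite /L /H; lra.
apply/eqP; rewrite -normr_le0; apply/ler_addgt0Pl => e e0; rewrite addr0.
pose W := (L + H) ^+ 2 + 1.
have W0 : 0 < W by rewrite ltr_wpDl// sqr_ge0.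
have [|r r0 hr] := loc (e / W); first by rewrite divr_gt0.
have [n hn] : exists n, (L + H) * h n < r.
  have /cvgrPdist_lt/(_ _ r0)[N _ /(_ N (leqnn N))] :
      (L + H) * h n @[n --> \oo] --> (0 : R).
    rewrite -(mulr0 (L + H)); apply: cvgMl_tmp.
    rewrite (_ : h = fun n => 2^-1 ^+ n); last by apply/funext => n; rewrite exprVn.
    by apply: cvg_expr; rewrite ger0_norm; lra.
  rewrite /= sub0r normrN => hN; exists N; apply: le_lt_trans hN; exact: ler_norm.
have [i1 i2 i3 i4] := sI n.
have := hr (s n).1 ((s n).1 + L * h n) (s n).2 ((s n).2 + H * h n) (hx n) (hy n).
have -> : (s n).1 + L * h n - (s n).1 + ((s n).2 + H * h n - (s n).2) = (L + H) * h n.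
  by ring.
move=> /(_ hn) hh.
have /hh : sepcont_on (s n).1 ((s n).1 + L * h n) (s n).2 ((s n).2 + H * h n).
  by apply: divfree_sepcont; apply: divfree_onS D.
move/(le_trans (big n)).
have -> : (4 ^+ n)^-1 = h n ^+ 2 :> R.
  by rewrite /h exprVn -exprM mulnC exprM; congr ((_ ^+ n)^-1); rewrite expr2; lra.
rewrite exprMn [X in _ <= X]mulrA ler_pM2r ?exprn_gt0// => /le_trans; apply.
rewrite -mulrA -{2}[e]mulr1 ler_pM2l// mulrC ler_pdivrMr// mul1r /W lerDl//.
Qed.

End Goursat.

(** * Polar coordinates and means over circles *)

Section FirstOrder.
Context {R : realType}.
Implicit Types (f A B u : R -> R -> R) (x y p q e d : R).

(** First-order expansion at (x0, y0), with partial derivatives p and q. *)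
Definition lin2 f x0 y0 p q := forall e, 0 < e -> exists2 d, 0 < d & forall x y,
  `|x - x0| < d -> `|y - y0| < d ->
  `|f x y - f x0 y0 - p * (x - x0) - q * (y - y0)| <= e * (`|x - x0| + `|y - y0|).

Definition jcont f x0 y0 := forall e, 0 < e -> exists2 d, 0 < d & forall x y,
  `|x - x0| < d -> `|y - y0| < d -> `|f x y - f x0 y0| <= e.

(** Chain rule; the case where u, A, B come from functions of one variable
    gives the derivatives of g in polar coordinates. *)
Lemma lin2_comp u A B x0 y0 p q a1 a2 b1 b2 :
  lin2 u (A x0 y0) (B x0 y0) p q -> lin2 A x0 y0 a1 a2 -> lin2 B x0 y0 b1 b2 ->
  lin2 (fun x y => u (A x y) (B x y)) x0 y0 (p * a1 + q * b1) (p * a2 + q * b2).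
Proof.
move=> Hu HA HB e e0.
pose K := 1 + `|a1| + `|a2| + `|b1| + `|b2|.
have [na1 na2 nb1 nb2] : [/\ 0 <= `|a1|, 0 <= `|a2|, 0 <= `|b1| & 0 <= `|b2|] by [].
have [np nq] : 0 <= `|p| /\ 0 <= `|q| by [].
have K0 : 0 < K by rewrite /K !ltr_wpDr.
pose D := 2 * K + `|p| + `|q|.
have D0 : 0 < D by rewrite /D !ltr_wpDr// mulr_gt0.
have e10 : 0 < e / D by rewrite divr_gt0.
have [d1 d10 h1] := Hu _ e10.
have m0 : 0 < Num.min 1 (e / D) by rewrite lt_min ltr01.
have [d2 d20 h2] := HA _ m0; have [d3 d30 h3] := HB _ m0.
have dd0 : 0 < d1 / (2 * K) by rewrite divr_gt0// mulr_gt0.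
exists (Num.min (d1 / (2 * K)) (Num.min d2 d3)); first by rewrite !lt_min dd0 d20.
move=> x y; rewrite !lt_min => /and3P[x1 x2 x3] /and3P[y1 y2 y3].
set N := `|x - x0| + `|y - y0|.
have N0 : 0 <= N by rewrite addr_ge0.
have kA := h2 _ _ x2 y2; have kB := h3 _ _ x3 y3.
have mle1 : Num.min 1 (e / D) * N <= N by rewrite ler_piMl// ge_min lexx.
have mle2 : Num.min 1 (e / D) * N <= e / D * N by rewrite ler_wpM2r// ge_min lexx orbT.
have lin c1 c2 : `|c1 * (x - x0) + c2 * (y - y0)| <= (`|c1| + `|c2|) * N.
  apply: le_trans (ler_normD _ _) _; rewrite !normrM /N.
  have := mulr_ge0 (normr_ge0 c1) (normr_ge0 (y - y0)).
  have := mulr_ge0 (normr_ge0 c2) (normr_ge0 (x - x0)).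
  by clear; lra.
have size (f : R -> R -> R) c1 c2 : `|f x y - f x0 y0 - c1 * (x - x0) - c2 * (y - y0)| <=
    Num.min 1 (e / D) * N -> `|f x y - f x0 y0| <= (1 + `|c1| + `|c2|) * N.
  move=> h; rewrite -[f x y - _](subrK (c1 * (x - x0) + c2 * (y - y0))).
  apply: le_trans (ler_normD _ _) _; rewrite opprD addrA.
  by have := lin c1 c2; have := le_trans h mle1; clear; lra.
have sA : `|A x y - A x0 y0| <= K * N.
  apply: le_trans (size _ _ _ kA) _; rewrite ler_wpM2r// /K.
  by move: nb1 nb2; clear; lra.
have sB : `|B x y - B x0 y0| <= K * N.
  apply: le_trans (size _ _ _ kB) _; rewrite ler_wpM2r// /K.
  by move: na1 na2; clear; lra.
have KN : K * N < d1.
  have : N < d1 / (2 * K) + d1 / (2 * K) by exact: ltrD.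
  by rewrite -(ltr_pM2l K0); congr (_ < _); field; rewrite gt_eqF.
have ku := h1 _ _ (le_lt_trans sA KN) (le_lt_trans sB KN).
have ku' : `|u (A x y) (B x y) - u (A x0 y0) (B x0 y0) - p * (A x y - A x0 y0)
    - q * (B x y - B x0 y0)| <= e / D * (2 * K * N).
  apply: (le_trans ku); rewrite ler_pM2l//.
  by have := lerD sA sB; clear; lra.
have kp : `|p * (A x y - A x0 y0 - a1 * (x - x0) - a2 * (y - y0))| <= `|p| * (e / D * N).
  by rewrite normrM ler_wpM2l// (le_trans kA).
have kq : `|q * (B x y - B x0 y0 - b1 * (x - x0) - b2 * (y - y0))| <= `|q| * (e / D * N).
  by rewrite normrM ler_wpM2l// (le_trans kB).
have -> : u (A x y) (B x y) - u (A x0 y0) (B x0 y0) - (p * a1 + q * b1) * (x - x0)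
    - (p * a2 + q * b2) * (y - y0) =
  (u (A x y) (B x y) - u (A x0 y0) (B x0 y0) - p * (A x y - A x0 y0)
    - q * (B x y - B x0 y0))
  + (p * (A x y - A x0 y0 - a1 * (x - x0) - a2 * (y - y0))
  + q * (B x y - B x0 y0 - b1 * (x - x0) - b2 * (y - y0))) by ring.
apply: le_trans (ler_normD _ _) _; apply: le_trans (lerD (lexx _) (ler_normD _ _)) _.
have -> : e * N = e / D * (2 * K * N) + (`|p| * (e / D * N) + `|q| * (e / D * N)).
  have -> : e / D * (2 * K * N) + (`|p| * (e / D * N) + `|q| * (e / D * N)) =
            e / D * D * N by rewrite /D; ring.
  by rewrite divfK// gt_eqF.
by rewrite !lerD.
Qed.

Lemma lin2_mul (a b : R) : lin2 (fun x y => x * y) a b b a.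
Proof.
move=> e e0; exists e => // x y xe ye.
have -> : x * y - a * b - b * (x - a) - a * (y - b) = (x - a) * (y - b) by ring.
rewrite normrM mulrDr; apply: ler_wpDl; first by rewrite mulr_ge0// ltW.
by apply: ler_wpM2r => //; exact: ltW.
Qed.

Lemma is_derive_eps (f : R -> R) (x df : R) : is_derive x 1 f df ->
  forall e, 0 < e -> exists2 d, 0 < d & forall t, `|t - x| < d ->
    `|f t - f x - df * (t - x)| <= e * `|t - x|.
Proof.
move=> Hd e e0; have dv := @ex_derive _ _ _ _ _ _ _ Hd.
have := @derive_val _ _ _ _ _ _ _ Hd; rewrite /derive => dE.
have := dv; rewrite /derivable => /cvgP; rewrite dE => /cvgrPdist_le/(_ _ e0)[d /= d0 hd].
exists d => // t td; have [->|tx] := eqVneq t x.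
  by rewrite !subrr mulr0 subr0 normr0 mulr0.
have h0 : t - x != 0 by rewrite subr_eq0.
have := hd (t - x); rewrite /ball_/= sub0r normrN => /(_ td h0).
rewrite -[(t - x) *: 1]/((t - x) * 1) mulr1 subrK -[_ *: _]/(_ * _) => hh.
have tp : 0 < `|t - x| by rewrite normr_gt0.
have -> : f t - f x - df * (t - x) = - ((df - (t - x)^-1 * (f t - f x)) * (t - x)).
  by rewrite mulrBl opprB [in RHS]mulrAC mulVf// mul1r.
by rewrite normrN normrM ler_pM2r.
Qed.

Lemma lin2_fst (f : R -> R) x0 y0 df : is_derive x0 1 f df ->
  lin2 (fun x _ => f x) x0 y0 df 0.
Proof.
move=> /is_derive_eps H e e0; have [d d0 hd] := H _ e0; exists d => // x y xd yd.
rewrite mul0r subr0; apply: le_trans (hd _ xd) _.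
by rewrite ler_pM2l// lerDl.
Qed.

Lemma lin2_snd (f : R -> R) x0 y0 df : is_derive y0 1 f df ->
  lin2 (fun _ y => f y) x0 y0 0 df.
Proof.
move=> /is_derive_eps H e e0; have [d d0 hd] := H _ e0; exists d => // x y xd yd.
rewrite mul0r subr0; apply: le_trans (hd _ yd) _.
by rewrite ler_pM2l// lerDr.
Qed.

Lemma lin2_jcont f x0 y0 p q : lin2 f x0 y0 p q -> jcont f x0 y0.
Proof.
move=> H e e0; have [d d0 hd] := H _ ltr01.
have [np nq] : 0 <= `|p| /\ 0 <= `|q| by [].
pose K := 2 + `|p| + `|q|; have K0 : 0 < K by rewrite /K; lra.
exists (Num.min d (e / K)); first by rewrite lt_min d0 divr_gt0.
move=> x y; rewrite !lt_min => /andP[x1 x2] /andP[y1 y2].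
rewrite -[f x y - _](subrK (p * (x - x0) + q * (y - y0))).
apply: le_trans (ler_normD _ _) _; rewrite opprD addrA.
apply: le_trans (lerD (hd _ _ x1 y1) (ler_normD _ _)) _; rewrite mul1r !normrM.
have eE : e = (2 + `|p| + `|q|) * (e / K) by rewrite mulrC divfK// gt_eqF.
have := ler_wpM2l np (ltW x2); have := ler_wpM2l nq (ltW y2).
by move: eE x2 y2; set E := e / K; clear; lra.
Qed.

Lemma jcont_sep f x0 y0 : jcont f x0 y0 ->
  {for x0, continuous (f ^~ y0)} /\ {for y0, continuous (f x0)}.
Proof.
move=> H; split; apply/cvgrPdist_le => e /H[d d0 hd]; exists d => //= t td.
  by rewrite distrC; apply: hd; rewrite ?subrr ?normr0// distrC.
by rewrite distrC; apply: hd; rewrite ?subrr ?normr0// distrC.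
Qed.

Lemma jcont_comp u A B x0 y0 : jcont u (A x0 y0) (B x0 y0) ->
  jcont A x0 y0 -> jcont B x0 y0 -> jcont (fun x y => u (A x y) (B x y)) x0 y0.
Proof.
move=> Hu HA HB e /Hu[d d0 hd].
have [|d1 d10 h1] := HA (d / 2); first by rewrite divr_gt0.
have [|d2 d20 h2] := HB (d / 2); first by rewrite divr_gt0.
exists (Num.min d1 d2); first by rewrite lt_min d10.
move=> x y; rewrite !lt_min => /andP[x1 x2] /andP[y1 y2].
by apply: hd; [apply: (le_lt_trans (h1 _ _ x1 y1))|apply: (le_lt_trans (h2 _ _ x2 y2))]; lra.
Qed.

End FirstOrder.

Section Polar.
Context {R : realType}.
Notation CC := (Cplx R).

Definition cis (r t : R) : R[i] := (r * cos t) +i* (r * sin t).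

Lemma normc_cis r t : 0 <= r -> normc (cis r t) = r.
Proof.
move=> r0; rewrite /cis/= !exprMn -mulrDr cos2Dsin2 mulr1 sqrtr_sqr ger0_norm//.
Qed.

Lemma cisE r t : cis r t = ((r%:C)%C * cis 1 t).
Proof. by apply/eqP; rewrite eq_complex/= !mul1r !mul0r subr0 addr0 !eqxx. Qed.

Lemma lin2_cosp (r t : R) : lin2 (fun r t : R => r * cos t) r t (cos t) (- (r * sin t)).
Proof.
have h1 : lin2 (fun r _ : R => r) r t 1 0 by apply: (@lin2_fst _ id); exact: is_derive_id.
have h2 : lin2 (fun _ t : R => cos t) r t 0 (- sin t) by apply: lin2_snd; exact: is_derive_cos.
have := lin2_comp (lin2_mul r (cos t)) h1 h2.
by rewrite !mulr0 mulr1 addr0 add0r mulrN.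
Qed.

Lemma lin2_sinp (r t : R) : lin2 (fun r t : R => r * sin t) r t (sin t) (r * cos t).
Proof.
have h1 : lin2 (fun r _ : R => r) r t 1 0 by apply: (@lin2_fst _ id); exact: is_derive_id.
have h2 : lin2 (fun _ t : R => sin t) r t 0 (cos t) by apply: lin2_snd; exact: is_derive_sin.
have := lin2_comp (lin2_mul r (sin t)) h1 h2.
by rewrite !mulr0 mulr1 addr0 add0r.
Qed.

Lemma lin2_complex (g : CC -> CC) (x y : R) : cdiff g ((x +i* y)%C : CC) ->
  exists c : R[i],
    lin2 (fun x y => Re (g (x +i* y)%C)) x y (Re c) (- Im c) /\
    lin2 (fun x y => Im (g (x +i* y)%C)) x y (Im c) (Re c).
Proof.
move=> /cdiff_eps[c H]; exists c.
have key e : 0 < e -> exists2 d, 0 < d & forall x' y',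
   `|x' - x| < d -> `|y' - y| < d ->
   normc (g (x' +i* y')%C - g (x +i* y)%C - c * ((x' - x) +i* (y' - y))%C)
     <= e * (`|x' - x| + `|y' - y|).
  move=> e0; have [d d0 hd] := H _ e0; exists (d / 2); first by rewrite divr_gt0.
  move=> x' y' xd yd.
  have nle : normc ((x' - x) +i* (y' - y))%C <= `|x' - x| + `|y' - y|.
    exact: normc_le_ReIm.
  have := hd (x' +i* y')%C.
  rewrite -[(x' +i* y')%C - _]/((x' - x) +i* (y' - y))%C => /(_ _)/le_trans; apply.
    by apply: (le_lt_trans nle); lra.
  by rewrite ler_pM2l.
split=> e /key[d d0 hd]; exists d => // x' y' xd yd.
  apply: le_trans (hd _ _ xd yd); apply: le_trans (Re_le_normc _).
  have -> := cReB (g (x' +i* y') - g (x +i* y)) (c * ((x' - x) +i* (y' - y))).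
  by rewrite cReB cReM/= le_eqVlt; apply/orP; left; apply/eqP; congr (`|_|); ring.
apply: le_trans (hd _ _ xd yd); apply: le_trans (Im_le_normc _).
have -> := cImB (g (x' +i* y') - g (x +i* y)) (c * ((x' - x) +i* (y' - y))).
by rewrite cImB cImM/= le_eqVlt; apply/orP; left; apply/eqP; congr (`|_|); ring.
Qed.

Variable g : CC -> CC.

(** The real and imaginary parts of g along the two coordinate directions: Q
    is divided by r so that (P, Q) is divergence-free in the plane of (r,
    t). *)
Definition polP (r t : R) := Re (g (cis r t)).
Definition polQ (r t : R) := - Im (g (cis r t)) / r.

(** The Cauchy-Riemann equations in polar coordinates. *)
Lemma polar_divfree r t : 0 < r -> cdiff g (cis r t : CC) ->
  divfree_at polP polQ r t.
Proof.
move=> r0 /lin2_complex[c [hRe hIm]].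
have h1 := @lin2_comp _ (fun x y => Re (g (x +i* y))) (fun r t => r * cos t)
  (fun r t => r * sin t) r t _ _ _ _ _ _ hRe (lin2_cosp r t) (lin2_sinp r t).
have h2 := @lin2_comp _ (fun x y => Im (g (x +i* y))) (fun r t => r * cos t)
  (fun r t => r * sin t) r t _ _ _ _ _ _ hIm (lin2_cosp r t) (lin2_sinp r t).
have rn0 : r != 0 by rewrite gt_eqF.
have h3 : lin2 (fun r _ : R => - r^-1) r t (r ^- 2) 0.
  apply: (@lin2_fst _ (fun r => - r^-1)).
  have hV : is_derive r 1 (fun x : R => x^-1) (- r ^- 2 *: (1 : R)).
    exact: (@is_deriveV R id r 1 1 rn0 (is_derive_id _ _)).
  have := is_deriveN hV.
  by rewrite scaleNr opprK -[_ *: _]/(_ * _) mulr1.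
have h4 := @lin2_comp _ (fun x y => x * y) (fun r t => Im (g (cis r t)))
  (fun r _ => - r^-1) r t _ _ _ _ _ _ (lin2_mul (Im (g (cis r t))) (- r^-1)) h2 h3.
exists (Re c * cos t + - Im c * sin t), (Re c * (- (r * sin t)) + - Im c * (r * cos t)).
exists (- r^-1 * (Im c * (- (r * sin t)) + Re c * (r * cos t)) + Im (g (cis r t)) * 0).
exists (- r^-1 * (Im c * cos t + Re c * sin t) + Im (g (cis r t)) * r ^- 2).
split; first by field.
move=> e e0; have [d1 d10 k1] := h1 _ e0; have [d2 d20 k2] := h4 _ e0.
exists (Num.min d1 d2); first by rewrite lt_min d10.
move=> x y; rewrite !lt_min => /andP[x1 x2] /andP[y1 y2]; split; first exact: k1.
have := k2 _ _ x2 y2.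
by rewrite /polQ /cis !mulrN !mulNr.
Qed.


Definition ccont (z : R[i]) := forall e, 0 < e -> exists2 d, 0 < d &
  forall w : R[i], normc (w - z) < d -> normc (g w - g z) <= e.

Lemma cdiff_ccont (z : CC) : cdiff g z -> ccont z.
Proof.
move=> /cdiff_eps[c H] e e0; have [d d0 hd] := H _ ltr01.
pose K := 1 + normc c; have K0 : 0 < K by rewrite ltr_pwDl// normc_ge0.
exists (Num.min d (e / K)); first by rewrite lt_min d0 divr_gt0.
move=> w; rewrite lt_min => /andP[wd we].
have := normcDle (g w - g z - c * (w - z)) (c * (w - z)).
rewrite subrK normcM => /le_trans; apply.
apply: le_trans (lerD (hd _ wd) (lexx _)) _; rewrite -mulrDl mulrC -ler_pdivlMr//.
exact: ltW.
Qed.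

Lemma jcont_cis (r t e : R) : 0 < e -> exists2 d, 0 < d & forall x y,
  `|x - r| < d -> `|y - t| < d -> normc (cis x y - cis r t) < e.
Proof.
move=> e0; have e3 : 0 < e / 3 by rewrite divr_gt0.
have [d1 d10 h1] := lin2_jcont (lin2_cosp r t) e3.
have [d2 d20 h2] := lin2_jcont (lin2_sinp r t) e3.
exists (Num.min d1 d2); first by rewrite lt_min d10.
move=> x y; rewrite !lt_min => /andP[x1 x2] /andP[y1 y2].
apply: le_lt_trans (normc_le_ReIm _) _.
have -> : Re (cis x y - cis r t) = x * cos y - r * cos t by [].
have -> : Im (cis x y - cis r t) = x * sin y - r * sin t by [].
by have := h1 _ _ x1 y1; have := h2 _ _ x2 y2; move: e0; clear; lra.
Qed.

Lemma ccont_sep (r t : R) : 0 < r -> ccont (cis r t) ->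
  [/\ {for r, continuous (polP ^~ t)}, {for t, continuous (polP r)},
      {for r, continuous (polQ ^~ t)} & {for t, continuous (polQ r)}].
Proof.
move=> r0 H.
have key e : 0 < e -> exists2 d, 0 < d & forall x y, `|x - r| < d -> `|y - t| < d ->
    normc (g (cis x y) - g (cis r t)) <= e.
  move=> /H[d d0 hd]; have [d' d'0 hd'] := jcont_cis r t d0.
  by exists d' => // x y xd yd; exact/hd/hd'.
have jP : jcont polP r t.
  move=> e /key[d d0 hd]; exists d => // x y xd yd.
  by rewrite /polP -cReB; apply: le_trans (Re_le_normc _) (hd _ _ xd yd).
have jI : jcont (fun r t => - Im (g (cis r t))) r t.
  move=> e /key[d d0 hd]; exists d => // x y xd yd.
  by rewrite -opprD normrN -cImB; apply: le_trans (Im_le_normc _) (hd _ _ xd yd).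
have jV : jcont (fun r _ : R => r^-1) r t.
  have rn0 : r != 0 by rewrite gt_eqF.
  apply: lin2_jcont; apply: (@lin2_fst _ (fun r => r^-1)).
  exact: (@is_deriveV R id r 1 1 rn0 (is_derive_id _ _)).
have jQ : jcont polQ r t.
  exact: (jcont_comp (u := fun x y => x * y) (lin2_jcont (lin2_mul _ _)) jI jV).
have [? ?] := jcont_sep jP; have [? ?] := jcont_sep jQ.
by split.
Qed.

End Polar.

Section CircleMean.
Context {R : realType}.
Notation CC := (Cplx R).

Lemma cis_pi (x : R) : cis x pi = cis x (- pi).
Proof. by rewrite /cis cosN sinN sinpi oppr0. Qed.

Lemma cis0r (x : R) : cis x 0 = x%:C.
Proof. by rewrite /cis cos0 sin0 mulr1 mulr0. Qed.

(** The value at the centre is the mean over a circle. One point y of the open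
    disc is allowed at which the function is only known to be continuous: small
    polar rectangles around it carry a flux that tends to zero. *)
Lemma circle_mean (g : CC -> CC) (rho r y : R) : 0 < r -> r < rho -> 0 <= y < r ->
  (forall z : CC, z != 0 -> normc z < rho -> z != y%:C -> cdiff g z) ->
  ccont g 0 -> ccont g y%:C ->
  segint (fun t => Re (g (cis r t))) (- pi) pi = Re (g 0) * (2 * pi).
Proof.
move=> r0 rrho /andP[y0 yr] dg c0 cy.
have pi0 := pi_gt0 R.
have npi : - pi <= pi :> R by rewrite lerNl; lra.
have pt x t : 0 < x -> x <= r -> cis x t != y%:C -> divfree_at (polP g) (polQ g) x t.
  move=> x0 xr xy; apply: polar_divfree => //; apply: dg => //.
    by rewrite -normc_gt0 normc_cis// ltW.
  by rewrite normc_cis ?ltW// (le_lt_trans xr).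
have sep s : 0 < s -> sepcont_on (polP g) (polQ g) s r (- pi) pi.
  move=> s0 x t /andP[sx xr] _; have x0 := lt_le_trans s0 sx.
  have [xy|xy] := eqVneq (cis x t) y%:C; first by apply: ccont_sep; rewrite ?xy.
  exact/divfree_cont/pt.
have df a b c d : 0 < a -> b <= r -> (forall x t, a <= x <= b -> c <= t <= d ->
    cis x t != y%:C) -> divfree_on (polP g) (polQ g) a b c d.
  move=> a0 br H x t xab tcd; have /andP[ax xb] := xab.
  by apply: pt; [exact: lt_le_trans ax|exact: le_trans br|exact: H].
have off x t : 0 < x -> x != y -> cis x t != y%:C.
  move=> x0 xy; apply/eqP => /(congr1 (@normc R)).
  rewrite normc_cis ?normc_real ?ltW// ger0_norm// => xy'.
  by move: xy; rewrite xy' eqxx.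
have offt x t : 0 < x -> 0 < `|t| -> `|t| <= pi -> cis x t != y%:C.
  move=> x0 t0 tpi; apply/eqP => E.
  have xy : x = y.
    apply/eqP/negPn/negP => xy; have := off x t x0 xy; by rewrite E eqxx.
  have : cos t = cos 0.
    have := congr1 (@complex.Re R) E; rewrite /= -xy cos0 => h.
    by apply: (mulfI (lt0r_neq0 x0)); rewrite mulr1.
  have -> : cos t = cos `|t| by case: (ger0P t) => _; rewrite ?cosN.
  move=> hc; suff t00 : `|t| = 0 by rewrite t00 ltxx in t0.
  by apply: cos_inj hc; rewrite in_itv/= ?normr_ge0 ?tpi ?lexx ?ltW.
have tot s : 0 < s -> s < r -> s != y -> flux (polP g) (polQ g) s r (- pi) pi = 0.
  move=> s0 sr sy; have [ys|ys] := leP y s.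
    have {}ys : y < s by rewrite lt_neqAle eq_sym sy.
    apply: goursat; rewrite ?(ltW sr)//; apply: df => // x t /andP[sx _] _.
    by apply: off; [exact: lt_le_trans sx|rewrite gt_eqF// (lt_le_trans ys)].
  have {}y0 : 0 < y := lt_trans s0 ys.
  have [d d0 hd] := cy _ ltr01.
  pose K := normc (g y%:C) + 1.
  have K0 : 0 < K by rewrite ltr_wpDl// normc_ge0.
  have [d' d'0 hd'] := jcont_cis y 0 d0.
  have bnd x t : `|x - y| < d' -> `|t| < d' -> normc (g (cis x t)) <= K.
    move=> xd td; have := hd' x t xd; rewrite subr0 cis0r => /(_ td)/hd h.
    rewrite -[g (cis x t)](subrK (g y%:C)); apply: le_trans (normcDle _ _) _.
    by rewrite addrC lerD2l.
  apply/eqP; rewrite -normr_le0; apply/ler_addgt0Pl => e e0; rewrite addr0.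
  (* The polar rectangle of half-side h around y carries a flux of at most h
     K'; the four rectangles around it carry none. *)
  pose K' := 4 * K + 8 * K / y.
  have K'0 : 0 < K' by apply: addr_gt0; [exact: mulr_gt0|apply: divr_gt0 => //; exact: mulr_gt0].
  pose h := Num.min (Num.min (y - s) (r - y)) (Num.min (Num.min (y / 2) (d' / 2)) (Num.min pi (e / K'))).
  have h0 : 0 < h by rewrite !lt_min !subr_gt0 ys yr pi0 !divr_gt0.
  have [h1 h2 h3 [h4 h5 h6]] : [/\ h <= y - s, h <= r - y, h <= y / 2
      & [/\ h <= d' / 2, h <= pi & h <= e / K']].
    by split; [| | |split]; rewrite /h !ge_min lexx ?orbT.
  have [a1 a2] : s <= y - h /\ y + h <= r by move: h1 h2; clear; lra.
  have [a3 a4] : 0 < y - h /\ y - h <= y + h by move: h0 h3 y0; clear; lra.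
  have [a5 a6] : - pi <= - h /\ - h <= h by rewrite lerN2; split => //; move: h0; clear; lra.
  have hh : h < d' by move: h4 d'0; clear; lra.
  have S := sep s s0.
  have z1 : flux (polP g) (polQ g) s (y - h) (- pi) pi = 0.
    apply: goursat => //; apply: df => //; first by rewrite (le_trans a4 a2).
    move=> x t /andP[sx xh] _; apply: off; first exact: lt_le_trans sx.
    by rewrite lt_eqF// (le_lt_trans xh)// ltrBlDr ltrDl.
  have z2 : flux (polP g) (polQ g) (y + h) r (- pi) pi = 0.
    apply: goursat => //; apply: df => //; first by rewrite (lt_le_trans a3).
    move=> x t /andP[sx xh] _; apply: off; first by rewrite (lt_le_trans a3)// (le_trans a4).
    by rewrite gt_eqF// (lt_le_trans _ sx)// ltrDl.
  have z3 : flux (polP g) (polQ g) (y - h) (y + h) (- pi) (- h) = 0.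
    apply: goursat => //; apply: df => // x t /andP[hx _] /andP[pt' th].
    apply: offt; first exact: lt_le_trans hx.
      by rewrite ltr0_norm ?oppr_gt0 (le_lt_trans th)// oppr_lt0.
    by rewrite ltr0_norm ?(le_lt_trans th) ?oppr_lt0// lerNl.
  have z4 : flux (polP g) (polQ g) (y - h) (y + h) h pi = 0.
    apply: goursat => //; apply: df => // x t /andP[hx _] /andP[th pt'].
    have t0 : 0 < t := lt_le_trans h0 th.
    by apply: offt; rewrite ?gtr0_norm//; exact: lt_le_trans hx.
  have S1 : sepcont_on (polP g) (polQ g) (y - h) r (- pi) pi by exact: sepcont_onS S.
  have S2 : sepcont_on (polP g) (polQ g) (y - h) (y + h) (- pi) pi by exact: sepcont_onS S1.
  have S3 : sepcont_on (polP g) (polQ g) (y - h) (y + h) (- h) pi by exact: sepcont_onS S2.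
  have S4 : sepcont_on (polP g) (polQ g) (y - h) (y + h) (- h) h by exact: sepcont_onS S3.
  rewrite (@flux_splitx _ _ _ s (y - h))//; last by rewrite a1 (le_trans a4).
  rewrite z1 add0r (@flux_splitx _ _ _ (y - h) (y + h)) ?a4// z2 addr0.
  rewrite (@flux_splity _ _ _ _ _ _ (- h))//; last by rewrite a5 (le_trans a6).
  rewrite z3 add0r (@flux_splity _ _ _ _ _ _ h) ?a6// z4 addr0.
  have xin x : y - h <= x <= y + h -> `|x - y| < d' /\ y / 2 <= x.
    move=> /andP[u1 u2]; split; last by move: u1 h3; clear; lra.
    by rewrite ltr_norml; move: u1 u2 hh; clear; lra.
  have tin t : - h <= t <= h -> `|t| < d'.
    by move=> /andP[u1 u2]; rewrite ltr_norml; move: u1 u2 hh; clear; lra.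
  have hin : y - h <= y - h <= y + h /\ y - h <= y + h <= y + h by rewrite !lexx a4.
  have tin' : - h <= - h <= h /\ - h <= h <= h by rewrite !lexx a6.
  have B1 : `|segint (fun t => polP g (y + h) t - polP g (y - h) t) (- h) h - 0 * (h - - h)|
      <= 2 * K * (h - - h).
    apply: segint_near => //.
      by apply: cont_onB => t th; [case: (S4 _ t hin.2 th)|case: (S4 _ t hin.1 th)].
    move=> t th; rewrite subr0; apply: le_trans (ler_normB _ _) _.
    have [q1 _] := xin _ hin.1; have [q2 _] := xin _ hin.2.
    have := le_trans (Re_le_normc _) (bnd _ _ q1 (tin _ th)).
    have := le_trans (Re_le_normc _) (bnd _ _ q2 (tin _ th)).
    by rewrite /polP; clear; lra.
  have Qb x t : y - h <= x <= y + h -> - h <= t <= h -> `|polQ g x t| <= 2 * K / y.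
    move=> xh th; have [q1 q2] := xin _ xh.
    have x0 : 0 < x by apply: lt_le_trans q2; rewrite divr_gt0.
    rewrite /polQ normrM normrN normfV (gtr0_norm x0).
    apply: (@le_trans _ _ (K / x)).
      by rewrite ler_pM2r ?invr_gt0// (le_trans (Im_le_normc _))// bnd// tin.
    rewrite ler_pdivrMr// mulrAC ler_pdivlMr// -mulrA mulrCA ler_pM2l//.
    by move: q2; clear; lra.
  have B2 : `|segint (fun x => polQ g x h - polQ g x (- h)) (y - h) (y + h)
       - 0 * (y + h - (y - h))| <= 4 * K / y * (y + h - (y - h)).
    apply: segint_near => //.
      by apply: cont_onB => x xh; [case: (S4 x _ xh tin'.2)|case: (S4 x _ xh tin'.1)].
    move=> x xh; rewrite subr0; apply: le_trans (ler_normB _ _) _.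
    have := Qb _ _ xh tin'.1; have := Qb _ _ xh tin'.2.
    have -> : 4 * K / y = 2 * K / y + 2 * K / y by ring.
    by clear; lra.
  rewrite !mul0r !subr0 in B1 B2.
  apply: le_trans (ler_normD _ _) _; apply: le_trans (lerD B1 B2) _.
  have -> : 2 * K * (h - - h) + 4 * K / y * (y + h - (y - h)) = h * K'.
    by rewrite /K'; ring.
  by rewrite -ler_pdivlMr.
have I s : 0 < s -> s < r -> s != y ->
    segint (polP g r) (- pi) pi = segint (polP g s) (- pi) pi.
  move=> s0 sr sy; have := tot s s0 sr sy; rewrite /flux.
  rewrite segintB; last 2 first.
  - by move=> t tp; case: (sep s s0 r t) => //; rewrite lexx (ltW sr).
  - by move=> t tp; case: (sep s s0 s t) => //; rewrite lexx (ltW sr).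
  rewrite (@eq_segint _ (fun x => polQ g x pi - polQ g x (- pi)) (fun=> 0) s r); last first.
    by move=> x _; rewrite /polQ cis_pi subrr.
  by rewrite segint_cst ?(ltW sr)// mul0r addr0 => /eqP; rewrite subr_eq0 => /eqP.
apply/eqP; rewrite -subr_eq0 -normr_le0; apply/ler_addgt0Pl => e e0; rewrite addr0.
have [|d d0 hd] := c0 (e / (2 * pi)); first by rewrite divr_gt0// mulr_gt0.
(* Let the inner radius s tend to 0, avoiding s = y. *)
pose y' := if y == 0 then r else y.
have y'0 : 0 < y' by rewrite /y'; case: ifPn => // yn; rewrite lt_neqAle eq_sym yn.
pose s := Num.min d (Num.min r y') / 2.
have m0 : 0 < Num.min d (Num.min r y') by rewrite !lt_min d0 r0.
have [m1 m2 m3] : [/\ Num.min d (Num.min r y') <= d, Num.min d (Num.min r y') <= r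
    & Num.min d (Num.min r y') <= y'] by split; rewrite !ge_min lexx ?orbT.
have s0 : 0 < s by rewrite divr_gt0.
have [sd sr sy'] : [/\ s < d, s < r & s < y'] by split; rewrite /s; move: m0 m1 m2 m3; clear; lra.
have sy : s != y.
  have [yy|yn] := eqVneq y 0; first by rewrite yy gt_eqF.
  by move: sy'; rewrite /y' (negbTE yn) => /lt_eqF ->.
rewrite [segint _ _ _](I s s0 sr sy).
have -> : 2 * pi = pi - - pi :> R by ring.
have eE : e = e / (2 * pi) * (pi - - pi).
  by rewrite opprK -mulr2n -[pi *+ 2]mulr_natl divfK// mulf_neq0// ?gt_eqF.
rewrite [leRHS]eE; apply: segint_near => //.
  by move=> t tp; case: (sep s s0 s t) => //; rewrite lexx (ltW sr).
move=> t _; rewrite /polP -cReB; apply: le_trans (Re_le_normc _) _.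
by apply: hd; rewrite subr0 normc_cis// ltW.
Qed.

Lemma circle_mean0 (g : CC -> CC) (rho r : R) : 0 < r -> r < rho ->
  (forall z : CC, z != 0 -> normc z < rho -> cdiff g z) -> ccont g 0 ->
  segint (fun t => Re (g (cis r t))) (- pi) pi = Re (g 0) * (2 * pi).
Proof.
move=> r0 rrho dg c0; have r00 : 0 <= (0 : R) < r by rewrite lexx.
have c0' : ccont g (0 : R)%:C by rewrite rmorph0.
by apply: (circle_mean r0 rrho r00 _ c0 c0') => z z0 zr _; exact: dg.
Qed.

End CircleMean.

(** * Cauchy's formula, Schwarz's lemma and a strict mean value inequality *)

Section DifferentiableRules.
Context {R : realType}.
Notation CC := (Cplx R).
Implicit Types (f g : CC -> CC) (z : CC).

Lemma cdiffM f g z : cdiff f z -> cdiff g z -> cdiff (fun w => f w * g w) z.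
Proof. exact: differentiableM. Qed.

Lemma cdiffD f g z : cdiff f z -> cdiff g z -> cdiff (fun w => f w + g w) z.
Proof. exact: differentiableD. Qed.

Lemma cdiffB f g z : cdiff f z -> cdiff g z -> cdiff (fun w => f w - g w) z.
Proof. exact: differentiableB. Qed.

Lemma cdiffV f z : cdiff f z -> f z != 0 -> cdiff (fun w => (f w)^-1) z.
Proof. move=> df fz; exact: differentiableV. Qed.

Lemma cdiff_cst (c : CC) z : cdiff (fun=> c) z.
Proof. exact: differentiable_cst. Qed.

Lemma cdiffX f n z : cdiff f z -> cdiff (fun w => f w ^+ n) z.
Proof.
move=> df; elim: n => [|n ih]; first exact: cdiff_cst.
rewrite (_ : (fun _ => _) = (fun w => f w * f w ^+ n)); first exact: cdiffM.
by apply/funext => w; rewrite exprS.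
Qed.

Lemma cdiff_id z : cdiff (fun w => w) z.
Proof.
apply: (@near_cdiff _ _ _ 1) => e e0; exists 1 => // w _.
by rewrite mul1r subrr normc0 mulr_ge0 ?normc_ge0// ltW.
Qed.

Lemma cdiff_comp f g z : cdiff g z -> cdiff f (g z) -> cdiff (fun w => f (g w)) z.
Proof. exact: differentiable_comp. Qed.

Lemma cdiff_comp2 (F : Cplx2 R -> CC) f g z : cdiff f z -> cdiff g z ->
  differentiable F ((f z, g z) : Cplx2 R) -> cdiff (fun w => F (f w, g w)) z.
Proof.
move=> df dg dF; apply: (differentiable_comp (f := fun w => (f w, g w)) _ dF).
exact: differentiable_pair.
Qed.

End DifferentiableRules.

Section Cauchy.
Context {R : realType}.
Notation CC := (Cplx R).

Lemma cont_circle (F : CC -> CC) (r a b : R) : 0 < r ->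
  (forall z : CC, normc z = r -> cdiff F z) ->
  cont_on (fun t => Re (F (cis r t))) a b.
Proof.
move=> r0 dF t _; have /(ccont_sep r0)[] // : ccont F (cis r t).
by apply: cdiff_ccont; apply: dF; rewrite normc_cis// ltW.
Qed.

Lemma cont_circle_norm (F : CC -> CC) (r a b : R) : 0 < r ->
  (forall z : CC, normc z = r -> cdiff F z) ->
  cont_on (fun t => normc (F (cis r t))) a b.
Proof.
move=> r0 dF t _; apply/cvgrPdist_le => e e0.
have /(_ e e0)[d d0 hd] : ccont F (cis r t).
  by apply: cdiff_ccont; apply: dF; rewrite normc_cis// ltW.
have [d' d'0 hd'] := jcont_cis r t d0; exists d' => //= u ut.
rewrite distrC; apply: le_trans (normc_tri _ _) _; apply: hd; apply: hd'.
  by rewrite subrr normr0.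
by rewrite distrC.
Qed.

Lemma cis_neq (r t y : R) : 0 <= y < r -> cis r t - y%:C != 0.
Proof.
move=> /andP[y0 yr]; rewrite subr_eq0; apply/eqP => /(congr1 (@normc R)).
rewrite normc_cis ?(le_trans y0) ?ltW// normc_real ger0_norm// => ry.
by rewrite ry ltxx in yr.
Qed.

Lemma conj_cis (r t : R) : conjc (cis r t) * cis r t = (r ^+ 2)%:C.
Proof.
rewrite mulrC mulcJ; congr (_%:C); rewrite sqr_normcE /= !exprMn -mulrDr.
by rewrite cos2Dsin2 mulr1.
Qed.

(** On the circle, the conjugate of z / (z - y) is the boundary value of a
    function that is holomorphic inside. *)
Lemma conj_kernel (r t y : R) : 0 <= y < r ->
  conjc (cis r t / (cis r t - y%:C)) = (r ^+ 2)%:C / ((r ^+ 2)%:C - y%:C * cis r t).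
Proof.
move=> yr; have /andP[y0 y1] := yr; have r0 : 0 < r := le_lt_trans y0 y1.
have z0 : cis r t != 0 by rewrite -normc_gt0 normc_cis// ltW.
rewrite -(conj_cis r t) -mulrBl invfM [in RHS]mulrACA divff// mulr1.
by rewrite rmorphM fmorphV rmorphB/= oppr0.
Qed.

Lemma kernel_mean_den (r y : R) (z : R[i]) : 0 <= y < r -> normc z <= r ->
  (r ^+ 2)%:C - y%:C * z != 0.
Proof.
move=> /andP[y0 yr] zr; have r0 : 0 < r := le_lt_trans y0 yr.
rewrite subr_eq0; apply/eqP => /(congr1 (@normc R)).
rewrite normcM !normc_real ger0_norm ?sqr_ge0// ger0_norm// => E.
have : y * normc z < r ^+ 2.
  apply: (@le_lt_trans _ _ (y * r)); first by rewrite ler_wpM2l.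
  by rewrite expr2 ltr_pM2r.
by rewrite -E ltxx.
Qed.

(** The mean of the product of a holomorphic function with the conjugate of the
    Cauchy kernel only sees the centre. *)
Lemma conj_kernel_mean (g : CC -> CC) (rho r y : R) : 0 < r -> r < rho -> 0 <= y < r ->
  (forall z : CC, normc z < rho -> cdiff g z) ->
  segint (fun t => Re (g (cis r t) * conjc (cis r t / (cis r t - y%:C)))) (- pi) pi
    = Re (g 0) * (2 * pi).
Proof.
move=> r0 rrho yr dg; have /andP[y0 yr'] := yr.
pose G (z : CC) : CC := g z * ((r ^+ 2)%:C / ((r ^+ 2)%:C - y%:C * z)).
have r2 : (r ^+ 2)%:C != 0 :> R[i] by rewrite -normc_gt0 normc_real gtr0_norm ?exprn_gt0.
have G0 : G 0 = g 0 by rewrite /G mulr0 subr0 divff// mulr1.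
rewrite -G0 (@eq_segint _ _ (fun t => Re (G (cis r t)))); last first.
  by move=> t _; rewrite conj_kernel.
have [rho' [rr' r'rho dG]] : exists rho', [/\ r < rho', rho' <= rho &
    forall z : CC, normc z < rho' -> cdiff G z].
  pose s := (y + r) / 2.
  have [sy sr] : y < s /\ s < r by split; rewrite /s; move: yr'; clear; lra.
  have s0 : 0 < s := le_lt_trans y0 sy.
  exists (Num.min rho (r ^+ 2 / s)); split.
  - by rewrite lt_min rrho/= ltr_pdivlMr// expr2 ltr_pM2l.
  - by rewrite ge_min lexx.
  move=> z; rewrite lt_min => /andP[z1 z2].
  have d1 := cdiffB (cdiff_cst (r ^+ 2)%:C z) (cdiffM (cdiff_cst y%:C z) (cdiff_id z)).
  apply: (cdiffM (dg z z1) (cdiffM (cdiff_cst (r ^+ 2)%:C z) (cdiffV d1 _))).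
  rewrite subr_eq0; apply/eqP => /(congr1 (@normc R)).
  rewrite normcM !normc_real ger0_norm ?sqr_ge0// ger0_norm// => E.
  move: z2; rewrite ltr_pdivlMr// mulrC E; apply/negP; rewrite -leNgt.
  by rewrite ler_wpM2r ?normc_ge0// ltW.
have Gc : ccont G 0 by apply: cdiff_ccont; apply: dG; rewrite normc0 (lt_trans r0).
by apply: (circle_mean0 r0 rr' _ Gc) => z _ zr; exact: dG.
Qed.

(** The function (g(z) - g(y) - g'(y) (z - y)) z / (z - y) tends to 0 at y, so
    that y may serve as the exceptional point of [circle_mean]. *)
Lemma cauchy_re (g : CC -> CC) (rho r y : R) : 0 < r -> r < rho -> 0 <= y < r ->
  (forall z : CC, z != 0 -> normc z < rho -> cdiff g z) -> ccont g 0 ->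
  segint (fun t => Re (g (cis r t) * (cis r t / (cis r t - y%:C)))) (- pi) pi
    = Re (g y%:C) * (2 * pi).
Proof.
move=> r0 rrho yr dg c0; have /andP[y0 yr'] := yr.
have zn0 t : cis r t != 0 by rewrite -normc_gt0 normc_cis// ltW.
have [yy|yn] := eqVneq y 0.
  rewrite yy (@eq_segint _ _ (fun t => Re (g (cis r t)))); last first.
    by move=> t _; rewrite subr0 divff// mulr1.
  exact: circle_mean0 r0 rrho dg c0.
have {yn}y0' : 0 < y by rewrite lt_neqAle eq_sym yn.
have yC : y%:C != 0 :> R[i] by rewrite -normc_gt0 normc_real gtr0_norm.
have dgy : cdiff g (y%:C : CC).
  by apply: dg; rewrite ?normc_real ?gtr0_norm// (lt_trans yr').
have [c Hc] := cdiff_eps dgy.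
pose G (z : CC) : CC := (g z - g y%:C - c * (z - y%:C)) * (z * (z - y%:C)^-1).
have Gdiff (z : CC) : z != 0 -> normc z < rho -> z != y%:C -> cdiff G z.
  move=> z0 zr zy; have dgz := dg z z0 zr.
  have dzy : cdiff (fun w : CC => w - y%:C : CC) z.
    exact: cdiffB (cdiff_id z) (cdiff_cst _ z).
  have zy0 : z - y%:C != 0 by rewrite subr_eq0.
  have d1 := cdiffM (cdiff_id z) (cdiffV dzy zy0).
  have d2 := cdiffM (cdiff_cst c z) dzy.
  exact: (cdiffM (cdiffB (cdiffB dgz (cdiff_cst (g y%:C) z)) d2) d1).
have G0 : G 0 = 0 by rewrite /G mul0r mulr0.
have Gy : G y%:C = 0 by rewrite /G !subrr mulr0 subrr mul0r.
have Gc0 : ccont G 0.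
  have [d d0 hd] := c0 _ ltr01.
  pose K := normc (g 0) + 1 + normc (g y%:C) + normc c * (2 * y).
  have K0 : 0 < K.
    by rewrite ltr_pwDl ?mulr_ge0 ?normc_ge0 ?mulr_ge0 ?ltW// ltr_pwDl ?normc_ge0 ?ltr_wpDl ?normc_ge0.
  move=> e e0.
  exists (Num.min d (Num.min (y / 2) (e / (K * (2 / y))))).
    by rewrite !lt_min d0 !divr_gt0// mulr_gt0// divr_gt0.
  move=> z; rewrite !lt_min G0 !subr0 => /and3P[zd zy ze].
  have ny : y / 2 <= normc (z - y%:C).
    have := normc_tri z y%:C; rewrite normc_real (gtr0_norm y0') ler_norml.
    by move=> /andP[+ _]; move: zy; clear; lra.
  have ny' : normc (z - y%:C) <= 2 * y.
    apply: le_trans (normcDle _ _) _; rewrite normc_opp normc_real (gtr0_norm y0').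
    by move: zy y0'; clear; lra.
  have gz : normc (g z) <= normc (g 0) + 1.
    rewrite -[g z](subrK (g 0)); apply: le_trans (normcDle _ _) _.
    by rewrite addrC lerD2l; apply: hd; rewrite subr0.
  rewrite /G !normcM normcV.
  have -> : e = K * (e / (K * (2 / y)) * (2 / y)) by field; rewrite !gt_eqF.
  apply: ler_pM; rewrite ?mulr_ge0 ?normc_ge0 ?invr_ge0 ?normc_ge0//.
    apply: le_trans (normcDle _ _) _; apply: le_trans (lerD (normcDle _ _) (lexx _)) _.
    by rewrite !normc_opp normcM /K !lerD// ler_wpM2l ?normc_ge0.
  apply: ler_pM; rewrite ?invr_ge0 ?normc_ge0//; first exact: ltW.
  by rewrite -[2 / y]invf_div lef_pV2// posrE ?divr_gt0// (lt_le_trans _ ny)// divr_gt0.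
have Gcy : ccont G y%:C.
  move=> e e0; have [|d d0 hd] := Hc (e / (2 * y)); first by rewrite divr_gt0// mulr_gt0.
  exists (Num.min d y); first by rewrite lt_min d0.
  move=> z; rewrite lt_min Gy subr0 => /andP[zd zy].
  have [->|zny] := eqVneq z y%:C; first by rewrite Gy normc0 ltW.
  have n0 : 0 < normc (z - y%:C) by rewrite normc_gt0 subr_eq0.
  have nz : normc z <= 2 * y.
    rewrite -[z](subrK y%:C); apply: le_trans (normcDle _ _) _.
    by rewrite normc_real (gtr0_norm y0'); move: zy; clear; lra.
  rewrite /G !normcM normcV.
  apply: (@le_trans _ _ (e / (2 * y) * normc (z - y%:C) * (2 * y * (normc (z - y%:C))^-1))).
    apply: ler_pM; rewrite ?mulr_ge0 ?normc_ge0 ?invr_ge0 ?normc_ge0//; first exact: hd.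
    by rewrite ler_wpM2r// invr_ge0 normc_ge0.
  rewrite mulrACA divff ?gt_eqF// mulr1 divfK// gt_eqF// mulr_gt0//.
have MG := circle_mean r0 rrho yr Gdiff Gc0 Gcy.
have M1 : segint (fun t => Re (c * cis r t)) (- pi) pi = Re (c * 0) * (2 * pi).
  have dc (z : CC) : cdiff (fun z : CC => c * z : CC) z.
    exact: cdiffM (cdiff_cst c z) (cdiff_id z).
  have dcc := cdiff_ccont (dc 0).
  exact: (circle_mean0 r0 rrho (fun z _ _ => dc z) dcc).
have M2 := @conj_kernel_mean (fun=> conjc (g y%:C)) rho r y r0 rrho yr
  (fun z _ => cdiff_cst _ _).
have C1 (F : CC -> CC) : (forall z : CC, normc z = r -> cdiff F z) ->
   cont_on (fun t => Re (F (cis r t))) (- pi) pi by exact: cont_circle.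
have cn z : normc z = r -> z != 0 /\ z != y%:C.
  move=> nz; rewrite -normc_gt0 nz; split => //; apply/eqP => E.
  by move: yr'; rewrite -nz E normc_real (gtr0_norm y0') ltxx.
have CG : cont_on (fun t => Re (G (cis r t))) (- pi) pi.
  by apply: C1 => z nz; have [? ?] := cn z nz; apply: Gdiff => //; rewrite nz.
have Cc : cont_on (fun t => Re (c * cis r t)) (- pi) pi.
  apply: (C1 (fun z => c * z)) => z nz.
  exact: cdiffM (cdiff_cst c z) (cdiff_id z).
have RJ (w z : R[i]) : Re (conjc w * conjc z) = Re (w * z).
  by case: w => ? ?; case: z => ? ? /=; rewrite mulrNN.
have CK : cont_on (fun t => Re (conjc (g y%:C) * conjc (cis r t / (cis r t - y%:C)))) (- pi) pi.
  have : cont_on (fun t => Re (g y%:C * (cis r t / (cis r t - y%:C)))) (- pi) pi.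
    apply: (C1 (fun z => g y%:C * (z / (z - y%:C)))) => z nz.
    have [z0 zy] := cn z nz; have zy0 : z - y%:C != 0 by rewrite subr_eq0.
    have d1 := cdiffV (cdiffB (cdiff_id z) (cdiff_cst y%:C z)) zy0.
    exact: (cdiffM (cdiff_cst (g y%:C) z) (cdiffM (cdiff_id z) d1)).
  by congr (cont_on _ _ _); apply/funext => t; rewrite RJ.
rewrite (@eq_segint _ _ (fun t => (Re (G (cis r t)) +
   Re (conjc (g y%:C) * conjc (cis r t / (cis r t - y%:C)))) + Re (c * cis r t))).
  rewrite segintD//; last exact: cont_onD.
  rewrite segintD// M1 M2 MG G0 mulr0 /= !mul0r add0r addr0.
  by case: (g y%:C).
move=> t _; rewrite RJ -!cReD; congr (Re _); rewrite /G.
have zy := cis_neq t yr.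
by field.
Qed.


Lemma cdiff_rot (g : CC -> CC) (b z : CC) : cdiff g (b * z) -> cdiff (fun w => g (b * w)) z.
Proof.
move=> dg; exact: (@cdiff_comp _ g (fun w => b * w) z (cdiffM (cdiff_cst b z) (cdiff_id z)) dg).
Qed.

Lemma kernel_norm (r t y : R) : 0 <= y < r ->
  normc (cis r t / (cis r t - y%:C)) <= r / (r - y).
Proof.
move=> yr; have /andP[y0 y1] := yr; have r0 : 0 < r := le_lt_trans y0 y1.
rewrite normcM normcV (normc_cis _ (ltW r0)) ler_pM2l// lef_pV2 ?posrE ?subr_gt0//.
  have := normc_tri (cis r t) y%:C; rewrite normc_real (ger0_norm y0) (normc_cis _ (ltW r0)).
  by move=> h; exact: le_trans (ler_norm _) h.
by rewrite normc_gt0 cis_neq.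
Qed.

Lemma bernoulli (t : R) n : 1 <= t -> 1 + n%:R * (t - 1) <= t ^+ n.
Proof.
move=> t1; have t0 : 0 < t := lt_le_trans ltr01 t1.
elim: n => [|n ih]; first by rewrite mul0r addr0 expr0.
rewrite exprS; apply: (@le_trans _ _ (t * (1 + n%:R * (t - 1)))); last by rewrite ler_pM2l.
rewrite -natr1; have : 0 <= n%:R * (t - 1) * (t - 1) by rewrite mulr_ge0 ?mulr_ge0// ?subr_ge0.
by clear; lra.
Qed.

Lemma geometric_bound (t c K : R) : 0 <= c -> (forall n, c * t ^+ n <= K) -> 1 < t -> c = 0.
Proof.
move=> c0 H t1; apply/eqP; rewrite eq_le c0 andbT leNgt; apply/negP => c1.
have bern n := bernoulli n (ltW t1).
pose n := Num.bound `|K / (c * (t - 1))|.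
have t10 : 0 < c * (t - 1) by rewrite mulr_gt0// subr_gt0.
have : K / (c * (t - 1)) < n%:R.
  by apply: le_lt_trans (ler_norm _) _; exact: archi_boundP.
rewrite ltr_pdivrMr// => h; have := H n; apply/negP; rewrite -ltNge.
apply: (lt_le_trans h); apply: (@le_trans _ _ (c * (1 + n%:R * (t - 1)))).
  by rewrite [leRHS]mulrDr mulr1 ler_wpDl// mulrCA.
by rewrite ler_pM2l.
Qed.

(** Schwarz's lemma. Cauchy's formula for f^(n+1) / z^n bounds its value at y by
    a constant times its maximum on a circle; the constant disappears by
    extracting n-th roots. *)
Lemma schwarz (f : CC -> CC) : (forall z : CC, normc z < 1 -> cdiff f z) ->
  (forall z : CC, normc z < 1 -> normc (f z) <= 1) -> f 0 = 0 ->
  forall z : CC, normc z < 1 -> normc (f z) <= normc z.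
Proof.
move=> df f1 f0 z z1.
wlog [y yz] : f z df f1 f0 z1 / exists y : R, z = y%:C.
  move=> W; have [b nb bz] := normc_phase z.
  have b0 : b != 0 by rewrite -normc_gt0 nb.
  have ncV : normc b^-1 = 1 by rewrite normcV nb invr1.
  have nbV (w : CC) : normc (b^-1 * w) = normc w by rewrite normcM ncV mul1r.
  have := @W (fun w => f (b^-1 * w)) (b * z).
  rewrite mulKf// normcM nb mul1r; apply => //.
  - by move=> w w1; apply: cdiff_rot; apply: df; rewrite nbV.
  - by move=> w w1; apply: f1; rewrite nbV.
  - by rewrite mulr0.
  - by exists (normc z).
wlog y0 : f y z df f1 f0 z1 yz / 0 < y.
  move=> W; have [y0|y0] := ltP 0 y; first exact: (W f y z df f1 f0 z1 yz y0).
  have [yy|yn] := eqVneq y 0; first by rewrite yz yy f0 normc0.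
  have := @W (fun w => f (-1 * w)) (- y) (- z).
  rewrite /= (_ : -1 * - z = z) ?normc_opp; last by rewrite mulrNN mul1r.
  apply => //.
  - by move=> w w1; apply: cdiff_rot; apply: df; rewrite mulN1r normc_opp.
  - by move=> w w1; apply: f1; rewrite mulN1r normc_opp.
  - by rewrite mulr0.
  - by rewrite yz rmorphN.
  - by rewrite oppr_gt0 lt_neqAle yn.
move: z1; rewrite yz normc_real gtr0_norm// => y1.
have yC : y%:C != 0 :> R[i] by rewrite -normc_gt0 normc_real gtr0_norm.
pose s := (y + 1) / 2.
suff main r : y < r -> r < 1 -> r * normc (f y%:C) <= y.
  apply/ler_addgt0Pl => e e0.
  have := main (1 - Num.min (e / 2) ((1 - y) / 2)).
  have m0 : 0 < Num.min (e / 2) ((1 - y) / 2).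
    by rewrite lt_min !divr_gt0// subr_gt0.
  have m1 : Num.min (e / 2) ((1 - y) / 2) <= e / 2 by rewrite ge_min lexx.
  have m2 : Num.min (e / 2) ((1 - y) / 2) <= (1 - y) / 2 by rewrite ge_min lexx orbT.
  move: m0 m1 m2; set m := Num.min _ _ => m0 m1 m2 h.
  have {h} : (1 - m) * normc (f y%:C) <= y by apply: h; move: m0 m2 y1; clear; lra.
  have : m * normc (f y%:C) <= m.
    by apply: ler_piMr; [exact: ltW|apply: f1; rewrite normc_real gtr0_norm].
  by move: m1 e0; clear; lra.
move=> yr r1; have r0 : 0 < r := lt_trans y0 yr.
have ryr : 0 <= y < r by rewrite ltW.
rewrite leNgt; apply/negP => h.
suff : normc (f y%:C) = 0 by move=> E; move: h; rewrite E mulr0 ltNge ltW.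
apply: (@geometric_bound (r * normc (f y%:C) / y) _ (r / (r - y))); first exact: normc_ge0.
  case=> [|n].
    rewrite expr0 mulr1; apply: (@le_trans _ _ 1).
      by apply: f1; rewrite normc_real gtr0_norm.
    by rewrite ler_pdivlMr ?subr_gt0// mul1r gerBl ltW.
  pose hh (w : CC) : CC := f w ^+ n.+2 * (w ^+ n.+1)^-1.
  have dh (w : CC) : w != 0 -> normc w < 1 -> cdiff hh w.
    move=> w0 w1; have wn : w ^+ n.+1 != 0 by rewrite expf_neq0.
    exact: cdiffM (cdiffX n.+2 (df w w1)) (cdiffV (cdiffX n.+1 (cdiff_id w)) wn).
  have ch : ccont hh 0.
    have [|c Hc] := @cdiff_eps _ f 0; first by apply: df; rewrite normc0.
    have [d d0 hd] := Hc _ ltr01.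
    pose K := 1 + normc c; have K0 : 0 < K by rewrite ltr_pwDl// normc_ge0.
    have fK w : normc w < d -> normc (f w) <= K * normc w.
      move=> wd; have := hd w; rewrite f0 !subr0 => /(_ wd) k.
      rewrite -[f w](subrK (c * w)); apply: le_trans (normcDle _ _) _.
      by rewrite normcM mulrDl lerD2r.
    move=> e e0; exists (Num.min d (e / K ^+ n.+2)).
      by rewrite lt_min d0 divr_gt0// exprn_gt0.
    move=> w; rewrite subr0 lt_min => /andP[wd we].
    rewrite {2}/hh f0 expr0n mul0r subr0.
    have [->|w0] := eqVneq w 0; first by rewrite /hh f0 expr0n mul0r normc0 ltW.
    rewrite /hh normcM normcV !normcX ler_pdivrMr ?exprn_gt0 ?normc_gt0//.
    apply: (@le_trans _ _ ((K * normc w) ^+ n.+2)).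
      by rewrite ler_pXn2r ?nnegrE ?normc_ge0// ?fK// mulr_ge0 ?normc_ge0// ltW.
    rewrite exprMn [normc w ^+ n.+2]exprS mulrA ler_pM2r ?exprn_gt0 ?normc_gt0//.
    by rewrite mulrC -ler_pdivlMr ?exprn_gt0// ltW.
  have [b nb bh] := normc_phase (hh y%:C).
  have dbh (w : CC) : w != 0 -> normc w < 1 -> cdiff (fun w => b * hh w) w.
    by move=> w0 w1; exact: cdiffM (cdiff_cst b w) (dh w w0 w1).
  have cbh : ccont (fun w => b * hh w) 0.
    by move=> e /ch[d d0 hd]; exists d => // w wd; rewrite -mulrBr normcM nb mul1r hd.
  have E : segint (fun t => Re (b * hh (cis r t) * (cis r t / (cis r t - y%:C)))) (- pi) pi =
      normc (hh y%:C) * (2 * pi).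
    have rc (x : R) : Re (x%:C) = x by [].
    have E1 := etrans (congr1 (@complex.Re R) bh) (rc _).
    exact: etrans (cauchy_re r0 r1 ryr dbh cbh) (congr1 (fun u => u * (2 * pi)) E1).
  have hy : normc (hh y%:C) = normc (f y%:C) ^+ n.+2 / y ^+ n.+1.
    by rewrite normcM normcV !normcX normc_real gtr0_norm.
  have B : normc (hh y%:C) * (2 * pi) <= (r ^- n.+1 * (r / (r - y))) * (pi - - pi).
    rewrite -E -segint_cst; last by rewrite lerNl; have := pi_gt0 R; clear; lra.
    apply: le_segint.
    - apply: (@cont_circle (fun w => b * hh w * (w / (w - y%:C))) r _ _ r0) => // w wr.
      have w0 : w != 0 by rewrite -normc_gt0 wr.
      have wy : w - y%:C != 0.
        rewrite subr_eq0; apply/eqP => ww; move: yr.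
        by rewrite -wr ww normc_real gtr0_norm// ltxx.
      have d1 := cdiffV (cdiffB (cdiff_id w) (cdiff_cst y%:C w)) wy.
      by apply: (cdiffM (dbh w w0 _) (cdiffM (cdiff_id w) d1)); rewrite wr.
    - exact: cont_on_cst.
    move=> t _; apply: le_trans (ler_norm _) _; apply: le_trans (Re_le_normc _) _.
    rewrite normcM normcM nb mul1r; apply: ler_pM; rewrite ?normc_ge0//; last exact: kernel_norm.
    rewrite normcM normcV !normcX (normc_cis _ (ltW r0)) ler_piMl ?invr_ge0 ?exprn_ge0 ?(ltW r0)//.
    by rewrite exprn_ile1 ?normc_ge0// f1// (normc_cis _ (ltW r0)).
  have pp : 0 < 2 * pi :> R by rewrite mulr_gt0// pi_gt0.
  have : normc (hh y%:C) <= r ^- n.+1 * (r / (r - y)).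
    by rewrite -(ler_pM2r pp) (le_trans B)// opprK -mulr2n -[pi *+ 2]mulr_natl.
  rewrite hy -(ler_pM2l (exprn_gt0 n.+1 r0)) mulVKf ?gt_eqF ?exprn_gt0// => h1; apply: le_trans _ h1.
  by rewrite le_eqVlt; apply/orP; left; apply/eqP; rewrite !exprMn exprVn [X in _ = _ * (X / _)]exprS; ring.
by rewrite ltr_pdivlMr// mul1r.
Qed.

Lemma normc_unit_i (x : R) : normc (1 +i* x) <= 1 + x ^+ 2.
Proof.
have x2 := sqr_ge0 x.
rewrite -(@ler_pXn2r _ 2)// ?nnegrE ?normc_ge0 ?addr_ge0// sqr_normcE /=.
have := sqr_ge0 (x ^+ 2); rewrite expr1n; move: x2; set u := x ^+ 2 => x2.
by rewrite sqrrD expr1n mul1r; move: x2; clear; lra.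
Qed.

(** A quantitative strict mean value inequality for the modulus: pairing g with
    the function 1 + i t k Re (gamma K), of modulus at most 1 + t^2, where K is
    the Cauchy kernel minus its mean, detects g(y) - g(0). *)
Lemma circle_gain (g : CC -> CC) (r y t : R) : 0 < y -> y < r -> r < 1 -> 0 <= t ->
  (forall z : CC, normc z < 1 -> cdiff g z) ->
  (normc (g 0) + t * ((r - y) / (2 * y)) * normc (g y%:C - g 0)) / (1 + t ^+ 2) * (2 * pi)
   <= segint (fun s => normc (g (cis r s))) (- pi) pi.
Proof.
move=> y0 yr r1 t0 dg; have r0 : 0 < r := lt_trans y0 yr.
have ryr : 0 <= y < r by rewrite ltW.
have npi : - pi <= pi :> R by rewrite lerNl; have := pi_gt0 R; clear; lra.
have [b nb bg] := normc_phase (g 0).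
have [c nc cg] := normc_phase (b * 'i%C * (g y%:C - g 0)).
have dg' z : z != 0 -> normc z < 1 -> cdiff g z by move=> _; exact: dg.
pose k := (r - y) / y.
have k0 : 0 < k by rewrite divr_gt0// subr_gt0.
pose K s := cis r s / (cis r s - y%:C).
have Kn s : normc (K s - 1) <= k^-1.
  have -> : K s - 1 = y%:C / (cis r s - y%:C).
    by rewrite /K; field; rewrite cis_neq.
  rewrite normcM normcV normc_real gtr0_norm// /k invf_div ler_pM2l//.
  rewrite lef_pV2 ?posrE ?subr_gt0//; last by rewrite normc_gt0 cis_neq.
  have := normc_tri (cis r s) y%:C; rewrite normc_real (gtr0_norm y0) (normc_cis _ (ltW r0)).
  by move=> h; exact: le_trans (ler_norm _) h.
have cauchy (a : R[i]) : segint (fun s => Re (a * g (cis r s) * K s)) (- pi) pi =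
    Re (a * g y%:C) * (2 * pi).
  have d1 (z : CC) : z != 0 -> normc z < 1 -> cdiff (fun z => a * g z) z.
    by move=> _ z1; exact: cdiffM (cdiff_cst a z) (dg z z1).
  have c1 : ccont (fun z => a * g z) 0.
    by apply/cdiff_ccont/(cdiffM (cdiff_cst a _))/dg; rewrite normc0.
  exact: cauchy_re r0 r1 ryr d1 c1.
have mean (a : R[i]) : segint (fun s => Re (a * g (cis r s))) (- pi) pi =
    Re (a * g 0) * (2 * pi).
  have d1 (z : CC) : normc z < 1 -> cdiff (fun z => a * g z) z.
    by move=> z1; exact: cdiffM (cdiff_cst a z) (dg z z1).
  have c1 : ccont (fun z => a * g z) 0 by apply/cdiff_ccont/d1; rewrite normc0.
  exact: (circle_mean0 r0 r1 (fun z _ => d1 z) c1).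
have cmean (a : R[i]) : segint (fun s => Re (a * g (cis r s) * conjc (K s))) (- pi) pi =
    Re (a * g 0) * (2 * pi).
  have d1 (z : CC) : normc z < 1 -> cdiff (fun z => a * g z) z.
    by move=> z1; exact: cdiffM (cdiff_cst a z) (dg z z1).
  exact: conj_kernel_mean r0 r1 ryr d1.
have dK (z : CC) : normc z = r -> cdiff (fun z => z / (z - y%:C)) z.
  move=> zr; have wy : z - y%:C != 0.
    rewrite subr_eq0; apply/eqP => ww; move: yr.
    by rewrite -zr ww normc_real gtr0_norm// ltxx.
  exact: cdiffM (cdiff_id z) (cdiffV (cdiffB (cdiff_id z) (cdiff_cst y%:C z)) wy).
have dgr (z : CC) : normc z = r -> cdiff g z by move=> zr; apply: dg; rewrite zr.
(* The phases b and c make the pairings with g(0) and g(y) - g(0)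
   nonnegative. *)
pose m s : R := Re (c * (K s - 1)).
have mE s : Re (b * g (cis r s) * (1 +i* (t * k * m s))) =
   Re (b * g (cis r s)) + t * k / 2 * (
     (Re (b * 'i%C * c * g (cis r s) * K s) - Re (b * 'i%C * c * g (cis r s))) +
     (Re (b * 'i%C * conjc c * g (cis r s) * conjc (K s)) -
      Re (b * 'i%C * conjc c * g (cis r s)))).
  rewrite /m; case: (K s) => K1 K2; case: (g (cis r s)) => g1 g2.
  by case: (b) => b1 b2; case: (c) => c1 c2 /=; field.
have RK z : conjc (z / (z - y%:C)) = conjc z / (conjc z - y%:C) :> R[i].
  by rewrite rmorphM fmorphV rmorphB /= oppr0.
have C1 a : cont_on (fun s => Re (a * g (cis r s))) (- pi) pi.
  apply: (@cont_circle (fun z => a * g z) r _ _ r0) => z zr.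
  exact: cdiffM (cdiff_cst a z) (dgr z zr).
have C2 a : cont_on (fun s => Re (a * g (cis r s) * K s)) (- pi) pi.
  apply: (@cont_circle (fun z => a * g z * (z / (z - y%:C))) r _ _ r0) => z zr.
  exact: cdiffM (cdiffM (cdiff_cst a z) (dgr z zr)) (dK z zr).
have C3 a : cont_on (fun s => Re (a * g (cis r s) * conjc (K s))) (- pi) pi.
  rewrite (_ : (fun _ => _) = (fun s => Re (a * g (cis r s) *
      ((r ^+ 2)%:C / ((r ^+ 2)%:C - y%:C * cis r s))))); last first.
    by apply/funext => s; rewrite conj_kernel.
  apply: (@cont_circle (fun z => a * g z * ((r ^+ 2)%:C / ((r ^+ 2)%:C - y%:C * z))) r _ _ r0).
  move=> z zr; have den : (r ^+ 2)%:C - y%:C * z != 0 by apply: kernel_mean_den ryr _; rewrite zr.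
  have d1 := cdiffV (cdiffB (cdiff_cst (r ^+ 2)%:C z) (cdiffM (cdiff_cst y%:C z) (cdiff_id z))) den.
  exact: cdiffM (cdiffM (cdiff_cst a z) (dgr z zr)) (cdiffM (cdiff_cst (r ^+ 2)%:C z) d1).
pose A s := Re (b * g (cis r s)) + t * k / 2 * (
     (Re (b * 'i%C * c * g (cis r s) * K s) - Re (b * 'i%C * c * g (cis r s))) +
     (Re (b * 'i%C * conjc c * g (cis r s) * conjc (K s)) -
      Re (b * 'i%C * conjc c * g (cis r s)))).
have CI : cont_on (fun s => (Re (b * 'i%C * c * g (cis r s) * K s) - Re (b * 'i%C * c * g (cis r s))) +
     (Re (b * 'i%C * conjc c * g (cis r s) * conjc (K s)) -
      Re (b * 'i%C * conjc c * g (cis r s)))) (- pi) pi.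
  by apply: cont_onD; apply: cont_onB.
have CI2 : cont_on (fun s => t * k / 2 * ((Re (b * 'i%C * c * g (cis r s) * K s) - Re (b * 'i%C * c * g (cis r s))) +
     (Re (b * 'i%C * conjc c * g (cis r s) * conjc (K s)) -
      Re (b * 'i%C * conjc c * g (cis r s))))) (- pi) pi.
  by move=> s sp; apply: continuousM; [exact: cst_continuous|exact: CI].
have IA : segint A (- pi) pi =
    (normc (g 0) + t * (k / 2) * normc (g y%:C - g 0)) * (2 * pi).
  rewrite /A segintD// segintZ// segintD; [|exact: cont_onB|exact: cont_onB].
  rewrite !segintB// cauchy !mean cmean bg subrr addr0 -mulrBl -cReB -mulrBr.
  have -> : b * 'i%C * c * (g y%:C - g 0) = c * (b * 'i%C * (g y%:C - g 0)) by ring.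
  by rewrite cg normcM normcM nb mul1r /= expr0n/= expr1n add0r sqrtr1 mul1r; ring.
have t1 : 0 < 1 + t ^+ 2 by rewrite ltr_pwDl// sqr_ge0.
have -> : (normc (g 0) + t * ((r - y) / (2 * y)) * normc (g y%:C - g 0)) / (1 + t ^+ 2) * (2 * pi)
   = (1 + t ^+ 2)^-1 * segint A (- pi) pi.
  by rewrite IA /k; field; rewrite !gt_eqF.
have CN : cont_on (fun s => normc (g (cis r s))) (- pi) pi by exact: cont_circle_norm.
rewrite mulrC ler_pdivrMr// mulrC -segintZ//.
apply: le_segint; first exact: cont_onD.
  by move=> s sp; apply: continuousM; [exact: cst_continuous|exact: CN].
move=> s _; rewrite /A -mE; apply: le_trans (ler_norm _) _; apply: le_trans (Re_le_normc _) _.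
rewrite normcM normcM nb mul1r mulrC ler_wpM2r ?normc_ge0//.
apply: le_trans (normc_unit_i _) _; rewrite lerD2l -mulrA exprMn.
rewrite ler_piMr ?sqr_ge0// -[X in _ <= X](expr1n _ 2) -real_normK ?num_real//.
rewrite ler_pXn2r ?nnegrE// normrM gtr0_norm//.
rewrite -ler_pdivlMl// mulr1; apply: le_trans (Re_le_normc _) _.
by rewrite normcM nc mul1r.
Qed.

End Cauchy.

(** * Automorphisms and pseudo-hyperbolic distance in the ball *)

Section BallGeometry.
Context {R : realType}.
Notation CC := (Cplx R).
Implicit Types (a b x z : Cplx2 R) (u v p q : R[i]) (s : R).

Definition ip x z : R[i] := x.1 * conjc z.1 + x.2 * conjc z.2.

Definition nsq x : R := normc x.1 ^+ 2 + normc x.2 ^+ 2.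

(** One minus the square of the pseudo-hyperbolic distance, in the ball and in
    the disc. *)
Definition pB a b : R := (1 - nsq a) * (1 - nsq b) / normc (1 - ip a b) ^+ 2.
Definition pD u v : R := (1 - normc u ^+ 2) * (1 - normc v ^+ 2) / normc (1 - conjc v * u) ^+ 2.

Lemma nsq_ge0 x : 0 <= nsq x.
Proof. by rewrite addr_ge0 ?sqr_ge0. Qed.

Lemma nsqE x : norm2 x ^+ 2 = nsq x.
Proof. by rewrite sqr_sqrtr ?nsq_ge0. Qed.

Lemma ball2E x : ball2 x <-> nsq x < 1.
Proof.
rewrite /ball2 /= -nsqE; split => [h|h].
  by rewrite expr_lt1 ?sqrtr_ge0.
by rewrite -(@expr_lt1 _ 2) ?sqrtr_ge0.
Qed.

Lemma cauchy_schwarz2 (u1 u2 v1 v2 : R[i]) :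
  normc (u1 * v1 + u2 * v2) ^+ 2 <=
  (normc u1 ^+ 2 + normc u2 ^+ 2) * (normc v1 ^+ 2 + normc v2 ^+ 2).
Proof.
apply: (@le_trans _ _ ((normc u1 * normc v1 + normc u2 * normc v2) ^+ 2)).
  rewrite ler_pXn2r ?nnegrE ?normc_ge0//; last by rewrite addr_ge0 ?mulr_ge0 ?normc_ge0.
  by rewrite -!normcM normcDle.
rewrite -subr_ge0 (_ : _ - _ = (normc u1 * normc v2 - normc u2 * normc v1) ^+ 2).
  exact: sqr_ge0.
by ring.
Qed.

Lemma ip_le x z : normc (ip x z) ^+ 2 <= nsq x * nsq z.
Proof. by apply: le_trans (cauchy_schwarz2 _ _ _ _) _; rewrite /nsq !normc_conj. Qed.

Lemma ipC x z : ip z x = conjc (ip x z).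
Proof. by rewrite /ip rmorphD !rmorphM /= !conjcK ![conjc _ * _]mulrC. Qed.

Lemma one_sub_ipC x z : normc (1 - ip z x) = normc (1 - ip x z).
Proof. by rewrite (ipC x z) -[X in X - conjc _](conjc1 R) -rmorphB normc_conj. Qed.

Lemma pB_sym a b : pB a b = pB b a.
Proof.
by rewrite /pB [(1 - nsq b) * _]mulrC (one_sub_ipC a b).
Qed.

Lemma one_sub_ip_ge x z : nsq x < 1 -> nsq z < 1 ->
  (1 - nsq x) / 2 <= normc (1 - ip x z).
Proof.
move=> x1 z1.
have h : normc (ip x z) <= Num.sqrt (nsq x).
  rewrite -(@ler_pXn2r _ 2) ?nnegrE ?normc_ge0 ?sqrtr_ge0// sqr_sqrtr ?nsq_ge0//.
  apply: le_trans (ip_le _ _) _; rewrite ler_piMr ?nsq_ge0// ltW//.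
have := normc_tri 1 (ip x z); rewrite normc1 => /(le_trans (ler_norm _)).
have := sqr_sqrtr (nsq_ge0 x); have := sqrtr_ge0 (nsq x); move: h x1.
set t := Num.sqrt _ => h x1 t0 tE k; apply: le_trans k.
have t1 : t < 1 by rewrite -(@expr_lt1 _ 2)// tE.
rewrite -tE; move: h; have : 0 <= (1 - t) * (1 - t) by rewrite mulr_ge0// subr_ge0 ltW.
clear; rewrite expr2; lra.
Qed.

Lemma one_sub_ip_gt0 x z : nsq x < 1 -> nsq z < 1 -> 0 < normc (1 - ip x z).
Proof.
move=> x1 z1; apply: lt_le_trans (one_sub_ip_ge x1 z1).
by rewrite divr_gt0// subr_gt0.
Qed.

Lemma one_sub_ip_le x z : nsq x < 1 -> nsq z < 1 -> normc (1 - ip x z) <= 2.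
Proof.
move=> x1 z1; apply: le_trans (normcDle _ _) _; rewrite normc1 normc_opp.
have : normc (ip x z) <= 1; last by lra.
rewrite -(@ler_pXn2r _ 2) ?nnegrE ?normc_ge0// expr1n.
by apply: le_trans (ip_le _ _) _; rewrite mulr_ile1 ?nsq_ge0 ?ltW.
Qed.

Lemma pB_ge x z : nsq x < 1 -> nsq z < 1 -> (1 - nsq x) * (1 - nsq z) / 4 <= pB x z.
Proof.
move=> x1 z1; rewrite /pB ler_pM2l ?mulr_gt0 ?subr_gt0//.
have d0 := one_sub_ip_gt0 x1 z1; have d2 := one_sub_ip_le x1 z1.
rewrite lef_pV2 ?posrE ?exprn_gt0//.
have -> : 4 = 2 ^+ 2 :> R by rewrite expr2; lra.
by rewrite ler_pXn2r ?nnegrE// ltW.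
Qed.

Lemma pB_le x z : nsq x < 1 -> nsq z < 1 -> pB x z <= 4 * (1 - nsq x) / (1 - nsq z).
Proof.
move=> x1 z1; have d0 := one_sub_ip_gt0 x1 z1.
have := one_sub_ip_ge z1 x1; rewrite one_sub_ipC => d1.
have [X Z] : 0 < 1 - nsq x /\ 0 < 1 - nsq z by rewrite !subr_gt0.
rewrite /pB ler_pdivrMr ?exprn_gt0//.
apply: (@le_trans _ _ (4 * (1 - nsq x) / (1 - nsq z) * ((1 - nsq z) / 2) ^+ 2)).
  by rewrite le_eqVlt; apply/orP; left; apply/eqP; field; rewrite gt_eqF.
rewrite ler_pM2l ?divr_gt0 ?mulr_gt0//.
by rewrite ler_pXn2r ?nnegrE ?(ltW d0) ?divr_ge0// ltW.
Qed.

Lemma pB_diag x : nsq x < 1 -> pB x x = 1.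
Proof.
move=> x1; have X : 0 < 1 - nsq x by rewrite subr_gt0.
have -> : pB x x = (1 - nsq x) * (1 - nsq x) / normc ((1 - nsq x)%:C) ^+ 2.
  by rewrite /pB /ip !mulcJ -rmorphD rmorphB rmorph1.
rewrite normc_real gtr0_norm//.
by rewrite -expr2 divff// gt_eqF// exprn_gt0.
Qed.

(** A point may be replaced by a nearby one, at the cost of a constant factor;
    so it suffices that the net comes close to the rational points. *)
Lemma pB_near z : nsq z < 1 -> exists2 e : R, 0 < e & forall q : Cplx2 R,
  normc (z.1 - q.1) < e -> normc (z.2 - q.2) < e -> nsq q < 1 /\
  forall a, nsq a < 1 -> pB q a / 8 <= pB z a.
Proof.
move=> z1; set D := 1 - nsq z; have D0 : 0 < D by rewrite subr_gt0.
have D1 : D <= 1 by rewrite gerBl nsq_ge0.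
exists (D / 16); first by rewrite divr_gt0.
move=> q q1 q2.
have sqd (u v : R[i]) : normc (u - v) < D / 16 -> normc u ^+ 2 <= 1 ->
    `|normc v ^+ 2 - normc u ^+ 2| <= D / 16 * (2 + D / 16).
  move=> uv u1; have un : normc u <= 1.
    by rewrite -(@ler_pXn2r _ 2) ?nnegrE ?normc_ge0// expr1n.
  have := normc_tri v u; rewrite normc_sub => /le_lt_trans/(_ uv) h.
  rewrite subr_sqr normrM; apply: ler_pM => //; first exact: ltW.
  rewrite ger0_norm ?addr_ge0 ?normc_ge0//.
  have := le_lt_trans (ler_norm _) h; move: un; clear; lra.
have c1 : normc z.1 ^+ 2 <= 1.
  by apply: le_trans (ltW z1); rewrite lerDl sqr_ge0.
have c2 : normc z.2 ^+ 2 <= 1.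
  by apply: le_trans (ltW z1); rewrite lerDr sqr_ge0.
have h1 := sqd _ _ q1 c1; have h2 := sqd _ _ q2 c2.
have DD : D * D <= D by rewrite ler_piMr// ltW.
have hE : `|nsq q - nsq z| <= D / 3.
  have -> : nsq q - nsq z = (normc q.1 ^+ 2 - normc z.1 ^+ 2) +
     (normc q.2 ^+ 2 - normc z.2 ^+ 2) by rewrite /nsq; ring.
  have e1 : D / 16 * (2 + D / 16) <= D / 6.
    have -> : D / 16 * (2 + D / 16) = D / 8 + (D * D) / 256 by field.
    by move: DD D0; clear; lra.
  apply: le_trans (ler_normD _ _) _; move: h1 h2 e1; clear; lra.
have [hl hu] : 2 / 3 * D <= 1 - nsq q /\ 1 - nsq q <= 4 / 3 * D.
  by move: hE; rewrite ler_norml /D => /andP[]; clear; split; lra.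
have qlt : nsq q < 1 by move: hl D0; clear; lra.
split=> // a a1.
have dq := one_sub_ip_gt0 qlt a1; have dz := one_sub_ip_gt0 z1 a1.
have A0 : 0 < 1 - nsq a by rewrite subr_gt0.
have near : normc (1 - ip z a) <= 2 * normc (1 - ip q a).
  have -> : 1 - ip z a = (1 - ip q a) + ((q.1 - z.1) * conjc a.1 + (q.2 - z.2) * conjc a.2).
    by rewrite /ip; ring.
  apply: le_trans (normcDle _ _) _.
  have : normc ((q.1 - z.1) * conjc a.1 + (q.2 - z.2) * conjc a.2) <= D / 16 + D / 16.
    apply: le_trans (normcDle _ _) _; rewrite !normcM !normc_conj.
    have an u : normc u ^+ 2 <= nsq a -> normc u <= 1.
      move=> h; rewrite -(@ler_pXn2r _ 2) ?nnegrE ?normc_ge0// expr1n.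
      exact: le_trans h (ltW a1).
    apply: lerD; rewrite normc_sub -[D / 16]mulr1; apply: ler_pM; rewrite ?normc_ge0//.
    - exact: ltW.
    - by apply: an; rewrite lerDl sqr_ge0.
    - exact: ltW.
    - by apply: an; rewrite lerDr sqr_ge0.
  by have := one_sub_ip_ge qlt a1; move: hl D0; clear; lra.
rewrite /pB -/D ler_pdivlMr ?exprn_gt0//.
apply: (@le_trans _ _ ((1 - nsq q) * (1 - nsq a) / normc (1 - ip q a) ^+ 2 / 8 *
    (2 * normc (1 - ip q a)) ^+ 2)).
  rewrite ler_wpM2l//.
    by rewrite !divr_ge0 ?mulr_ge0 ?sqr_ge0// ?subr_ge0 ltW.
  by rewrite ler_pXn2r ?nnegrE ?mulr_ge0 ?normc_ge0.
have -> : (1 - nsq q) * (1 - nsq a) / normc (1 - ip q a) ^+ 2 / 8 *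
    (2 * normc (1 - ip q a)) ^+ 2 = (1 - nsq q) / 2 * (1 - nsq a).
  by field; rewrite gt_eqF.
by rewrite ler_pM2r//; move: hu D0; clear; lra.
Qed.

(** The identities behind the invariance of the pseudo-hyperbolic distance. *)
Lemma mobius_id p q s : normc (p - s%:C) ^+ 2 + (1 - s ^+ 2) * normc q ^+ 2 =
  normc (1 - s%:C * p) ^+ 2 - (1 - s ^+ 2) * (1 - normc p ^+ 2 - normc q ^+ 2).
Proof.
rewrite !sqr_normcE; case: p => p1 p2; case: q => q1 q2 /=; ring.
Qed.

Lemma mobius_id1 u v : normc (1 - conjc v * u) ^+ 2 - normc (u - v) ^+ 2 =
  (1 - normc u ^+ 2) * (1 - normc v ^+ 2).
Proof.
rewrite !sqr_normcE; case: u => p1 p2; case: v => q1 q2 /=; ring.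
Qed.

(** The unit vector orthogonal to z. With z1 + j z2 for z, right
    multiplication by the quaternion A + j B gives A z + B (perp z). *)
Definition perp z : Cplx2 R := (- conjc z.2, conjc z.1).

Lemma ip_perp_sq x z : normc (ip x z) ^+ 2 + normc (ip x (perp z)) ^+ 2 = nsq x * nsq z.
Proof.
rewrite /ip /perp /nsq !sqr_normcE; case: x => -[x1 x2] [x3 x4].
by case: z => -[z1 z2] [z3 z4] /=; ring.
Qed.

Lemma frame_expand x z : nsq z = 1 ->
  x.1 = ip x z * z.1 + ip x (perp z) * (perp z).1 /\
  x.2 = ip x z * z.2 + ip x (perp z) * (perp z).2.
Proof.
rewrite /nsq !sqr_normcE /ip /perp; case: x => -[x1 x2] [x3 x4].
case: z => -[z1 z2] [z3 z4] /= E.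
have D t : t = t * (z1 ^+ 2 + z2 ^+ 2 + (z3 ^+ 2 + z4 ^+ 2)) by rewrite E mulr1.
split; apply/eqP; rewrite eq_complex /=; apply/andP; split; apply/eqP.
- by rewrite [LHS]D; ring.
- by rewrite [LHS]D; ring.
- by rewrite [LHS]D; ring.
- by rewrite [LHS]D; ring.
Qed.

(** Coordinates, in the frame (z, perp z), of the automorphism of the ball that
    takes s z to the origin. *)
Definition mobU s z x : R[i] := (ip x z - s%:C) / (1 - s%:C * ip x z).
Definition mobV s z x : R[i] :=
  (Num.sqrt (1 - s ^+ 2))%:C * ip x (perp z) / (1 - s%:C * ip x z).

(** The inverse automorphism. *)
Definition mobA s (u : R[i]) : R[i] := (s%:C + u) / (1 + s%:C * u).
Definition mobB s (u v : R[i]) : R[i] := (Num.sqrt (1 - s ^+ 2))%:C * v / (1 + s%:C * u).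

Lemma mob_den s z x : 0 <= s < 1 -> nsq z = 1 -> nsq x < 1 -> 1 - s%:C * ip x z != 0.
Proof.
move=> /andP[s0 s1] z1 x1; rewrite subr_eq0; apply/eqP => /(congr1 (fun w => normc w ^+ 2)).
rewrite normc1 expr1n normcM exprMn normc_real ger0_norm// => E.
have : s ^+ 2 * normc (ip x z) ^+ 2 < 1; last by rewrite -E ltxx.
apply: (@le_lt_trans _ _ (1 * nsq x)); last by rewrite mul1r.
apply: ler_pM; rewrite ?sqr_ge0//; first by rewrite expr_le1// ltW.
by apply: le_trans (ip_le _ _) _; rewrite z1 mulr1.
Qed.

(** The automorphism takes x to a point whose distance from the origin is the
    pseudo-hyperbolic distance from x to s z. *)
Lemma mob_sq s z x : 0 <= s < 1 -> nsq z = 1 -> nsq x < 1 ->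
  normc (mobU s z x) ^+ 2 + normc (mobV s z x) ^+ 2 =
  1 - pB x (s%:C * z.1, s%:C * z.2).
Proof.
move=> s01 z1 x1; have den := mob_den s01 z1 x1; have /andP[s0 s1] := s01.
have s2 : 0 <= 1 - s ^+ 2 by rewrite subr_ge0 expr_le1// ltW.
have E1 : nsq (s%:C * z.1, s%:C * z.2) = s ^+ 2.
  by rewrite /nsq /= !normcM normc_real ger0_norm// !exprMn -mulrDr -/(nsq z) z1 mulr1.
have E2 : ip x (s%:C * z.1, s%:C * z.2) = s%:C * ip x z.
  have cs w : conjc (s%:C * w) = s%:C * conjc w by case: w => w1 w2; simpc.
  by rewrite /ip /= !cs; ring.
rewrite /mobU /mobV /pB E1 E2 !normcM !exprMn normcV normc_real ger0_norm ?sqrtr_ge0//.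
rewrite sqr_sqrtr// -mulrDl mobius_id -addrA -opprD ip_perp_sq z1 mulr1.
have n0 : normc (1 - s%:C * ip x z) != 0 by rewrite normc_eq0.
by field.
Qed.

Lemma mobAB_sq s u v : 0 <= s < 1 -> normc u ^+ 2 + normc v ^+ 2 < 1 ->
  normc (mobA s u) ^+ 2 + normc (mobB s u v) ^+ 2 < 1.
Proof.
move=> /andP[s0 s1] uv.
have s2 : 0 < 1 - s ^+ 2 by rewrite subr_gt0 expr_lt1.
have u1 : normc u < 1.
  by rewrite -(@expr_lt1 _ 2) ?normc_ge0// (le_lt_trans _ uv)// lerDl sqr_ge0.
have den : 0 < normc (1 + s%:C * u).
  rewrite normc_gt0 addrC addr_eq0; apply/eqP => /(congr1 (@normc R)).
  rewrite normc_opp normc1 normcM normc_real ger0_norm// => E.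
  have : s * normc u < 1 by rewrite mulr_ilt1 ?normc_ge0.
  by rewrite E ltxx.
rewrite /mobA /mobB !normcM normcV !exprMn exprVn -mulrDl normc_real ger0_norm ?sqrtr_ge0//.
rewrite sqr_sqrtr ?ltW// ltr_pdivrMr ?exprn_gt0// mul1r.
have := mobius_id (- u) v s; rewrite normc_opp mulrN opprK.
have -> : normc (- u - s%:C) = normc (s%:C + u) by rewrite -normc_opp opprD !opprK addrC.
move=> ->; rewrite ltrBlDr ltrDl mulr_gt0// -addrA -opprD subr_gt0//.
Qed.

Lemma frame_sq z (a b : R[i]) :
  nsq (a * z.1 + b * (perp z).1, a * z.2 + b * (perp z).2) =
  (normc a ^+ 2 + normc b ^+ 2) * nsq z.
Proof.
rewrite /nsq /= !sqr_normcE; case: z => -[z1 z2] [z3 z4].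
by case: a => a1 a2; case: b => b1 b2 /=; ring.
Qed.

Lemma mobK s z x : 0 <= s < 1 -> nsq z = 1 -> nsq x < 1 ->
  mobA s (mobU s z x) = ip x z /\ mobB s (mobU s z x) (mobV s z x) = ip x (perp z).
Proof.
move=> s01 z1 x1; have den := mob_den s01 z1 x1; have /andP[s0 s1] := s01.
have s2 : 0 < 1 - s ^+ 2 by rewrite subr_gt0 expr_lt1.
have sC : (1 - s%:C * s%:C) != 0 :> R[i].
  rewrite -rmorphM -[1](rmorph1 (real_complex R)) -rmorphB -normc_gt0 normc_real.
  by rewrite -expr2 gtr0_norm.
have d2 : 1 + s%:C * mobU s z x = (1 - s%:C * s%:C) / (1 - s%:C * ip x z).
  by rewrite /mobU; field.
have sq : (Num.sqrt (1 - s ^+ 2))%:C * (Num.sqrt (1 - s ^+ 2))%:C = 1 - s%:C * s%:C :> R[i].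
  by rewrite -!rmorphM -expr2 sqr_sqrtr ?ltW// rmorphB rmorph1 expr2.
split.
  rewrite /mobA d2; have -> : s%:C + mobU s z x = (1 - s%:C * s%:C) * ip x z / (1 - s%:C * ip x z).
    by rewrite /mobU; field.
  move: den sC; set D := 1 - s%:C * ip x z; set E := 1 - s%:C * s%:C.
  by move=> den sC; field; rewrite den sC.
have -> : mobB s (mobU s z x) (mobV s z x) = ((Num.sqrt (1 - s ^+ 2))%:C *
    (Num.sqrt (1 - s ^+ 2))%:C) * (ip x (perp z) / (1 - s%:C * ip x z)) / (1 + s%:C * mobU s z x).
  by rewrite /mobB /mobV !mulrA.
rewrite sq d2; move: den sC; set D := 1 - s%:C * ip x z; set E := 1 - s%:C * s%:C.
by move=> den sC; field; rewrite den sC.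
Qed.

Lemma polar2 x : exists s z, [/\ 0 <= s, nsq z = 1, x = (s%:C * z.1, s%:C * z.2) & s ^+ 2 = nsq x].
Proof.
have [x0|x0] := eqVneq (nsq x) 0.
  exists 0, (1, 0); split => //; first by rewrite /nsq /fst /snd normc1 normc0 expr1n expr0n addr0.
    move: x0; rewrite /nsq => /eqP; rewrite paddr_eq0 ?sqr_ge0// !sqrf_eq0 !normc_eq0.
    by case: x => x1 x2 /= /andP[/eqP -> /eqP ->]; rewrite !mul0r.
  by rewrite x0 expr0n.
have n0 : 0 < nsq x by rewrite lt_neqAle eq_sym x0 nsq_ge0.
pose s := Num.sqrt (nsq x); have s0 : 0 < s by rewrite sqrtr_gt0.
have sC : s%:C != 0 :> R[i] by rewrite -normc_gt0 normc_real gtr0_norm.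
exists s, (s%:C^-1 * x.1, s%:C^-1 * x.2); split.
- exact: ltW.
- rewrite /nsq /= !normcM normcV normc_real gtr0_norm// !exprMn -mulrDr -/(nsq x).
  by rewrite exprVn sqr_sqrtr ?ltW// mulVf.
- by rewrite /= !mulVKf//; case: (x).
- by rewrite sqr_sqrtr// ltW.
Qed.

End BallGeometry.

(** * The Schwarz-Pick lemma *)

Section SchwarzPick.
Context {R : realType}.
Notation CC := (Cplx R).

Lemma cdiff_fst (phi : CC -> Cplx2 R) (z : CC) : differentiable phi z ->
  cdiff (fun w => (phi w).1) z /\ cdiff (fun w => (phi w).2) z.
Proof.
move=> dphi.
have L (h : R[i]) : 'd phi z (h : CC) = h *: 'd phi z (1 : CC).
  have hE : (h : CC) = h *: (1 : CC) by rewrite -[RHS]/(_ * _) mulr1.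
  by rewrite {1}hE linearZ.
have pr (w : Cplx2 R) (K : R) : `|w| <= K%:C -> normc w.1 <= K /\ normc w.2 <= K.
  rewrite prod_normE comparable_ge_max ?real_comparable ?normr_real// => /andP[].
  by rewrite !normr_normc !lecR.
split; [apply: (@near_cdiff _ _ _ ('d phi z (1 : CC)).1)|
        apply: (@near_cdiff _ _ _ ('d phi z (1 : CC)).2)] => e e0.
  have [d d0 hd] := differentiable_near dphi e0; exists d => // w wd.
  have := hd w; rewrite (normr_normc (w - z)) ltcR => /(_ wd).
  by rewrite -rmorphM => /pr[k _]; rewrite L in k; rewrite [_ * (w - z)]mulrC; exact: k.
have [d d0 hd] := differentiable_near dphi e0; exists d => // w wd.
have := hd w; rewrite (normr_normc (w - z)) ltcR => /(_ wd).
by rewrite -rmorphM => /pr[_ k]; rewrite L in k; rewrite [_ * (w - z)]mulrC; exact: k.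
Qed.

Lemma pD_den (u v : R[i]) : normc u < 1 -> normc v < 1 -> 1 - conjc v * u != 0.
Proof.
move=> u1 v1; rewrite subr_eq0; apply/eqP => /(congr1 (@normc R)).
rewrite normc1 normcM normc_conj => E.
have : normc v * normc u < 1 by rewrite mulr_ilt1 ?normc_ge0.
by rewrite -E ltxx.
Qed.

Lemma mobius1_sq (u v : R[i]) : normc u < 1 -> normc v < 1 ->
  normc ((u - v) / (1 - conjc v * u)) ^+ 2 = 1 - pD u v.
Proof.
move=> u1 v1; have den := pD_den u1 v1.
have n0 : normc (1 - conjc v * u) != 0 by rewrite normc_eq0.
by rewrite normcM normcV exprMn exprVn /pD -mobius_id1; field.
Qed.

Lemma pD_sub (u v : R[i]) : normc u < 1 -> normc v < 1 -> 0 < pD u v <= 1.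
Proof.
move=> u1 v1; have := mobius1_sq u1 v1; have := sqr_ge0 (normc ((u - v) / (1 - conjc v * u))).
move=> h1 h2; apply/andP; split; last by move: h1; rewrite h2 subr_ge0.
rewrite /pD divr_gt0// ?mulr_gt0 ?subr_gt0 ?exprn_gt0 ?normc_gt0 ?pD_den//.
  by rewrite expr_lt1 ?normc_ge0.
by rewrite expr_lt1 ?normc_ge0.
Qed.

(** Holomorphic maps from the disc to the ball contract the pseudo-hyperbolic
    distance: Schwarz's lemma applies to the component, in the direction of the
    image of z, of the map normalised by automorphisms at both ends. *)
Lemma schwarz_pick (phi : CC -> Cplx2 R) (z w : CC) :
  (forall x : CC, normc x < 1 -> differentiable phi x) ->
  (forall x : CC, normc x < 1 -> nsq (phi x) < 1) ->
  normc z < 1 -> normc w < 1 -> pD z w <= pB (phi z) (phi w).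
Proof.
move=> dphi ball z1 w1.
have [s [e [s0 e1 wE sE]]] := polar2 (phi w).
have s01 : 0 <= s < 1 by rewrite s0 -(@expr_lt1 _ 2)// sE ball.
pose U (x : CC) : CC := mobU s e (phi x); pose V (x : CC) : CC := mobV s e (phi x).
have UV x : normc x < 1 -> normc (U x) ^+ 2 + normc (V x) ^+ 2 = 1 - pB (phi x) (phi w).
  by move=> x1; rewrite [in RHS]wE; apply: mob_sq; rewrite ?ball.
have [N0|N0] := eqVneq (normc (U z) ^+ 2 + normc (V z) ^+ 2) 0.
  have -> : pB (phi z) (phi w) = 1.
    by move: N0; rewrite UV// => /eqP; rewrite subr_eq0 => /eqP.
  by have /andP[] := pD_sub z1 w1.
have Np : 0 < normc (U z) ^+ 2 + normc (V z) ^+ 2.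
  by rewrite lt_neqAle eq_sym N0 addr_ge0 ?sqr_ge0.
pose N := Num.sqrt (normc (U z) ^+ 2 + normc (V z) ^+ 2).
have Ngt : 0 < N by rewrite sqrtr_gt0.
have NE : N ^+ 2 = normc (U z) ^+ 2 + normc (V z) ^+ 2 by rewrite sqr_sqrtr// ltW.
have NC : N%:C != 0 :> R[i] by rewrite -normc_gt0 normc_real gtr0_norm.
(* Coefficients of the unit functional that attains the norm of (U z, V z). *)
pose c1 : R[i] := conjc (U z) / N%:C; pose c2 : R[i] := conjc (V z) / N%:C.
have c12 : normc c1 ^+ 2 + normc c2 ^+ 2 = 1.
  rewrite /c1 /c2 !normcM normcV !normc_conj normc_real gtr0_norm// !exprMn -mulrDl -NE.
  by rewrite -exprMn divff ?expr1n// gt_eqF.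
(* Automorphism of the disc that takes 0 to w. *)
pose psi (x : CC) : CC := (x + w) / (1 + conjc w * x).
have wn x : normc x < 1 -> 1 + conjc w * x != 0.
  move=> x1; have : 1 - conjc w * (- x) != 0 by apply: pD_den; rewrite ?normc_opp.
  by rewrite mulrN opprK.
have psi1 x : normc x < 1 -> normc (psi x) < 1.
  move=> x1; have x1' : normc (- x) < 1 by rewrite normc_opp.
  have := mobius1_sq x1' w1; rewrite mulrN opprK -opprD mulNr normc_opp => E.
  rewrite -(@expr_lt1 _ 2) ?normc_ge0// E ltrBlDr ltrDl.
  by have /andP[] := pD_sub x1' w1.
have psi0 : psi 0 = w by rewrite /psi add0r mulr0 addr0 divr1.
pose f (x : CC) : CC := c1 * U (psi x) + c2 * V (psi x).
have dU x : normc x < 1 -> cdiff U x /\ cdiff V x.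
  move=> x1; have [d1 d2] := cdiff_fst (dphi x x1).
  have dip y : cdiff (fun t => ip (phi t) y) x.
    exact: cdiffD (cdiffM d1 (cdiff_cst (conjc y.1) x)) (cdiffM d2 (cdiff_cst (conjc y.2) x)).
  have den := mob_den s01 e1 (ball x x1).
  have dden := cdiffV (cdiffB (cdiff_cst 1 x) (cdiffM (cdiff_cst s%:C x) (dip e))) den.
  split; first exact: cdiffM (cdiffB (dip e) (cdiff_cst s%:C x)) dden.
  exact: cdiffM (cdiffM (cdiff_cst (Num.sqrt (1 - s ^+ 2))%:C x) (dip (perp e))) dden.
have df x : normc x < 1 -> cdiff f x.
  move=> x1.
  have dpsi : cdiff psi x.
    apply: (cdiffM (cdiffD (cdiff_id x) (cdiff_cst w x)) (cdiffV (cdiffD (cdiff_cst 1 x)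
      (cdiffM (cdiff_cst (conjc w) x) (cdiff_id x))) _)).
    exact: wn.
  have [d1 d2] := dU _ (psi1 _ x1).
  exact: cdiffD (cdiffM (cdiff_cst c1 x) (cdiff_comp dpsi d1))
    (cdiffM (cdiff_cst c2 x) (cdiff_comp dpsi d2)).
have f1 x : normc x < 1 -> normc (f x) <= 1.
  move=> x1; rewrite -(@expr_le1 _ 2) ?normc_ge0//.
  apply: le_trans (cauchy_schwarz2 _ _ _ _) _; rewrite c12 mul1r UV ?psi1//.
  rewrite lerBlDr lerDl; have p1 := ball _ (psi1 _ x1); have p2 := ball _ w1.
  by rewrite !mulr_ge0 ?invr_ge0 ?sqr_ge0// subr_ge0 ltW.
have f0 : f 0 = 0.
  have : normc (U w) ^+ 2 + normc (V w) ^+ 2 = 0 by rewrite UV// pB_diag ?subrr// ball.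
  move/eqP; rewrite paddr_eq0 ?sqr_ge0// !sqrf_eq0 !normc_eq0 => /andP[/eqP Uw /eqP Vw].
  by rewrite /f psi0 Uw Vw !mulr0 addr0.
pose xi : CC := (z - w) / (1 - conjc w * z).
have den := pD_den z1 w1.
have xi2 : normc xi ^+ 2 = 1 - pD z w by exact: mobius1_sq.
have xi1 : normc xi < 1.
  rewrite -(@expr_lt1 _ 2) ?normc_ge0// xi2 ltrBlDr ltrDl.
  by have /andP[] := pD_sub z1 w1.
have psixi : psi xi = z.
  have dd : 1 + conjc w * xi != 0 by exact: wn.
  have w0 : 1 - conjc w * w != 0 by apply: pD_den.
  apply: (mulIf dd); rewrite /psi divfK// /xi.
  by field.
have := schwarz df f1 f0 xi1.
have -> : f xi = N%:C.
  rewrite /f psixi /c1 /c2 mulrAC [conjc _ / _ * V z]mulrAC -mulrDl.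
  apply: (mulIf NC); rewrite divfK// mulrC mulcJ [conjc (V z) * _]mulrC mulcJ -rmorphD -NE.
  by rewrite expr2 rmorphM.
rewrite normc_real gtr0_norm// => NX.
have : N ^+ 2 <= normc xi ^+ 2 by rewrite ler_pXn2r ?nnegrE ?normc_ge0// ltW.
by rewrite NE UV// xi2 lerD2l lerN2.
Qed.

End SchwarzPick.

(** * Nets in the ball *)

Section SeparatedNet.
Context {R : realType}.
Notation pt := (Cplx2 R).

(** An enumeration of the points with rational coordinates, starting at 0. *)
Definition ratpt (n : nat) : pt :=
  if n is m.+1 then
    if (unpickle m : option (rat * rat * rat * rat)) is Some (a, b, c, d) then
      (ratr a +i* ratr b, ratr c +i* ratr d) else (0, 0)
  else (0, 0).

Lemma ratpt_dense (z : pt) (e : R) : 0 < e ->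
  exists n, normc (z.1 - (ratpt n).1) < e /\ normc (z.2 - (ratpt n).2) < e.
Proof.
move=> e0.
have dens (x : R) : exists q : rat, `|x - ratr q| < e / 2.
  have [|q] := @rat_in_itvoo R (x - e / 2) (x + e / 2).
    by move: e0; clear; lra.
  rewrite in_itv /= => /andP[q1 q2]; exists q.
  by rewrite ltr_norml; move: q1 q2; clear; lra.
case: z => -[z1 z2] [z3 z4].
have [a ha] := dens z1; have [b hb] := dens z2.
have [c hc] := dens z3; have [d hd] := dens z4.
exists (pickle (a, b, c, d)).+1; rewrite /ratpt pickleK /fst /snd; split.
  apply: le_lt_trans (normc_le_ReIm _) _.
  rewrite -[Re _]/(z1 - ratr a) -[Im _]/(z2 - ratr b).
  by move: ha hb; clear; lra.
apply: le_lt_trans (normc_le_ReIm _) _.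
rewrite -[Re _]/(z3 - ratr c) -[Im _]/(z4 - ratr d).
by move: hc hd; clear; lra.
Qed.

Variable eta : R.
Hypothesis eta01 : 0 < eta < 1.

Definition eligible (l : seq nat) (i : nat) := nsq (ratpt i) < 1 /\
  forall j, j \in l -> nsq (ratpt j) < 1 -> pB (ratpt i) (ratpt j) <= eta.

(** Points close to the sphere are far from finitely many given points, by
    [pB_le]. *)
Lemma eligible_ex (l : seq nat) : exists i, eligible l i.
Proof.
have /andP[eta0 eta1] := eta01.
have [m m0 hm] : exists2 m : R, 0 < m <= 1 &
    forall j, j \in l -> nsq (ratpt j) < 1 -> m <= 1 - nsq (ratpt j).
  elim: l => [|j l [m /andP[m0 m1] ih]]; first by exists 1 => //; rewrite ltr01 lexx.
  have [j1|j1] := boolP (nsq (ratpt j) < 1); last first.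
    exists m; first by rewrite m0.
    by move=> k; rewrite inE => /predU1P[->|/ih//]; rewrite (negbTE j1).
  exists (Num.min m (1 - nsq (ratpt j))).
    by rewrite lt_min m0 subr_gt0 j1 ge_min m1.
  move=> k; rewrite inE => /predU1P[-> _|kl k1]; first by rewrite ge_min lexx orbT.
  by rewrite ge_min ih.
have /andP[m0' m1] := m0.
have em : 0 < eta * m / 8 by rewrite divr_gt0// mulr_gt0.
have em1 : eta * m < 1 by apply: (@le_lt_trans _ _ eta) => //; rewrite ler_piMr// ltW.
have [|t] := @rat_in_itvoo R (1 - eta * m / 8) 1; first by rewrite ltrBlDr ltrDl.
rewrite in_itv /= => /andP[t1 t2].
have t0 : 0 < ratr t :> R by move: t1 em1; clear; lra.
exists (pickle (t, 0 : rat, 0 : rat, 0 : rat)).+1.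
have E : nsq (ratpt (pickle (t, 0 : rat, 0 : rat, 0 : rat)).+1) = ratr t ^+ 2 :> R.
  by rewrite /nsq /ratpt pickleK /fst /snd !sqr_normcE /= rmorph0 expr0n/= !addr0.
have q1 : nsq (ratpt (pickle (t, 0 : rat, 0 : rat, 0 : rat)).+1) < 1 :> R.
  by rewrite E expr_lt1// ltW.
split=> // j jl j1; apply: le_trans (pB_le q1 j1) _.
rewrite ler_pdivrMr ?subr_gt0// E.
apply: (@le_trans _ _ (eta * m)); last by rewrite ler_pM2l// hm.
have : (ratr t : R) <= 1 by exact: ltW.
have : 0 <= (1 - ratr t) * (1 - ratr t) :> R by rewrite mulr_ge0// subr_ge0 ltW.
by rewrite expr2; move: t1; clear; lra.
Qed.

Lemma least_eligible (l : seq nat) :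
  exists i, eligible l i /\ forall k, eligible l k -> (i <= k)%N.
Proof.
have ex : exists i, `[< eligible l i >] by have [i /asboolP] := eligible_ex l; exists i.
case: (ex_minnP ex) => i /asboolP hi hm.
by exists i; split => // k /asboolP /hm.
Qed.

(** The greedy choice, newest first: each time the least index compatible with
    the earlier ones. *)
Fixpoint chosen (n : nat) : seq nat :=
  if n is m.+1 then sval (cid (least_eligible (chosen m))) :: chosen m else [::].

Let pick (n : nat) := sval (cid (least_eligible (chosen n))).

Let pickP n : eligible (chosen n) (pick n) /\
  forall k, eligible (chosen n) k -> (pick n <= k)%N.
Proof. exact: (svalP (cid (least_eligible (chosen n)))). Qed.

Let mem_chosen n i : i \in chosen n -> exists2 m, (m < n)%N & i = pick m.
Proof.
elim: n => // n ih; rewrite inE => /predU1P[->|/ih[m mn ->]]; first by exists n.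
by exists m => //; exact: ltnW.
Qed.

Let chosen_pick m n : (m < n)%N -> pick m \in chosen n.
Proof.
elim: n => // n ih; rewrite ltnS leq_eqVlt => /predU1P[->|/ih h].
  by rewrite inE eqxx.
by rewrite inE h orbT.
Qed.

Let pick_ge n : (n <= pick n)%N.
Proof.
elim: n => // n ih; apply: (leq_ltn_trans ih).
have [[h1 h2] _] := pickP n.+1; have [[k1 _] k2] := pickP n.
rewrite ltn_neqAle; apply/andP; split.
  apply/eqP => E; have := h2 (pick n) (chosen_pick (ltnSn n)) k1.
  by rewrite -E pB_diag// leNgt; have /andP[_ ->] := eta01.
by apply: k2; split => // j jn; apply: h2; rewrite inE jn orbT.
Qed.

(** A rational point that was never chosen is close to a point chosen before
    it, because the choice always takes the least eligible index. If that
    point is a_0 = 0 then z stays away from the sphere, and a_1 serves in its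
    place. *)
Lemma separated_net : exists a : nat -> pt, [/\ forall k, nsq (a k) < 1, a 0%N = (0, 0),
  forall j k, j <> k -> pB (a j) (a k) <= eta &
  exists2 c : R, 0 < c & forall z, nsq z < 1 -> exists2 k, (0 < k)%N & c <= pB z (a k)].
Proof.
have /andP[eta0 eta1] := eta01.
pose a n := ratpt (pick n).
have a1 k : nsq (a k) < 1 by have [[]] := pickP k.
have a0 : a 0%N = (0, 0).
  have [_ h] := pickP 0%N; have e0 : eligible (chosen 0) 0.
    by split => //; rewrite /nsq /fst /snd normc0 expr0n addr0.
  by have := h _ e0; rewrite /a leqn0 => /eqP ->.
have sep j k : (j < k)%N -> pB (a k) (a j) <= eta.
  by move=> jk; have [[_ h] _] := pickP k; apply: h (chosen_pick jk) (a1 j).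
have cover i : nsq (ratpt i) < 1 -> exists j, eta < pB (ratpt i) (a j).
  move=> i1; have [h|] := pselect (eligible (chosen i.+1) i).
    by have [_ /(_ _ h)] := pickP i.+1; rewrite leqNgt pick_ge.
  move=> NE; apply/not_existsP => H; apply: NE; split => // j jc j1.
  have [m _ jE] := mem_chosen jc; have := H m => /negP; rewrite -leNgt /a jE //.
exists a; split => //.
  move=> j k jk; have [h|] := ltnP j k; first by rewrite pB_sym sep.
  rewrite leq_eqVlt => /predU1P[E|]; [by rewrite E in jk|exact: sep].
pose c1 := eta / 8 * (1 - nsq (a 1%N)) / 4.
have A1 : 0 < 1 - nsq (a 1%N) by rewrite subr_gt0.
exists (Num.min (eta / 8) c1).
  by rewrite lt_min !divr_gt0// mulr_gt0// divr_gt0.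
move=> z z1; have [e e0 he] := pB_near z1.
have [n [n1 n2]] := ratpt_dense z e0; have [q1 hq] := he _ n1 n2.
have [j hj] := cover _ q1.
have big : eta / 8 <= pB z (a j).
  by apply: le_trans (hq _ (a1 j)); rewrite ler_pM2r// ltW.
have [j0|j0] := posnP j; last by exists j => //; rewrite ge_min big.
exists 1%N => //; rewrite ge_min; apply/orP; right.
apply: le_trans (pB_ge z1 (a1 1%N)).
rewrite /c1 ler_pM2r// ler_pM2r//; apply: (le_trans big).
have i0 : ip z (0, 0) = 0 by rewrite /ip /fst /snd conjc0 !mulr0 addr0.
have n0 : nsq (0, 0) = 0 :> R by rewrite /nsq /fst /snd normc0 expr0n addr0.
by rewrite j0 a0 /pB i0 n0 !subr0 normc1 expr1n divr1 mulr1.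
Qed.

End SeparatedNet.

(** * Translations, rotations and quaternions acting on integrals *)

Section Invariance.
Local Open Scope ereal_scope.
Context {R : realType}.
Notation T1 := (measurableTypeR R).

Lemma measurable_add1 (c : R) : measurable_fun [set: T1] (fun x : T1 => (x + c)%R : T1).
Proof. by apply: measurable_funD => //; exact: measurable_cst. Qed.

(** The translated measure agrees with the original one on half-open
    intervals. *)
Lemma leb_trans (c : R) (h : T1 -> \bar R) : measurable_fun setT h ->
  (forall x, 0 <= h x) -> \int[leb R]_x h (x + c)%R = \int[leb R]_x h x.
Proof.
move=> mh h0.
have mc := measurable_add1 c.
have := @ge0_integral_pushforward _ _ T1 T1 R _ mc (leb R) setT h measurableT mh (fun x _ => h0 x).
rewrite preimage_setT => <-; apply: eq_measure_integral => A mA _.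
symmetry.
apply: (@lebesgue_measure_unique R (measure_function_pushforward__canonical__measure_function_Measure (leb R) mc) _ A mA).
move=> X [[a b] _ <-] /=; rewrite /pushforward.
have -> : (fun x : T1 => (x + c)%R) @^-1` `]a, b] = `](a - c)%R, (b - c)%R]%classic.
  by apply/seteqP; split=> x /=; rewrite !in_itv/= ltrBlDr lerBrDr.
by rewrite /leb/= !lebesgue_measure_itv /= !lte_fin ltrD2r -!EFinB opprB addrA subrK.
Qed.

Lemma area_fubini (f : Real2 R -> \bar R) : measurable_fun setT f -> (forall x, 0 <= f x) ->
  \int[area]_z f z = \int[leb R]_x \int[leb R]_y f (x, y).
Proof. move=> mf f0; exact: (@fubini_tonelli1 _ _ _ _ _ (leb R) (leb R) f mf f0). Qed.

Lemma area_fubini2 (f : Real2 R -> \bar R) : measurable_fun setT f -> (forall x, 0 <= f x) ->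
  \int[area]_z f z = \int[leb R]_y \int[leb R]_x f (x, y).
Proof.
move=> mf f0; rewrite (area_fubini mf f0).
exact: (@fubini_tonelli _ _ _ _ _ (leb R) (leb R) f mf f0).
Qed.

Lemma volume_fubini (f : Real4 R -> \bar R) : measurable_fun setT f -> (forall x, 0 <= f x) ->
  \int[volume]_z f z = \int[area]_x \int[area]_y f (x, y).
Proof. by move=> mf f0; exact: (@fubini_tonelli1 _ _ _ _ _ area area f mf f0). Qed.

Lemma volume_fubini2 (f : Real4 R -> \bar R) : measurable_fun setT f -> (forall x, 0 <= f x) ->
  \int[volume]_z f z = \int[area]_y \int[area]_x f (x, y).
Proof.
move=> mf f0; rewrite (volume_fubini mf f0).
exact: (@fubini_tonelli _ _ _ _ _ area area f mf f0).
Qed.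

Definition add2 (x c : Real2 R) : Real2 R := ((x.1 + c.1)%R, (x.2 + c.2)%R).

Lemma measurable_add2 d (T : measurableType d) (f g : T -> Real2 R) :
  measurable_fun setT f -> measurable_fun setT g ->
  measurable_fun setT (fun x => add2 (f x) (g x)).
Proof.
move=> mf mg; apply/measurable_fun_pairP; split; apply: measurable_funD.
- exact: (measurableT_comp measurable_fst mf).
- exact: (measurableT_comp measurable_fst mg).
- exact: (measurableT_comp measurable_snd mf).
- exact: (measurableT_comp measurable_snd mg).
Qed.

Lemma area_trans (c : Real2 R) (h : Real2 R -> \bar R) : measurable_fun setT h ->
  (forall x, 0 <= h x) -> \int[area]_x h (add2 x c) = \int[area]_x h x.
Proof.
move=> mh h0.
have ma : measurable_fun setT (fun x : Real2 R => add2 x c).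
  by apply: measurable_add2 => //; exact: measurable_cst.
rewrite (area_fubini mh h0) (area_fubini (measurableT_comp mh ma) (fun x => h0 _)).
rewrite -(leb_trans c.1 (h := fun x => \int[leb R]_y h (x, y))); last 2 first.
- exact: (@measurable_fun_fubini_tonelli_F _ _ _ _ _ (leb R) h mh h0).
- by move=> x; exact: integral_ge0.
apply: eq_integral => x _.
rewrite -(leb_trans c.2 (h := fun y => h ((x + c.1)%R, y)))//.
exact: (measurableT_comp mh (pair1_measurable _)).
Qed.

(** Shears preserve volume, for they are translations on each fibre. *)
Lemma shear2 (k : Real2 R -> Real2 R) (h : Real4 R -> \bar R) : measurable_fun setT k ->
  measurable_fun setT h -> (forall x, 0 <= h x) ->
  \int[volume]_z h (z.1, add2 z.2 (k z.1)) = \int[volume]_z h z.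
Proof.
move=> mk mh h0.
have ms : measurable_fun setT (fun z : Real4 R => (z.1, add2 z.2 (k z.1))).
  apply/measurable_fun_pairP; split; first exact: measurable_fst.
  by apply: measurable_add2; [exact: measurable_snd|exact: (measurableT_comp mk measurable_fst)].
rewrite (volume_fubini mh h0) (volume_fubini (measurableT_comp mh ms) (fun x => h0 _)).
apply: eq_integral => x _ /=.
rewrite -(area_trans (k x) (h := fun y => h (x, y)))//.
exact: (measurableT_comp mh (pair1_measurable _)).
Qed.

Lemma shear1 (k : Real2 R -> Real2 R) (h : Real4 R -> \bar R) : measurable_fun setT k ->
  measurable_fun setT h -> (forall x, 0 <= h x) ->
  \int[volume]_z h (add2 z.1 (k z.2), z.2) = \int[volume]_z h z.
Proof.
move=> mk mh h0.
have ms : measurable_fun setT (fun z : Real4 R => (add2 z.1 (k z.2), z.2)).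
  apply/measurable_fun_pairP; split; last exact: measurable_snd.
  by apply: measurable_add2; [exact: measurable_fst|exact: (measurableT_comp mk measurable_snd)].
rewrite (volume_fubini2 mh h0) (volume_fubini2 (measurableT_comp mh ms) (fun x => h0 _)).
apply: eq_integral => x _ /=.
rewrite -(area_trans (k x) (h := fun y => h (y, x)))//.
exact: (measurableT_comp mh (pair2_measurable _)).
Qed.

End Invariance.

Section ComplexMeasurable.
Context {R : realType} {d : measure_display} {T : measurableType d}.
Implicit Types (f g : T -> R[i]).
Local Open Scope ring_scope.

Definition cmeas f := measurable_fun [set: T] (fun x => Re (f x)) /\
  measurable_fun [set: T] (fun x => Im (f x)).

Lemma cmeas_cst (c : R[i]) : cmeas (fun=> c).
Proof. by split; exact: measurable_cst. Qed.

Lemma cmeasD f g : cmeas f -> cmeas g -> cmeas (fun x => f x + g x).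
Proof.
move=> [f1 f2] [g1 g2]; split.
  by under eq_fun do rewrite cReD; exact: measurable_funD.
by under eq_fun do rewrite cImD; exact: measurable_funD.
Qed.

Lemma cmeasM f g : cmeas f -> cmeas g -> cmeas (fun x => f x * g x).
Proof.
move=> [f1 f2] [g1 g2]; split.
  under eq_fun do rewrite cReM.
  by apply: measurable_funB; exact: measurable_funM.
under eq_fun do rewrite cImM.
by apply: measurable_funD; exact: measurable_funM.
Qed.

Lemma cmeasN f : cmeas f -> cmeas (fun x => - f x).
Proof.
move=> hf; rewrite (_ : (fun _ => _) = (fun x => (-1) * f x)).
  by apply: cmeasM => //; exact: cmeas_cst.
by apply/funext => x; rewrite mulN1r.
Qed.

Lemma cmeasB f g : cmeas f -> cmeas g -> cmeas (fun x => f x - g x).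
Proof. by move=> hf /cmeasN; exact: cmeasD. Qed.

Lemma cmeas_conj f : cmeas f -> cmeas (fun x => conjc (f x)).
Proof.
move=> [f1 f2]; split.
  by rewrite (_ : (fun _ => _) = (fun x => Re (f x)))//; apply/funext => x; case: (f x).
rewrite (_ : (fun _ => _) = (fun x => - Im (f x))); last by apply/funext => x; case: (f x).
exact: measurable_funN.
Qed.

Lemma cmeas_real (u : T -> R) : measurable_fun setT u -> cmeas (fun x => (u x)%:C).
Proof. by move=> mu; split => //=; exact: measurable_cst. Qed.

Lemma measurable_inv_ge0 (u : T -> R) : measurable_fun setT u -> (forall x, 0 <= u x) ->
  measurable_fun setT (fun x => (u x)^-1).
Proof.
move=> mu u0; under eq_fun do rewrite -powR_inv1//.
exact: (measurableT_comp (measurable_powR _) mu).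
Qed.

Lemma cmeas_normc f : cmeas f -> measurable_fun setT (fun x => normc (f x)).
Proof.
move=> [f1 f2].
rewrite (_ : (fun _ => _) = (fun x => Num.sqrt (Re (f x) ^+ 2 + Im (f x) ^+ 2))); last first.
  by apply/funext => x; case: (f x).
have hs : measurable_fun [set: R] (@Num.sqrt R).
  by apply: continuous_measurable_fun; exact: sqrt_continuous.
apply: (measurableT_comp hs).
by apply: measurable_funD; exact: measurable_funX.
Qed.

Lemma cmeasV f : cmeas f -> cmeas (fun x => (f x)^-1).
Proof.
move=> hf; have hn := cmeas_normc hf.
have hi : measurable_fun setT (fun x => (normc (f x) ^+ 2)^-1).
  by apply: measurable_inv_ge0 => [|x]; [exact: measurable_funX|exact: sqr_ge0].
rewrite (_ : (fun _ => _) = (fun x => conjc (f x) * ((normc (f x) ^+ 2)^-1)%:C)).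
  by apply: cmeasM; [exact: cmeas_conj|exact: cmeas_real].
apply/funext => x; have [->|n0] := eqVneq (f x) 0; first by rewrite conjc0 mul0r invr0.
apply: (mulfI n0); rewrite divff// mulrA mulcJ -rmorphM divff ?rmorph1//.
by rewrite expf_neq0// normc_eq0.
Qed.

End ComplexMeasurable.

Section Quaternions.
Context {R : realType}.
Local Open Scope ring_scope.

Definition toR2 (z : R[i]) : Real2 R := (Re z, Im z).
Definition toR4 (z : Cplx2 R) : Real4 R := (toR2 z.1, toR2 z.2).

Lemma toR2K z : ofR2 (toR2 z) = z. Proof. by case: z. Qed.
Lemma ofR2K x : toR2 (ofR2 x) = x. Proof. by case: x. Qed.
Lemma toR4K z : ofR4 (toR4 z) = z.
Proof. by case: z => a b; rewrite /ofR4 /toR4 /= !toR2K. Qed.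
Lemma ofR4K x : toR4 (ofR4 x) = x.
Proof. by case: x => a b; rewrite /ofR4 /toR4 /= !ofR2K. Qed.

Lemma add2E x c : ofR2 (add2 x c) = ofR2 x + ofR2 c :> R[i].
Proof. by []. Qed.

Lemma measurable_toR2 d (T : measurableType d) (f : T -> R[i]) : cmeas f ->
  measurable_fun setT (fun x => toR2 (f x)).
Proof. by move=> [f1 f2]; apply/measurable_fun_pairP; split. Qed.

Lemma measurable_toR4 d (T : measurableType d) (f : T -> Cplx2 R) :
  cmeas (fun x => (f x).1) -> cmeas (fun x => (f x).2) ->
  measurable_fun setT (fun x => toR4 (f x)).
Proof.
by move=> f1 f2; apply/measurable_fun_pairP; split; exact: measurable_toR2.
Qed.

Lemma cmeas_ofR2 d (T : measurableType d) (f : T -> Real2 R) : measurable_fun setT f ->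
  cmeas (fun x => ofR2 (f x) : R[i]).
Proof.
move=> mf; split; first exact: (measurableT_comp measurable_fst mf).
exact: (measurableT_comp measurable_snd mf).
Qed.

Lemma cmeas_ofR4 d (T : measurableType d) (f : T -> Real4 R) : measurable_fun setT f ->
  cmeas (fun x => (ofR4 (f x)).1 : R[i]) /\ cmeas (fun x => (ofR4 (f x)).2 : R[i]).
Proof.
move=> mf; split; apply: cmeas_ofR2; first exact: (measurableT_comp measurable_fst mf).
exact: (measurableT_comp measurable_snd mf).
Qed.

(** Right multiplication by the quaternion A + j B, when (z1, z2) stands for
    z1 + j z2. *)
Definition qmul (A B : R[i]) (z : Cplx2 R) : Cplx2 R :=
  (A * z.1 + B * (perp z).1, A * z.2 + B * (perp z).2).

Definition qmap A B (x : Real4 R) : Real4 R := toR4 (qmul A B (ofR4 x)).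

Lemma measurable_qmap A B : measurable_fun setT (qmap A B).
Proof.
have [c1 c2] := cmeas_ofR4 (@measurable_id _ (Real4 R) setT).
apply: measurable_toR4; apply: cmeasD; apply: cmeasM => //; try exact: cmeas_cst.
  by apply: cmeasN; exact: cmeas_conj.
exact: cmeas_conj.
Qed.

(** A unit quaternion with B != 0 is a product of three shears. *)
Lemma qmap_shears A B (h : Real4 R -> \bar R) : B != 0 ->
  normc A ^+ 2 + normc B ^+ 2 = 1 -> measurable_fun setT h -> (forall x, (0 <= h x)%E) ->
  (\int[volume]_x h (qmap A B x) = \int[volume]_x h x)%E.
Proof.
move=> B0 AB mh h0.
pose S2 (l : R[i]) (z : Real2 R) := toR2 (conjc (l * ofR2 z)).
pose S1 (m : R[i]) (z : Real2 R) := toR2 (m * conjc (ofR2 z)).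
have mS2 l : measurable_fun setT (S2 l).
  apply: measurable_toR2; apply: cmeas_conj; apply: cmeasM; first exact: cmeas_cst.
  exact: (cmeas_ofR2 (@measurable_id _ (Real2 R) setT)).
have mS1 m : measurable_fun setT (S1 m).
  apply: measurable_toR2; apply: cmeasM; first exact: cmeas_cst.
  exact: (cmeas_conj (cmeas_ofR2 (@measurable_id _ (Real2 R) setT))).
pose L l (z : Real4 R) : Real4 R := (z.1, add2 z.2 (S2 l z.1)).
pose U m (z : Real4 R) : Real4 R := (add2 z.1 (S1 m z.2), z.2).
have mL l : measurable_fun setT (L l).
  apply/measurable_fun_pairP; split; first exact: measurable_fst.
  by apply: measurable_add2; [exact: measurable_snd|exact: (measurableT_comp (mS2 l) measurable_fst)].
have mU m : measurable_fun setT (U m).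
  apply/measurable_fun_pairP; split; last exact: measurable_snd.
  by apply: measurable_add2; [exact: measurable_fst|exact: (measurableT_comp (mS1 m) measurable_snd)].
have IL l g : measurable_fun setT g -> (forall x, (0 <= g x)%E) ->
    (\int[volume]_x g (L l x) = \int[volume]_x g x)%E by move=> mg g0; exact: shear2.
have IU m g : measurable_fun setT g -> (forall x, (0 <= g x)%E) ->
    (\int[volume]_x g (U m x) = \int[volume]_x g x)%E by move=> mg g0; exact: shear1.
pose p := (A - 1) / (- B); pose q := (conjc A - 1) / (- B).
have AB' : A * conjc A + B * conjc B = 1.
  by rewrite !mulcJ -rmorphD AB rmorph1.
have E x : qmap A B x = L q (U (- B) (L p x)).
  rewrite -[RHS]ofR4K; congr toR4; rewrite /qmul /ofR4 /L /U /S1 /S2 /perp.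
  case: x => x y; rewrite /fst /snd.
  rewrite !add2E !toR2K; move: (ofR2 x) (ofR2 y) => u v.
  have E1 : A * u + B * - conjc v = u + - B * conjc (v + conjc (p * u)).
    by rewrite rmorphD /= conjcK /p; field.
  congr (_, _); first exact: E1.
  have cB : conjc B != 0 by rewrite conjc_eq0.
  apply: (inv_inj (@conjcK R)).
  have E2 : u + - B * (conjc v + p * u) = A * u + B * - conjc v by rewrite /p; field.
  rewrite !rmorphD /= !conjcK !rmorphM /= !conjcK E2.
  have -> : conjc B = (1 - A * conjc A) / B.
    by rewrite -AB' addrC addKr mulrAC divff// mul1r.
  by rewrite /p /q; field.
under eq_integral do rewrite E.
have mLq : measurable_fun setT (fun x => h (L q x)) by exact: (measurableT_comp mh (mL q)).
have mUL : measurable_fun setT (fun x => h (L q (U (- B) x))).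
  exact: (measurableT_comp mLq (mU _)).
by rewrite (IL p (fun x => h (L q (U (- B) x))))// (IU (- B) (fun x => h (L q x)))// IL.
Qed.

Lemma qmap_invariant A B (h : Real4 R -> \bar R) :
  normc A ^+ 2 + normc B ^+ 2 = 1 -> measurable_fun setT h -> (forall x, (0 <= h x)%E) ->
  (\int[volume]_x h (qmap A B x) = \int[volume]_x h x)%E.
Proof.
have [->|B0] := eqVneq B 0; last by move=> AB mh h0; exact: qmap_shears.
rewrite normc0 expr0n addr0 => A1 mh h0.
have E x : qmap A 0 x = qmap 0 1 (qmap 0 (- conjc A) x).
  rewrite /qmap toR4K; congr toR4; case: (ofR4 x) => u v.
  rewrite /qmul /perp /fst /snd !mul0r !add0r !addr0 !mul1r !rmorphM !rmorphN /= !conjcK.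
  by rewrite mulNr opprK mulrNN.
under eq_integral do rewrite E.
have nA : - conjc A != 0.
  rewrite oppr_eq0 conjc_eq0; apply/eqP => A0; move: A1.
  by rewrite A0 normc0 expr0n /= => /eqP; rewrite eq_sym oner_eq0.
have m1 : measurable_fun setT (fun x => h (qmap 0 1 x)).
  exact: (measurableT_comp mh (measurable_qmap 0 1)).
rewrite (@qmap_shears 0 (- conjc A) (fun x => h (qmap 0 1 x)))//.
  by rewrite qmap_shears ?oner_eq0// normc0 normc1 expr0n expr1n add0r.
by rewrite normc0 expr0n add0r normc_opp normc_conj.
Qed.

Lemma qmul_sq A B z : nsq (qmul A B z) = (normc A ^+ 2 + normc B ^+ 2) * nsq z.
Proof. exact: frame_sq. Qed.

Lemma volume_trans (c : Real4 R) (h : Real4 R -> \bar R) : measurable_fun setT h ->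
  (forall x, (0 <= h x)%E) ->
  (\int[volume]_x h (add2 x.1 c.1, add2 x.2 c.2) = \int[volume]_x h x)%E.
Proof.
move=> mh h0.
have m1 : measurable_fun setT (fun z : Real4 R => h (z.1, add2 z.2 c.2)).
  apply: (measurableT_comp mh); apply/measurable_fun_pairP; split; first exact: measurable_fst.
  by apply: measurable_add2; [exact: measurable_snd|exact: measurable_cst].
have := shear1 (k := fun=> c.1) (measurable_cst _) m1 (fun x => h0 _) => /= ->.
exact: (shear2 (k := fun=> c.2) (measurable_cst _) mh h0).
Qed.

End Quaternions.

(** * Measurability of holomorphic functions *)

Section Cutoff.
Context {R : realType}.

Lemma measurable_discrete d (T : measurableType d) (C : countType) (code : T -> C) (w : C -> R) :
  (forall c, measurable (code @^-1` [set c])) -> measurable_fun setT (w \o code).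
Proof.
move=> mc _ Y _; rewrite setTI.
rewrite (_ : _ @^-1` Y = \bigcup_n (if (unpickle n : option C) is Some c then
    (if `[< Y (w c) >] then code @^-1` [set c] else set0) else set0)).
  apply: bigcupT_measurable => n; case: unpickle => [c|]; last exact: measurable0.
  by case: ifP => _; [exact: mc|exact: measurable0].
apply/seteqP; split=> x /=.
  by move=> Yx; exists (pickle (code x)) => //; rewrite pickleK; case: asboolP.
by move=> [n _]; case: unpickle => [c|//]; case: asboolP => // Yc /= ->.
Qed.

Lemma measurable_floor_fiber d (T : measurableType d) (h : T -> R) (n : nat) (z : int) :
  measurable_fun setT h -> measurable [set x | Num.floor (h x * n%:R) = z].
Proof.
move=> mh.
rewrite (_ : mkset _ = (fun x => h x * n%:R) @^-1` `[z%:~R, (z + 1)%:~R[); last first.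
  apply/seteqP; split=> x /=; rewrite in_itv /=.
    by move=> <-; exact: floor_itv.
  exact: floor_def.
rewrite -[X in measurable X]setTI; apply: measurable_funM => //; exact: measurable_cst.
Qed.

Definition near4 (x y : Real4 R) (e : R) := [/\ `|y.1.1 - x.1.1| < e, `|y.1.2 - x.1.2| < e,
  `|y.2.1 - x.2.1| < e & `|y.2.2 - x.2.2| < e].

(** Such a function is the limit, on U, of its values at the points with
    coordinates floor (n t) / n, which are countably many. *)
Lemma measurable_cut4 (u : Real4 R -> R) (U : set (Real4 R)) : measurable U ->
  (forall x, U x -> forall e, 0 < e -> exists2 d, 0 < d & forall y, near4 x y d -> `|u y - u x| <= e) ->
  measurable_fun setT (fun x => \1_U x * u x).
Proof.
move=> mU cu.
pose code n (x : Real4 R) : int * int * int * int :=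
  (Num.floor (x.1.1 * n%:R), Num.floor (x.1.2 * n%:R),
   Num.floor (x.2.1 * n%:R), Num.floor (x.2.2 * n%:R)).
pose w n (c : int * int * int * int) : R :=
  u ((c.1.1.1%:~R / n%:R, c.1.1.2%:~R / n%:R), (c.1.2%:~R / n%:R, c.2%:~R / n%:R)).
apply: (@measurable_fun_cvg _ _ R setT (fun n x => \1_U x * (w n.+1 \o code n.+1) x)).
  move=> n; apply: measurable_funM; first exact: measurable_indic.
  apply: measurable_discrete => -[[[a b] c] d].
  rewrite (_ : _ @^-1` _ = [set x | Num.floor (x.1.1 * n.+1%:R) = a] `&`
     [set x | Num.floor (x.1.2 * n.+1%:R) = b] `&` [set x | Num.floor (x.2.1 * n.+1%:R) = c] `&`
     [set x | Num.floor (x.2.2 * n.+1%:R) = d]); last first.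
    by apply/seteqP; split => x /=; [case=> <- <- <- <-|case=> [[[<- <-] <-] <-]].
  apply: measurableI; first apply: measurableI; first apply: measurableI.
  - exact: (measurable_floor_fiber _ _ (measurableT_comp measurable_fst measurable_fst)).
  - exact: (measurable_floor_fiber _ _ (measurableT_comp measurable_snd measurable_fst)).
  - exact: (measurable_floor_fiber _ _ (measurableT_comp measurable_fst measurable_snd)).
  - exact: (measurable_floor_fiber _ _ (measurableT_comp measurable_snd measurable_snd)).
move=> x _; rewrite indicE; have [xU|xU] := boolP (x \in U); last first.
  by rewrite !mul0r; under eq_cvg do rewrite mul0r; exact: cvg_cst.
under eq_cvg do rewrite mul1r; rewrite mul1r.
apply/cvgrPdist_le => e e0; have [d d0 hd] := cu x (set_mem xU) e e0.
near=> n; rewrite distrC; apply: hd.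
have n0 : 0 < n.+1%:R :> R by rewrite ltr0n.
have fl (t : R) : `|(Num.floor (t * n.+1%:R))%:~R / n.+1%:R - t| < d.
  have nd : n.+1%:R^-1 < d.
    by near: n; exact: (near_infty_natSinv_lt (PosNum d0)).
  apply: le_lt_trans nd; have := floor_itv (t * n.+1%:R) => /andP[f1 f2].
  rewrite ler_norml; apply/andP; split.
    rewrite lerBrDr addrC lerBlDr -[X in _ + X]mul1r -mulrDl ler_pdivlMr//.
    by move: f2; rewrite intrD => /ltW.
  rewrite lerBlDr ler_pdivrMr// mulrDl mulVf ?gt_eqF//.
  by apply: (le_trans f1); rewrite lerDr.
by split; exact: fl.
Unshelve. all: by end_near. Qed.

Definition ballcut (f : Cplx2 R -> R[i]) (x : Real4 R) : R[i] :=
  if nsq (ofR4 x) < 1 then f (ofR4 x) else 0.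

Definition disccut (f : Cplx R -> R[i]) (x : Real2 R) : R[i] :=
  if normc (ofR2 x) < 1 then f (ofR2 x) else 0.

Lemma measurable_nsq d (T : measurableType d) (f : T -> Cplx2 R) :
  cmeas (fun x => (f x).1) -> cmeas (fun x => (f x).2) ->
  measurable_fun setT (fun x => nsq (f x)).
Proof.
by move=> c1 c2; apply: measurable_funD; apply: measurable_funX; exact: cmeas_normc.
Qed.

Lemma measurable_nsq4 : measurable_fun setT (fun x : Real4 R => nsq (ofR4 x)).
Proof.
have [c1 c2] := cmeas_ofR4 (@measurable_id _ (Real4 R) setT).
exact: measurable_nsq.
Qed.

Lemma measurable_ltr d (T : measurableType d) (h : T -> R) (r : R) :
  measurable_fun setT h -> measurable [set x | h x < r].
Proof.
move=> mh; rewrite (_ : mkset _ = h @^-1` `]-oo, r[).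
  by rewrite -[X in measurable X]setTI; exact: mh.
by apply/seteqP; split=> x /=; rewrite in_itv.
Qed.

Lemma measurable_gtr d (T : measurableType d) (h : T -> R) (r : R) :
  measurable_fun setT h -> measurable [set x | r < h x].
Proof.
move=> mh; rewrite (_ : mkset _ = h @^-1` `]r, +oo[).
  by rewrite -[X in measurable X]setTI; exact: mh.
by apply/seteqP; split=> x /=; rewrite in_itv/= andbT.
Qed.

Lemma cmeas_cut4 (f : Cplx2 R -> R[i]) (U : set (Real4 R)) : measurable U ->
  (forall x, U x -> forall e : R, 0 < e -> exists2 d : R, 0 < d & forall z : Cplx2 R,
     normc (z.1 - (ofR4 x).1) < d -> normc (z.2 - (ofR4 x).2) < d ->
     normc (f z - f (ofR4 x)) <= e) ->
  cmeas (fun x => if x \in U then f (ofR4 x) else 0).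
Proof.
move=> mU cf.
have key x : U x -> forall e : R, 0 < e -> exists2 d : R, 0 < d & forall y, near4 x y d ->
    normc (f (ofR4 y) - f (ofR4 x)) <= e.
  move=> Ux e e0; have [d d0 hd] := cf x Ux e e0; exists (d / 2); first by rewrite divr_gt0.
  move=> y [y1 y2 y3 y4]; apply: hd; apply: le_lt_trans (normc_le_ReIm _) _.
    by move: y1 y2; rewrite /= => ? ?; lra.
  by move: y3 y4; rewrite /= => ? ?; lra.
split.
  rewrite (_ : (fun _ => _) = (fun x => \1_U x * Re (f (ofR4 x)))); last first.
    by apply/funext => x; rewrite indicE; case: (x \in U); rewrite ?mul1r ?mul0r.
  apply: measurable_cut4 => // x Ux e /(key x Ux)[d d0 hd]; exists d => // y /hd.
  by rewrite -cReB; apply: le_trans; exact: Re_le_normc.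
rewrite (_ : (fun _ => _) = (fun x => \1_U x * Im (f (ofR4 x)))); last first.
  by apply/funext => x; rewrite indicE; case: (x \in U); rewrite ?mul1r ?mul0r.
apply: measurable_cut4 => // x Ux e /(key x Ux)[d d0 hd]; exists d => // y /hd.
by rewrite -cImB; apply: le_trans; exact: Im_le_normc.
Qed.

Lemma cmeas_ballcut (f : Cplx2 R -> Cplx R) :
  (forall z : Cplx2 R, nsq z < 1 -> differentiable f z) -> cmeas (ballcut f).
Proof.
move=> df; pose U : set (Real4 R) := [set x | nsq (ofR4 x) < 1].
have mU : measurable U by apply: measurable_ltr; exact: measurable_nsq4.
rewrite (_ : ballcut f = (fun x => if x \in U then f (ofR4 x) else 0)).
  by apply: cmeas_cut4 => // x Ux e e0; exact: differentiable2_eps (df _ Ux) _ e0.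
apply/funext => x; rewrite /ballcut; congr (if _ then _ else _).
by apply/idP/idP; rewrite inE.
Qed.

Lemma cmeas_disccut (f : Cplx R -> Cplx R) :
  (forall z : Cplx R, normc z < 1 -> cdiff f z) -> cmeas (disccut f).
Proof.
move=> df; pose U : set (Real4 R) := [set x | normc (ofR4 x).1 < 1].
have [c1 _] := cmeas_ofR4 (@measurable_id _ (Real4 R) setT).
have mU : measurable U by apply: measurable_ltr; exact: cmeas_normc.
have [m1 m2] : cmeas (fun x => if x \in U then f (ofR4 x).1 else 0).
  apply: (@cmeas_cut4 (fun z => f z.1)) => // x Ux e e0.
  by have [d d0 hd] := cdiff_ccont (df _ Ux) e0; exists d => // z z1 _; exact: hd.
pose i (x : Real2 R) : Real4 R := (x, (0, 0)).
have mi : measurable_fun setT i.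
  by apply/measurable_fun_pairP; split; [exact: measurable_id|exact: measurable_cst].
have E : disccut f = (fun x => if i x \in U then f (ofR4 (i x)).1 else 0).
  apply/funext => x; rewrite /disccut; congr (if _ then _ else _).
  by apply/idP/idP; rewrite inE.
by rewrite E; split; [exact: (measurableT_comp m1 mi)|exact: (measurableT_comp m2 mi)].
Qed.

End Cutoff.

Section CircleSubmean.
Context {R : realType}.
Notation CC := (Cplx R).

(** A phase turns the modulus of g(0) into a real part, to which the mean
    value formula applies. *)
Lemma circle_submean (g : CC -> CC) (rho : R) : 1 < rho ->
  (forall z : CC, normc z < rho -> cdiff g z) ->
  normc (g 0) * (2 * pi) <= segint (fun s => normc (g (cis 1 s))) (- pi) pi.
Proof.
move=> rho1 dg; have [b nb bg] := normc_phase (g 0).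
have dbg (z : CC) : normc z < rho -> cdiff (fun z => b * g z) z.
  by move=> zr; exact: cdiffM (cdiff_cst b z) (dg z zr).
have r0 : normc (0 : R[i]) < rho by rewrite normc0 (lt_trans _ rho1).
have := circle_mean0 ltr01 rho1 (fun z _ => dbg z) (cdiff_ccont (dbg _ r0)).
rewrite bg /= => <-.
have on1 (z : CC) : normc z = 1 -> normc z < rho by move=> ->.
apply: le_segint.
- by apply: (@cont_circle _ (fun z => b * g z) 1 _ _ ltr01) => z /on1 /dbg.
- by apply: (@cont_circle_norm _ g 1 _ _ ltr01) => z /on1 /dg.
move=> s _; apply: le_trans (ler_norm _) _; apply: le_trans (Re_le_normc _) _.
by rewrite normcM nb mul1r.
Qed.

Lemma EFin_segint (f : R -> R) (a b : R) : cont_on f a b ->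
  (segint f a b)%:E = (\int[leb R]_(s in `[a, b]) (f s)%:E)%E.
Proof.
move=> cf; rewrite /segint /Rintegral fineK//.
exact: (integrable_fin_num _ (cont_on_integrable cf)).
Qed.

End CircleSubmean.

Section BallVolumes.
Context {R : realType}.

Definition box4 (h : R) : set (Real4 R) :=
  (`]- h, h[ `*` `]- h, h[) `*` (`]- h, h[ `*` `]- h, h[).

Lemma volume_box4 h : 0 < h -> volume (box4 h) = ((2 * h) ^+ 4)%:E.
Proof.
move=> h0.
have L : lebesgue_measure (`]- h, h[%classic : set R) = (2 * h)%:E.
  rewrite lebesgue_measure_itv /= lte_fin gtrN// -EFinB.
  by congr (_%:E); ring.
have mI : measurable (`]- h, h[%classic : set (measurableTypeR R)) by [].
have A : area (`]- h, h[ `*` `]- h, h[ : set (Real2 R)) = ((2 * h) ^+ 2)%:E.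
  rewrite /area /=.
  rewrite (product_measure1E (leb R) (leb R) mI mI).
  by rewrite /leb /= L -EFinM expr2.
rewrite /volume /= (product_measure1E area area (measurableX mI mI) (measurableX mI mI)).
by rewrite [X in (X * X)%E]A -EFinM -exprD.
Qed.

Definition vball (r : R) : set (Real4 R) := [set x | nsq (ofR4 x) < r].

Lemma measurable_vball r : measurable (vball r).
Proof. by apply: measurable_ltr; exact: measurable_nsq4. Qed.

Lemma measurable_box4 h : measurable (box4 h).
Proof. by apply: measurableX; apply: measurableX. Qed.

Lemma nsqR4 (x : Real4 R) : nsq (ofR4 x) = x.1.1 ^+ 2 + x.1.2 ^+ 2 + (x.2.1 ^+ 2 + x.2.2 ^+ 2).
Proof. by rewrite /nsq !sqr_normcE. Qed.

(** The ball is squeezed between cubes. *)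
Lemma volume_vball r : 0 < r -> exists2 v : R, 0 < v & volume (vball r) = v%:E.
Proof.
move=> r0.
have up : (volume (vball r) < +oo)%E.
  have s0 : 0 < r + 1 by rewrite addr_gt0.
  suff : (volume (vball r) <= volume (box4 (r + 1)))%E.
    by move/le_lt_trans; apply; rewrite (volume_box4 s0) ltry.
  apply: le_measure; rewrite ?inE; [exact: measurable_vball|exact: measurable_box4|].
  move=> x; rewrite /vball /= nsqR4 => xr.
  have key (t : R) : t ^+ 2 < r -> t \in `](- (r + 1)), (r + 1)[.
    move=> tr; rewrite in_itv /= -ltr_norml.
    rewrite -(@ltr_pXn2r _ 2)// ?nnegrE ?ltW// real_normK ?num_real//.
    apply: (lt_trans tr); rewrite sqrrD; have := sqr_ge0 r; move: r0; clear; rewrite expr1n; lra.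
  have p1 := sqr_ge0 x.1.1; have p2 := sqr_ge0 x.1.2.
  have p3 := sqr_ge0 x.2.1; have p4 := sqr_ge0 x.2.2.
  by split; split; apply: key; move: xr p1 p2 p3 p4; clear; lra.
have low : (0 < volume (vball r))%E.
  pose h := Num.min 1 r / 4.
  have m0 : 0 < Num.min 1 r by rewrite lt_min ltr01.
  have h0 : 0 < h by rewrite divr_gt0.
  have [h1 h2] : h <= 1 / 4 /\ h <= r / 4 by split; rewrite ler_pM2r// ge_min lexx ?orbT.
  apply: (@lt_le_trans _ _ (volume (box4 h))).
    by rewrite (volume_box4 h0) lte_fin exprn_gt0// mulr_gt0.
  apply: le_measure; rewrite ?inE; [exact: measurable_box4|exact: measurable_vball|].
  have hh : h ^+ 2 <= r / 16.
    rewrite expr2; apply: (@le_trans _ _ (r / 4 * (1 / 4))); last by move: r0; clear; lra.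
    by apply: ler_pM => //; exact: ltW.
  have key (t : R) : t \in `](- h), h[ -> t ^+ 2 <= r / 16.
    rewrite in_itv /= -ltr_norml => th; apply: le_trans hh.
    by rewrite -real_normK ?num_real// ler_pXn2r ?nnegrE// ltW.
  move=> [[a b] [c e]] [[/= ha hb] [/= hc he]]; rewrite /vball /= nsqR4 /=.
  have := key _ ha; have := key _ hb; have := key _ hc; have := key _ he.
  by move: r0; clear; lra.
exists (fine (volume (vball r))).
  by rewrite -lte_fin fineK// ge0_fin_numE// ltW.
by rewrite fineK// ge0_fin_numE// ltW.
Qed.

End BallVolumes.

(** * Mean value inequalities on the ball *)

Section Rotations.
Context {R : realType}.

Definition crot (s : R) (w : Real4 R) : Real4 R := qmap (cis 1 s) 0 w.

Lemma rotE s w : ofR4 (crot s w) = (cis 1 s * (ofR4 w).1, cis 1 s * (ofR4 w).2).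
Proof. by rewrite /crot /qmap toR4K /qmul !mul0r !addr0. Qed.

Lemma nsq_scale (a : R[i]) (z : Cplx2 R) : nsq (a * z.1, a * z.2) = normc a ^+ 2 * nsq z.
Proof. by rewrite /nsq /= !normcM !exprMn mulrDr. Qed.

Lemma nsq_rot s w : nsq (ofR4 (crot s w)) = nsq (ofR4 w).
Proof. by rewrite rotE nsq_scale normc_cis// expr1n mul1r. Qed.

Lemma measurable_rot : measurable_fun setT (fun x : Real4 R * measurableTypeR R => crot x.2 x.1).
Proof.
have [c1 c2] := cmeas_ofR4 (@measurable_fst _ _ (Real4 R) (measurableTypeR R)).
have cc : cmeas (fun x : Real4 R * measurableTypeR R => cis 1 x.2).
  split.
    under eq_fun do rewrite /= mul1r.
    have mc : measurable_fun setT (@cos R) by apply: continuous_measurable_fun; exact: continuous_cos.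
    exact: (measurableT_comp mc measurable_snd).
  under eq_fun do rewrite /= mul1r.
  have ms : measurable_fun setT (@sin R) by apply: continuous_measurable_fun; exact: continuous_sin.
  exact: (measurableT_comp ms measurable_snd).
rewrite (_ : (fun _ => _) = (fun x : Real4 R * measurableTypeR R =>
    toR4 (cis 1 x.2 * (ofR4 x.1).1, cis 1 x.2 * (ofR4 x.1).2))); last first.
  by apply/funext => x; rewrite -rotE ofR4K.
by apply: measurable_toR4; exact: cmeasM.
Qed.

Definition period : set (measurableTypeR R) := `[- pi, pi]%classic.

(** Rotations preserve volume, so Tonelli's theorem applies. *)
Lemma rot_mean (H : Real4 R -> R) : measurable_fun setT H -> (forall x, 0 <= H x) ->
  measurable_fun setT (fun w => \int[leb R]_(s in period) (H (crot s w))%:E)%E /\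
  (\int[volume]_w \int[leb R]_(s in period) (H (crot s w))%:E =
   ((2 * pi)%R)%:E * \int[volume]_w (H w)%:E)%E.
Proof.
move=> mH H0; pose D := period.
have mD : measurable D by exact: measurable_itv.
pose K (x : Real4 R * measurableTypeR R) : \bar R := (\1_D x.2 * H (crot x.2 x.1))%:E.
have mK : measurable_fun setT K.
  apply/measurable_EFinP; apply: measurable_funM.
    have mi : measurable_fun setT (\1_D : measurableTypeR R -> R) by exact: measurable_indic.
    exact: (measurableT_comp mi measurable_snd).
  exact: (measurableT_comp mH measurable_rot).
have K0 x : (0 <= K x)%E by rewrite lee_fin mulr_ge0.
have KE w : (\int[leb R]_(s in D) (H (crot s w))%:E = \int[leb R]_s K (w, s))%E.
  rewrite integral_mkcond; apply: eq_integral => s _; rewrite /K /= patchE indicE.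
  by case: (s \in D); rewrite ?mul1r ?mul0r.
split.
  under eq_fun do rewrite KE.
  exact: (@measurable_fun_fubini_tonelli_F _ _ _ _ _ (leb R) K mK K0).
under eq_integral do rewrite KE.
rewrite (@fubini_tonelli _ _ _ _ _ volume (leb R) K mK K0).
have E s : (\int[volume]_w K (w, s) = (\int[volume]_w (H w)%:E) * (\1_D s)%:E)%E.
  rewrite /K /=.
  under eq_integral do rewrite EFinM.
  have mHs : measurable_fun setT (fun w => (H (crot s w))%:E).
    by apply/measurable_EFinP; apply: (measurableT_comp mH); exact: measurable_qmap.
  rewrite (ge0_integralZl volume measurableT mHs); [|by move=> x _; rewrite lee_fin|by rewrite lee_fin].
  rewrite muleC; congr (_ * _)%E.
  have mHE : measurable_fun setT (fun x => (H x)%:E) by exact/measurable_EFinP.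
  apply: (qmap_invariant (h := fun x => (H x)%:E)) => //.
  by rewrite normc_cis// normc0 expr1n expr0n addr0.
under eq_integral do rewrite E.
have mi : measurable_fun setT (fun s => (\1_D s : R)%:E).
  by apply/measurable_EFinP; exact: measurable_indic.
rewrite (ge0_integralZl (leb R) measurableT mi); [|by move=> x _; rewrite lee_fin|
  by apply: integral_ge0 => x _; rewrite lee_fin].
rewrite muleC; congr (_ * _)%E.
rewrite integral_indic// setIT /D /period /leb/= lebesgue_measure_itv/= lte_fin gtrN ?pi_gt0//.
by rewrite -EFinB opprK; congr (_%:E); ring.
Qed.

End Rotations.

Section BallGain.
Context {R : realType}.
Notation CC := (Cplx R).

(** An inequality between integrals follows from the same inequality for the
    means over all circles of rotations. *)
Lemma rot_le (K H : Real4 R -> R) : measurable_fun setT K -> (forall x, 0 <= K x) ->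
  measurable_fun setT H -> (forall x, 0 <= H x) ->
  (forall w, ((K w * (2 * pi))%:E <= \int[leb R]_(s in period) (H (crot s w))%:E)%E) ->
  (\int[volume]_w (K w)%:E <= \int[volume]_w (H w)%:E)%E.
Proof.
move=> mK K0 mH H0 KH; have [mI E] := rot_mean mH H0.
have p0 : 0 < 2 * pi :> R by rewrite mulr_gt0// pi_gt0.
have mKE : measurable_fun setT (fun w => (K w)%:E) by exact/measurable_EFinP.
rewrite -(@lee_pmul2l _ (2 * pi)%:E) ?lte_fin// -E.
rewrite -(ge0_integralZl volume measurableT mKE); last 2 first.
- by move=> x _; rewrite lee_fin.
- by rewrite lee_fin ltW.
apply: ge0_le_integral => //.
- by move=> x _; rewrite mule_ge0// lee_fin// ltW.
- by apply: measurable_funeM.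
- by move=> w _; rewrite -EFinM mulrC; exact: KH.
Qed.

Definition sc (z : CC) (v : Cplx2 R) : Cplx2 R := (z * v.1, z * v.2).

Definition vplus (p q : Cplx2 R) : Cplx2 R := (p.1 + q.1, p.2 + q.2).

Lemma nsq_sc z v : nsq (sc z v) = normc z ^+ 2 * nsq v.
Proof. exact: nsq_scale. Qed.

Lemma ofR4_rot s w : ofR4 (crot s w) = sc (cis 1 s) (ofR4 w).
Proof. exact: rotE. Qed.

(** The mean value inequality holds on each complex line through the
    origin. *)
Lemma submean_ball (G : Cplx2 R -> CC) (rr v : R) : 0 < rr -> volume (vball rr) = v%:E ->
  (forall w z, normc z ^+ 2 * nsq w < rr -> cdiff (fun z => G (sc z w)) z) ->
  measurable_fun setT (fun x : Real4 R => if nsq (ofR4 x) < rr then normc (G (ofR4 x)) else 0) ->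
  ((normc (G (0, 0)) * v)%:E <=
    \int[volume]_x (if nsq (ofR4 x) < rr then normc (G (ofR4 x)) else 0)%:E)%E.
Proof.
move=> rr0 vE dG mH.
have -> : (normc (G (0, 0)) * v)%:E =
    (\int[volume]_x (normc (G (0, 0)) * \1_(vball rr) x)%:E)%E.
  under eq_integral do rewrite EFinM.
  have mi : measurable_fun setT (fun s => (\1_(vball rr) s : R)%:E).
    by apply/measurable_EFinP; apply: measurable_indic; exact: measurable_vball.
  rewrite (ge0_integralZl volume measurableT mi); [|by move=> x _; rewrite lee_fin|by rewrite lee_fin normc_ge0].
  by rewrite integral_indic//; [rewrite setIT EFinM -vE|exact: measurable_vball].
apply: rot_le => //.
- apply: measurable_funM; first exact: measurable_cst.
  by apply: measurable_indic; exact: measurable_vball.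
- by move=> x; rewrite mulr_ge0 ?normc_ge0.
- by move=> x; case: ifP => // _; exact: normc_ge0.
move=> w; rewrite indicE; have [wr|wr] := boolP (w \in vball rr); last first.
  by rewrite mulr0 mul0r integral_ge0// => s _; case: ifP; rewrite lee_fin ?normc_ge0.
move: wr; rewrite inE /vball /= mulr1 => wr.
pose m := (nsq (ofR4 w) + rr) / 2.
have w0 := nsq_ge0 (ofR4 w).
have [m1 m2] : nsq (ofR4 w) < m /\ m < rr by split; rewrite /m; move: wr; clear; lra.
have m0 : 0 < m := le_lt_trans w0 m1.
pose rho := Num.sqrt (rr / m).
have rho2 : rho ^+ 2 = rr / m by rewrite sqr_sqrtr// divr_ge0// ltW.
have rho1 : 1 < rho.
  rewrite -(@ltr_pXn2r _ 2) ?nnegrE ?sqrtr_ge0//.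
  by rewrite rho2 expr1n ltr_pdivlMr// mul1r.
have dg (z : CC) : normc z < rho -> cdiff (fun z => G (sc z (ofR4 w))) z.
  move=> zr; apply: dG.
  have zz : normc z ^+ 2 <= rr / m.
    by rewrite -rho2 ler_pXn2r ?nnegrE ?normc_ge0 ?sqrtr_ge0// ltW.
  apply: (@le_lt_trans _ _ (rr / m * nsq (ofR4 w))); first by rewrite ler_wpM2r.
  by rewrite mulrAC ltr_pdivrMr// ltr_pM2l.
have E s : (if nsq (ofR4 (crot s w)) < rr then normc (G (ofR4 (crot s w))) else 0) =
    normc (G (sc (cis 1 s) (ofR4 w))).
  by rewrite nsq_rot wr ofR4_rot.
under eq_integral do rewrite E.
have := circle_submean rho1 dg.
have -> : sc 0 (ofR4 w) = (0, 0) by rewrite /sc !mul0r.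
rewrite -lee_fin => /le_trans; apply.
rewrite (EFin_segint (f := fun s => normc (G (sc (cis 1 s) (ofR4 w)))))//.
apply: (@cont_circle_norm _ (fun z => G (sc z (ofR4 w))) 1 _ _ ltr01) => z z1.
by apply: dg; rewrite z1.
Qed.

(** By [circle_gain] on each complex line, the mean of |F| exceeds |F(0)| by a
    multiple of the mean of |F - F(0)| over a smaller ball, up to a term of
    second order in t; and |F - F(0)| is at least |F(0)| in mean on a small
    ball around the zero of F. The constants gam and r are the same for all
    F. *)
Lemma ball_gain (c v : R) : 0 < c <= 1 -> 0 < v -> volume (vball 1) = v%:E ->
  exists gam r : R, [/\ 0 < gam, 0 < r < 1 & forall F : Cplx2 R -> CC,
    (forall p q z, nsq (vplus p (sc z q)) < 1 -> cdiff (fun z => F (vplus p (sc z q))) z) ->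
    cmeas (ballcut F) ->
    (exists2 a, nsq a <= 1 - c & F a = 0) ->
    (((1 + gam) * v * normc (F (0, 0)))%:E <=
      \int[volume]_x (if nsq (ofR4 x) < 1 then normc (F (sc r%:C (ofR4 x))) else 0)%:E)%E].
Proof.
move=> /andP[c0 c1] v0 vE.
(* F is dilated by r' for the lower bound near its zero and by r > r' for the
   mean; after dilation the ball of squared radius rr around the zero stays in
   the unit ball. *)
pose r' := 1 - c / 4; pose r := 1 - c / 8; pose rr := c ^+ 3 / 16.
have [r'0 r'r r1] : [/\ 0 < r', r' < r & r < 1].
  by split; rewrite /r' /r; move: c0 c1; clear; lra.
have r0 : 0 < r := lt_trans r'0 r'r.
have rr0 : 0 < rr by rewrite divr_gt0// exprn_gt0.
have [u u0 uE] := volume_vball rr0.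
pose k := (r - r') / (2 * r').
have k0 : 0 < k by rewrite divr_gt0 ?subr_gt0// mulr_gt0.
pose la := k * u / v; have la0 : 0 < la by rewrite divr_gt0// mulr_gt0.
pose t := la / 2; have t0 : 0 < t by rewrite divr_gt0.
have t2 : 0 < 1 + t ^+ 2 by rewrite ltr_pwDl// sqr_ge0.
pose gam := t ^+ 2 / (1 + t ^+ 2).
exists gam, r; split; [by rewrite divr_gt0// exprn_gt0|by rewrite r0|].
move=> F dF mF [a a1 Fa].
have sc_meas (s : R) d (T : measurableType d) (g : T -> Real4 R) : measurable_fun setT g ->
    measurable_fun setT (fun x => toR4 (sc s%:C (ofR4 (g x)))).
  move=> mg; have [g1 g2] := cmeas_ofR4 mg.
  by apply: measurable_toR4; apply: cmeasM => //; exact: cmeas_cst.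
have mid : measurable_fun setT (fun x : Real4 R => x) by exact: measurable_id.
have scn (s : R) (z : Cplx2 R) : 0 < s -> s < 1 -> nsq z < 1 -> nsq (sc s%:C z) < 1.
  move=> s0 s1 z1; rewrite nsq_sc normc_real gtr0_norm//.
  apply: le_lt_trans z1; by rewrite ler_piMl ?nsq_ge0// expr_le1 ?(ltW s1)// ltW.
have cF (s : R) : 0 < s -> s < 1 ->
    cmeas (fun x : Real4 R => ballcut F (toR4 (sc s%:C (ofR4 x)))).
  by move=> s0 s1; have mm := sc_meas s _ _ _ mid; case: mF => h1 h2;
    split; [exact: (measurableT_comp h1 mm)|exact: (measurableT_comp h2 mm)].
have mB : measurable_fun setT (\1_(vball 1) : Real4 R -> R).
  by apply: measurable_indic; exact: measurable_vball.
pose HR (x : Real4 R) : R := if nsq (ofR4 x) < 1 then normc (F (sc r%:C (ofR4 x))) else 0.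
have HRE x : HR x = \1_(vball 1) x * normc (ballcut F (toR4 (sc r%:C (ofR4 x)))).
  rewrite /HR indicE /ballcut toR4K; have [x1|x1] := boolP (nsq (ofR4 x) < 1).
    by rewrite (scn _ _ r0 r1 x1) mem_set ?mul1r.
  by rewrite memNset ?mul0r//; exact/negP.
have mHR : measurable_fun setT HR.
  rewrite (_ : HR = fun x => \1_(vball 1) x * normc (ballcut F (toR4 (sc r%:C (ofR4 x))))).
    by apply: measurable_funM => //; apply: cmeas_normc; exact: cF.
  by apply/funext => x; exact: HRE.
have r'1 : r' < 1 := lt_trans r'r r1.
pose HB (x : Real4 R) : R := if nsq (ofR4 x) < 1 then normc (F (sc r'%:C (ofR4 x)) - F (0, 0)) else 0.
have HBE x : HB x = \1_(vball 1) x * normc (ballcut F (toR4 (sc r'%:C (ofR4 x))) - F (0, 0)).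
  rewrite /HB indicE /ballcut toR4K; have [x1|x1] := boolP (nsq (ofR4 x) < 1).
    by rewrite (scn _ _ r'0 r'1 x1) mem_set ?mul1r.
  by rewrite memNset ?mul0r//; exact/negP.
have mHB : measurable_fun setT HB.
  rewrite (_ : HB = fun x => \1_(vball 1) x * normc (ballcut F (toR4 (sc r'%:C (ofR4 x))) - F (0, 0))).
    by apply: measurable_funM => //; apply: cmeas_normc; apply: cmeasB; [exact: cF|exact: cmeas_cst].
  by apply/funext => x; exact: HBE.
have HR0 x : 0 <= HR x by rewrite /HR; case: ifP => // _; exact: normc_ge0.
have HB0 x : 0 <= HB x by rewrite /HB; case: ifP => // _; exact: normc_ge0.
have stepB : ((normc (F (0, 0)) * u)%:E <= \int[volume]_x (HB x)%:E)%E.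
  pose b : Cplx2 R := sc (r'^-1)%:C a.
  have r'C : r'%:C != 0 :> R[i] by rewrite -normc_gt0 normc_real gtr0_norm.
  have bE : sc r'%:C b = a.
    by rewrite /b /sc /fst /snd !mulrA -rmorphM divff ?gt_eqF// !mul1r; case: (a).
  have b1 : nsq b <= 1 - c / 2.
    rewrite nsq_sc normc_real gtr0_norm ?invr_gt0// exprVn mulrC ler_pdivrMr ?exprn_gt0//.
    apply: (le_trans a1); rewrite /r'.
    have -> : (1 - c / 2) * (1 - c / 4) ^+ 2 = 1 - c + c ^+ 2 * (5 / 16 - c / 32) by field.
    by rewrite lerDl mulr_ge0 ?sqr_ge0//; move: c1; clear; lra.
  have addb (w : Cplx2 R) : nsq w < rr -> nsq (vplus b w) < 1.
    move=> wr.
    have comp (x y : R[i]) : normc (x + y) ^+ 2 <= (1 + c / 2) * normc x ^+ 2 + (1 + 2 / c) * normc y ^+ 2.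
      have h : normc (x + y) ^+ 2 <= (normc x + normc y) ^+ 2.
        by rewrite ler_pXn2r ?nnegrE ?normc_ge0 ?addr_ge0 ?normc_ge0// normcDle.
      apply: (le_trans h); rewrite -subr_ge0.
      have -> : (1 + c / 2) * normc x ^+ 2 + (1 + 2 / c) * normc y ^+ 2 - (normc x + normc y) ^+ 2
         = (c * normc x - 2 * normc y) ^+ 2 / (2 * c) by field; rewrite gt_eqF.
      by rewrite divr_ge0 ?sqr_ge0// mulr_ge0// ltW.
    have : nsq (vplus b w) <= (1 + c / 2) * nsq b + (1 + 2 / c) * nsq w.
      apply: le_trans (lerD (comp _ _) (comp _ _)) _.
      by rewrite /nsq le_eqVlt; apply/orP; left; apply/eqP; ring.
    move/le_lt_trans; apply.
    have e1 : (1 + c / 2) * nsq b <= (1 + c / 2) * (1 - c / 2).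
      by rewrite ler_pM2l// addr_gt0// divr_gt0.
    have e2 : (1 + 2 / c) * nsq w <= (1 + 2 / c) * rr.
      by rewrite ler_pM2l ?(ltW wr)// addr_gt0// divr_gt0.
    have e3 : (1 + 2 / c) * rr = c ^+ 2 * (c / 16 + 1 / 8) by rewrite /rr; field; rewrite gt_eqF.
    have e4 : c ^+ 2 * (c / 16 + 1 / 8) <= c ^+ 2 * (3 / 16).
      by rewrite ler_pM2l ?exprn_gt0//; move: c1; clear; lra.
    have e5 : 0 < c ^+ 2 by rewrite exprn_gt0.
    have e6 : (1 + c / 2) * (1 - c / 2) = 1 - c ^+ 2 / 4 by field.
    by move: e1 e2; rewrite e3 e6; move: e4 e5; set C2 := c ^+ 2; clear; lra.
  pose G (w : Cplx2 R) : CC := F (sc r'%:C (vplus b w)) - F (0, 0).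
  have GF w : sc r'%:C (vplus b w) = vplus a (sc r'%:C w).
    rewrite -bE /vplus /sc /fst /snd; congr (_, _); rewrite mulrDr//.
  have dG w z : normc z ^+ 2 * nsq w < rr -> cdiff (fun z => G (sc z w)) z.
    move=> zw.
    have E : (fun z => G (sc z w)) = (fun z => F (vplus a (sc z (sc r'%:C w))) - F (0, 0)).
      apply/funext => y; rewrite /G GF /sc /fst /snd; congr (F _ - _); congr vplus.
      by congr (_, _); rewrite mulrCA.
    rewrite E; apply: cdiffB (cdiff_cst _ _); apply: dF.
    have -> : vplus a (sc z (sc r'%:C w)) = sc r'%:C (vplus b (sc z w)).
      by rewrite GF /sc /fst /snd; congr vplus; congr (_, _); rewrite mulrCA.
    by apply: scn => //; apply: addb; rewrite nsq_sc.
  pose HG (x : Real4 R) : R := if nsq (ofR4 x) < rr then normc (G (ofR4 x)) else 0.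
  pose sh (x : Real4 R) : Real4 R := (add2 x.1 (toR2 b.1), add2 x.2 (toR2 b.2)).
  have shE x : ofR4 (sh x) = vplus b (ofR4 x).
    by rewrite /sh /ofR4 /vplus /fst /snd !add2E !toR2K; congr (_, _); rewrite addrC.
  have msh : measurable_fun setT sh.
    apply/measurable_fun_pairP; split; apply: measurable_add2;
      by [exact: measurable_fst|exact: measurable_snd|exact: measurable_cst].
  have HGE x : HG x = \1_(vball rr) x * HB (sh x).
    rewrite /HG /HB indicE shE; have [x1|x1] := boolP (nsq (ofR4 x) < rr).
      by rewrite mem_set// (addb _ x1) mul1r.
    by rewrite memNset ?mul0r//; exact/negP.
  have mHG : measurable_fun setT HG.
    rewrite (_ : HG = fun x => \1_(vball rr) x * HB (sh x)); last first.
      by apply/funext => x; exact: HGE.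
    apply: measurable_funM; first by apply: measurable_indic; exact: measurable_vball.
    exact: (measurableT_comp mHB msh).
  have := submean_ball rr0 uE dG mHG.
  have -> : normc (G (0, 0)) = normc (F (0, 0)).
    have e0 : vplus b (0, 0) = b by case: (b) => x y; rewrite /vplus /fst /snd !addr0.
    by rewrite /G e0 bE Fa sub0r normc_opp.
  move/le_trans; apply.
  have mHBE : measurable_fun setT (fun x => (HB x)%:E) by exact/measurable_EFinP.
  have <- := volume_trans (toR4 b) (h := fun x => (HB x)%:E) mHBE (fun x => HB0 x).
  have mHBs : measurable_fun setT (fun x => (HB (sh x))%:E) by exact: (measurableT_comp mHBE msh).
  apply: ge0_le_integral => //.
  - by move=> x _; rewrite lee_fin; case: ifP => // _; exact: normc_ge0.
  - exact/measurable_EFinP.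
  move=> x _; rewrite lee_fin -/(HG x) HGE -/(sh x) indicE.
  by case: (x \in _); rewrite ?mul1r ?mul0r.
have stepA : (\int[volume]_x (((1 + t ^+ 2)^-1 * (\1_(vball 1) x * normc (F (0, 0)) + t * k * HB x))%:E)
     <= \int[volume]_x (HR x)%:E)%E.
  apply: rot_le => //.
  - apply: measurable_funM; first exact: measurable_cst.
    apply: measurable_funD; apply: measurable_funM => //; exact: measurable_cst.
  - move=> x; apply: mulr_ge0; first by rewrite invr_ge0 (ltW t2).
    apply: addr_ge0; first by rewrite mulr_ge0 ?normc_ge0.
    by rewrite mulr_ge0// mulr_ge0 ?(ltW t0) ?(ltW k0).
  move=> w; rewrite indicE; have [w1|w1] := boolP (w \in vball 1); last first.
    have -> : HB w = 0.
      by rewrite /HB ifF//; apply/negP => h; move/negP: w1; apply; rewrite inE.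
    rewrite mul0r mulr0 addr0 mulr0 mul0r integral_ge0// => s _.
    by rewrite lee_fin.
  move: w1; rewrite inE /vball /= mul1r => w1.
  have dg (z : CC) : normc z < 1 -> cdiff (fun z => F (sc z (ofR4 w))) z.
    move=> z1.
    have E : (fun z => F (sc z (ofR4 w))) = (fun z => F (vplus (0, 0) (sc z (ofR4 w)))).
      by apply/funext => y; case: (sc y _) => x x'; rewrite /vplus /fst /snd !add0r.
    rewrite E; apply: dF.
    have -> : vplus (0, 0) (sc z (ofR4 w)) = sc z (ofR4 w).
      by case: (sc z _) => x x'; rewrite /vplus /fst /snd !add0r.
    rewrite nsq_sc; apply: le_lt_trans w1; rewrite ler_piMl ?nsq_ge0//.
    by rewrite expr_le1 ?normc_ge0// ltW.
  have := circle_gain r'0 r'r r1 (ltW t0) dg.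
  have -> : sc 0 (ofR4 w) = (0, 0) by rewrite /sc !mul0r.
  rewrite -/k -lee_fin => h; apply: le_trans (_ : _ <= _)%E _; last first.
    have -> : (\int[leb R]_(s in period) (HR (crot s w))%:E)%E =
       (\int[leb R]_(s in period) (normc (F (sc (cis r s) (ofR4 w))))%:E)%E.
      apply: eq_integral => s _; rewrite /HR nsq_rot w1 ofR4_rot.
      congr (_%:E); congr normc; congr F; rewrite [cis r s]cisE.
      by rewrite /sc /fst /snd !mulrA.
    rewrite -(EFin_segint (f := fun s => normc (F (sc (cis r s) (ofR4 w))))).
      exact: h.
    apply: (@cont_circle_norm _ (fun z => F (sc z (ofR4 w))) r _ _ r0) => z zr.
    by apply: dg; rewrite zr.
  rewrite /HB w1 lee_fin le_eqVlt; apply/orP; left; apply/eqP.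
  by congr (_ * _); rewrite mulrC.
have int1 : (\int[volume]_x (\1_(vball 1) x * normc (F (0, 0)))%:E = (normc (F (0, 0)) * v)%:E)%E.
  under eq_integral do rewrite mulrC EFinM.
  have mi : measurable_fun setT (fun s => (\1_(vball (1 : R)) s : R)%:E) by apply/measurable_EFinP; exact: mB.
  rewrite (ge0_integralZl volume measurableT mi); [|by move=> x _; rewrite lee_fin|by rewrite lee_fin normc_ge0].
  by rewrite integral_indic//; [rewrite setIT EFinM -vE|exact: measurable_vball].
apply: le_trans stepA.
have mi2 : measurable_fun setT (fun x => (\1_(vball (1 : R)) x * normc (F (0, 0)))%:E).
  by apply/measurable_EFinP; apply: measurable_funM => //; exact: measurable_cst.
have mHBE : measurable_fun setT (fun x => (HB x)%:E) by exact/measurable_EFinP.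
have mHBt : measurable_fun setT (fun x => (t * k * HB x)%:E).
  by apply/measurable_EFinP; apply: measurable_funM => //; exact: measurable_cst.
have tk : 0 <= t * k by rewrite mulr_ge0// ltW.
have i20 x : (0 <= (\1_(vball (1 : R)) x * normc (F (0, 0)))%:E)%E by rewrite lee_fin mulr_ge0 ?normc_ge0.
have B0 x : (0 <= (t * k * HB x)%:E)%E by rewrite lee_fin mulr_ge0.
have it : (0 <= ((1 + t ^+ 2)^-1)%:E)%E by rewrite lee_fin invr_ge0 ltW.
under eq_integral do rewrite EFinM EFinD.
rewrite (ge0_integralZl volume measurableT _ _ it); last 2 first.
- exact: emeasurable_funD.
- by move=> x _; rewrite adde_ge0.
rewrite (ge0_integralD volume measurableT (fun x _ => i20 x) mi2 (fun x _ => B0 x) mHBt) int1.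
have -> : (\int[volume]_x (t * k * HB x)%:E = (t * k)%:E * \int[volume]_x (HB x)%:E)%E.
  under eq_integral do rewrite EFinM.
  by rewrite (ge0_integralZl volume measurableT mHBE)// => x _; rewrite lee_fin.
have := lee_wpmul2l (x := (t * k)%:E) _ stepB; rewrite lee_fin => /(_ tk) sB.
apply: (@le_trans _ _ (((1 + t ^+ 2)^-1)%:E *
   ((normc (F (0, 0)) * v)%:E + (t * k)%:E * (normc (F (0, 0)) * u)%:E))%E); last first.
  by apply: lee_wpmul2l => //; apply: leeD.
rewrite -!EFinM lee_fin le_eqVlt; apply/orP; left; apply/eqP.
have uk : k * u = 2 * t * v.
  by rewrite /t /la; field; rewrite gt_eqF.
have -> : normc (F (0, 0)) * v + t * k * (normc (F (0, 0)) * u) =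
   normc (F (0, 0)) * (v + t * (k * u)) by ring.
by rewrite uk /gam; field; rewrite gt_eqF.
Qed.

End BallGain.

(** * Means over spheres *)

Section SphereIntegral.
Context {R : realType}.

(** The ball without its centre, where [radial] is meaningful. *)
Definition pball : set (Real4 R) := [set x | 0 < nsq (ofR4 x)] `&` [set x | nsq (ofR4 x) < 1].

Lemma measurable_pball : measurable pball.
Proof.
apply: measurableI; first exact: measurable_gtr measurable_nsq4.
exact: measurable_ltr measurable_nsq4.
Qed.

Definition dir (x : Real4 R) : Cplx2 R := ofR4 (radial x).

Lemma dirE x : dir x = sc ((norm2 (ofR4 x))^-1)%:C (ofR4 x).
Proof.
rewrite /dir /radial /ofR4 /sc /ofR2 /fst /snd; set t := (norm2 _)^-1.
by congr (_, _); apply/eqP; rewrite eq_complex /= !mul0r subr0 addr0 !eqxx.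
Qed.

Lemma nsq_dir x : 0 < nsq (ofR4 x) -> nsq (dir x) = 1.
Proof.
move=> x0; rewrite dirE nsq_sc normc_real -nsqE real_normK ?num_real// exprVn mulVf//.
by rewrite nsqE gt_eqF.
Qed.

(** [surface] is defined as four times the image of the volume of the ball
    under [radial]. *)
Lemma surface_integral (h : Real4 R -> \bar R) : measurable_fun setT h -> (forall x, (0 <= h x)%E) ->
  (\int[surface]_(x in [set x : Real4 R | sphere2 (ofR4 x)]) h x =
   4%:E * \int[volume]_(x in pball) h (radial x))%E.
Proof.
move=> mh h0; set S := [set x | _].
have SE x : S x <-> nsq (ofR4 x) = 1.
  rewrite /S /sphere2 /= -nsqE; split => [->|]; first by rewrite expr1n.
  have n0 : 0 <= norm2 (ofR4 x) by exact: sqrtr_ge0.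
  by move/eqP; rewrite -[X in _ == X](expr1n _ 2) eqrXn2// => /eqP.
have mS : measurable S.
  rewrite (_ : S = (fun x => nsq (ofR4 x)) @^-1` [set 1]).
    by rewrite -[X in measurable X]setTI; exact: measurable_nsq4.
  by apply/seteqP; split => x /SE.
pose c (x : Real4 R) : R := \1_(vball 1) x.
have mc : measurable_fun setT c by apply: measurable_indic; exact: measurable_vball.
pose rad (x : Real4 R) : Real4 R := ((c x * (radial x).1.1, c x * (radial x).1.2),
   (c x * (radial x).2.1, c x * (radial x).2.2)).
have mrad : measurable_fun setT rad.
  have mr := @measurable_radial R.
  have m1 := measurableT_comp measurable_fst mr; have m2 := measurableT_comp measurable_snd mr.
  have m11 := measurableT_comp measurable_fst m1; have m12 := measurableT_comp measurable_snd m1.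
  have m21 := measurableT_comp measurable_fst m2; have m22 := measurableT_comp measurable_snd m2.
  by apply/measurable_fun_pairP; split; apply/measurable_fun_pairP; split; exact: measurable_funM.
have radE x : nsq (ofR4 x) < 1 -> rad x = radial x.
  by move=> x1; rewrite /rad /c indicE mem_set// !mul1r; case: (radial x) => -[? ?] [? ?].
have radN x : ~ (nsq (ofR4 x) < 1) -> rad x = ((0, 0), (0, 0)).
  by move=> x1; rewrite /rad /c indicE memNset// !mul0r.
have S0 : ~ S ((0, 0), (0, 0)).
  by move=> /SE; rewrite nsqR4 /= expr0n/= !addr0 => /eqP; rewrite eq_sym oner_eq0.
have pre : rad @^-1` S = pball.
  apply/seteqP; split => x.
    rewrite /preimage /= => Sx; have x1 : nsq (ofR4 x) < 1.
      by apply: contrapT => /radN E; move: Sx; rewrite E.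
    move: Sx; rewrite radE// => /SE; rewrite -/(dir x) dirE nsq_sc => E; split => //=.
    rewrite lt_neqAle nsq_ge0 andbT eq_sym; apply/eqP => x0.
    by move/eqP: E; rewrite x0 mulr0 eq_sym oner_eq0.
  by move=> [/= x0 x1]; rewrite /preimage /= radE//; apply/SE; exact: nsq_dir.
pose k4 : {nonneg R} := NngNum (ler0n R 4).
pose pf : {measure set (Real4 R) -> \bar R} :=
  measure_function_pushforward__canonical__measure_function_Measure volume mrad.
pose m : {measure set (Real4 R) -> \bar R} := mscale k4 pf.
have -> : (\int[surface]_(x in S) h x = \int[m]_(x in S) h x)%E.
  apply: eq_measure_integral => A mA AS; rewrite /m /= /mscale /= /pushforward /surface.
  congr (_ * volume _)%E; apply/seteqP; split => x /=.
    by rewrite ball2E => -[x1 Ax]; rewrite radE.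
  move=> Ax; have x1 : nsq (ofR4 x) < 1.
    by apply: contrapT => /radN E; move: Ax; rewrite E => /AS.
  by split; [exact/ball2E|rewrite -radE].
have mhS : measurable_fun S h by exact: measurable_funS mh.
have E1 : (\int[m]_(x in S) h x = 4%:E * \int[pf]_(x in S) h x)%E.
  exact: (ge0_integral_mscale pf mS k4 mhS (fun x _ => h0 x)).
have E2 : (\int[pf]_(x in S) h x = \int[volume]_(x in rad @^-1` S) h (rad x))%E.
  exact: (ge0_integral_pushforward mrad volume mS mhS (fun x _ => h0 x)).
have E3 : (\int[volume]_(x in pball) h (rad x) = \int[volume]_(x in pball) h (radial x))%E.
  by apply: eq_integral => x; rewrite inE => -[_ /= x1]; rewrite radE.
have E4 := etrans E2 (etrans (congr1 (fun D => \int[volume]_(x in D) h (rad x))%E pre) E3).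
exact: (etrans E1 (congr1 (fun y => 4%:E * y)%E E4)).
Qed.

Lemma volume_pball : (0 < volume pball)%E.
Proof.
have [v v0 vE] := @volume_vball R 1 ltr01.
rewrite lt_neqAle measure_ge0 andbT eq_sym; apply/eqP => D0.
pose h := Num.min 1 v / 4.
have m0 : 0 < Num.min 1 v by rewrite lt_min ltr01.
have h0 : 0 < h by rewrite divr_gt0.
have [h1 h2] : 2 * h <= 1 /\ 2 * h < v.
  have [a1 a2] : Num.min 1 v <= 1 /\ Num.min 1 v <= v by split; rewrite ge_min lexx ?orbT.
  by rewrite /h; move: m0 a1 a2 v0; clear; split; lra.
have : (volume (vball 1) <= volume pball + volume (box4 h))%E.
  have mU : measurable (pball `|` box4 h) by apply: measurableU; [exact: measurable_pball|exact: measurable_box4].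
  apply: (@le_trans _ _ (volume (pball `|` box4 h))).
    apply: le_measure; rewrite ?inE; [exact: measurable_vball|exact: mU|].
    move=> x x1; have [x0|x0] := ltP 0 (nsq (ofR4 x)); [by left; split|right].
    have {}x0 : nsq (ofR4 x) = 0 by apply/eqP; rewrite eq_le x0 nsq_ge0.
    have key (t : R) : t ^+ 2 <= nsq (ofR4 x) -> t \in `](- h), h[.
      rewrite x0 => t2; have : t ^+ 2 = 0 by apply/eqP; rewrite eq_le t2 sqr_ge0.
      by move/eqP; rewrite sqrf_eq0 => /eqP ->; rewrite in_itv /= oppr_lt0 h0.
    have p1 := sqr_ge0 x.1.1; have p2 := sqr_ge0 x.1.2.
    have p3 := sqr_ge0 x.2.1; have p4 := sqr_ge0 x.2.2.
    by split; split; apply: key; rewrite nsqR4; move: p1 p2 p3 p4; clear; lra.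
  apply: measureU2; [exact: measurable_pball|exact: measurable_box4].
rewrite D0 add0e vE (volume_box4 h0) lee_fin; apply/negP; rewrite -ltNge.
have hp : 0 <= 2 * h by rewrite mulr_ge0// ltW.
by apply: le_lt_trans h2; rewrite exprS ler_piMr// exprn_ile1.
Qed.

End SphereIntegral.

Section SphereMeans.
Context {R : realType}.
Notation CC := (Cplx R).
Variable f : Cplx2 R -> CC.
Hypothesis df : forall z : Cplx2 R, nsq z < 1 -> differentiable f z.

(** The mean of |f| over the sphere of radius s, as an integral over the ball
    of a radially constant function. *)
Definition smean_fun (s : R) (x : Real4 R) : R :=
  \1_pball x * normc (ballcut f (toR4 (sc s%:C (dir x)))).

Definition smean (s : R) : \bar R := (\int[volume]_x (smean_fun s x)%:E)%E.

Lemma measurable_dir d (T : measurableType d) (g : T -> Real4 R) : measurable_fun setT g ->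
  cmeas (fun x => (@dir R (g x)).1) /\ cmeas (fun x => (@dir R (g x)).2).
Proof.
by move=> mg; apply: cmeas_ofR4; exact: (measurableT_comp (@measurable_radial R) mg).
Qed.

Lemma measurable_smean_fun s : measurable_fun setT (smean_fun s).
Proof.
have [d1 d2] := measurable_dir (@measurable_id _ (Real4 R) setT).
apply: measurable_funM; first by apply: measurable_indic; exact: measurable_pball.
have ms : measurable_fun setT (fun x : Real4 R => toR4 (sc s%:C (dir x))).
  by apply: measurable_toR4; apply: cmeasM => //; exact: cmeas_cst.
have [c1 c2] := cmeas_ballcut df.
by apply: (@cmeas_normc _ _ _ (fun x => ballcut f (toR4 (sc s%:C (dir x)))));
  split; [exact: (measurableT_comp c1 ms)|exact: (measurableT_comp c2 ms)].
Qed.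

Lemma smean_fun_ge0 s x : 0 <= smean_fun s x.
Proof. by rewrite mulr_ge0 ?normc_ge0. Qed.

Lemma smean_funE s x : 0 <= s < 1 -> pball x -> smean_fun s x = normc (f (sc s%:C (dir x))).
Proof.
move=> /andP[s0 s1] px; rewrite /smean_fun indicE mem_set// mul1r /ballcut toR4K.
by rewrite nsq_sc nsq_dir ?mulr1; [rewrite normc_real ger0_norm// expr_lt1//; rewrite s1|case: px].
Qed.

Lemma qmul_dir (A B : R[i]) (x : Real4 R) : normc A ^+ 2 + normc B ^+ 2 = 1 -> dir (qmap A B x) = qmul A B (dir x).
Proof.
move=> AB; rewrite !dirE.
have -> : norm2 (ofR4 (qmap A B x)) = norm2 (ofR4 x).
  by rewrite /norm2 -!/(nsq _) /qmap toR4K qmul_sq AB mul1r.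
rewrite /qmap toR4K; set t := _^-1; case: (ofR4 x) => u v.
rewrite /sc /qmul /perp /fst /snd.
have cs w : conjc (t%:C * w) = t%:C * conjc w by case: w => w1 w2; simpc.
by rewrite !cs; congr (_, _); ring.
Qed.

(** Dividing by its modulus sqrt (|A|^2 + |B|^2), the quaternion A + j B acts
    as an isometry, which preserves the volume of the ball and commutes with
    [dir]. *)
Lemma qmul_mean (A B : R[i]) : normc A ^+ 2 + normc B ^+ 2 < 1 ->
  (\int[volume]_x (\1_pball x * normc (f (qmul A B (dir x))))%:E =
   smean (Num.sqrt (normc A ^+ 2 + normc B ^+ 2)))%E.
Proof.
set N := normc A ^+ 2 + normc B ^+ 2 => N1; set rho := Num.sqrt N.
have N0 : 0 <= N by rewrite addr_ge0 ?sqr_ge0.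
have r0 : 0 <= rho by exact: sqrtr_ge0.
have r2 : rho ^+ 2 = N by rewrite sqr_sqrtr.
have r1 : rho < 1 by rewrite -(@expr_lt1 _ 2)// r2.
have [NN|NN] := eqVneq N 0.
  have [A0 B0] : A = 0 /\ B = 0.
    move/eqP: NN; rewrite /N paddr_eq0 ?sqr_ge0// !sqrf_eq0 !normc_eq0.
    by move=> /andP[/eqP -> /eqP ->].
  apply: eq_integral => x _; congr (_%:E).
  have [px|px] := boolP (x \in pball); last by rewrite /smean_fun indicE (negbTE px) !mul0r.
  rewrite smean_funE ?r0//; last by rewrite inE in px.
  rewrite indicE px mul1r /rho NN sqrtr0 A0 B0 /qmul /sc !mul0r addr0.
  by [].
have rp : 0 < rho by rewrite sqrtr_gt0 lt_neqAle eq_sym NN.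
have rC : rho%:C != 0 :> R[i] by rewrite -normc_gt0 normc_real gtr0_norm.
pose a := A / rho%:C; pose b := B / rho%:C.
have ab : normc a ^+ 2 + normc b ^+ 2 = 1.
  rewrite /a /b !normcM normcV normc_real gtr0_norm// !exprMn -mulrDl -/N -r2.
  by rewrite -exprMn divff ?expr1n// gt_eqF.
have E x : \1_pball x * normc (f (qmul A B (dir x))) = smean_fun rho (qmap a b x).
  have nq : nsq (ofR4 (qmap a b x)) = nsq (ofR4 x) by rewrite /qmap toR4K qmul_sq ab mul1r.
  have pq : (qmap a b x \in pball) = (x \in pball).
    by apply/idP/idP; rewrite !inE /pball /= nq.
  have [px|px] := boolP (x \in pball); last first.
    by rewrite /smean_fun !indicE pq (negbTE px) !mul0r.
  rewrite indicE px mul1r smean_funE ?r0//; last by rewrite -pq inE in px.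
  rewrite qmul_dir//; congr (normc (f _)).
  by rewrite /sc /qmul /fst /snd /a /b; congr (_, _); field.
under eq_integral do rewrite E.
have mh : measurable_fun setT (fun x => (smean_fun rho x)%:E).
  by apply/measurable_EFinP; exact: measurable_smean_fun.
exact: (qmap_invariant (h := fun x => (smean_fun rho x)%:E) ab mh (fun x => smean_fun_ge0 rho x)).
Qed.

End SphereMeans.

(** * A net is not interpolating for the Hardy space *)

Section NoPeak.
Context {R : realType}.
Notation CC := (Cplx R).

Lemma le_1_powR (t p : R) : 0 <= t -> 1 <= p -> t <= 1 + t `^ p.
Proof.
move=> t0 p1; have [t1|t1] := leP t 1; first by apply: ler_wpDr => //; exact: powR_ge0.
rewrite ler_wpDl//; have := ler_powR (ltW t1) p1; by rewrite powRr1.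
Qed.

Lemma vball_finite : exists2 v : R, 0 < v & volume (vball 1) = v%:E.
Proof. exact: volume_vball ltr01. Qed.

Lemma pball_finite : exists2 v : R, 0 < v & volume (pball : set (Real4 R)) = v%:E.
Proof.
have [v v0 vE] := vball_finite; have p0 := @volume_pball R.
have le : (volume (pball : set (Real4 R)) <= v%:E)%E.
  rewrite -vE; apply: le_measure; rewrite ?inE; [exact: measurable_pball|exact: measurable_vball|].
  by move=> x [].
have fin : volume (pball : set (Real4 R)) \is a fin_num.
  by rewrite ge0_fin_numE ?measure_ge0// (le_lt_trans le)// ltry.
exists (fine (volume (pball : set (Real4 R)))); last by rewrite fineK.
by rewrite -lte_fin fineK.
Qed.

Lemma integral_indic_volume (A : set (Real4 R)) : measurable A ->
  (\int[volume]_x (\1_A x)%:E = volume A)%E.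
Proof.
move=> mA; have E := integral_indic volume measurableT mA.
exact: (etrans E (congr1 volume (setIT A))).
Qed.

(** A bound for the p-th powers suffices, since t <= 1 + t ^ p. *)
Lemma smean_bounded (p : R) (f : Cplx2 R -> CC) : 1 <= p -> Hp p f ->
  exists K : R, forall s, 0 <= s < 1 -> (smean f s <= K%:E)%E.
Proof.
move=> p1 [df fp]; have p0 : 0 < p := lt_le_trans ltr01 p1.
have {}df z : nsq z < 1 -> differentiable f z by move=> /ball2E; exact: df.
move: fp; rewrite /Hp_norm; set S := [set _ | _ in _] => fp.
have Sfin : (ereal_sup S < +oo)%E.
  rewrite ltey; apply/eqP => SE; move: fp.
  by rewrite SE poweRyr ?ltxx// invr_eq0 gt_eqF.
have S0 : (0 <= ereal_sup S)%E.
  have : S (\int[surface]_(x in [set x : Real4 R | sphere2 (ofR4 x)])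
            (normc (f ((0:R)%:C *: ofR4 x)) `^ p)%:E)%E by exists 0; rewrite //= lexx ltr01.
  by move/ereal_sup_ubound; apply: le_trans; apply: integral_ge0 => x _; rewrite lee_fin powR_ge0.
have [v v0 vE] := pball_finite.
pose M := fine (ereal_sup S).
have ME : ereal_sup S = M%:E by rewrite fineK// ge0_fin_numE.
exists (v + M) => s s01; have /andP[s0 s1] := s01.
pose h (x : Real4 R) : \bar R := (normc (ballcut f (toR4 (sc s%:C (ofR4 x)))) `^ p)%:E.
have mb (g : Real4 R -> Real4 R) : measurable_fun setT g ->
    measurable_fun setT (fun x => normc (ballcut f (toR4 (sc s%:C (ofR4 (g x)))))).
  move=> mg; have [d1 d2] := cmeas_ofR4 mg.
  have ms : measurable_fun setT (fun x : Real4 R => toR4 (sc s%:C (ofR4 (g x)))).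
    by apply: measurable_toR4; apply: cmeasM => //; exact: cmeas_cst.
  have [c1 c2] := cmeas_ballcut df.
  by apply: (@cmeas_normc _ _ _ (fun x => ballcut f (toR4 (sc s%:C (ofR4 (g x))))));
    split; [exact: (measurableT_comp c1 ms)|exact: (measurableT_comp c2 ms)].
have mp (g : Real4 R -> Real4 R) : measurable_fun setT g -> measurable_fun setT (h \o g).
  move=> mg; apply/measurable_EFinP.
  exact: (measurableT_comp (measurable_powR p) (mb g mg)).
have mh : measurable_fun setT h by exact: (mp id (@measurable_id _ _ _)).
have h0 x : (0 <= h x)%E by rewrite lee_fin powR_ge0.
have hM : (\int[surface]_(x in [set x : Real4 R | sphere2 (ofR4 x)]) h x <= M%:E)%E.
  rewrite -ME; apply: ereal_sup_ubound; exists s; first by rewrite /= s0 s1.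
  apply: eq_integral => x; rewrite inE /sphere2 /= => x1.
  rewrite /h /ballcut toR4K nsq_sc -nsqE x1 expr1n mulr1 normc_real ger0_norm//.
  by rewrite expr_lt1// s1.
rewrite (surface_integral mh h0) in hM.
have mhr : measurable_fun setT (fun x => h (radial x)) by exact: (mp _ (@measurable_radial R)).
have hM' : (\int[volume]_(x in pball) h (radial x) <= M%:E)%E.
  apply: le_trans hM; rewrite -[X in (X <= _)%E]mul1e.
  by apply: lee_wpmul2r; [apply: integral_ge0 => x _; exact: h0|rewrite lee_fin ler1n].
have mpb := @measurable_pball R.
have -> : smean f s = (\int[volume]_(x in pball) (normc (ballcut f (toR4 (sc s%:C (dir x)))))%:E)%E.
  rewrite [RHS]integral_mkcond; apply: eq_integral => x _.
  rewrite /smean_fun /patch indicE; case: (x \in pball); by rewrite ?mul1r ?mul0r.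
have mS := mb _ (@measurable_radial R).
apply: (@le_trans _ _ (\int[volume]_(x in pball) (1 + h (radial x)))%E).
  apply: ge0_le_integral => //.
  - by move=> x _; rewrite lee_fin normc_ge0.
  - by apply: measurable_funTS; apply/measurable_EFinP; exact: mS.
  - by apply: measurable_funTS; apply: emeasurable_funD => //; exact: measurable_cst.
  - by move=> x _; rewrite lee_fin le_1_powR// normc_ge0.
rewrite ge0_integralD//; last by apply: measurable_funTS.
by rewrite integral_cst// mul1e EFinD; apply: leeD => //; rewrite -vE.
Qed.


Lemma nsq_ofR4_gt0 (x : Real4 R) : pball x -> nsq (dir x) = 1.
Proof. by move=> [x0 _]; exact: nsq_dir. Qed.

(** The ball automorphism that takes the origin to s zeta, in the frame of zeta. *)
Definition mobmap (s : R) (zeta u : Cplx2 R) : Cplx2 R :=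
  qmul (mobA s u.1) (mobB s u.1 u.2) zeta.

Lemma mobmap0 s zeta : mobmap s zeta (0, 0) = sc s%:C zeta.
Proof.
by rewrite /mobmap /qmul /mobA /mobB /sc /fst /snd !mulr0 !mul0r !addr0 divr1.
Qed.

Lemma mobmap_den s (u : R[i]) : 0 <= s < 1 -> normc u < 1 -> 1 + s%:C * u != 0.
Proof.
move=> /andP[s0 s1] u1; rewrite addrC addr_eq0; apply/eqP => /(congr1 (@normc R)).
rewrite normc_opp normc1 normcM normc_real ger0_norm// => E.
have : s * normc u < 1 by rewrite mulr_ilt1 ?normc_ge0.
by rewrite E ltxx.
Qed.

Lemma nsq_fst_lt1 (u : Cplx2 R) : nsq u < 1 -> normc u.1 < 1.
Proof.
by move=> u1; rewrite -(@expr_lt1 _ 2) ?normc_ge0// (le_lt_trans _ u1)// lerDl sqr_ge0.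
Qed.

Lemma nsq_mobmap s zeta u : 0 <= s < 1 -> nsq zeta = 1 -> nsq u < 1 -> nsq (mobmap s zeta u) < 1.
Proof. by move=> s01 z1 u1; rewrite qmul_sq z1 mulr1; exact: mobAB_sq. Qed.

Lemma cmeas_mobmap d (T : measurableType d) s (zeta u : T -> Cplx2 R) :
  cmeas (fun x => (zeta x).1) -> cmeas (fun x => (zeta x).2) ->
  cmeas (fun x => (u x).1) -> cmeas (fun x => (u x).2) ->
  measurable_fun setT (fun x => toR4 (mobmap s (zeta x) (u x))).
Proof.
move=> z1 z2 u1 u2.
have den : cmeas (fun x => (1 + s%:C * (u x).1)^-1).
  by apply: cmeasV; apply: cmeasD; [exact: cmeas_cst|apply: cmeasM => //; exact: cmeas_cst].
have mA : cmeas (fun x => mobA s (u x).1).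
  by apply: cmeasM den; apply: cmeasD => //; exact: cmeas_cst.
have mB : cmeas (fun x => mobB s (u x).1 (u x).2).
  by apply: cmeasM den; apply: cmeasM => //; exact: cmeas_cst.
apply: measurable_toR4; apply: cmeasD; apply: cmeasM => //.
  by apply: cmeasN; exact: cmeas_conj.
exact: cmeas_conj.
Qed.

Lemma cdiff_mobmap (f : Cplx2 R -> CC) (s : R) (zeta p q : Cplx2 R) (z : CC) : 0 <= s < 1 -> nsq zeta = 1 ->
  (forall z : Cplx2 R, nsq z < 1 -> differentiable f z) -> nsq (vplus p (sc z q)) < 1 ->
  cdiff (fun z => f (mobmap s zeta (vplus p (sc z q)))) z.
Proof.
move=> s01 z1 df pq.
have den : 1 + s%:C * (p.1 + z * q.1) != 0 by apply: mobmap_den => //; exact: nsq_fst_lt1 pq.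
have dl (a b : CC) : cdiff (fun z => a + z * b) z.
  exact: cdiffD (cdiff_cst a z) (cdiffM (cdiff_id z) (cdiff_cst b z)).
have dd : cdiff (fun z => (1 + s%:C * (p.1 + z * q.1))^-1) z.
  exact: (cdiffV (cdiffD (cdiff_cst 1 z) (cdiffM (cdiff_cst s%:C z) (dl p.1 q.1))) den).
have dA : cdiff (fun z => mobA s (p.1 + z * q.1)) z.
  exact: (cdiffM (cdiffD (cdiff_cst s%:C z) (dl p.1 q.1)) dd).
have dB : cdiff (fun z => mobB s (p.1 + z * q.1) (p.2 + z * q.2)) z.
  exact: (cdiffM (cdiffM (cdiff_cst _ z) (dl p.2 q.2)) dd).
have dC (a b : CC) : cdiff (fun z => mobA s (p.1 + z * q.1) * a +
    mobB s (p.1 + z * q.1) (p.2 + z * q.2) * b) z.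
  exact: (cdiffD (cdiffM dA (cdiff_cst a z)) (cdiffM dB (cdiff_cst b z))).
have dF := df _ (nsq_mobmap s01 z1 pq).
exact: (cdiff_comp2 (dC zeta.1 (perp zeta).1) (dC zeta.2 (perp zeta).2) dF).
Qed.

Section Gain.
Variables (f : Cplx2 R -> CC) (a : nat -> Cplx2 R) (c : R).
Hypothesis df : forall z : Cplx2 R, nsq z < 1 -> differentiable f z.
Hypothesis fa : forall k, (0 < k)%N -> f (a k) = 0.
Hypothesis a1 : forall k, nsq (a k) < 1.
Hypothesis c0 : 0 < c.
Hypothesis ac : forall z, nsq z < 1 -> exists2 k, (0 < k)%N & c <= pB z (a k).

(** The automorphism takes the point of the net near s zeta to a zero near the
    origin. *)
Lemma zero_near s zeta : 0 <= s < 1 -> nsq zeta = 1 ->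
  exists2 w, nsq w <= 1 - c & f (mobmap s zeta w) = 0.
Proof.
move=> s01 z1; have /andP[s0 s1] := s01.
have sz : nsq (s%:C * zeta.1, s%:C * zeta.2) < 1.
  rewrite (nsq_sc s%:C zeta) z1 mulr1 normc_real ger0_norm// expr_lt1//.
have [k k0 ck] := ac sz.
exists (mobU s zeta (a k), mobV s zeta (a k)).
  by rewrite /nsq /fst /snd mob_sq// lerB// pB_sym.
have [E1 E2] := mobK s01 z1 (a1 k); have [F1 F2] := frame_expand (a k) z1.
rewrite /mobmap /qmul /fst /snd E1 E2; rewrite -/(fst _) -/(snd _) -[RHS](fa k0); congr f.
by rewrite -F1 -F2; case: (a k).
Qed.

(** [ball_gain] at each point s zeta, averaged over zeta. By Tonelli the
    average on the right is, for each point of the inner ball, a mean over a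
    sphere of smaller radius. *)
Lemma mean_gain (K : R) : (forall s, 0 <= s < 1 -> (smean f s <= K%:E)%E) ->
  exists2 gam, 0 < gam & forall s, 0 <= s < 1 -> ((1 + gam)%:E * smean f s <= K%:E)%E.
Proof.
move=> hK; have [v v0 vE] := vball_finite.
have c1 : c <= 1.
  have s01 : 0 <= (0:R) < 1 by rewrite lexx ltr01.
  have z1 : nsq ((1, 0) : Cplx2 R) = 1 by rewrite /nsq /fst /snd normc1 normc0 expr1n expr0n addr0.
  have [w w1 _] := zero_near s01 z1; have := le_trans (nsq_ge0 w) w1; by rewrite subr_ge0.
have [|gam [r [gam0 /andP[r0 r1] gain]]] := @ball_gain R c v _ v0 vE; first by rewrite c0.
exists gam => // s s01.
have nr u : nsq (ofR4 u) < 1 -> nsq (sc r%:C (ofR4 u)) < 1.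
  move=> u1; rewrite nsq_sc normc_real (gtr0_norm r0).
  have rr1 : r ^+ 2 < 1 by rewrite expr_lt1// ltW.
  exact: (mulr_ilt1 (sqr_ge0 r) (nsq_ge0 _) rr1 u1).
pose J (x u : Real4 R) : R := \1_(pball) x * (\1_(vball 1) u *
   normc (ballcut f (toR4 (mobmap s (dir x) (sc r%:C (ofR4 u)))))).
have J0 x u : 0 <= J x u by rewrite mulr_ge0// mulr_ge0 ?normc_ge0.
have mcut d (T : measurableType d) (X U : T -> Real4 R) : measurable_fun setT X ->
    measurable_fun setT U ->
    cmeas (fun t => ballcut f (toR4 (mobmap s (dir (X t)) (sc r%:C (ofR4 (U t)))))).
  move=> mX mU; have [d1 d2] := measurable_dir mX; have [u1 u2] := cmeas_ofR4 mU.
  have mm := cmeas_mobmap (u := fun t => sc r%:C (ofR4 (U t))) s d1 d2 (cmeasM (cmeas_cst r%:C) u1) (cmeasM (cmeas_cst r%:C) u2).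
  have [m1 m2] := cmeas_ballcut df.
  by split; [exact: (measurableT_comp m1 mm)|exact: (measurableT_comp m2 mm)].
have mJ : measurable_fun setT (fun y : Real4 R * Real4 R => (J y.1 y.2)%:E).
  apply/measurable_EFinP; apply: measurable_funM; last apply: measurable_funM.
  - apply: (measurableT_comp _ measurable_fst); apply: measurable_indic; exact: measurable_pball.
  - apply: (measurableT_comp _ measurable_snd); apply: measurable_indic; exact: measurable_vball.
  - exact: (cmeas_normc (mcut _ _ _ _ measurable_fst measurable_snd)).
have JE x u : J x u = if (x \in pball) && (u \in vball 1) then
    normc (f (mobmap s (dir x) (sc r%:C (ofR4 u)))) else 0.
  rewrite /J !indicE; have [px|_] := boolP (x \in pball); last by rewrite mul0r.
  have [pu|_] := boolP (u \in vball 1); last by rewrite mul0r mulr0.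
  move: px pu; rewrite !inE => px pu.
  by rewrite /ballcut toR4K !mul1r (nsq_mobmap s01 (nsq_ofR4_gt0 px) (nr u pu)).
clearbody J.
have swap : (\int[volume]_x \int[volume]_u (J x u)%:E = \int[volume]_u \int[volume]_x (J x u)%:E)%E.
  exact: (@fubini_tonelli _ _ _ _ _ volume volume (fun y => (J y.1 y.2)%:E) mJ (fun y => J0 y.1 y.2)).
have mrow x : measurable_fun setT (fun u => (J x u)%:E).
  exact: (measurableT_comp mJ (pair1_measurable x)).
have mcol u : measurable_fun setT (fun x => (J x u)%:E).
  exact: (measurableT_comp mJ (pair2_measurable u)).
have low x : (((1 + gam) * v * smean_fun f s x)%:E <= \int[volume]_u (J x u)%:E)%E.
  have [px|px] := boolP (x \in (pball : set (Real4 R))); last first.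
    rewrite /smean_fun indicE (negbTE px) mul0r mulr0.
    by apply: integral_ge0 => u _; rewrite lee_fin.
  have zx : nsq (dir x) = 1 by apply: nsq_ofR4_gt0; rewrite inE in px.
  have mF : cmeas (ballcut (fun w => f (mobmap s (dir x) w))).
    have [u1 u2] := cmeas_ofR4 (@measurable_id _ (Real4 R) setT).
    have mm := cmeas_mobmap (zeta := fun=> dir x) (u := fun t => ofR4 t) s (cmeas_cst _) (cmeas_cst _) u1 u2.
    have [m1 m2] := cmeas_ballcut df.
    have mc : cmeas (fun t : Real4 R => (\1_(vball 1) t)%:C *
        ballcut f (toR4 (mobmap s (dir x) (ofR4 t)))).
      apply: cmeasM; last by split; [exact: (measurableT_comp m1 mm)|exact: (measurableT_comp m2 mm)].
      by apply: cmeas_real; apply: measurable_indic; exact: measurable_vball.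
    rewrite (_ : ballcut _ = (fun t : Real4 R => (\1_(vball 1) t)%:C *
        ballcut f (toR4 (mobmap s (dir x) (ofR4 t)))))//.
    apply/funext => t; rewrite /ballcut toR4K indicE; case: ifP => t1.
      by rewrite mem_set// nsq_mobmap// mul1r.
    by rewrite memNset ?mul0r// /vball /= t1.
  have := gain (fun w => f (mobmap s (dir x) w)) (fun p q z => @cdiff_mobmap f s (dir x) p q z s01 zx df)
    mF (zero_near s01 zx).
  have sE := smean_funE f s01 (set_mem px).
  rewrite mobmap0 -sE => /le_trans; apply.
  rewrite le_eqVlt; apply/orP; left; apply/eqP; apply: eq_integral => u _.
  congr (_%:E); rewrite JE px /=; case: ifP => u1; first by rewrite mem_set.
  by rewrite memNset// /vball /= u1.
(* By [qmul_mean] the inner integral is a mean over a sphere. *)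
have up u : (\int[volume]_x (J x u)%:E <= (K * \1_(vball 1) u)%:E)%E.
  have [u1|u1] := boolP (u \in (vball 1 : set (Real4 R))); last first.
    under eq_integral do rewrite JE (negbTE u1) andbF.
    by rewrite integral0 indicE (negbTE u1) mulr0.
  have u1' : nsq (sc r%:C (ofR4 u)) < 1 by apply: nr; rewrite inE in u1.
  pose A := mobA s (sc r%:C (ofR4 u)).1; pose A' := mobB s (sc r%:C (ofR4 u)).1 (sc r%:C (ofR4 u)).2.
  have AB : normc A ^+ 2 + normc A' ^+ 2 < 1 by exact: mobAB_sq.
  have E : (\int[volume]_x (J x u)%:E = smean f (Num.sqrt (normc A ^+ 2 + normc A' ^+ 2)))%E.
    rewrite -(qmul_mean df AB); apply: eq_integral => x _; congr (_%:E).
    rewrite JE u1 andbT indicE; case: (x \in pball); last by rewrite mul0r.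
    by rewrite mul1r.
  rewrite E indicE u1 mulr1; apply: hK; rewrite sqrtr_ge0 -(@expr_lt1 _ 2) ?sqrtr_ge0// sqr_sqrtr//.
  by rewrite addr_ge0 ?sqr_ge0.
have msm := @measurable_smean_fun _ f df s.
have K0 : 0 <= K.
  have s0 : 0 <= (0:R) < 1 by rewrite lexx ltr01.
  have := hK 0 s0; rewrite -lee_fin; apply: le_trans; apply: integral_ge0 => x _.
  by rewrite lee_fin smean_fun_ge0.
have G0 : 0 <= (1 + gam) * v := ltW (mulr_gt0 (addr_gt0 ltr01 gam0) v0).
have L : (\int[volume]_x ((1 + gam) * v * smean_fun f s x)%:E = ((1 + gam) * v)%:E * smean f s)%E.
  under eq_integral do rewrite EFinM.
  have ms' : measurable_fun setT (fun x => (smean_fun f s x)%:E) by exact/measurable_EFinP.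
  by rewrite (ge0_integralZl volume measurableT ms')// => x _; rewrite lee_fin smean_fun_ge0.
have U : (\int[volume]_u (K * \1_(vball 1) u)%:E = (K * v)%:E)%E.
  under eq_integral do rewrite EFinM.
  have mi : measurable_fun setT (fun s : Real4 R => (\1_(vball 1) s : R)%:E).
    by apply/measurable_EFinP; apply: measurable_indic; exact: measurable_vball.
  rewrite (ge0_integralZl volume measurableT mi); [|by move=> x _; rewrite lee_fin|by rewrite lee_fin].
  by rewrite (integral_indic_volume (measurable_vball 1)) vE.
have main : (((1 + gam) * v)%:E * smean f s <= (K * v)%:E)%E.
  rewrite -L -U; apply: (@le_trans _ _ (\int[volume]_x \int[volume]_u (J x u)%:E)%E).
    apply: ge0_le_integral; first exact: measurableT.
    - by move=> x _; rewrite lee_fin; exact: (mulr_ge0 G0 (smean_fun_ge0 f s x)).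
    - by apply/measurable_EFinP; apply: measurable_funM => //; exact: measurable_cst.
    - exact: (@measurable_fun_fubini_tonelli_F _ _ _ _ _ volume (fun y => (J y.1 y.2)%:E) mJ (fun y => J0 y.1 y.2)).
    - by move=> x _; exact: low.
  rewrite swap; apply: ge0_le_integral; first exact: measurableT.
  - by move=> u _; apply: integral_ge0 => x _; rewrite lee_fin.
  - exact: (@measurable_fun_fubini_tonelli_G _ _ _ _ _ volume (fun y => (J y.1 y.2)%:E) mJ (fun y => J0 y.1 y.2)).
  - apply/measurable_EFinP; apply: measurable_funM; first exact: measurable_cst.
    by apply: measurable_indic; exact: measurable_vball.
  - by move=> u _; exact: up.
have fin : smean f s \is a fin_num.
  rewrite ge0_fin_numE; last by apply: integral_ge0 => x _; rewrite lee_fin smean_fun_ge0.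
  by apply: le_lt_trans (hK s s01) _; exact: ltry.
rewrite -(fineK fin) -!EFinM !lee_fin in main *.
by rewrite -(ler_pM2r v0) mulrAC.
Qed.

(** The supremum of the means is at most 1 / (1 + gam) times itself, so it
    vanishes, and so does the mean of radius 0. *)
Lemma gain_absurd (K : R) : (forall s, 0 <= s < 1 -> (smean f s <= K%:E)%E) -> f (0, 0) = 0.
Proof.
move=> hK; have s01 : 0 <= (0:R) < 1 by rewrite lexx ltr01.
have m0 s : (0 <= smean f s)%E by apply: integral_ge0 => x _; rewrite lee_fin smean_fun_ge0.
pose S := [set smean f s | s in [set s : R | 0 <= s < 1]].
have SK : (ereal_sup S <= K%:E)%E by apply: ge_ereal_sup => _ [s hs <-]; exact: hK.
have S0 : (0 <= ereal_sup S)%E.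
  by apply: (le_trans (m0 0)); apply: ereal_sup_ubound; exists 0.
have Sf : ereal_sup S \is a fin_num by rewrite ge0_fin_numE// (le_lt_trans SK)// ltry.
pose k := fine (ereal_sup S); have kE : ereal_sup S = k%:E by rewrite fineK.
have hk s : 0 <= s < 1 -> (smean f s <= k%:E)%E.
  by move=> hs; rewrite -kE; apply: ereal_sup_ubound; exists s.
have [gam gam0 hg] := mean_gain hk.
have g1 : 0 < 1 + gam by rewrite addr_gt0.
have : (ereal_sup S <= (k / (1 + gam))%:E)%E.
  apply: ge_ereal_sup => _ [s hs <-]; have := hg s hs.
  have fin : smean f s \is a fin_num by rewrite ge0_fin_numE// (le_lt_trans (hk s hs))// ltry.
  by rewrite -(fineK fin) -EFinM !lee_fin ler_pdivlMr// mulrC.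
rewrite kE lee_fin ler_pdivlMr// mulrDr mulr1 gerDl => kg.
have k0 : k <= 0 by move: kg; rewrite pmulr_lle0.
have [v v0 vE] := pball_finite.
have : (smean f 0 = (normc (f (0, 0)) * v)%:E)%E.
  rewrite EFinM -vE /smean.
  have mi : measurable_fun setT (fun s : Real4 R => (\1_pball s : R)%:E).
    by apply/measurable_EFinP; apply: measurable_indic; exact: measurable_pball.
  rewrite -(integral_indic_volume (@measurable_pball R)).
  rewrite -(ge0_integralZl volume measurableT mi); [|by move=> x _; rewrite lee_fin|by rewrite lee_fin normc_ge0].
  apply: eq_integral => x _; rewrite -EFinM; congr (_%:E).
  rewrite /smean_fun mulrC; congr (_ * _).
  by rewrite /ballcut toR4K nsq_sc normc0 expr0n mul0r ltr01 /sc !mul0r.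
move=> E; have := hk 0 s01; rewrite E lee_fin => le.
have : normc (f (0, 0)) * v <= 0 by exact: le_trans le k0.
rewrite pmulr_lle0// => n0; apply/eqP; rewrite -normc_eq0 eq_le n0 normc_ge0//.
Qed.

End Gain.

(** Interpolating 1 at a_0 and 0 elsewhere would give a function that
    contradicts [gain_absurd], as the points a_k with k > 0 still form a
    net. *)
Lemma net_not_interpolating (p : R) (a : nat -> Cplx2 R) (c : R) : 1 <= p ->
  (forall k, nsq (a k) < 1) -> a 0%N = (0, 0) -> 0 < c ->
  (forall z, nsq z < 1 -> exists2 k, (0 < k)%N & c <= pB z (a k)) -> ~ Hp_interpolating p a.
Proof.
move=> p1 a1 a0 c0 ac [C hC].
pose lam (k : nat) : CC := if k is 0%N then 1 else 0.
have p0 : p != 0 by rewrite gt_eqF// (lt_le_trans ltr01).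
have lfin : (seqH_norm p a lam < +oo)%E.
  rewrite /seqH_norm (@nneseries_split _ _ _ 1); last by move=> k _; rewrite lee_fin mulr_ge0 ?powR_ge0 ?sqr_ge0.
  rewrite big_nat1 eseries0 ?adde0 ?poweR_EFin ?ltry// => k k1 _.
  by case: k k1 => // k _; rewrite /lam normc0 powR0// mul0r.
have [f [fp fl _]] := hC lam lfin.
have [K hK] := smean_bounded p1 fp.
have df z : nsq z < 1 -> differentiable f z by move=> /ball2E; case: fp => + _; exact.
have fa k : (0 < k)%N -> f (a k) = 0 by rewrite fl; case: k.
have := gain_absurd df fa a1 c0 ac hK; rewrite -a0 fl /lam => /eqP.
by rewrite oner_eq0.
Qed.

End NoPeak.

(** * Area near a boundary point of the disc *)

Section Layers.
Context {R : realType}.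

(** The least exponent n with u < B^(n+1) works. *)
Lemma dyadic (B u : R) : 1 < B -> 1 <= u -> exists n, B ^+ n <= u < B ^+ n.+1.
Proof.
move=> B1 u1; have B0 : 0 < B := lt_trans ltr01 B1.
have ex : exists n, u < B ^+ n.+1.
  have b0 : 0 < B - 1 by rewrite subr_gt0.
  have [n hn] : exists n, u / (B - 1) < n%:R.
    by exists (Num.bound (u / (B - 1))); apply: archi_boundP; rewrite divr_ge0 ?(ltW b0)// (le_trans ler01).
  exists n; move: hn; rewrite ltr_pdivrMr// => hn; apply: (lt_le_trans hn).
  apply: le_trans (bernoulli n.+1 (ltW B1)); rewrite -natr1 mulrDl mul1r; move: b0; clear; lra.
case: (ex_minnP ex) => n hn hm; exists n; rewrite hn andbT.
case: n hn hm => [|n] hn hm; first by rewrite expr0.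
by rewrite leNgt; apply/negP => /hm; rewrite ltnn.
Qed.

(** Estimates an integral by slicing: on D n the integrand is at most c n
    times a weight whose integral over D n is under control, and the resulting
    bounds form a geometric series. *)
Lemma layer_integral d (T : measurableType d) (mu : {measure set T -> \bar R})
    (F w : T -> R) (D : nat -> set T) (c : nat -> R) (B r : R) :
  measurable_fun setT F -> measurable_fun setT w -> (forall n, measurable (D n)) ->
  (forall x, 0 <= F x) -> (forall x, 0 <= w x) -> (forall n, 0 <= c n) -> 0 <= B -> 0 <= r < 1 ->
  (forall x, F x != 0 -> exists n, D n x /\ F x <= c n * w x) ->
  (forall n, ((c n)%:E * \int[mu]_x (\1_(D n) x * w x)%:E <= (B * r ^+ n)%:E)%E) ->
  (\int[mu]_x (F x)%:E <= (B / (1 - r))%:E)%E.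
Proof.
move=> mF mw mD F0 w0 c0 B0 /andP[r0 r1] hF hD.
pose g n x : \bar R := (c n * (\1_(D n) x * w x))%:E.
have g0 n x : (0 <= g n x)%E by rewrite lee_fin mulr_ge0// mulr_ge0.
have mi n : measurable_fun setT (fun x => (\1_(D n) x * w x)%:E).
  by apply/measurable_EFinP; apply: measurable_funM => //; exact: measurable_indic.
have mg n : measurable_fun setT (g n).
  apply/measurable_EFinP; apply: measurable_funM; first exact: measurable_cst.
  by apply/measurable_EFinP; exact: mi.
apply: (@le_trans _ _ (\int[mu]_x \sum_(0 <= n <oo) g n x)%E).
  apply: ge0_le_integral => //.
  - by move=> x _; rewrite lee_fin.
  - exact/measurable_EFinP.
  - by apply: ge0_emeasurable_sum => //.
  move=> x _; have [->|Fx] := eqVneq (F x) 0; first by apply: nneseries_ge0.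
  have [n [Dn Fn]] := hF x Fx.
  apply: (@le_trans _ _ (g n x)); first by rewrite /g indicE mem_set// mul1r lee_fin.
  rewrite (@nneseriesD1 _ (fun k => g k x) n xpredT)//; apply: leeDl; exact: nneseries_ge0.
rewrite integral_nneseries//.
have geo : (\sum_(0 <= n <oo) (B * r ^+ n)%:E = (B / (1 - r))%:E)%E.
  have r1' : `|r| < 1 by rewrite ger0_norm.
  apply/cvg_lim => //; have := @cvg_geometric_series R B r r1' => h.
  apply: (@cvg_trans _ ((fun n => (series (geometric B r) n)%:E) @ \oo)); last by apply: cvg_EFin; [exact: nearW|exact: h].
  by apply: near_eq_cvg; apply: nearW => n; rewrite /series /= sumEFin.
rewrite -geo; apply: lee_nneseries => [n _ _|n _]; first by apply: integral_ge0 => x _; exact: g0.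
apply: le_trans (hD n); rewrite le_eqVlt; apply/orP; left; apply/eqP.
rewrite /g; under eq_integral do rewrite EFinM.
rewrite ge0_integralZl//; last by rewrite lee_fin.
by move=> x _; rewrite lee_fin mulr_ge0.
Qed.

End Layers.

Section AreaEstimates.
Context {R : realType}.
Notation R2 := (Real2 R).

Lemma measurable_ler d (T : measurableType d) (h : T -> R) (r : R) :
  measurable_fun setT h -> measurable [set x | h x <= r].
Proof.
move=> mh; rewrite (_ : mkset _ = ~` [set x | r < h x]).
  by apply: measurableC; exact: measurable_gtr.
by apply/seteqP; split=> x /=; rewrite leNgt => /negP.
Qed.

Lemma area_integral_indic (A : set R2) : measurable A ->
  (\int[area]_x (\1_A x)%:E = area A)%E.
Proof.
move=> mA; have E := integral_indic area measurableT mA.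
exact: (etrans E (congr1 area (setIT A))).
Qed.

Lemma leb_itv (a l : R) : 0 <= l ->
  (\int[leb R]_x (\1_(`[a - l, a + l]%classic : set (measurableTypeR R)) x)%:E = (2 * l)%:E)%E.
Proof.
move=> l0; have mI : measurable (`[a - l, a + l]%classic : set (measurableTypeR R)) by exact: measurable_itv.
have E := integral_indic (leb R) measurableT mI.
rewrite E setIT /leb /= lebesgue_measure_itv /= lte_fin.
case: ltP => h; first by rewrite -EFinB; congr (_%:E); ring.
by congr (_%:E); move: h l0; clear; lra.
Qed.

(** By Tonelli: a slice of diameter at most l lies in an interval of length 2
    l. *)
Lemma area_slices (S : set R2) (l t o : R) : measurable S -> 0 <= l -> 0 <= t ->
  (forall y x x', S (x, y) -> S (x', y) -> `|x - x'| <= l) ->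
  (forall x y, S (x, y) -> `|y - o| <= t) -> (area S <= (4 * l * t)%:E)%E.
Proof.
move=> mS l0 t0 hx hy; rewrite -area_integral_indic//.
have mi : measurable_fun setT (fun x => (\1_S x : R)%:E).
  by apply/measurable_EFinP; exact: measurable_indic.
have i0 (x : R2) : (0 <= (\1_S x : R)%:E)%E by rewrite lee_fin.
rewrite area_fubini2//; pose I : set (measurableTypeR R) := `[o - t, o + t]%classic.
have mI : measurable I by exact: measurable_itv.
have mI' : measurable_fun setT (fun y => (\1_I y : R)%:E).
  by apply/measurable_EFinP; exact: measurable_indic.
have key y : (\int[leb R]_x (\1_S (x, y))%:E <= (2 * l)%:E * (\1_I y)%:E)%E.
  have [[x0 Sx0]|nS] := pselect (exists x, S (x, y)); last first.
    rewrite (_ : (fun x => _) = (fun=> 0%E)).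
      by rewrite integral0 -EFinM lee_fin !mulr_ge0.
    by apply/funext => x; rewrite indicE memNset// => Sx; apply: nS; exists x.
  have -> : \1_I y = 1 :> R.
    rewrite indicE mem_set// /I /= in_itv /=; have := hy _ _ Sx0.
    by rewrite ler_distl.
  rewrite mule1 -(leb_itv x0 l0); apply: ge0_le_integral; first exact: measurableT.
  - by move=> x _; rewrite lee_fin.
  - exact: (measurableT_comp mi (pair2_measurable y)).
  - by apply/measurable_EFinP; apply: measurable_indic; exact: measurable_itv.
  move=> x _; rewrite lee_fin !indicE; have [Sx|_] := boolP ((x, y) \in S); last by rewrite ler0n.
  rewrite mem_set// /= in_itv /=; have := hx _ _ _ (set_mem Sx) Sx0.
  by rewrite ler_distl.
apply: (@le_trans _ _ (\int[leb R]_y ((2 * l)%:E * (\1_I y)%:E))%E).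
  apply: ge0_le_integral; first exact: measurableT.
  - by move=> y _; apply: integral_ge0 => x _; rewrite lee_fin.
  - exact: (@measurable_fun_fubini_tonelli_G _ _ _ _ _ (leb R) (fun x => (\1_S x)%:E) mi i0).
  - by apply: emeasurable_funM => //; exact: measurable_cst.
  - by move=> y _; exact: key.
rewrite (ge0_integralZl (leb R) measurableT mI'); [|by move=> x _; rewrite lee_fin|by rewrite lee_fin mulr_ge0].
rewrite leb_itv// -EFinM lee_fin le_eqVlt; apply/orP; left; apply/eqP; ring.
Qed.

Definition swap2 (x : R2) : R2 := (x.2, x.1).

Lemma area_swap (S : set R2) : measurable S ->
  measurable (swap2 @^-1` S) /\ area (swap2 @^-1` S) = area S.
Proof.
move=> mS.
have ms : measurable_fun setT swap2.
  by apply/measurable_fun_pairP; split; [exact: measurable_snd|exact: measurable_fst].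
have mS' : measurable (swap2 @^-1` S) by rewrite -[X in measurable X]setTI; exact: ms.
split=> //; rewrite -!area_integral_indic//.
have mi (A : set R2) : measurable A -> measurable_fun setT (fun x => (\1_A x : R)%:E).
  by move=> mA; apply/measurable_EFinP; exact: measurable_indic.
rewrite (area_fubini2 (mi _ mS)); last by move=> x; rewrite lee_fin.
rewrite (area_fubini (mi _ mS')); last by move=> x; rewrite lee_fin.
by [].
Qed.

Definition cden (z w : R[i]) : R := normc (1 - conjc w * z).
(** The defect is comparable with the distance to the unit circle. *)
Definition defect (w : R[i]) : R := 1 - normc w ^+ 2.

Lemma measurable_defect : measurable_fun setT (fun w : R2 => defect (ofR2 w)).
Proof.
apply: measurable_funB; first exact: measurable_cst.
by apply: measurable_funX; apply: cmeas_normc; exact: (cmeas_ofR2 (@measurable_id _ R2 setT)).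
Qed.

Lemma measurable_cden z : measurable_fun setT (fun w : R2 => cden z (ofR2 w)).
Proof.
apply: (cmeas_normc (f := fun w => 1 - conjc (ofR2 w) * z)).
apply: cmeasB; first exact: cmeas_cst.
apply: cmeasM; last exact: cmeas_cst.
by apply: cmeas_conj; exact: (cmeas_ofR2 (@measurable_id _ R2 setT)).
Qed.

Lemma defect_gt0 w : normc w < 1 -> 0 < defect w.
Proof. by move=> w1; rewrite subr_gt0 expr_lt1 ?normc_ge0. Qed.

Lemma cdenC z w : cden z w = cden w z.
Proof.
rewrite /cden -[LHS]normc_conj; congr normc.
by rewrite rmorphB rmorph1 rmorphM /= conjcK mulrC.
Qed.

Lemma cden_ge z w : normc z < 1 -> normc w < 1 -> defect w <= 2 * cden z w.
Proof.
move=> z1 w1; rewrite /cden /defect.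
have := normc_tri 1 (conjc w * z); rewrite normc1 normcM normc_conj => /(le_trans (ler_norm _)).
have h : normc w * normc z <= normc w by rewrite ler_piMr ?normc_ge0// ltW.
have n0 := normc_ge0 w; have : 0 <= (1 - normc w) * (1 - normc w) by rewrite mulr_ge0// subr_ge0 ltW.
move: h n0; clear; rewrite expr2; lra.
Qed.

Lemma cden_gt0 z w : normc z < 1 -> normc w < 1 -> 0 < cden z w.
Proof. by move=> z1 w1; have := cden_ge z1 w1; have := defect_gt0 w1; clear; lra. Qed.

(** The part of the disc near the point z / |z| of the circle, at scale t, and
    within x of the circle. *)
Definition corner z t x : set R2 := [set w | normc (ofR2 w) < 1] `&`
  ([set w | cden z (ofR2 w) <= t] `&` [set w | defect (ofR2 w) <= x]).

Lemma measurable_normc_ofR2 : measurable_fun setT (fun w : R2 => normc (ofR2 w)).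
Proof. by apply: cmeas_normc; exact: (cmeas_ofR2 (@measurable_id _ R2 setT)). Qed.

Lemma measurable_corner z t x : measurable (corner z t x).
Proof.
apply: measurableI; first by apply: measurable_ltr; exact: measurable_normc_ofR2.
apply: measurableI; apply: measurable_ler; [exact: measurable_cden|exact: measurable_defect].
Qed.

(** Part of the annulus 1 - |w|^2 <= x that is far from the axis w1 = 0. *)
Definition piece (e x o t : R) : set R2 := [set w | normc (ofR2 w) < 1] `&`
  ([set w | defect (ofR2 w) <= x] `&` ([set w | 1 / 4 <= e * w.1] `&` [set w | `|w.2 - o| <= t])).

Lemma normc_ofR2 (w : R2) : normc (ofR2 w) ^+ 2 = w.1 ^+ 2 + w.2 ^+ 2.
Proof. by rewrite sqr_normcE. Qed.

(** On a slice where e w1 >= 1/4, the function w1 -> w1^2 has derivative at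
    least 1/2 in modulus and varies by at most x, so the slice has diameter at
    most 2 x. *)
Lemma area_piece e x o t : `|e| = 1 -> 0 <= x -> 0 <= t ->
  measurable (piece e x o t) /\ (area (piece e x o t) <= (8 * x * t)%:E)%E.
Proof.
move=> e1 x0 t0.
have mp : measurable (piece e x o t).
  apply: measurableI; first by apply: measurable_ltr; exact: measurable_normc_ofR2.
  apply: measurableI; first by apply: measurable_ler; exact: measurable_defect.
  apply: measurableI.
    rewrite (_ : mkset _ = [set w | - (e * w.1) <= - (1 / 4)]).
      apply: measurable_ler; apply: measurable_funN; apply: measurable_funM; [exact: measurable_cst|exact: measurable_fst].
    by apply/seteqP; split => w /=; rewrite lerN2.
  apply: (@measurable_ler _ _ (fun w : R2 => `|w.2 - o|)).
  apply: (measurableT_comp (@normr_measurable R setT)).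
  by apply: measurable_funB; [exact: measurable_snd|exact: measurable_cst].
split=> //; rewrite (_ : 8 * x * t = 4 * (2 * x) * t); last by ring.
apply: (@area_slices _ _ _ o) => //; first by rewrite mulr_ge0.
  move=> y a a' [/= A1 [A2 [A3 _]]] [/= B1 [B2 [B3 _]]].
  have s1 : normc (ofR2 (a, y)) ^+ 2 < 1 by rewrite expr_lt1 ?normc_ge0.
  have s2 : normc (ofR2 (a', y)) ^+ 2 < 1 by rewrite expr_lt1 ?normc_ge0.
  move: s1 s2 A2 B2; rewrite /defect !normc_ofR2 /= => s1 s2 A2 B2.
  have h : `|a - a'| * `|a + a'| <= x.
    rewrite -normrM -subr_sqr ler_norml; apply/andP; split; move: s1 s2 A2 B2; clear; lra.
  have h2 : 1 / 2 <= `|a + a'|.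
    have -> : `|a + a'| = `|e * (a + a')| by rewrite normrM e1 mul1r.
    rewrite mulrDr; apply: le_trans (ler_norm _).
    by move: A3 B3 => /=; clear; lra.
  have h3 : `|a - a'| * (1 / 2) <= `|a - a'| * `|a + a'| by rewrite ler_wpM2l.
  by move: h h3; clear; lra.
by move=> a y [/= _ [_ [_]]].
Qed.

Definition rim x : set R2 := [set w | normc (ofR2 w) < 1] `&` [set w | defect (ofR2 w) <= x].

Lemma measurable_rim x : measurable (rim x).
Proof.
apply: measurableI; first by apply: measurable_ltr; exact: measurable_normc_ofR2.
apply: measurable_ler; exact: measurable_defect.
Qed.

Lemma quarter_sq (u : R) : 1 / 4 <= u ^+ 2 -> exists2 e, `|e| = 1 & 1 / 4 <= e * u.
Proof.
move=> u4; exists (Num.sg u); first by rewrite normr_sg; case: eqVneq u4 => // ->; rewrite expr0n /=; lra.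
rewrite -normrEsg leNgt; apply/negP => ul; have n0 := normr_ge0 u.
have : `|u| * `|u| <= `|u| * (1 / 4) by rewrite ler_wpM2l// ltW.
by rewrite -expr2 real_normK ?num_real//; move: u4 ul n0; clear; lra.
Qed.

Lemma measureU4 (A B C D : set R2) (k : R) : measurable A -> measurable B -> measurable C ->
  measurable D -> (area A <= k%:E)%E -> (area B <= k%:E)%E -> (area C <= k%:E)%E ->
  (area D <= k%:E)%E -> (area ((A `|` B) `|` (C `|` D)) <= (4 * k)%:E)%E.
Proof.
move=> mA mB mC mD kA kB kC kD.
apply: (le_trans (measureU2 area (measurableU _ _ mA mB) (measurableU _ _ mC mD))).
apply: (@le_trans _ _ ((k%:E + k%:E) + (k%:E + k%:E))%E).
  have AB := le_trans (measureU2 area mA mB) (leeD kA kB).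
  exact: (leeD AB (le_trans (measureU2 area mC mD) (leeD kC kD))).
by rewrite -!EFinD lee_fin le_eqVlt; apply/orP; left; apply/eqP; ring.
Qed.

(** Four pieces, up to sign and exchange of the coordinates, cover the
    annulus. *)
Lemma area_rim x : 0 < x -> x <= 1 / 2 -> (area (rim x) <= (32 * x)%:E)%E.
Proof.
move=> x0 x2.
have [m1 l1] := area_piece 0 (normr1 R) (ltW x0) ler01.
have [m2 l2] := area_piece 0 (normrN1 R) (ltW x0) ler01.
have [m3 l3] := area_swap m1; have [m4 l4] := area_swap m2.
rewrite -l3 in l1; have {}l3 := l1; rewrite {1}(area_swap m1).2 in l1.
rewrite -l4 in l2; have {}l4 := l2; rewrite {1}(area_swap m2).2 in l2.
have -> : 32 * x = 4 * (8 * x * 1) by ring.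
apply: le_trans (measureU4 m1 m2 m3 m4 l1 l2 l3 l4).
apply: le_measure; rewrite ?inE; [exact: measurable_rim|by do 2! apply: measurableU|].
move=> w [/= w1 bx].
have s1 : normc (ofR2 w) ^+ 2 < 1 by rewrite expr_lt1 ?normc_ge0.
have wE := normc_ofR2 w.
have bd (u : R) : u ^+ 2 < 1 -> `|u - 0| <= 1.
  by move=> u1; rewrite subr0 -(@expr_le1 _ 2)// real_normK ?num_real// ltW.
have p1 := sqr_ge0 w.1; have p2 := sqr_ge0 w.2.
have w1b : `|w.1 - 0| <= 1 by apply: bd; move: s1 p1 p2; rewrite wE; clear; lra.
have w2b : `|w.2 - 0| <= 1 by apply: bd; move: s1 p1 p2; rewrite wE; clear; lra.
have swn : normc (ofR2 (swap2 w)) < 1.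
  by rewrite -(@expr_lt1 _ 2) ?normc_ge0// normc_ofR2 /= addrC -wE.
have swb : defect (ofR2 (swap2 w)) <= x.
  by move: bx; rewrite /defect !normc_ofR2 /= [w.2 ^+ 2 + _]addrC.
have pm (e : R) : `|e| = 1 -> e = 1 \/ e = -1.
  by move/eqP; rewrite eqr_norml => /andP[/orP[/eqP ->|/eqP ->] _]; [left|right].
have [/quarter_sq[e /pm[]-> h]|h2] := leP (1 / 4) (w.1 ^+ 2).
- by left; left; exact: (conj w1 (conj bx (conj h w2b))).
- by left; right; exact: (conj w1 (conj bx (conj h w2b))).
have /quarter_sq[e /pm[]-> h] : 1 / 4 <= w.2 ^+ 2 by move: bx h2 x2; rewrite /defect wE; clear; lra.
- by right; left; exact: (conj swn (conj swb (conj h w1b))).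
- by right; right; exact: (conj swn (conj swb (conj h w1b))).
Qed.

(** At scales t < 1/8 the set lies in a square of half-side 2 t around z /
    |z|, and one coordinate of that point is at least 1/2 in modulus; at
    larger scales the whole annulus is taken. *)
Lemma area_corner z t x : normc z < 1 -> 0 < t -> 0 < x ->
  (area (corner z t x) <= (256 * t * x)%:E)%E.
Proof.
move=> z1 t0 x0; have tx : 0 < t * x by rewrite mulr_gt0.
have mC := measurable_corner z t x.
have [t8|t8] := leP (1 / 8) t.
  have [x2|x2] := leP x (1 / 2); last first.
    apply: (@le_trans _ _ (4 * 2 * 1)%:E); last first.
      rewrite lee_fin; have : 1 / 8 * (1 / 2) <= t * x by apply: ler_pM => //; exact: ltW.
      by rewrite -mulrA; clear; lra.
    have co (a b : R) : normc (ofR2 (a, b)) < 1 -> `|a| <= 1 /\ `|b| <= 1.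
      move=> ab; have s1 : normc (ofR2 (a, b)) ^+ 2 < 1 by rewrite expr_lt1 ?normc_ge0.
      have key (u : R) : u ^+ 2 <= 1 -> `|u| <= 1.
        by move=> u1; rewrite -(@expr_le1 _ 2)// real_normK// num_real.
      move: s1; rewrite normc_ofR2 /= => s1; have p1 := sqr_ge0 a; have p2 := sqr_ge0 b.
      by split; apply: key; move: s1 p1 p2; clear; lra.
    apply: (@area_slices _ _ _ 0) => //.
      move=> y a a' [/co[a1 _] _] [/co[a2 _] _]; apply: le_trans (ler_normB _ _) _.
      by move: a1 a2; clear; lra.
    by move=> a y [/co[_ y1] _]; rewrite subr0.
  apply: (@le_trans _ _ (32 * x)%:E).
    apply: le_trans (area_rim x0 x2); apply: le_measure; rewrite ?inE; [exact: mC|exact: measurable_rim|].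
    by move=> w [w1 [_ bx]].
  rewrite lee_fin; have : 1 / 8 * x <= t * x by rewrite ler_pM2r.
  by rewrite -[256 * t * x]mulrA; clear; lra.
(* Only the arc near om = z / |z| matters. *)
have zb : 3 / 4 < normc z \/ corner z t x = set0.
  have [h|h] := ltP (3 / 4) (normc z); [by left|right].
  apply/seteqP; split => // w [/= w1 [dt _]].
  have := normc_tri 1 (conjc (ofR2 w) * z); rewrite normc1 normcM normc_conj => /(le_trans (ler_norm _)).
  rewrite -/(cden z (ofR2 w)); have : normc (ofR2 w) * normc z <= 1 * normc z.
    by rewrite ler_wpM2r ?normc_ge0// ltW.
  by move: dt h t8; clear; lra.
case: zb => [zb|->]; last first.
  by rewrite measure0 lee_fin -mulrA; move: tx; clear; lra.
have z0 : 0 < normc z by move: zb; clear; lra.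
pose om : R[i] := z / (normc z)%:C.
have nz : (normc z)%:C != 0 :> R[i] by rewrite -normc_gt0 normc_real gtr0_norm.
have om1 : normc om = 1 by rewrite /om normcM normcV normc_real gtr0_norm// divff// gt_eqF.
have near w : normc w < 1 -> cden z w <= t -> normc (w - om) <= 2 * t.
  move=> w1 dt; have -> : normc (w - om) = normc (1 - conjc w * om).
    have e : conjc om * om = 1 by rewrite mulrC mulcJ om1 expr1n rmorph1.
    have -> : 1 - conjc w * om = - (conjc (w - om) * om) by rewrite rmorphB mulrBl e opprB.
    by rewrite normc_opp normcM normc_conj om1 mulr1.
  have -> : 1 - conjc w * om = (1 - conjc w * z) - conjc w * (om - z) by ring.
  apply: le_trans (normcDle _ _) _; rewrite normc_opp normcM normc_conj.
  have omz : normc (om - z) = 1 - normc z.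
    have -> : om - z = om * (1 - normc z)%:C by rewrite rmorphB rmorph1 /om; field.
    by rewrite normcM om1 mul1r normc_real ger0_norm// subr_ge0 ltW.
  have zt : 1 - normc z <= cden z w.
    have := normc_tri 1 (conjc w * z); rewrite normc1 normcM normc_conj => /(le_trans (ler_norm _)).
    rewrite -/(cden z w); have : normc w * normc z <= 1 * normc z by rewrite ler_wpM2r// ltW.
    by clear; lra.
  have : normc w * normc (om - z) <= 1 * normc (om - z) by rewrite ler_wpM2r ?normc_ge0// ltW.
  by rewrite omz -/(cden z w); move: dt zt; clear; lra.
have t20 : 0 <= 2 * t by rewrite mulr_ge0// ltW.
have bnd : 8 * x * (2 * t) <= 256 * t * x.
  have -> : 8 * x * (2 * t) = 16 * (t * x) by ring.
  by rewrite -mulrA; move: tx; clear; lra.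
have ReIm : 1 / 2 <= `|Re om| \/ 1 / 2 <= `|Im om|.
  have [h|h] := leP (1 / 2) `|Re om|; [by left|right]; rewrite leNgt; apply/negP => k.
  have sq (u : R) : `|u| < 1 / 2 -> u ^+ 2 <= 1 / 4.
    move=> u2; rewrite -real_normK ?num_real// expr2; have : `|u| * `|u| <= 1 / 2 * (1 / 2).
      by apply: ler_pM => //; exact: ltW.
    by clear; lra.
  have := sqr_normcE om; rewrite om1 expr1n; have := sq _ h; have := sq _ k; clear; lra.
have sgn (u : R) : exists2 e, `|e| = 1 & e * u = `|u|.
  have [u0|u0] := leP 0 u.
    by exists 1; rewrite ?normr1// mul1r ger0_norm.
  by exists (-1); rewrite ?normrN1// mulN1r ltr0_norm.
have cmp (e u v : R) : `|e| = 1 -> e * u = `|u| -> 1 / 2 <= `|u| -> `|v - u| <= 2 * t -> 1 / 4 <= e * v.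
  move=> e1 eu u2 vu; have : `|e * (v - u)| <= 2 * t by rewrite normrM e1 mul1r.
  rewrite ler_norml mulrBr eu => /andP[h _]; move: h u2 t8; clear; lra.
have nearC w : corner z t x w -> `|w.1 - Re om| <= 2 * t /\ `|w.2 - Im om| <= 2 * t.
  move=> [w1 [dt _]]; have h := near (ofR2 w) w1 dt; split.
    by apply: le_trans h; have := Re_le_normc (ofR2 w - om); rewrite cReB.
  by apply: le_trans h; have := Im_le_normc (ofR2 w - om); rewrite cImB.
case: ReIm => u2.
  have [e e1 eu] := sgn (Re om).
  have [mP lP] := area_piece (Im om) e1 (ltW x0) t20.
  apply: (@le_trans _ _ (8 * x * (2 * t))%:E); last by rewrite lee_fin.
  apply: le_trans lP; apply: le_measure; rewrite ?inE// => w wC; have [n1 n2] := nearC w wC.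
  by case: wC => w1 [_ bx]; split => //; split => //; split => //; exact: (cmp _ _ _ e1 eu u2 n1).
have [e e1 eu] := sgn (Im om).
have [mP lP] := area_piece (Re om) e1 (ltW x0) t20.
have [mS lS] := area_swap mP.
apply: (@le_trans _ _ (8 * x * (2 * t))%:E); last by rewrite lee_fin.
rewrite -lS in lP; apply: le_trans lP; apply: le_measure; rewrite ?inE; [exact: mC|exact: mS|].
move=> w wC.
have [n1 n2] := nearC w wC; case: wC => w1 [_ bx].
have swE : normc (ofR2 (swap2 w)) ^+ 2 = normc (ofR2 w) ^+ 2 by rewrite !normc_ofR2 /= addrC.
have sw1 : normc (ofR2 (swap2 w)) < 1.
  by rewrite -(@expr_lt1 _ 2) ?normc_ge0// swE expr_lt1 ?normc_ge0.
have sw2 : defect (ofR2 (swap2 w)) <= x by rewrite /defect swE.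
exact: (conj sw1 (conj sw2 (conj (cmp _ _ _ e1 eu u2 n2) n1))).
Qed.

End AreaEstimates.

(** * Integrals of powers of the Cauchy kernel *)

Section KernelIntegral.
Context {R : realType}.
Notation R2 := (Real2 R).

Definition idisc : set R2 := [set w | normc (ofR2 w) < 1].
Definition cap (z : R[i]) (t : R) : set R2 := idisc `&` [set w | cden z (ofR2 w) <= t].

Lemma measurable_idisc : measurable idisc.
Proof. by apply: measurable_ltr; exact: measurable_normc_ofR2. Qed.

Lemma measurable_cap z t : measurable (cap z t).
Proof.
by apply: measurableI; [exact: measurable_idisc|apply: measurable_ler; exact: measurable_cden].
Qed.

Definition rim_weight (w : R2) : R := (Num.sqrt (defect (ofR2 w)))^-1.

Lemma rim_weight_ge0 w : 0 <= rim_weight w.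
Proof. by rewrite invr_ge0 sqrtr_ge0. Qed.

Lemma measurable_rim_weight : measurable_fun setT rim_weight.
Proof.
apply: measurable_inv_ge0; last by move=> x; exact: sqrtr_ge0.
have hs : measurable_fun [set: R] (@Num.sqrt R).
  by apply: continuous_measurable_fun; exact: sqrt_continuous.
exact: (measurableT_comp hs (@measurable_defect R)).
Qed.

(** Slices of ratio 4 in the distance to the circle contribute a geometric
    series of ratio 1/2. *)
Lemma cap_integral (z : R[i]) (t : R) : normc z < 1 -> 0 < t ->
  (\int[area]_w (\1_(cap z t) w * rim_weight w)%:E <= (1024 * t * Num.sqrt (2 * t))%:E)%E.
Proof.
move=> z1 t0; have t20 : 0 < 2 * t by rewrite mulr_gt0.
set q := Num.sqrt (2 * t).
have q0 : 0 < q by rewrite sqrtr_gt0.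
have q2 : q ^+ 2 = 2 * t by rewrite sqr_sqrtr// ltW.
have p4 n : 0 < 4 ^+ n :> R by rewrite exprn_gt0.
have p2 n : 0 < 2 ^+ n :> R by rewrite exprn_gt0.
have -> : 1024 * t * q = (512 * t * q) / (1 - 1 / 2) by field.
have B0 : 0 <= 512 * t * q := mulr_ge0 (mulr_ge0 (ler0n _ _) (ltW t0)) (ltW q0).
have mI (A : set R2) : measurable A -> measurable_fun setT (\1_A : R2 -> R) by exact: measurable_indic.
have mcap := measurable_cap z t.
apply: (@layer_integral _ _ _ area (fun w => \1_(cap z t) w * rim_weight w) (fun=> 1)
  (fun n => corner z t (2 * t / 4 ^+ n)) (fun n => 2 ^+ n.+1 / q)).
- by apply: measurable_funM; [exact: mI|exact: measurable_rim_weight].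
- exact: measurable_cst.
- by move=> n; exact: measurable_corner.
- by move=> x; rewrite mulr_ge0 ?rim_weight_ge0.
- by [].
- by move=> n; rewrite divr_ge0 ?(ltW q0)// ltW.
- by [].
- by apply/andP; split; lra.
- move=> w; rewrite indicE; have [wC|] := boolP (w \in cap z t); last by rewrite mul0r eqxx.
  move=> _; rewrite mul1r; have [w1 dw] := set_mem wC.
  have b0 := defect_gt0 w1.
  have b1 : defect (ofR2 w) <= 2 * t.
    by apply: le_trans (cden_ge z1 w1) _; rewrite ler_pM2l.
  have [||n /andP[n1 n2]] := @dyadic _ 4 (2 * t / defect (ofR2 w)); first by rewrite ltr1n.
    by rewrite ler_pdivlMr// mul1r.
  exists n; split.
    by split => //; split => //; rewrite /= ler_pdivlMr// mulrC -ler_pdivlMr.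
  rewrite mulr1 /rim_weight -[leRHS]invrK lef_pV2 ?posrE ?sqrtr_gt0 ?invr_gt0 ?divr_gt0//.
  rewrite -(@ler_pXn2r _ 2) ?nnegrE ?sqrtr_ge0 ?invr_ge0 ?divr_ge0 ?(ltW q0) ?(ltW (p2 _))//.
  rewrite sqr_sqrtr ?(ltW b0)// invf_div exprMn q2 exprVn -exprM mulnC exprM.
  have -> : 2 ^+ 2 = 4 :> R by ring.
  by rewrite ler_pdivrMr// [defect _ * _]mulrC -ler_pdivrMr// ltW.
- move=> n; under eq_integral do rewrite mulr1.
  rewrite (area_integral_indic (measurable_corner _ _ _)).
  have x0 : 0 < 2 * t / 4 ^+ n by rewrite divr_gt0.
  apply: (@le_trans _ _ ((2 ^+ n.+1 / q)%:E * (256 * t * (2 * t / 4 ^+ n))%:E)%E).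
    by apply: lee_wpmul2l; [rewrite lee_fin divr_ge0 ?(ltW q0)// ltW|exact: area_corner].
  rewrite -EFinM lee_fin le_eqVlt; apply/orP; left; apply/eqP.
  have -> : 4 ^+ n = 2 ^+ n * 2 ^+ n :> R by rewrite -exprMn; congr (_ ^+ _); ring.
  have -> : 2 * t = q * q by rewrite -q2 expr2.
  by rewrite exprS expr_div_n expr1n; field; rewrite !gt_eqF.
Qed.

(** The constant of [bkernel_integral]. *)
Definition kernel_cst (g : R) : R := 4096 * 2 `^ g / (1 - 2 `^ (- g)).

Lemma powR_exprn (n : nat) (g x : R) : 0 <= x -> (x `^ g) ^+ n = (x ^+ n) `^ g.
Proof.
move=> x0; rewrite -(powR_mulrn n (powR_ge0 x g)) -(powR_mulrn n x0) -!powRrM.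
exact: (congr1 _ (mulrC _ _)).
Qed.

Lemma ler02 : 0 <= 2 :> R.
Proof. by rewrite ler0n. Qed.

Lemma powR2_lt1 (g : R) : 0 < g -> 0 < 2 `^ (- g) < 1.
Proof.
move=> g0; rewrite powR_gt0//= powRN invf_lt1 ?powR_gt0//.
rewrite -[X in X < _](powRr0 2) /powR gt_eqF// ltr_expR.
by rewrite mul0r mulr_gt0// ln_gt0// ltr1n.
Qed.

Lemma kernel_cst_gt0 g : 0 < g -> 0 < kernel_cst g.
Proof.
move=> g0; have /andP[_ h] := powR2_lt1 g0.
have p0 : 0 < 2 `^ g :> R by rewrite powR_gt0.
have c0 : 0 < 4096 :> R by rewrite ltr0n.
have q0 : 0 < 1 - 2 `^ (- g) :> R by rewrite subr_gt0.
exact: divr_gt0 (mulr_gt0 c0 p0) q0.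
Qed.

(** The exponents -1/2 and -3/2 - g are the only ones used; others reduce to
    them because (1 - |w|^2) <= 2 |1 - conj(w) z|. *)
Definition bkernel (z : R[i]) (g : R) (w : R2) : R :=
  \1_idisc w * (rim_weight w * cden z (ofR2 w) `^ (- (3 / 2 + g))).

Lemma measurable_bkernel z g : measurable_fun setT (bkernel z g).
Proof.
apply: measurable_funM; first by apply: measurable_indic; exact: measurable_idisc.
apply: measurable_funM; first exact: measurable_rim_weight.
exact: (measurableT_comp (measurable_powR _) (@measurable_cden R z)).
Qed.

Lemma bkernel_ge0 z g w : 0 <= bkernel z g w.
Proof. by rewrite mulr_ge0// mulr_ge0 ?rim_weight_ge0 ?powR_ge0. Qed.

(** Dyadic slices in the denominator, which is at least (1 - |z|^2) / 2. *)
Lemma bkernel_integral (z : R[i]) (g : R) : normc z < 1 -> 0 < g ->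
  (\int[area]_w (bkernel z g w)%:E <= (kernel_cst g * defect z `^ (- g))%:E)%E.
Proof.
move=> z1 g0; have b0 := defect_gt0 z1; pose be := defect z / 2.
have be0 : 0 < be by rewrite divr_gt0.
have /andP[r0 r1] := powR2_lt1 g0.
have p2 n : 0 < 2 ^+ n :> R by rewrite exprn_gt0.
have s0 n : 0 < 2 ^+ n * be by rewrite mulr_gt0.
have -> : kernel_cst g * defect z `^ (- g) = (4096 * be `^ (- g)) / (1 - 2 `^ (- g)).
  have -> : be `^ (- g) = 2 `^ g * defect z `^ (- g).
    rewrite /be powRM ?(ltW b0) ?invr_ge0// -powR_inv1// -powRrM mulN1r opprK mulrC //.
  by rewrite /kernel_cst; field; rewrite subr_eq0 eq_sym lt_eqF.
apply: (@layer_integral _ _ _ area (bkernel z g) (fun w => \1_idisc w * rim_weight w)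
  (fun n => cap z (2 ^+ n.+1 * be)) (fun n => (2 ^+ n * be) `^ (- (3 / 2 + g)))).
- exact: measurable_bkernel.
- by apply: measurable_funM; [apply: measurable_indic; exact: measurable_idisc|exact: measurable_rim_weight].
- by move=> n; exact: measurable_cap.
- exact: bkernel_ge0.
- by move=> w; rewrite mulr_ge0 ?rim_weight_ge0.
- by move=> n; exact: powR_ge0.
- by apply: mulr_ge0; [rewrite ler0n|exact: powR_ge0].
- by rewrite (ltW r0).
- move=> w; rewrite /bkernel indicE; have [wD|] := boolP (w \in idisc); last by rewrite mul0r eqxx.
  move=> _; rewrite !mul1r; have w1 : normc (ofR2 w) < 1 := set_mem wD.
  have [||n /andP[n1 n2]] := @dyadic _ 2 (cden z (ofR2 w) / be); first by rewrite ltr1n.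
    by rewrite ler_pdivlMr// mul1r /be ler_pdivrMr// mulrC cdenC; exact: cden_ge.
  have d0 := cden_gt0 z1 w1.
  exists n; split; first by split => //=; rewrite -ler_pdivrMr// ltW.
  rewrite mulrC ler_wpM2r ?rim_weight_ge0// !powRN lef_pV2 ?posrE ?powR_gt0//.
  apply: ge0_ler_powR; rewrite ?nnegrE ?(ltW (s0 _)) ?(ltW d0)//; first by rewrite addr_ge0 ?(ltW g0)//; lra.
  by rewrite -ler_pdivlMr.
- move=> n.
  have -> : (\int[area]_x (\1_(cap z (2 ^+ n.+1 * be)) x * (\1_idisc x * rim_weight x))%:E =
      \int[area]_x (\1_(cap z (2 ^+ n.+1 * be)) x * rim_weight x)%:E)%E.
    apply: eq_integral => w _; congr (_%:E); rewrite !indicE.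
    have [wC|_] := boolP (w \in cap _ _); last by rewrite !mul0r.
    have [wD _] := set_mem wC; by rewrite (mem_set (A := idisc) wD) !mul1r.
  have T0 : 0 < 2 ^+ n.+1 * be by rewrite mulr_gt0.
  apply: (@le_trans _ _ (((2 ^+ n * be) `^ (- (3 / 2 + g)))%:E *
     (1024 * (2 ^+ n.+1 * be) * Num.sqrt (2 * (2 ^+ n.+1 * be)))%:E)%E).
    by apply: lee_wpmul2l; [rewrite lee_fin powR_ge0|exact: cap_integral].
  rewrite -EFinM lee_fin le_eqVlt; apply/orP; left; apply/eqP.
  have -> : 4096 * be `^ (- g) * (2 `^ (- g)) ^+ n = 4096 * (2 ^+ n * be) `^ (- g).
    rewrite (powR_exprn n (- g) ler02) (powRM (- g) (ltW (p2 n)) (ltW be0)).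
    by rewrite -mulrA; exact: (congr1 _ (mulrC _ _)).
  have := s0 n; rewrite !exprS; set s := 2 ^+ n * be => sn.
  have -> : Num.sqrt (2 * (2 * 2 ^+ n * be)) = 2 * s `^ (1 / 2).
    have -> : 2 * (2 * 2 ^+ n * be) = 2 ^+ 2 * s by rewrite /s; ring.
    by rewrite sqrtrM ?sqr_ge0// sqrtr_sqr ger0_norm// -powR12_sqrt ?(ltW sn)// mul1r.
  have -> : 2 * 2 ^+ n * be = 2 * s `^ 1 by rewrite powRr1 ?(ltW sn)// /s mulrA.
  have -> : s `^ (- (3 / 2 + g)) * (1024 * (2 * s `^ 1) * (2 * s `^ (1 / 2))) =
     4096 * (s `^ (- (3 / 2 + g)) * s `^ 1 * s `^ (1 / 2)) by ring.
  have sn0 : s != 0 by rewrite gt_eqF.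
  by rewrite -!powRD ?sn0 ?implybT//; congr (_ * _ `^ _); field.
Qed.

End KernelIntegral.

(** * Sums over separated sequences and Schur's test *)

Section DiscreteSums.
Context {R : realType}.
Notation R2 := (Real2 R).

Lemma powR_add (x u v : R) : 0 < x -> x `^ (u + v) = x `^ u * x `^ v.
Proof. by move=> x0; apply: powRD; rewrite (gt_eqF x0) implybT. Qed.

Lemma powR_le_base (x y u : R) : 0 <= u -> 0 <= x -> x <= y -> x `^ u <= y `^ u.
Proof. by move=> u0 x0 xy; have y0 := le_trans x0 xy; apply: ge0_ler_powR; rewrite ?nnegrE. Qed.

Lemma powRN_le_base (x y u : R) : 0 <= u -> 0 < x -> x <= y -> y `^ (- u) <= x `^ (- u).
Proof.
move=> u0 x0 xy; have y0 := lt_le_trans x0 xy.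
by rewrite !powRN lef_pV2 ?posrE ?powR_gt0//; apply: powR_le_base => //; exact: ltW.
Qed.

Definition box (c : R[i]) (h : R) : set R2 :=
  `]Re c - h, Re c + h[%classic `*` `]Im c - h, Im c + h[%classic.

Lemma measurable_box c h : measurable (box c h).
Proof. by apply: measurableX; exact: measurable_itv. Qed.

Lemma area_box c h : 0 < h -> area (box c h) = (4 * h ^+ 2)%:E.
Proof.
move=> h0; have L a : leb R (`]a - h, a + h[%classic) = (2 * h)%:E.
  rewrite /leb /= lebesgue_measure_itv /= lte_fin ifT; last by move: h0; clear; lra.
  by rewrite -EFinB; congr (_%:E); ring.
have E : area (box c h) = (leb R (`](Re c - h)%R, (Re c + h)%R[%classic) *
      leb R (`](Im c - h)%R, (Im c + h)%R[%classic))%E.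
  by apply: product_measure1E; exact: measurable_itv.
by rewrite E !L -EFinM; congr (_%:E); ring.
Qed.

Lemma box_near c h w : box c h w -> normc (ofR2 w - c) <= 2 * h.
Proof.
move=> [/= ]; rewrite !in_itv /= => /andP[h1 h2] /andP[h3 h4].
apply: le_trans (normc_le_ReIm _) _; rewrite cReB cImB /ofR2 /=.
have -> : 2 * h = h + h by ring.
by apply: lerD; rewrite ler_norml; apply/andP; split; move: h1 h2 h3 h4; clear; lra.
Qed.

(** On a square around c whose size is comparable with the distance from c to
    the circle, the kernel stays comparable with its value at c. *)
Lemma near_point (c z w : R[i]) : normc c < 1 -> normc z < 1 -> normc (w - c) <= defect c / 8 ->
  [/\ normc w < 1, defect w <= 2 * defect c & cden z w <= 2 * cden z c].
Proof.
move=> c1 z1 wc; have a0 := defect_gt0 c1; have n0 := normc_ge0 c.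
have a1 : defect c <= 2 * (1 - normc c).
  have : 0 <= (1 - normc c) * (1 - normc c) by rewrite mulr_ge0// subr_ge0 ltW.
  by rewrite /defect expr2; clear; lra.
have h := normc_tri w c.
have wl : normc w < 1.
  have := le_trans (le_trans (ler_norm _) h) wc; move: a1 c1; clear; lra.
split => //.
  have : `|normc w ^+ 2 - normc c ^+ 2| <= defect c / 8 * 2.
    rewrite subr_sqr normrM; apply: ler_pM => //; first exact: le_trans h wc.
    by rewrite ger0_norm ?addr_ge0 ?normc_ge0//; move: wl c1; clear; lra.
  by rewrite ler_norml => /andP[]; rewrite /defect in a0 *; move: a0; clear; lra.
rewrite /cden; have -> : 1 - conjc w * z = (1 - conjc c * z) - conjc (w - c) * z.
  by rewrite rmorphB; ring.
apply: le_trans (normcDle _ _) _; rewrite normc_opp normcM normc_conj -/(cden z c).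
have e1 : normc (w - c) * normc z <= defect c / 8 * 1.
  by apply: ler_pM; rewrite ?normc_ge0// ltW.
by have := cden_ge z1 c1; move: e1 a0; clear; lra.
Qed.

(** The constant of [discrete_sum]. *)
Definition sum_cst (g : R) : R := 128 * 2 `^ (3 / 2 + g) * kernel_cst g.

Lemma sum_cst_gt0 g : 0 < g -> 0 < sum_cst g.
Proof.
move=> g0; have k0 := kernel_cst_gt0 g0; have c0 : 0 < 128 :> R by rewrite ltr0n.
have p0 : 0 < 2 `^ (3 / 2 + g) :> R by rewrite powR_gt0// ltr0n.
exact: mulr_gt0 (mulr_gt0 c0 p0) k0.
Qed.

(** The square has area (defect c)^2 / 64, which accounts for the exponent 3/2
    = 2 - 1/2. *)
Lemma term_le (c z : R[i]) (g : R) : 0 < g -> normc c < 1 -> normc z < 1 ->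
  ((defect c `^ (3 / 2) * cden z c `^ (- (3 / 2 + g)))%:E <=
   (128 * 2 `^ (3 / 2 + g))%:E * \int[area]_w (\1_(box c (defect c / 16)) w * bkernel z g w)%:E)%E.
Proof.
move=> g0 c1 z1; have a0 := defect_gt0 c1; set h := defect c / 16.
have h0 : 0 < h by rewrite divr_gt0// ltr0n.
have d0 := cden_gt0 z1 c1.
have q0 : 0 <= 3 / 2 + g by move: g0; clear; lra.
have c0 : 0 < 128 :> R by rewrite ltr0n.
have p2 : 0 < 2 `^ (3 / 2 + g) :> R by rewrite powR_gt0// ltr0n.
set m := (Num.sqrt (2 * defect c))^-1 * (2 * cden z c) `^ (- (3 / 2 + g)).
have m0 : 0 <= m by rewrite mulr_ge0 ?powR_ge0// invr_ge0 sqrtr_ge0.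
have low : ((m * (4 * h ^+ 2))%:E <= \int[area]_w (\1_(box c h) w * bkernel z g w)%:E)%E.
  rewrite EFinM -(area_box c h0) -(area_integral_indic (measurable_box c h)).
  have mi : measurable_fun setT (fun x => (\1_(box c h) x : R)%:E).
    by apply/measurable_EFinP; apply: measurable_indic; exact: measurable_box.
  rewrite -(ge0_integralZl area measurableT mi); [|by move=> x _; rewrite lee_fin|by rewrite lee_fin].
  apply: ge0_le_integral; first exact: measurableT.
  - by move=> x _; rewrite -EFinM lee_fin mulr_ge0.
  - by apply: emeasurable_funM => //; exact: measurable_cst.
  - apply/measurable_EFinP; apply: measurable_funM; last exact: measurable_bkernel.
    by apply: measurable_indic; exact: measurable_box.
  move=> w _; rewrite -EFinM lee_fin mulrC indicE.
  have [wB|_] := boolP (w \in box c h); last by rewrite !mul0r.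
  rewrite !mul1r; have wn : normc (ofR2 w - c) <= defect c / 8.
    by apply: le_trans (box_near (set_mem wB)) _; rewrite /h; move: a0; clear; lra.
  have [w1 bw dw] := near_point c1 z1 wn.
  rewrite /bkernel indicE mem_set// mul1r /m; apply: ler_pM; rewrite ?powR_ge0 ?invr_ge0 ?sqrtr_ge0//.
    rewrite /rim_weight lef_pV2 ?posrE ?sqrtr_gt0 ?defect_gt0// ?mulr_gt0//.
    by rewrite ler_wsqrtr.
  by apply: powRN_le_base; rewrite ?cden_gt0.
have lift := lee_wpmul2l (x := (128 * 2 `^ (3 / 2 + g))%:E) _ low.
apply: le_trans (lift _); last by rewrite lee_fin mulr_ge0// ltW.
rewrite -EFinM lee_fin /m /h.
have s0 : 0 < Num.sqrt (defect c) by rewrite sqrtr_gt0.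
have s2 : Num.sqrt (defect c) * Num.sqrt (defect c) = defect c by rewrite -expr2 sqr_sqrtr ?ltW.
have r0 : 0 < Num.sqrt 2 :> R by rewrite sqrtr_gt0 ltr0n.
have r2 : Num.sqrt 2 * Num.sqrt 2 = 2 :> R by rewrite -expr2 sqr_sqrtr ?ler0n.
have a32 : defect c `^ (3 / 2) = defect c * Num.sqrt (defect c).
  have -> : 3 / 2 = 1 + 2^-1 :> R by field.
  by rewrite (powR_add _ _ a0) powRr1 ?(ltW a0)// powR12_sqrt ?(ltW a0).
have E2 : (2 * cden z c) `^ (- (3 / 2 + g)) =
    (2 `^ (3 / 2 + g))^-1 * cden z c `^ (- (3 / 2 + g)).
  by rewrite (powRM _ ler02 (ltW d0)) powRN.
rewrite a32 E2 (sqrtrM _ ler02); move: p2 d0 s0 s2 r0 r2.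
set P := 2 `^ _; set s := Num.sqrt (defect c); set r := Num.sqrt 2; set Q := _ `^ (- _).
move=> P0 d0 s0 s2 r0 r2.
have Q0 : 0 < Q by rewrite powR_gt0.
have r1 : r <= 2.
  have : 1 * 1 <= r * r by rewrite r2 mulr1 ler1n.
  rewrite -!expr2 ler_pXn2r ?nnegrE ?(ltW r0)// => r1; rewrite -r2 ler_peMr// ltW//.
have -> : 128 * P * ((r * s)^-1 * (P^-1 * Q) * (4 * (defect c / 16) ^+ 2)) =
    (2 / r) * (defect c * s * Q).
  by rewrite -s2; field; rewrite !gt_eqF.
rewrite ler_peMl//.
  by rewrite !mulr_ge0 ?(ltW s0) ?(ltW Q0)// ltW.
by rewrite ler_pdivlMr// mul1r.
Qed.

Variable alpha : nat -> R[i].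
Hypothesis alpha1 : forall k, normc (alpha k) < 1.
Let a k := defect (alpha k).
Hypothesis sep : forall j k, j <> k -> pD (alpha j) (alpha k) <= 1 / 2.

(** Separation with eta <= 1/2 gives |alpha j - alpha k| > |1 - conj(alpha k)
    (alpha j)| / 2, more than the squares allow. *)
Lemma box_disjoint j k w : box (alpha j) (a j / 16) w -> box (alpha k) (a k / 16) w -> j = k.
Proof.
wlog ajk : j k / a j <= a k.
  by move=> H; have [h|/ltW h] := leP (a j) (a k) => wj wk; [exact: H|apply/esym; exact: H].
move=> wj wk; apply: contrapT => jk; have := sep jk.
have a0 := defect_gt0 (alpha1 k); rewrite -/(a k) in a0.
have d0 := cden_gt0 (alpha1 j) (alpha1 k).
have h1 := box_near wj; have h2 := box_near wk.
have close : normc (alpha j - alpha k) <= a k / 4.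
  have -> : alpha j - alpha k = (ofR2 w - alpha k) - (ofR2 w - alpha j) by ring.
  apply: le_trans (normcDle _ _) _; rewrite normc_opp; move: h1 h2 ajk; clear; lra.
have dk := cden_ge (alpha1 j) (alpha1 k); rewrite -/(a k) in dk.
have id := mobius_id1 (alpha j) (alpha k).
rewrite /pD ler_pdivrMr ?exprn_gt0// -id => E.
have c2 : normc (alpha j - alpha k) ^+ 2 <= (cden (alpha j) (alpha k) / 2) ^+ 2.
  rewrite ler_pXn2r ?nnegrE ?normc_ge0 ?divr_ge0 ?(ltW d0)//.
  by apply: le_trans close _; move: dk; clear; lra.
move: E c2; rewrite -/(cden (alpha j) (alpha k)).
have : 0 < cden (alpha j) (alpha k) ^+ 2 by rewrite exprn_gt0.
by rewrite expr_div_n; clear; lra.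
Qed.

(** The squares are disjoint, so the sum is at most a multiple of the integral
    over the whole disc. *)
Lemma discrete_sum (z : R[i]) (g : R) n : 0 < g -> normc z < 1 ->
  \sum_(j < n) a j `^ (3 / 2) * cden z (alpha j) `^ (- (3 / 2 + g)) <= sum_cst g * defect z `^ (- g).
Proof.
move=> g0 z1; rewrite -lee_fin -sumEFin.
have K0 : 0 <= 128 * 2 `^ (3 / 2 + g) :> R by apply: mulr_ge0; [rewrite ler0n|exact: powR_ge0].
pose f (j : nat) (w : R2) : R := \1_(box (alpha j) (a j / 16)) w * bkernel z g w.
have f0 j w : 0 <= f j w by rewrite mulr_ge0 ?bkernel_ge0.
have mf j : measurable_fun setT (fun w => (f j w)%:E).
  apply/measurable_EFinP; apply: measurable_funM; last exact: measurable_bkernel.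
  by apply: measurable_indic; exact: measurable_box.
apply: (@le_trans _ _ (\sum_(j < n) ((128 * 2 `^ (3 / 2 + g))%:E * \int[area]_w (f j w)%:E))%E).
  by apply: lee_sum => j _; exact: term_le.
have i0 j : (0 <= \int[area]_w (f j w)%:E)%E by apply: integral_ge0 => w _; rewrite lee_fin.
rewrite -ge0_sume_distrr; last by move=> j _; exact: i0.
have E : (\sum_(j < n) \int[area]_w (f j w)%:E = \int[area]_w \sum_(j < n) (f j w)%:E)%E.
  rewrite (@ge0_integral_sum _ _ _ area setT measurableT _ (fun (j : 'I_n) w => (f j w)%:E))//.
  by move=> j w _; rewrite lee_fin.
have le : (\int[area]_w \sum_(j < n) (f j w)%:E <= (kernel_cst g * defect z `^ (- g))%:E)%E.
  apply: le_trans (bkernel_integral z1 g0); apply: ge0_le_integral; first exact: measurableT.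
  - by move=> w _; apply: sume_ge0 => j _; rewrite lee_fin.
  - by apply: emeasurable_sum => j; exact: mf.
  - by apply/measurable_EFinP; exact: measurable_bkernel.
  move=> w _; rewrite sumEFin lee_fin.
  have [[j wj]|nw] := pselect (exists j : 'I_n, box (alpha j) (a j / 16) w); last first.
    rewrite big1 ?bkernel_ge0// => j _; rewrite /f indicE memNset ?mul0r// => wj.
    by apply: nw; exists j.
  rewrite (bigD1 j)//= big1 ?addr0; first by rewrite /f indicE mem_set// mul1r.
  move=> k kj; rewrite /f indicE memNset ?mul0r// => wk.
  by move/eqP: kj; apply; apply/val_inj; exact: box_disjoint wk wj.
rewrite E; apply: le_trans (lee_wpmul2l _ le) _; first by rewrite lee_fin.
by rewrite -EFinM lee_fin /sum_cst mulrA.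
Qed.

End DiscreteSums.

Section SchurTest.
Context {R : realType}.
Notation R2 := (Real2 R).

Lemma two_powR_le4 (u : R) : u <= 2 -> 2 `^ u <= 4.
Proof.
move=> u2; have -> : 4 = 2 `^ 2 :> R by rewrite -[X in _ `^ X]/(2%:R) powR_mulrn ?ler02// -natrX.
by apply: ler_powR => //; rewrite ler1n.
Qed.

(** Since defect c <= 2 cden z c, exponents may be moved from the denominator
    to the numerator. *)
Lemma term_shift (c z : R[i]) (A g : R) : normc c < 1 -> normc z < 1 -> 3 / 2 <= A <= 3 ->
  defect c `^ A * cden z c `^ (- (A + g)) <=
  4 * (defect c `^ (3 / 2) * cden z c `^ (- (3 / 2 + g))).
Proof.
move=> c1 z1 /andP[A1 A2]; have a0 := defect_gt0 c1; have d0 := cden_gt0 z1 c1.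
have ad := cden_ge z1 c1; set e := A - 3 / 2.
have e0 : 0 <= e by rewrite subr_ge0.
have -> : A = 3 / 2 + e by rewrite /e; ring.
have -> : - (3 / 2 + e + g) = - (3 / 2 + g) + - e by ring.
rewrite (powR_add _ _ a0) (powR_add _ _ d0).
have h : defect c `^ e * cden z c `^ (- e) <= 4.
  apply: (@le_trans _ _ ((2 * cden z c) `^ e * cden z c `^ (- e))).
    by apply: ler_wpM2r; [exact: powR_ge0|exact: (powR_le_base e0 (ltW a0) ad)].
  rewrite (powRM _ ler02 (ltW d0)) -mulrA -(powR_add _ _ d0) subrr powRr0 mulr1.
  by apply: two_powR_le4; rewrite /e; move: A2; clear; lra.
set P := defect c `^ (3 / 2); set Q := cden z c `^ (- (3 / 2 + g)).
have PQ : 0 <= P * Q by rewrite mulr_ge0 ?powR_ge0.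
have -> : P * defect c `^ e * (Q * cden z c `^ (- e)) = defect c `^ e * cden z c `^ (- e) * (P * Q) by ring.
exact: ler_wpM2r.
Qed.

(** Splits off the factor pD z c ^ s, where pD z c = defect z * defect c /
    cden z c ^ 2. *)
Lemma term_gain (c z : R[i]) (A g s eta : R) : normc c < 1 -> normc z < 1 -> 0 <= s ->
  pD z c <= eta ->
  defect c `^ A * cden z c `^ (- (A + g)) <=
  eta `^ s * defect z `^ (- s) * (defect c `^ (A - s) * cden z c `^ (- ((A - s) + (g - s)))).
Proof.
move=> c1 z1 s0 zc; have a0 := defect_gt0 c1; have d0 := cden_gt0 z1 c1; have b0 := defect_gt0 z1.
have /andP[pD0 _] := pD_sub z1 c1.
have h : pD z c `^ s <= eta `^ s by exact: powR_le_base s0 (ltW pD0) zc.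
have E : pD z c `^ s = defect z `^ s * defect c `^ s * cden z c `^ (- (2 * s)).
  rewrite /pD -!/(defect _) -/(cden _ _) (powRM _ _ _) ?mulr_ge0 ?invr_ge0 ?exprn_ge0 ?(ltW d0) ?(ltW b0) ?(ltW a0)//.
  rewrite (powRM _ (ltW b0) (ltW a0)); congr (_ * _).
  by rewrite -[cden z c ^+ 2]powR_mulrn ?(ltW d0)// -powR_inv1 ?powR_ge0// -!powRrM; congr (_ `^ _); ring.
have -> : defect c `^ A * cden z c `^ (- (A + g)) =
  pD z c `^ s * defect z `^ (- s) * (defect c `^ (A - s) * cden z c `^ (- ((A - s) + (g - s)))).
  have -> : - (A + g) = - (2 * s) + - ((A - s) + (g - s)) by ring.
  have aE : defect c `^ A = defect c `^ s * defect c `^ (A - s).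
    by rewrite -(powR_add _ _ a0); congr (_ `^ _); ring.
  rewrite E aE (powR_add _ _ d0) (powRN (defect z)).
  by field; rewrite gt_eqF// powR_gt0.
apply: ler_wpM2r; first by rewrite mulr_ge0 ?powR_ge0.
by apply: ler_wpM2r; [exact: powR_ge0|].
Qed.

Variable alpha : nat -> R[i].
Hypothesis alpha1 : forall k, normc (alpha k) < 1.
Variable eta : R.
Hypothesis eta12 : eta <= 1 / 2.
Hypothesis sep : forall j k, j <> k -> pD (alpha j) (alpha k) <= eta.
Let a k := defect (alpha k).

Let sep2 j k : j <> k -> pD (alpha j) (alpha k) <= 1 / 2.
Proof. by move=> jk; exact: le_trans (sep jk) eta12. Qed.

Lemma row_sum (z : R[i]) (A g : R) n : normc z < 1 -> 3 / 2 <= A <= 3 -> 0 < g ->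
  \sum_(j < n) a j `^ A * cden z (alpha j) `^ (- (A + g)) <= 4 * sum_cst g * defect z `^ (- g).
Proof.
move=> z1 A32 g0; rewrite -mulrA.
apply: (@le_trans _ _ (\sum_(j < n) 4 * (a j `^ (3 / 2) * cden z (alpha j) `^ (- (3 / 2 + g))))).
  by apply: ler_sum => j _; exact: term_shift.
by rewrite -mulr_sumr ler_pM2l ?ltr0n//; exact: discrete_sum.
Qed.

(** [term_gain] trades part of the exponents for a power of eta. *)
Lemma off_sum k (A g s : R) n : 3 / 2 + s <= A <= 3 -> 0 <= s < g ->
  \sum_(j < n | (j : nat) != k) a j `^ A * cden (alpha k) (alpha j) `^ (- (A + g)) <=
  eta `^ s * (4 * sum_cst (g - s)) * a k `^ (- g).
Proof.
move=> /andP[A1 A2] /andP[s0 sg]; have a0 := defect_gt0 (alpha1 k); rewrite -/(a k) in a0.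
pose t (j : nat) := a j `^ (A - s) * cden (alpha k) (alpha j) `^ (- ((A - s) + (g - s))).
have t0 j : 0 <= t j by rewrite mulr_ge0 ?powR_ge0.
have E0 : 0 <= eta `^ s * a k `^ (- s) by rewrite mulr_ge0 ?powR_ge0.
apply: (@le_trans _ _ (\sum_(j < n | (j : nat) != k) eta `^ s * a k `^ (- s) * t j)).
  apply: ler_sum => j jk; apply: term_gain => //.
  by apply: sep => E; rewrite E eqxx in jk.
rewrite -mulr_sumr.
have sum_le : \sum_(j < n | (j : nat) != k) t j <= \sum_(j < n) t j.
  by rewrite [leLHS]big_mkcond; apply: ler_sum => j _; case: ifP.
have rs : \sum_(j < n) t j <= 4 * sum_cst (g - s) * a k `^ (- (g - s)).
  apply: row_sum => //; last by rewrite subr_gt0.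
  by apply/andP; split; move: A1 A2 s0; lra.
apply: le_trans (ler_wpM2l E0 (le_trans sum_le rs)) _.
rewrite le_eqVlt; apply/orP; left; apply/eqP.
have -> : - g = - s + - (g - s) by ring.
by rewrite (powR_add _ _ a0); ring.
Qed.

Definition kernel_mod (z : R[i]) (j : nat) : R := (a j / cden z (alpha j)) ^+ 3.

Lemma kernel_mod_ge0 z j : normc z < 1 -> 0 <= kernel_mod z j.
Proof. by move=> z1; rewrite exprn_ge0// divr_ge0// ltW ?defect_gt0 ?cden_gt0. Qed.

Lemma kernel_modE z j (u : R) : normc z < 1 ->
  kernel_mod z j * a j `^ (- u) = a j `^ (3 - u) * cden z (alpha j) `^ (- ((3 - u) + u)).
Proof.
move=> z1; have a0 := defect_gt0 (alpha1 j); have d0 := cden_gt0 z1 (alpha1 j).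
rewrite -/(a j) in a0.
have -> : - ((3 - u) + u) = - 3 :> R by ring.
rewrite (powR_add _ _ a0) /kernel_mod expr_div_n (powRN (cden _ _)).
have p3 (x : R) : 0 < x -> x `^ 3 = x ^+ 3 by move=> x0; exact: (powR_mulrn 3 (ltW x0)).
by rewrite (p3 _ a0) (p3 _ d0); ring.
Qed.

Variable p : R.
Hypothesis p1 : 1 <= p.
(** The exponent of the weights in Schur's test. The dual weights have the
    exponent schur_exp * (p - 1), and neither exceeds 1/4, so that the exponents fed
    to [row_sum] and [off_sum] are admissible. *)
Definition schur_exp : R := 1 / (4 * p).
Definition dual_exp : R := schur_exp * (p - 1).

Lemma schur_exp_bnd : 0 < schur_exp <= 1 / 4.
Proof.
have p0 : 0 < p := lt_le_trans ltr01 p1; have q0 : 0 < 4 * p by rewrite mulr_gt0// ltr0n.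
rewrite /schur_exp divr_gt0//= ler_pdivrMr//; move: p1; lra.
Qed.

Lemma dual_exp_bnd : 0 <= dual_exp <= 1 / 4.
Proof.
have /andP[d0 d4] := schur_exp_bnd; have p0 : 0 < p := lt_le_trans ltr01 p1.
apply/andP; split; first by rewrite mulr_ge0 ?(ltW d0)// subr_ge0.
rewrite /dual_exp /schur_exp mul1r mulrC ler_pdivrMr ?mulr_gt0 ?ltr0n//; move: p0; lra.
Qed.

(** The constants of [row_test] and, for off-diagonal sums, of [row_test_off]
    and [col_test_off]. *)
Definition row_cst : R := 4 * sum_cst schur_exp.
Definition off_cst : R := eta `^ (schur_exp / 2) * (4 * (sum_cst (schur_exp / 2) + sum_cst (1 + dual_exp - schur_exp / 2))).

Lemma row_test z n : normc z < 1 ->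
  \sum_(j < n) kernel_mod z j * a j `^ (- schur_exp) <= row_cst * defect z `^ (- schur_exp).
Proof.
move=> z1; have /andP[d0 d4] := schur_exp_bnd.
rewrite (eq_bigr (fun j : 'I_n => a j `^ (3 - schur_exp) * cden z (alpha j) `^ (- ((3 - schur_exp) + schur_exp)))).
  by apply: row_sum => //; apply/andP; split; move: d0 d4; lra.
by move=> j _; exact: kernel_modE.
Qed.

Lemma row_test_off k n :
  \sum_(j < n | (j : nat) != k) kernel_mod (alpha k) j * a j `^ (- schur_exp) <= off_cst * a k `^ (- schur_exp).
Proof.
have /andP[d0 d4] := schur_exp_bnd; have /andP[k0 k4] := dual_exp_bnd.
rewrite (eq_bigr (fun j : 'I_n => a j `^ (3 - schur_exp) * cden (alpha k) (alpha j) `^ (- ((3 - schur_exp) + schur_exp)))); last first.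
  by move=> j _; exact: kernel_modE.
have b1 : 3 / 2 + schur_exp / 2 <= 3 - schur_exp <= 3 by apply/andP; split; move: d0 d4; lra.
(* Half of the exponent is spent on the factor eta^(schur_exp / 2). *)
have b2 : 0 <= schur_exp / 2 < schur_exp by apply/andP; split; move: d0 d4; lra.
apply: le_trans (off_sum k n b1 b2) _; apply: ler_wpM2r; first exact: powR_ge0.
apply: ler_wpM2l; first exact: powR_ge0.
have -> : schur_exp - schur_exp / 2 = schur_exp / 2 by field.
rewrite ler_pM2l ?ltr0n// lerDl ltW//; apply: sum_cst_gt0; move: k0 d4; lra.
Qed.

Lemma col_test_off k n :
  \sum_(j < n | (j : nat) != k) kernel_mod (alpha j) k * a j `^ (2 - dual_exp) <= off_cst * a k `^ (2 - dual_exp).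
Proof.
have /andP[d0 d4] := schur_exp_bnd; have /andP[k0 k4] := dual_exp_bnd.
have a0 := defect_gt0 (alpha1 k); rewrite -/(a k) in a0.
have b1 : 3 / 2 + schur_exp / 2 <= 2 - dual_exp <= 3 by apply/andP; split; move: d0 d4 k0 k4; lra.
have b2 : 0 <= schur_exp / 2 < 1 + dual_exp by apply/andP; split; move: d0 d4 k0 k4; lra.
rewrite (eq_bigr (fun j : 'I_n => a k ^+ 3 * (a j `^ (2 - dual_exp) *
   cden (alpha k) (alpha j) `^ (- ((2 - dual_exp) + (1 + dual_exp)))))); last first.
  move=> j _; have dd := cden_gt0 (alpha1 k) (alpha1 j).
  have -> : - ((2 - dual_exp) + (1 + dual_exp)) = - 3 :> R by ring.
  rewrite /kernel_mod cdenC expr_div_n powRN (powR_mulrn 3 (ltW dd)); ring.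
rewrite -mulr_sumr; apply: (@le_trans _ _ (a k ^+ 3 * (off_cst * a k `^ (- (1 + dual_exp))))).
  rewrite ler_pM2l ?exprn_gt0//; apply: le_trans (off_sum k n b1 b2) _.
  apply: ler_wpM2r; first exact: powR_ge0.
  apply: ler_wpM2l; first exact: powR_ge0.
  by rewrite ler_pM2l ?ltr0n// lerDr ltW//; apply: sum_cst_gt0; move: d0; lra.
have -> : 2 - dual_exp = 3 + - (1 + dual_exp) by ring.
by rewrite (powR_add _ _ a0) (powR_mulrn 3 (ltW a0)) mulrCA.
Qed.

(** The constant of [col_test_int]. *)
Definition area_cst : R := 2 * kernel_cst (1 + dual_exp).

Lemma col_test_int k :
  (\int[area]_w (\1_idisc w * (kernel_mod (ofR2 w) k * defect (ofR2 w) `^ (- dual_exp)))%:E <=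
   (area_cst * a k `^ (2 - dual_exp))%:E)%E.
Proof.
have /andP[k0 k4] := dual_exp_bnd; have a0 := defect_gt0 (alpha1 k); rewrite -/(a k) in a0.
have g0 : 0 < 1 + dual_exp by move: k0; lra.
have K := bkernel_integral (alpha1 k) g0.
have c0 : 0 <= 2 * a k ^+ 3 by rewrite mulr_ge0 ?ler0n// exprn_ge0// ltW.
have md := @measurable_cden R (alpha k).
apply: (@le_trans _ _ ((2 * a k ^+ 3)%:E * \int[area]_w (bkernel (alpha k) (1 + dual_exp) w)%:E)%E); last first.
  apply: le_trans (lee_wpmul2l _ K) _; first by rewrite lee_fin.
  rewrite -EFinM lee_fin le_eqVlt; apply/orP; left; apply/eqP.
  have -> : 2 - dual_exp = 3 + - (1 + dual_exp) by ring.
  by rewrite (powR_add _ _ a0) (powR_mulrn 3 (ltW a0)) /area_cst; ring.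
have mk : measurable_fun setT (fun w => (bkernel (alpha k) (1 + dual_exp) w)%:E).
  by apply/measurable_EFinP; exact: measurable_bkernel.
rewrite -(ge0_integralZl area measurableT mk); [|by move=> w _; rewrite lee_fin bkernel_ge0|by rewrite lee_fin].
have ind (w : R2) (u v : R) : (normc (ofR2 w) < 1 -> u <= v) -> \1_idisc w * u <= \1_idisc w * v.
  move=> uv; rewrite indicE; have [wD|_] := boolP (w \in idisc); last by rewrite !mul0r.
  by rewrite !mul1r; apply: uv; exact: (set_mem wD).
apply: ge0_le_integral; first exact: measurableT.
- move=> w _; rewrite lee_fin indicE; have [wD|_] := boolP (w \in idisc); last by rewrite mul0r.
  by rewrite mul1r mulr_ge0 ?powR_ge0//; apply: kernel_mod_ge0; exact: (set_mem wD).
- apply/measurable_EFinP; apply: measurable_funM; first by apply: measurable_indic; exact: measurable_idisc.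
  apply: measurable_funM; last exact: (measurableT_comp (measurable_powR _) (@measurable_defect R)).
  apply: measurable_funX; apply: measurable_funM; first exact: measurable_cst.
  have := measurable_inv_ge0 md (fun x => normc_ge0 _).
  by under eq_fun do rewrite cdenC.
- by apply: emeasurable_funM => //; exact: measurable_cst.
move=> w _; rewrite -EFinM lee_fin /bkernel [leRHS]mulrCA; apply: ind => w1.
have b0 := defect_gt0 w1; have d0 := cden_gt0 (alpha1 k) w1.
have u0 : 0 <= 1 / 2 - dual_exp by move: k4; lra.
have -> : rim_weight w = defect (ofR2 w) `^ (- (1 / 2)).
  by rewrite /rim_weight powRN mul1r powR12_sqrt// ltW.
have -> : defect (ofR2 w) `^ (- dual_exp) = defect (ofR2 w) `^ (- (1 / 2)) * defect (ofR2 w) `^ (1 / 2 - dual_exp).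
  by rewrite -(powR_add _ _ b0); congr (_ `^ _); ring.
have h : defect (ofR2 w) `^ (1 / 2 - dual_exp) <= 2 * cden (alpha k) (ofR2 w) `^ (1 / 2 - dual_exp).
  apply: le_trans (powR_le_base u0 (ltW b0) (cden_ge (alpha1 k) w1)) _.
  rewrite (powRM _ ler02 (ltW d0)) ler_wpM2r ?powR_ge0//.
  rewrite -[X in _ <= X](powRr1 ler02); apply: ler_powR; first by rewrite ler1n.
  by move: k0; lra.
have -> : kernel_mod (ofR2 w) k = a k ^+ 3 * cden (alpha k) (ofR2 w) `^ (- 3).
  by rewrite /kernel_mod cdenC expr_div_n powRN (powR_mulrn 3 (ltW d0)).
have -> : - (3 / 2 + (1 + dual_exp)) = (- 3) + (1 / 2 - dual_exp) by field.
rewrite (powR_add _ _ d0).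
move: h; set P := defect _ `^ (- _); set Q := _ `^ (- 3); set U := defect _ `^ _; set V := _ `^ (1 / 2 - dual_exp).
move=> h; have a3 : 0 <= a k ^+ 3 := exprn_ge0 3 (ltW a0).
have c1 : 0 <= a k ^+ 3 * Q * P by exact: (mulr_ge0 (mulr_ge0 a3 (powR_ge0 _ _)) (powR_ge0 _ _)).
have -> : a k ^+ 3 * Q * (P * U) = a k ^+ 3 * Q * P * U by ring.
have -> : 2 * a k ^+ 3 * (P * (Q * V)) = a k ^+ 3 * Q * P * (2 * V) by ring.
exact: ler_wpM2l.
Qed.

End SchurTest.

(** * Limits controlled by increasing sequences *)

Section Limits.
Context {R : realType}.

Definition incr_to (m : nat -> R) (L : R) := (forall n, m n <= L) /\
  forall e, 0 < e -> exists N, forall n, (N <= n)%N -> L - m n <= e.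

Lemma incr_mono (m : nat -> R) : (forall n, m n <= m n.+1) -> forall i j, (i <= j)%N -> m i <= m j.
Proof.
move=> inc i j ij; rewrite -(subnKC ij); elim: (j - i)%N => [|d ih]; first by rewrite addn0.
by rewrite addnS; exact: le_trans ih (inc _).
Qed.

Lemma incr_lim (m : nat -> R) (B : R) : (forall n, m n <= m n.+1) -> (forall n, m n <= B) ->
  exists L, incr_to m L.
Proof.
move=> inc bnd; pose E := range m.
have hs : has_sup E by split; [exists (m 0%N); exists 0%N|exists B => _ [n _ <-]].
exists (sup E); split=> [n|e e0]; first by apply: (ub_le_sup hs.2); exists n.
have [_ [N _ <-] hN] := sup_adherent e0 hs.
exists N => n Nn; have := incr_mono inc Nn; move: hN; clear; lra.
Qed.

(** Both r + m and m are increasing and bounded. *)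
Lemma controlled_lim (r m : nat -> R) (L : R) : incr_to m L ->
  (forall i j, (i <= j)%N -> `|r j - r i| <= m j - m i) ->
  exists l, forall n, `|l - r n| <= L - m n.
Proof.
move=> mL rm; have [mle _] := mL.
have [n|n|A [A1 A2]] := @incr_lim (fun n => r n + m n) (r 0%N + m 0%N + 2 * (L - m 0%N)).
- by have := rm n n.+1 (leqnSn n); rewrite ler_norml => /andP[+ _]; clear; lra.
- have := rm 0%N n (leq0n n); rewrite ler_norml => /andP[_ +]; have := mle n; clear; lra.
exists (A - L) => n.
have up : A <= r n + m n + 2 * (L - m n).
  rewrite leNgt; apply/negP => lt; set B := r n + m n + _ in lt.
  have e0 : 0 < (A - B) / 2 by rewrite divr_gt0// subr_gt0.
  have [N hN] := A2 _ e0; have := hN (maxn N n) (leq_maxl _ _).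
  have := rm n (maxn N n) (leq_maxr _ _); rewrite ler_norml => /andP[_].
  have := mle (maxn N n); move: lt; rewrite /B; clear; lra.
have := A1 n; have := mle n; move: up; rewrite ler_norml => h1 h2 h3.
by apply/andP; split; move: h1 h2 h3; clear; lra.
Qed.

Definition cconv (u : nat -> R[i]) (l : R[i]) :=
  forall e : R, 0 < e -> exists N, forall n, (N <= n)%N -> normc (l - u n) <= e.

(** Real and imaginary parts converge; the sharp bound for the modulus follows
    by comparing with later terms. *)
Lemma ccontrolled_lim (u : nat -> R[i]) (m : nat -> R) (L : R) : incr_to m L ->
  (forall n, normc (u n.+1 - u n) <= m n.+1 - m n) ->
  exists l, forall n, normc (l - u n) <= L - m n.
Proof.
move=> mL um.
have um' i j : (i <= j)%N -> normc (u j - u i) <= m j - m i.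
  move=> ij; rewrite -(subnKC ij); elim: (j - i)%N => [|d ih]; first by rewrite addn0 !subrr normc0.
  rewrite addnS; have -> : u (i + d).+1 - u i = (u (i + d).+1 - u (i + d)%N) + (u (i + d)%N - u i) by ring.
  by apply: le_trans (normcDle _ _) _; have := um (i + d)%N; move: ih; clear; lra.
have [a ha] : exists l, forall n, `|l - Re (u n)| <= L - m n.
  apply: controlled_lim => // i j ij; apply: le_trans (um' i j ij).
  by rewrite -cReB; exact: Re_le_normc.
have [b hb] : exists l, forall n, `|l - Im (u n)| <= L - m n.
  apply: controlled_lim => // i j ij; apply: le_trans (um' i j ij).
  by rewrite -cImB; exact: Im_le_normc.
exists (a +i* b) => n; rewrite leNgt; apply/negP => lt.
pose e := (normc ((a +i* b) - u n) - (L - m n)) / 4.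
have e0 : 0 < e by rewrite divr_gt0// subr_gt0.
have [_ h] := mL; have [N hN] := h _ e0.
set k := maxn N n; have kN := hN k (leq_maxl _ _).
have lk : normc ((a +i* b) - u k) <= 2 * (L - m k).
  apply: le_trans (normc_le_ReIm _) _; rewrite cReB cImB /=.
  by have := ha k; have := hb k; clear; lra.
have nk := um' n k (leq_maxr _ _).
have := normcDle ((a +i* b) - u k) (u k - u n).
rewrite addrA subrK; have [mle _] := mL; have := mle k.
move: lt lk nk kN; rewrite /e; clear; lra.
Qed.

Lemma ctail_conv (u : nat -> R[i]) (m : nat -> R) (L : R) l : incr_to m L ->
  (forall n, normc (l - u n) <= L - m n) -> cconv u l.
Proof.
move=> [_ h] lu e e0; have [N hN] := h e e0.
by exists N => n Nn; exact: le_trans (lu n) (hN n Nn).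
Qed.

Lemma incr_sum (m : nat -> nat -> R) (L c : nat -> R) n : (forall k, incr_to (m^~ k) (L k)) ->
  (forall k, 0 <= c k) ->
  forall e, 0 < e -> exists N, forall i, (N <= i)%N -> \sum_(k < n) c k * (L k - m i k) <= e.
Proof.
move=> mL c0; elim: n => [|n ih] e e0; first by exists 0%N => i _; rewrite big_ord0 ltW.
have e2 : 0 < e / 2 by rewrite divr_gt0.
have [N1 h1] := ih _ e2.
have c1 : 0 < 1 + c n by rewrite ltr_pwDl.
have [_ h] := mL n; have e3 : 0 < e / 2 / (1 + c n) by rewrite divr_gt0.
have [N2 h2] := h _ e3; exists (maxn N1 N2) => i; rewrite geq_max => /andP[i1 i2].
rewrite big_ord_recr /=; have := h1 i i1.
have : c n * (L n - m i n) <= e / 2.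
  apply: (@le_trans _ _ (c n * (e / 2 / (1 + c n)))); first by rewrite ler_wpM2l// h2.
  rewrite mulrCA ger_pMr// ler_pdivrMr// mul1r; by rewrite lerDr.
by clear; lra.
Qed.

End Limits.

(** * Jensen's inequality and Neumann series in weighted l^p *)

Section Jensen.
Context {R : realType}.
Variable p : R.
Hypothesis p1 : 1 <= p.

(** From x^p = x exp ((p - 1) ln x), by exp t >= 1 + t used twice. *)
Lemma bernoulli_powR (x : R) : 0 <= x -> 1 + p * (x - 1) <= x `^ p.
Proof.
move=> x0; have [->|xn] := eqVneq x 0.
  by rewrite powR0 ?gt_eqF ?(lt_le_trans ltr01)//; move: p1; lra.
have xp : 0 < x by rewrite lt_neqAle eq_sym xn.
have xE : x `^ p = x * expR ((p - 1) * ln x).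
  rewrite -[X in X * _](powRr1 (ltW xp)) /powR (negbTE xn) -expRD; congr expR; ring.
have l1 : 1 - ln x <= x^-1.
  by have := expR_ge1Dx (- ln x); rewrite expRN lnK.
have h1 : x - 1 <= x * ln x.
  have := ler_wpM2l x0 l1; rewrite divff// mulrBr mulr1; lra.
have h2 : (p - 1) * (x - 1) <= (p - 1) * (x * ln x) by rewrite ler_wpM2l// subr_ge0.
have h3 := ler_wpM2l x0 (expR_ge1Dx ((p - 1) * ln x)).
rewrite xE; apply: le_trans h3; move: h2.
have -> : (p - 1) * (x * ln x) = x * (p - 1) * ln x by ring.
have -> : x * (1 + (p - 1) * ln x) = x + x * (p - 1) * ln x by ring.
have -> : (p - 1) * (x - 1) = p * (x - 1) - x + 1 by ring.
lra.
Qed.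

Lemma tangent_powR (m y : R) : 0 < m -> 0 <= y -> m `^ p + p * m `^ (p - 1) * (y - m) <= y `^ p.
Proof.
move=> m0 y0; have yE : y = m * (y / m) by rewrite mulrCA divff ?mulr1// gt_eqF.
have ym : 0 <= y / m by rewrite divr_ge0// ltW.
have mE : m `^ p = m `^ (p - 1) * m.
  by rewrite -[X in _ * X](powRr1 (ltW m0)) -(powR_add _ _ m0) subrK.
rewrite [in leRHS]yE (powRM _ (ltW m0) ym).
apply: le_trans (ler_wpM2l (powR_ge0 m p) (bernoulli_powR ym)).
by rewrite mE le_eqVlt; apply/orP; left; apply/eqP; field; rewrite gt_eqF.
Qed.

(** Sum the tangent inequality of t -> t^p at the mean m of y. The total
    weight may be less than T, because the constant term (1 - p) m^p is
    nonpositive. *)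
Lemma jensen_sum (v y : nat -> R) (T : R) (P : pred nat) n : 0 < T -> (forall j, 0 <= v j) ->
  (forall j, 0 <= y j) -> \sum_(j < n | P j) v j <= T ->
  (\sum_(j < n | P j) v j * y j) `^ p <= T `^ (p - 1) * \sum_(j < n | P j) v j * y j `^ p.
Proof.
move=> T0 v0 y0 vT; set S := \sum_(j < n | P j) v j * y j.
have R0 : 0 <= \sum_(j < n | P j) v j * y j `^ p.
  by apply: sumr_ge0 => j _; rewrite mulr_ge0 ?powR_ge0.
have S0 : 0 <= S by apply: sumr_ge0 => j _; rewrite mulr_ge0.
have [->|Sn] := eqVneq S 0.
  by rewrite powR0 ?gt_eqF ?(lt_le_trans ltr01)// mulr_ge0 ?powR_ge0.
have Sp : 0 < S by rewrite lt_neqAle eq_sym Sn.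
set m := S / T; have m0 : 0 < m by rewrite divr_gt0.
have SE : S = m * T by rewrite /m mulrVK// unitfE gt_eqF.
have mE : m `^ p = m `^ (p - 1) * m.
  by rewrite -[X in _ * X](powRr1 (ltW m0)) -(powR_add _ _ m0) subrK.
have TE : T `^ p = T `^ (p - 1) * T.
  by rewrite -[X in _ * X](powRr1 (ltW T0)) -(powR_add _ _ T0) subrK.
have key : m `^ p * T <= \sum_(j < n | P j) v j * y j `^ p.
  apply: (@le_trans _ _ (\sum_(j < n | P j) v j * (m `^ p + p * m `^ (p - 1) * (y j - m)))); last first.
    by apply: ler_sum => j _; rewrite ler_wpM2l// tangent_powR.
  have -> : \sum_(j < n | P j) v j * (m `^ p + p * m `^ (p - 1) * (y j - m)) =
      (m `^ p - p * m `^ (p - 1) * m) * (\sum_(j < n | P j) v j) + p * m `^ (p - 1) * S.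
    rewrite /S !mulr_sumr -big_split /=; apply: eq_bigr => j _; ring.
  rewrite SE mE; set q := m `^ (p - 1).
  have q0 : 0 <= (p - 1) * (q * m).
    by apply: mulr_ge0; [rewrite subr_ge0|exact: mulr_ge0 (powR_ge0 _ _) (ltW m0)].
  have := ler_wpM2l q0 vT; set V := \sum_(j < n | P j) v j.
  have -> : (q * m - p * q * m) * V + p * q * (m * T) =
     p * q * m * T - (p - 1) * (q * m) * V by ring.
  have -> : (p - 1) * (q * m) * T = p * q * m * T - q * m * T by ring.
  by clear; lra.
rewrite SE (powRM _ (ltW m0) (ltW T0)) TE.
have -> : m `^ p * (T `^ (p - 1) * T) = T `^ (p - 1) * (m `^ p * T) by ring.
by rewrite ler_wpM2l ?powR_ge0.
Qed.

Lemma powR_addl_le (x y : R) : 0 <= x -> 0 <= y -> (x + y) `^ p <= 2 `^ (p - 1) * (x `^ p + y `^ p).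
Proof.
move=> x0 y0; have y'0 (j : nat) : 0 <= (if j is 0%N then x else y) by case: j.
have := @jensen_sum (fun=> 1) (fun j => if j is 0%N then x else y) 2 xpredT 2.
rewrite !big_ord_recl !big_ord0 /= !mul1r !addr0; apply => //.
Qed.

End Jensen.

Section Neumann.
Context {R : realType}.
Variables (p : R) (G : nat -> nat -> R[i]) (h W : nat -> R) (lam : nat -> R[i]) (La : R).
Hypothesis p1 : 1 <= p.
Hypothesis h0 : forall k, 0 < h k.
Hypothesis W0 : forall k, 0 < W k.
Let g k j := normc (G k j).
Hypothesis rows : forall k n, \sum_(j < n) g k j * h j <= 1 / 2 * h k.
Hypothesis cols : forall j n,
  \sum_(k < n) g k j * (W k * h k `^ (p - 1)) <= 1 / 2 * (W j * h j `^ (p - 1)).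
Hypothesis lamW : forall n, \sum_(k < n) normc (lam k) `^ p * W k <= La.

(** Truncated Neumann iteration for mu + G mu = lam, and its majorant. The
    sums are finite: the truncation index grows with the number of steps. *)
Fixpoint iter_mu (N : nat) (k : nat) : R[i] :=
  if N is N'.+1 then lam k - \sum_(j < N') G k j * iter_mu N' j else 0.

Fixpoint iter_maj (N : nat) (k : nat) : R :=
  if N is N'.+1 then normc (lam k) + \sum_(j < N') g k j * iter_maj N' j else 0.

Lemma sum_recr (V : zmodType) (F : nat -> V) n :
  \sum_(j < n.+1) F j = \sum_(j < n) F j + F n.
Proof. by rewrite big_ord_recr. Qed.

Lemma iter_muS N k : iter_mu N.+1 k = lam k - \sum_(j < N) G k j * iter_mu N j.
Proof. by []. Qed.

Lemma iter_majS N k : iter_maj N.+1 k = normc (lam k) + \sum_(j < N) g k j * iter_maj N j.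
Proof. by []. Qed.

Lemma g_ge0 k j : 0 <= g k j.
Proof. exact: normc_ge0. Qed.

Lemma maj_ge0 N k : 0 <= iter_maj N k.
Proof.
elim: N k => [|N ih] k //=; rewrite addr_ge0 ?normc_ge0//.
by apply: sumr_ge0 => j _; rewrite mulr_ge0 ?g_ge0.
Qed.

Lemma normc_sum n (u : nat -> R[i]) : normc (\sum_(j < n) u j) <= \sum_(j < n) normc (u j).
Proof.
elim: n => [|n ih]; first by rewrite !big_ord0 normc0.
by rewrite !big_ord_recr /=; apply: le_trans (normcDle _ _) _; rewrite lerD2r.
Qed.

Lemma mu_le_maj N k : normc (iter_mu N k) <= iter_maj N k.
Proof.
elim: N k => [|N ih] k.
  have -> : iter_mu 0 k = 0 by [].
  by rewrite normc0 maj_ge0.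
rewrite /=; apply: le_trans (normcDle _ _) _; rewrite normc_opp lerD2l.
apply: le_trans (normc_sum N (fun j => G k j * iter_mu N j)) _.
by apply: ler_sum => j _; rewrite normcM ler_wpM2l ?normc_ge0.
Qed.

(** Increments of the iteration are dominated by those of the majorant, so
    [ccontrolled_lim] applies. *)
Lemma mu_step N k : normc (iter_mu N.+1 k - iter_mu N k) <= iter_maj N.+1 k - iter_maj N k.
Proof.
elim: N k => [|N ih] k.
  have -> : iter_mu 1 k - iter_mu 0 k = lam k by rewrite /= big_ord0 !subr0.
  by rewrite /= big_ord0 addr0 subr0.
have -> : iter_mu N.+2 k - iter_mu N.+1 k =
    - (\sum_(j < N) G k j * (iter_mu N.+1 j - iter_mu N j) + G k N * iter_mu N.+1 N).
  have -> : \sum_(j < N) G k j * (iter_mu N.+1 j - iter_mu N j) =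
      \sum_(j < N) G k j * iter_mu N.+1 j - \sum_(j < N) G k j * iter_mu N j.
    by rewrite -sumrB; apply: eq_bigr => j _; rewrite mulrBr.
  rewrite (iter_muS N.+1 k) (iter_muS N k) (sum_recr (fun j => G k j * iter_mu N.+1 j)); ring.
have -> : iter_maj N.+2 k - iter_maj N.+1 k =
    \sum_(j < N) g k j * (iter_maj N.+1 j - iter_maj N j) + g k N * iter_maj N.+1 N.
  have -> : \sum_(j < N) g k j * (iter_maj N.+1 j - iter_maj N j) =
      \sum_(j < N) g k j * iter_maj N.+1 j - \sum_(j < N) g k j * iter_maj N j.
    by rewrite -sumrB; apply: eq_bigr => j _; rewrite mulrBr.
  rewrite (iter_majS N.+1 k) (iter_majS N k) (sum_recr (fun j => g k j * iter_maj N.+1 j)); ring.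
rewrite normc_opp; apply: le_trans (normcDle _ _) _; apply: lerD.
  apply: le_trans (normc_sum N (fun j => G k j * (iter_mu N.+1 j - iter_mu N j))) _.
  by apply: ler_sum => j _; rewrite normcM ler_wpM2l ?normc_ge0.
by rewrite normcM ler_wpM2l ?normc_ge0// mu_le_maj.
Qed.

Lemma maj_inc N k : iter_maj N k <= iter_maj N.+1 k.
Proof. by rewrite -subr_ge0; apply: le_trans (mu_step N k); exact: normc_ge0. Qed.

Lemma La_ge0 : 0 <= La.
Proof. by have := lamW 0; rewrite big_ord0. Qed.

(** Schur's test: Jensen's inequality along the rows, then summation along the
    columns. *)
Lemma schur_contract (x : nat -> R) (N n : nat) : (forall j, 0 <= x j) ->
  \sum_(k < n) (\sum_(j < N) g k j * x j) `^ p * W k <=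
  (1 / 2) `^ p * \sum_(j < N) x j `^ p * W j.
Proof.
move=> x0; have hf : 0 < 1 / 2 :> R by lra.
have y0 j : 0 <= x j / h j by rewrite divr_ge0// ltW.
have xE j : x j = h j * (x j / h j) by rewrite mulrCA divff ?mulr1// gt_eqF.
have J k : (\sum_(j < N) g k j * x j) `^ p <=
    (1 / 2 * h k) `^ (p - 1) * \sum_(j < N) (g k j * h j) * (x j / h j) `^ p.
  rewrite (eq_bigr (fun j : 'I_N => (g k j * h j) * (x j / h j))); last first.
    by move=> j _; rewrite -mulrA -xE.
  apply: (@jensen_sum _ p p1 (fun j => g k j * h j) (fun j => x j / h j) _ xpredT) => //.
    by rewrite mulr_gt0.
  by move=> j; rewrite mulr_ge0 ?g_ge0// ltW.
apply: (@le_trans _ _ (\sum_(k < n) \sum_(j < N) (1 / 2) `^ (p - 1) *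
    (h j * (x j / h j) `^ p) * (g k j * (W k * h k `^ (p - 1))))).
  apply: ler_sum => k _; apply: le_trans (ler_wpM2r (ltW (W0 k)) (J k)) _.
  rewrite (powRM _ (ltW hf) (ltW (h0 k))) mulr_sumr mulr_suml.
  by rewrite le_eqVlt; apply/orP; left; apply/eqP; apply: eq_bigr => j _; ring.
rewrite exchange_big /= mulr_sumr; apply: ler_sum => j _; rewrite -mulr_sumr.
have c0 : 0 <= (1 / 2) `^ (p - 1) * (h j * (x j / h j) `^ p).
  by rewrite mulr_ge0 ?powR_ge0// mulr_ge0 ?powR_ge0// ltW.
apply: le_trans (ler_wpM2l c0 (cols j n)) _.
have pE (t : R) : 0 < t -> t `^ p = t `^ (p - 1) * t.
  by move=> t0; rewrite -[X in _ * X](powRr1 (ltW t0)) -(powR_add _ _ t0) subrK.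
rewrite [in leRHS]xE (powRM _ (ltW (h0 j)) (y0 j)) (pE _ (h0 j)) (pE _ hf).
by rewrite le_eqVlt; apply/orP; left; apply/eqP; ring.
Qed.

(** The constant comes from X <= 2^(p-1) La + X / 2. *)
Lemma maj_bound N n : \sum_(k < n) iter_maj N k `^ p * W k <= 2 `^ p * La.
Proof.
have p0 : p != 0 by rewrite gt_eqF// (lt_le_trans ltr01).
have la0 := La_ge0; have two0 : 0 < 2 :> R by rewrite ltr0n.
have hf : 0 < 1 / 2 :> R by lra.
elim: N n => [|N ih] n.
  rewrite big1 ?mulr_ge0 ?powR_ge0// => k _; by rewrite /= powR0// mul0r.
apply: (@le_trans _ _ (\sum_(k < n) 2 `^ (p - 1) * (normc (lam k) `^ p * W k +
    (\sum_(j < N) g k j * iter_maj N j) `^ p * W k))).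
  apply: ler_sum => k _; rewrite -mulrDl mulrA; apply: ler_wpM2r; first exact: ltW.
  apply: powR_addl_le => //; first exact: normc_ge0.
  by apply: sumr_ge0 => j _; rewrite mulr_ge0 ?g_ge0 ?maj_ge0.
rewrite -mulr_sumr big_split /=.
have sc := schur_contract N n (maj_ge0 N).
have q0 : 0 <= (1 / 2) `^ p :> R by exact: powR_ge0.
have b1 := le_trans sc (ler_wpM2l q0 (ih N)).
have e : (1 / 2) `^ p * (2 `^ p * La) = La.
  rewrite mulrA -(powRM _ (ltW hf) (ltW two0)); have -> : 1 / 2 * 2 = 1 :> R by field.
  by rewrite powR1 mul1r.
rewrite e in b1; have := lamW n => b2.
have -> : 2 `^ p * La = 2 `^ (p - 1) * (La + La).
  have -> : p = (p - 1) + 1 by ring.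
  by rewrite (powR_add _ _ two0) powRr1 ?(ltW two0)// addrK; ring.
by rewrite ler_wpM2l ?powR_ge0// lerD.
Qed.

Lemma maj_lim : exists L, forall k, incr_to (iter_maj^~ k) (L k).
Proof.
have H k : exists L, incr_to (iter_maj^~ k) L.
  apply: (@incr_lim _ _ (1 + 2 `^ p * La / W k)) => N; first exact: maj_inc.
  apply: le_trans (le_1_powR (maj_ge0 N k) p1) _; rewrite lerD2l ler_pdivlMr//.
  apply: le_trans (maj_bound N k.+1); rewrite big_ord_recr /= lerDr.
  by apply: sumr_ge0 => j _; rewrite mulr_ge0 ?powR_ge0// ltW.
by have [L hL] := choice H; exists L.
Qed.

(** The limit of the iteration. The equation passes to the limit because the
    remainder of row k is at most twice the increment still to come of the
    majorant. *)
Lemma neumann : exists mu : nat -> R[i],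
  (forall n, \sum_(k < n) normc (mu k) `^ p * W k <= 2 `^ p * La) /\
  forall k, cconv (fun n => \sum_(j < n) G k j * mu j) (lam k - mu k).
Proof.
have [L hL] := maj_lim.
have L0 k : 0 <= L k by have [h1 _] := hL k; exact: le_trans (maj_ge0 0 k) (h1 0%N).
have H k : exists l, forall n, normc (l - iter_mu n k) <= L k - iter_maj n k.
  exact: ccontrolled_lim (hL k) (mu_step^~ k).
have [mu hmu] := choice H; exists mu; split=> [n|k].
  have mL k : normc (mu k) <= L k.
    by have := hmu k 0%N; rewrite /= !subr0.
  apply: (@le_trans _ _ (\sum_(k < n) L k `^ p * W k)).
    apply: ler_sum => k _; apply: ler_wpM2r; first exact: ltW.
    apply: powR_le_base; [exact: le_trans ler01 p1|exact: normc_ge0|exact: mL].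
  apply/ler_addgt0Pr => e e0.
  pose c k := p * L k `^ (p - 1) * W k.
  have c0 k : 0 <= c k.
    by rewrite mulr_ge0 ?(ltW (W0 _))// mulr_ge0 ?powR_ge0// (le_trans ler01).
  have [N hN] := incr_sum (m := iter_maj) n hL c0 e0.
  apply: le_trans (lerD (maj_bound N n) (hN N (leqnn N))); rewrite -big_split /=.
  apply: ler_sum => k _; have Mk := maj_ge0 N k.
  have [Lk|Lk] := eqVneq (L k) 0.
    rewrite Lk powR0 ?mul0r; last by rewrite gt_eqF// (lt_le_trans ltr01).
    have [h1 _] := hL k; apply: addr_ge0; first by rewrite mulr_ge0 ?powR_ge0// ltW.
    by apply: mulr_ge0 => //; have := h1 N; rewrite Lk subr_ge0.
  have Lp : 0 < L k by rewrite lt_neqAle eq_sym Lk L0.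
  have := ler_wpM2r (ltW (W0 k)) (tangent_powR p1 Lp Mk).
  rewrite /c; set A := L k `^ p; set B := L k `^ (p - 1).
  have -> : (A + p * B * (iter_maj N k - L k)) * W k = A * W k - p * B * W k * (L k - iter_maj N k) by ring.
  lra.
have Lfix N : \sum_(j < N) g k j * L j <= L k - normc (lam k).
  apply/ler_addgt0Pr => e e0.
  have [N' hN'] := incr_sum (m := iter_maj) N hL (g_ge0 k) e0.
  have := hN' (maxn N' N) (leq_maxl _ _); set M := maxn N' N => s1.
  have [h1 _] := hL k; have := h1 M.+1; rewrite /= => s2.
  have s3 : \sum_(j < N) g k j * iter_maj M j <= \sum_(j < M) g k j * iter_maj M j.
    have -> : \sum_(j < M) g k j * iter_maj M j = \sum_(0 <= j < M) g k j * iter_maj M j by rewrite big_mkord.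
    have -> : \sum_(j < N) g k j * iter_maj M j = \sum_(0 <= j < N) g k j * iter_maj M j by rewrite big_mkord.
    rewrite (@big_cat_nat _ _ _ N 0 M) ?leq_maxr//= lerDl.
    by apply: sumr_ge0 => j _; rewrite mulr_ge0 ?g_ge0 ?maj_ge0.
  have s4 : \sum_(j < N) g k j * L j =
      \sum_(j < N) g k j * (L j - iter_maj M j) + \sum_(j < N) g k j * iter_maj M j.
    by rewrite -big_split /=; apply: eq_bigr => j _; ring.
  by rewrite s4; move: s1 s2 s3; lra.
apply: (@ctail_conv _ _ (fun n => 2 * iter_maj n.+1 k) (2 * L k)).
  have [h1 h2] := hL k; split=> [n|e e0]; first by rewrite ler_pM2l// ltr0n.
  have e2 : 0 < e / 2 by rewrite divr_gt0// ltr0n.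
  have [N hN] := h2 _ e2; exists N => n Nn; have := hN n.+1 (leqW Nn); lra.
move=> N; have -> : lam k - mu k - \sum_(j < N) G k j * mu j =
    - ((mu k - iter_mu N.+1 k) + \sum_(j < N) G k j * (mu j - iter_mu N j)).
  have -> : \sum_(j < N) G k j * (mu j - iter_mu N j) =
      \sum_(j < N) G k j * mu j - \sum_(j < N) G k j * iter_mu N j.
    by rewrite -sumrB; apply: eq_bigr => j _; rewrite mulrBr.
  by rewrite [iter_mu _.+1 _]/=; ring.
rewrite normc_opp; apply: le_trans (normcDle _ _) _.
have t1 : normc (\sum_(j < N) G k j * (mu j - iter_mu N j)) <= \sum_(j < N) g k j * (L j - iter_maj N j).
  apply: le_trans (normc_sum N (fun j => G k j * (mu j - iter_mu N j))) _.
  by apply: ler_sum => j _; rewrite normcM ler_wpM2l ?normc_ge0.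
have t2 : \sum_(j < N) g k j * (L j - iter_maj N j) =
    \sum_(j < N) g k j * L j - (iter_maj N.+1 k - normc (lam k)).
  rewrite [iter_maj _.+1 _]/= [normc _ + _]addrC addrK -sumrB.
  by apply: eq_bigr => j _; rewrite mulrBr.
have t3 := hmu k N.+1; have t4 := Lfix N.
move: t1 t2 t3 t4; set A := iter_maj N.+1 k; lra.
Qed.

End Neumann.

(** * Series of kernel functions *)

Section KernelSeries.
Context {R : realType}.
Notation CC := (Cplx R).
Variable alpha : nat -> R[i].
Hypothesis alpha1 : forall k, normc (alpha k) < 1.

Definition ek (z : R[i]) (j : nat) : R[i] := (1 - conjc (alpha j) * z)^-1.

Lemma ek_den z j : normc z < 1 -> 1 - conjc (alpha j) * z != 0.
Proof. by move=> z1; exact: pD_den. Qed.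

Lemma ek_le (z : R[i]) j (r : R) : r < 1 -> normc z <= r -> normc (ek z j) <= (1 - r)^-1.
Proof.
move=> r1 zr; have z1 : normc z < 1 := le_lt_trans zr r1.
have d0 := cden_gt0 z1 (alpha1 j).
rewrite /ek normcV -/(cden z (alpha j)) lef_pV2 ?posrE ?subr_gt0//.
have := normc_tri 1 (conjc (alpha j) * z); rewrite normc1 normcM normc_conj => /(le_trans (ler_norm _)).
rewrite -/(cden z (alpha j)); have : normc (alpha j) * normc z <= 1 * r.
  by apply: ler_pM; rewrite ?normc_ge0// ltW.
lra.
Qed.

(** Uniformity in the parameter makes termwise differentiation of the series
    immediate. *)
Lemma ek_taylor (z w : R[i]) j (r : R) : r < 1 -> normc z <= r -> normc w <= r ->
  normc (ek w j ^+ 3 - ek z j ^+ 3 - 3 * conjc (alpha j) * ek z j ^+ 4 * (w - z)) <=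
  6 * (1 - r)^-1 ^+ 5 * normc (w - z) ^+ 2.
Proof.
move=> r1 zr wr; set K := (1 - r)^-1.
have K0 : 0 <= K by rewrite invr_ge0 subr_ge0 ltW.
have zd := ek_den j (le_lt_trans zr r1); have wd := ek_den j (le_lt_trans wr r1).
have hz := ek_le j r1 zr; have hw := ek_le j r1 wr; rewrite -/K in hz hw.
have E : ek w j - ek z j = conjc (alpha j) * (w - z) * ek w j * ek z j.
  by rewrite /ek; field; rewrite zd wd.
move: hz hw E; set y := ek z j; set x := ek w j; set q := conjc (alpha j); set t := w - z => hz hw E.
have -> : x ^+ 3 - y ^+ 3 - 3 * q * y ^+ 4 * t =
    (x - y) * (x ^+ 2 + x * y + y ^+ 2) - 3 * q * y ^+ 4 * t by ring.
have -> : (x - y) * (x ^+ 2 + x * y + y ^+ 2) - 3 * q * y ^+ 4 * t =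
    q * t * y * ((x - y) * (x ^+ 2 + 2 * x * y + 3 * y ^+ 2)) by rewrite [in LHS]E; ring.
rewrite E; have -> : q * t * y * (q * t * x * y * (x ^+ 2 + 2 * x * y + 3 * y ^+ 2)) =
    (q * q) * ((x * y * y) * (x ^+ 2 + 2 * x * y + 3 * y ^+ 2)) * (t * t) by ring.
rewrite !normcM -!expr2.
have q1 : normc q ^+ 2 <= 1 by rewrite expr_le1 ?normc_ge0// normc_conj ltW.
have x0 := normc_ge0 x; have y0 := normc_ge0 y.
have b1 : normc x * normc y * normc y <= K * K * K.
  by apply: ler_pM => //; [exact: mulr_ge0|exact: ler_pM].
have b2 : normc (x ^+ 2 + 2 * x * y + 3 * y ^+ 2) <= 6 * (K * K).
  have s1 : normc (x ^+ 2) <= K * K by rewrite normcX expr2; exact: ler_pM.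
  have s2 : normc (2 * x * y) <= 2 * (K * K).
    have -> : 2 * x * y = (2 : R)%:C * (x * y) by rewrite mulrA rmorph_nat.
    by rewrite normcM normc_real ger0_norm ?ler0n// normcM ler_pM2l ?ltr0n//; exact: ler_pM.
  have s3 : normc (3 * y ^+ 2) <= 3 * (K * K).
    have -> : 3 * y ^+ 2 = (3 : R)%:C * y ^+ 2 by rewrite rmorph_nat.
    by rewrite normcM normc_real ger0_norm ?ler0n// normcX expr2 ler_pM2l ?ltr0n//; exact: ler_pM.
  apply: le_trans (normcDle _ _) _; have := normcDle (x ^+ 2) (2 * x * y); move: s1 s2 s3; clear -R; lra.
have -> : 6 * K ^+ 5 * normc t ^+ 2 = 1 * ((K * K * K) * (6 * (K * K))) * normc t ^+ 2 by ring.
apply: ler_wpM2r; first exact: sqr_ge0.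
have n1 : 0 <= normc x * normc y * normc y := mulr_ge0 (mulr_ge0 x0 y0) y0.
apply: ler_pM => //; first exact: sqr_ge0.
  exact: mulr_ge0 n1 (normc_ge0 _).
by apply: ler_pM => //; exact: normc_ge0.
Qed.

Variables (c : nat -> R[i]) (B : R).
Hypothesis cB : forall n, \sum_(j < n) normc (c j) <= B.

Let m n := \sum_(j < n) normc (c j).

Let m_lim : exists L, incr_to m L.
Proof.
apply: (@incr_lim _ _ B) => // n; rewrite /m (sum_recr (fun j => normc (c j))).
by rewrite lerDl normc_ge0.
Qed.

Lemma weighted_lim (L : R) (e : nat -> R[i]) (K : R) : incr_to m L -> (forall j, normc (e j) <= K) ->
  exists l, forall n, normc (l - \sum_(j < n) c j * e j) <= K * (L - m n).
Proof.
move=> mL eK; have K0 : 0 <= K := le_trans (normc_ge0 _) (eK 0%N).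
have mL' : incr_to (fun n => K * m n) (K * L).
  have [h1 h2] := mL; split=> [n|e' e0]; first exact: ler_wpM2l.
  have K1 : 0 < K + 1 by rewrite ltr_wpDl.
  have e1 : 0 < e' / (K + 1) by rewrite divr_gt0.
  have [N hN] := h2 _ e1; exists N => n Nn; rewrite -mulrBr.
  have := hN n Nn; rewrite ler_pdivlMr// => hh.
  have p0 : 0 <= L - m n by rewrite subr_ge0.
  by rewrite mulrDr mulr1 in hh; rewrite mulrC; move: hh p0; lra.
have [l hl] : exists l, forall n, normc (l - \sum_(j < n) c j * e j) <= K * L - K * m n.
  apply: ccontrolled_lim mL' _ => n.
  rewrite (sum_recr (fun j => c j * e j)) /m (sum_recr (fun j => normc (c j))).
  by rewrite addrAC subrr add0r mulrDr addrAC subrr add0r normcM mulrC ler_wpM2r ?normc_ge0.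
by exists l => n; rewrite mulrBr.
Qed.

(** The derivative is the series of derivatives; the quadratic remainder of
    [ek_taylor] is summable. *)
Lemma kernel_series : exists f : CC -> CC, (forall z : CC, normc z < 1 -> cdiff f z) /\
  forall z, normc z < 1 -> cconv (fun n => \sum_(j < n) c j * ek z j ^+ 3) (f z).
Proof.
have [L mL] := m_lim; have [mle mcv] := mL.
have Hf z : exists l, normc z < 1 -> forall n,
    normc (l - \sum_(j < n) c j * ek z j ^+ 3) <= (1 - normc z)^-1 ^+ 3 * (L - m n).
  have [z1|z1] := ltP (normc z) 1; last by exists 0.
  have [|l hl] := @weighted_lim L (fun j => ek z j ^+ 3) ((1 - normc z)^-1 ^+ 3) mL; last by exists l.
  move=> j; rewrite normcX ler_pXn2r ?nnegrE ?normc_ge0 ?invr_ge0 ?subr_ge0 ?(ltW z1)//.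
  exact: ek_le.
have [f hf] := choice Hf; exists f; split=> z z1; last first.
  move=> e e0; have K0 : 0 < (1 - normc z)^-1 ^+ 3 by rewrite exprn_gt0// invr_gt0 subr_gt0.
  have e1 : 0 < e / (1 - normc z)^-1 ^+ 3 by rewrite divr_gt0.
  have [N hN] := mcv _ e1; exists N => n Nn; apply: le_trans (hf z z1 n) _.
  by rewrite mulrC -ler_pdivlMr// hN.
pose r := (1 + normc z) / 2; have r1 : r < 1 by rewrite /r; lra.
have zr : normc z <= r by rewrite /r; lra.
pose K := (1 - r)^-1; have K0 : 0 < K by rewrite invr_gt0 subr_gt0.
have [|f' hf'] := @weighted_lim L (fun j => 3 * conjc (alpha j) * ek z j ^+ 4) (3 * K ^+ 4) mL.
  move=> j; have -> : 3 * conjc (alpha j) * ek z j ^+ 4 = (3 : R)%:C * (conjc (alpha j) * ek z j ^+ 4).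
    by rewrite mulrA rmorph_nat.
  rewrite normcM normc_real ger0_norm ?ler0n// ler_pM2l ?ltr0n// normcM normc_conj normcX.
  rewrite -[X in _ <= X]mul1r; apply: ler_pM; rewrite ?normc_ge0 ?exprn_ge0 ?normc_ge0// ?(ltW (alpha1 j))//.
  by rewrite ler_pXn2r ?nnegrE ?normc_ge0 ?(ltW K0)//; exact: ek_le.
have L0 : 0 <= L by have := mle 0%N; rewrite /m big_ord0.
pose A := 6 * K ^+ 5 * L.
have A0 : 0 <= A by rewrite mulr_ge0// mulr_ge0 ?ler0n// exprn_ge0// ltW.
apply: (@near_cdiff _ _ _ f') => e e0.
exists (Num.min ((1 - normc z) / 2) (e / (A + 1))).
  by rewrite lt_min !divr_gt0 ?subr_gt0// ltr_wpDl.
move=> w; rewrite lt_min => /andP[w1 w2].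
have wr : normc w <= r.
  by have := normc_tri w z => /(le_trans (ler_norm _)); rewrite /r; lra.
have wlt : normc w < 1 := le_lt_trans wr r1.
set t := normc (w - z); have t0 : 0 <= t := normc_ge0 _.
apply: (@le_trans _ _ (A * t ^+ 2)); last first.
  rewrite expr2 mulrA ler_wpM2r//; apply: (@le_trans _ _ ((A + 1) * t)).
    by rewrite ler_wpM2r// lerDl.
  by rewrite mulrC -ler_pdivlMr ?ltW// ltr_wpDl.
pose K1 := (1 - normc w)^-1 ^+ 3; pose K2 := (1 - normc z)^-1 ^+ 3; pose K3 := 3 * K ^+ 4 * t.
have K10 : 0 <= K1 by rewrite exprn_ge0// invr_ge0 subr_ge0 ltW.
have K20 : 0 <= K2 by rewrite exprn_ge0// invr_ge0 subr_ge0 ltW.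
have K30 : 0 <= K3 by rewrite mulr_ge0// mulr_ge0 ?ler0n// exprn_ge0// ltW.
have main n : normc (f w - f z - f' * (w - z)) <= A * t ^+ 2 + (K1 + K2 + K3) * (L - m n).
  set U := \sum_(j < n) c j * ek w j ^+ 3; set V := \sum_(j < n) c j * ek z j ^+ 3.
  set D := \sum_(j < n) c j * (3 * conjc (alpha j) * ek z j ^+ 4).
  have -> : f w - f z - f' * (w - z) =
     (f w - U) - (f z - V) - (f' - D) * (w - z) + (U - V - D * (w - z)) by ring.
  have e1 := hf w wlt n; have e2 := hf z z1 n; have e3 := hf' n.
  rewrite -/U -/K1 in e1; rewrite -/V -/K2 in e2; rewrite -/D in e3.
  have e4 : normc (U - V - D * (w - z)) <= A * t ^+ 2.
    have -> : U - V - D * (w - z) = \sum_(j < n) c j * (ek w j ^+ 3 - ek z j ^+ 3 -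
        3 * conjc (alpha j) * ek z j ^+ 4 * (w - z)).
      rewrite /U /V /D mulr_suml -!sumrB; apply: eq_bigr => j _; ring.
    apply: le_trans (normc_sum n (fun j => c j * (ek w j ^+ 3 - ek z j ^+ 3 -
        3 * conjc (alpha j) * ek z j ^+ 4 * (w - z)))) _.
    apply: (@le_trans _ _ (\sum_(j < n) normc (c j) * (6 * K ^+ 5 * t ^+ 2))).
      by apply: ler_sum => j _; rewrite normcM ler_wpM2l ?normc_ge0//; exact: ek_taylor.
    rewrite -mulr_suml; have -> : A * t ^+ 2 = L * (6 * K ^+ 5 * t ^+ 2) by rewrite /A; ring.
    apply: ler_wpM2r; last exact: mle.
    by rewrite mulr_ge0 ?sqr_ge0// mulr_ge0 ?ler0n// exprn_ge0// ltW.
  have e5 : normc ((f' - D) * (w - z)) <= K3 * (L - m n).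
    rewrite normcM /K3 -/t; have -> : 3 * K ^+ 4 * t * (L - m n) = 3 * K ^+ 4 * (L - m n) * t by ring.
    exact: ler_wpM2r.
  apply: le_trans (normcDle _ _) _; apply: le_trans (lerD (normcDle _ _) (lexx _)) _.
  apply: le_trans (lerD (lerD (normcDle _ _) (lexx _)) (lexx _)) _.
  rewrite !normc_opp (_ : A * t ^+ 2 + (K1 + K2 + K3) * (L - m n) =
     K1 * (L - m n) + K2 * (L - m n) + K3 * (L - m n) + A * t ^+ 2); last by ring.
  by do 3! apply: lerD => //.
apply/ler_addgt0Pr => e' e'0; pose KK := K1 + K2 + K3 + 1.
have KK0 : 0 < KK by rewrite ltr_wpDl// !addr_ge0.
have e1 : 0 < e' / KK by rewrite divr_gt0.
have [N hN] := mcv _ e1; apply: le_trans (main N) _; rewrite lerD2l.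
have := hN N (leqnn N); rewrite ler_pdivlMr// mulrC => hh; apply: le_trans hh.
by rewrite ler_wpM2r ?subr_ge0// /KK lerDl.
Qed.

End KernelSeries.

(** * Interpolation in the Bergman space *)

Section BergmanInterpolation.
Context {R : realType}.
Notation CC := (Cplx R).
Notation R2 := (Real2 R).
Variables (p : R) (alpha : nat -> R[i]) (eta : R).
Hypothesis p1 : 1 <= p.
Hypothesis alpha1 : forall k, normc (alpha k) < 1.
Hypothesis eta12 : eta <= 1 / 2.
Hypothesis sep : forall j k, j <> k -> pD (alpha j) (alpha k) <= eta.
Hypothesis eps12 : off_cst eta p <= 1 / 2.
Let a k := defect (alpha k).

Let a0 k : 0 < a k. Proof. exact: defect_gt0. Qed.

Let a1 k : a k <= 1.
Proof. by rewrite /a /defect gerBl sqr_ge0. Qed.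

Lemma row_cst_gt0 : 0 < row_cst p.
Proof.
have /andP[d0 _] := schur_exp_bnd p1; have := sum_cst_gt0 d0; rewrite /row_cst => h.
by rewrite mulr_gt0// ltr0n.
Qed.

Lemma area_cst_gt0 : 0 < area_cst p.
Proof.
have /andP[k0 _] := dual_exp_bnd p1; rewrite /area_cst mulr_gt0 ?ltr0n//; apply: kernel_cst_gt0; lra.
Qed.

Definition kernel_fun (z : R[i]) (j : nat) : R[i] := (a j ^+ 3)%:C * ek alpha z j ^+ 3.

Lemma normc_kernel_fun z j : normc (kernel_fun z j) = kernel_mod alpha z j.
Proof.
rewrite /kernel_fun normcM normc_real ger0_norm ?exprn_ge0 ?(ltW (a0 j))// normcX /ek normcV.
by rewrite /kernel_mod expr_div_n exprVn.
Qed.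

Lemma kernel_fun_diag k : kernel_fun (alpha k) k = 1.
Proof.
rewrite /kernel_fun /ek mulrC; have -> : 1 - conjc (alpha k) * alpha k = (a k)%:C.
  by rewrite mulrC mulcJ -[1](rmorph1 (real_complex R)) -rmorphB.
have nz : (a k)%:C != 0 :> R[i] by rewrite -normc_gt0 normc_real ger0_norm ?(ltW (a0 k)).
by rewrite rmorphXn -exprMn mulVf// expr1n.
Qed.

(** Jensen's inequality along the row of z, with the weights of [row_test]. *)
Lemma schur_point (mu : nat -> R[i]) (z : R[i]) n : normc z < 1 ->
  (\sum_(j < n) kernel_mod alpha z j * normc (mu j)) `^ p <=
  (row_cst p * defect z `^ (- schur_exp p)) `^ (p - 1) *
    \sum_(j < n) kernel_mod alpha z j * (a j `^ dual_exp p * normc (mu j) `^ p).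
Proof.
move=> z1; have b0 := defect_gt0 z1.
have T0 : 0 < row_cst p * defect z `^ (- schur_exp p) by rewrite mulr_gt0 ?row_cst_gt0 ?powR_gt0.
have v0 j : 0 <= kernel_mod alpha z j * a j `^ (- schur_exp p) by rewrite mulr_ge0 ?powR_ge0// kernel_mod_ge0.
have y0 j : 0 <= a j `^ schur_exp p * normc (mu j) by rewrite mulr_ge0 ?powR_ge0 ?normc_ge0.
have := jensen_sum (P := xpredT) p1 T0 v0 y0 (row_test alpha1 eta12 sep p1 n z1).
have E1 : \sum_(j < n) kernel_mod alpha z j * a j `^ (- schur_exp p) * (a j `^ schur_exp p * normc (mu j)) =
    \sum_(j < n) kernel_mod alpha z j * normc (mu j).
  apply: eq_bigr => j _; rewrite mulrA -[_ * _ `^ (- _) * _]mulrA -(powR_add _ _ (a0 j)).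
  by rewrite addNr powRr0 mulr1.
have E2 : \sum_(j < n) kernel_mod alpha z j * a j `^ (- schur_exp p) * (a j `^ schur_exp p * normc (mu j)) `^ p =
    \sum_(j < n) kernel_mod alpha z j * (a j `^ dual_exp p * normc (mu j) `^ p).
  apply: eq_bigr => j _; rewrite (powRM _ (powR_ge0 _ _) (normc_ge0 _)) -powRrM.
  have -> : dual_exp p = - schur_exp p + schur_exp p * p by rewrite /dual_exp; ring.
  by rewrite (powR_add _ _ (a0 j)) !mulrA.
by rewrite E1 E2.
Qed.

(** [schur_point] at z = 0, where the kernel functions have modulus (a
    j)^3. *)
Lemma coef_bound (mu : nat -> R[i]) (X : R) :
  (forall n, \sum_(k < n) normc (mu k) `^ p * a k ^+ 2 <= X) ->
  exists B, forall n, \sum_(j < n) normc (mu j * (a j ^+ 3)%:C) <= B.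
Proof.
move=> hX; exists (1 + row_cst p `^ (p - 1) * X) => n.
have z1 : normc (0 : R[i]) < 1 by rewrite normc0.
have b1 : defect (0 : R[i]) = 1 by rewrite /defect normc0 expr0n subr0.
have g0 j : kernel_mod alpha 0 j = a j ^+ 3.
  by rewrite /kernel_mod /cden mulr0 subr0 normc1 divr1.
have E : \sum_(j < n) normc (mu j * (a j ^+ 3)%:C) = \sum_(j < n) kernel_mod alpha 0 j * normc (mu j).
  apply: eq_bigr => j _; rewrite g0 normcM normc_real ger0_norm ?exprn_ge0 ?(ltW (a0 j))//.
  by rewrite mulrC.
have S0 : 0 <= \sum_(j < n) kernel_mod alpha 0 j * normc (mu j).
  by apply: sumr_ge0 => j _; rewrite mulr_ge0 ?normc_ge0// kernel_mod_ge0.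
rewrite E; apply: le_trans (le_1_powR S0 p1) _; rewrite lerD2l.
apply: le_trans (schur_point mu n z1) _; rewrite b1 powR1 mulr1.
apply: ler_wpM2l; first exact: powR_ge0.
apply: le_trans (hX n); apply: ler_sum => j _; rewrite g0.
have /andP[k0 _] := dual_exp_bnd p1; have aj : 0 < a j <= 1 by rewrite a0 a1.
have ak : a j `^ dual_exp p <= 1 by have := ger_powR aj k0; rewrite powRr0.
have a3 : a j ^+ 3 <= a j ^+ 2 by rewrite exprS ler_piMl ?a1// exprn_ge0// ltW.
have m0 : 0 <= normc (mu j) `^ p := powR_ge0 _ _.
rewrite mulrA mulrC ler_wpM2l// -[X in _ <= X]mulr1.
by apply: ler_pM; rewrite ?powR_ge0// exprn_ge0// ltW.
Qed.

(** [neumann] for the matrix of the values g_j(alpha k) with the diagonal,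
    which is 1, removed. *)
Lemma coefficients (lam : nat -> R[i]) (La : R) :
  (forall n, \sum_(k < n) normc (lam k) `^ p * a k ^+ 2 <= La) ->
  exists mu : nat -> R[i], (forall n, \sum_(k < n) normc (mu k) `^ p * a k ^+ 2 <= 2 `^ p * La) /\
    forall k, cconv (fun n => \sum_(j < n) mu j * kernel_fun (alpha k) j) (lam k).
Proof.
move=> hl; pose G k j : R[i] := if j == k then 0 else kernel_fun (alpha k) j.
have gG n (F : nat -> R) k : \sum_(j < n) normc (G k j) * F j =
    \sum_(j < n | (j : nat) != k) kernel_mod alpha (alpha k) j * F j.
  rewrite [RHS]big_mkcond; apply: eq_bigr => j _; rewrite /G.
  by case: eqVneq => _; rewrite ?normc0 ?mul0r ?normc_kernel_fun.
have gG2 n (F : nat -> R) j : \sum_(k < n) normc (G k j) * F k =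
    \sum_(k < n | (k : nat) != j) kernel_mod alpha (alpha k) j * F k.
  rewrite [RHS]big_mkcond; apply: eq_bigr => k _; rewrite /G eq_sym.
  by case: eqVneq => _; rewrite ?normc0 ?mul0r ?normc_kernel_fun.
(* The weights a^2 of the norm and a^(-schur_exp) of the test combine into the
   exponent of the column test. *)
have hE k : a k ^+ 2 * (a k `^ (- schur_exp p)) `^ (p - 1) = a k `^ (2 - dual_exp p).
  rewrite -powRrM (powR_add _ _ (a0 k)) (powR_mulrn 2 (ltW (a0 k))).
  by congr (_ * _ `^ _); rewrite /dual_exp; ring.
have rows k n : \sum_(j < n) normc (G k j) * a j `^ (- schur_exp p) <= 1 / 2 * a k `^ (- schur_exp p).
  rewrite (gG n (fun j => a j `^ (- schur_exp p)) k); apply: le_trans (row_test_off alpha1 eta12 sep p1 k n) _.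
  by apply: ler_wpM2r => //; exact: powR_ge0.
have cols j n : \sum_(k < n) normc (G k j) * (a k ^+ 2 * (a k `^ (- schur_exp p)) `^ (p - 1)) <=
    1 / 2 * (a j ^+ 2 * (a j `^ (- schur_exp p)) `^ (p - 1)).
  rewrite (gG2 n (fun k => a k ^+ 2 * (a k `^ (- schur_exp p)) `^ (p - 1)) j) hE.
  under eq_bigr do rewrite hE.
  apply: le_trans (col_test_off alpha1 eta12 sep p1 j n) _.
  by apply: ler_wpM2r => //; exact: powR_ge0.
have h0 k : 0 < a k `^ (- schur_exp p) by exact: powR_gt0.
have W0 k : 0 < a k ^+ 2 by exact: exprn_gt0.
have [mu [mu1 mu2]] := neumann p1 h0 W0 rows cols hl; exists mu; split=> // k e e0.
have [N hN] := mu2 k e e0; exists (maxn N k.+1) => n; rewrite geq_max => /andP[nN nk].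
have -> : \sum_(j < n) mu j * kernel_fun (alpha k) j = \sum_(j < n) G k j * mu j + mu k.
  rewrite (bigD1 (Ordinal nk))//= kernel_fun_diag mulr1 addrC; congr (_ + _).
  rewrite [RHS](bigD1 (Ordinal nk))//= {1}/G eqxx mul0r add0r.
  apply: eq_bigr => j jk; rewrite mulrC /G ifN//.
by have := hN n nN; rewrite addrAC -addrA -opprD.
Qed.

Definition bergman_cst : R := (row_cst p `^ (p - 1) * area_cst p * 2 `^ p) `^ p^-1.

Lemma cconv_unique (u : nat -> R[i]) l l' : cconv u l -> cconv u l' -> l = l'.
Proof.
move=> h h'; apply/eqP; rewrite -subr_eq0 -normc_eq0 eq_le normc_ge0 andbT.
apply/ler_addgt0Pr => e e0; rewrite add0r; have e2 : 0 < e / 2 by rewrite divr_gt0// ltr0n.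
have [N hN] := h _ e2; have [N' hN'] := h' _ e2.
have x1 := hN _ (leq_maxl N N'); have x2 := hN' _ (leq_maxr N N').
have -> : l - l' = (l - u (maxn N N')) - (l' - u (maxn N N')) by ring.
apply: le_trans (normcDle _ _) _; rewrite normc_opp; lra.
Qed.

(** [schur_point] in the limit. *)
Lemma pow_le_series (mu : nat -> R[i]) (z l : R[i]) : normc z < 1 ->
  cconv (fun n => \sum_(j < n) mu j * kernel_fun z j) l ->
  ((normc l `^ p)%:E <= \sum_(0 <= j <oo) (row_cst p `^ (p - 1) * (a j `^ dual_exp p * normc (mu j) `^ p) *
     (kernel_mod alpha z j * defect z `^ (- dual_exp p)))%:E)%E.
Proof.
move=> z1 hl; have b0 := defect_gt0 z1.
pose t (j : nat) : \bar R := (row_cst p `^ (p - 1) * (a j `^ dual_exp p * normc (mu j) `^ p) *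
  (kernel_mod alpha z j * defect z `^ (- dual_exp p)))%:E.
rewrite -[X in (_ <= X)%E]/(\sum_(0 <= j <oo) t j)%E.
have t0 j : (0 <= t j)%E.
  rewrite lee_fin; apply: mulr_ge0; last by rewrite mulr_ge0 ?powR_ge0// kernel_mod_ge0.
  by rewrite mulr_ge0 ?powR_ge0// mulr_ge0 ?powR_ge0.
set S := (\sum_(0 <= j <oo) t j)%E.
have S0 : (0 <= S)%E by apply: nneseries_ge0.
have [Sf|Si] := ltP S +oo%E; last by apply: le_trans Si; exact: leey.
have SE : S = (fine S)%:E by rewrite fineK// ge0_fin_numE.
have s0 : 0 <= fine S by rewrite -lee_fin -SE.
have p0 : 0 < p := lt_le_trans ltr01 p1.
have pi0 : 0 <= p^-1 by rewrite invr_ge0 ltW.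
have bd n : normc (\sum_(j < n) mu j * kernel_fun z j) <= fine S `^ p^-1.
  set V := \sum_(j < n) kernel_mod alpha z j * normc (mu j).
  have V0 : 0 <= V by apply: sumr_ge0 => j _; rewrite mulr_ge0 ?normc_ge0// kernel_mod_ge0.
  have UV : normc (\sum_(j < n) mu j * kernel_fun z j) <= V.
    apply: le_trans (normc_sum n (fun j => mu j * kernel_fun z j)) _.
    by apply: ler_sum => j _; rewrite normcM normc_kernel_fun mulrC.
  apply: le_trans UV _; have -> : V = (V `^ p) `^ p^-1.
    by rewrite -powRrM divff ?powRr1// gt_eqF.
  apply: powR_le_base => //; first exact: powR_ge0.
  rewrite -lee_fin -SE; apply: le_trans (nneseries_lim_ge n _); last by move=> j _ _; exact: t0.
  rewrite big_mkord sumEFin lee_fin; apply: le_trans (schur_point mu n z1) _.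
  rewrite (powRM _ (ltW row_cst_gt0) (powR_ge0 _ _)) -powRrM mulr_sumr.
  have -> : - schur_exp p * (p - 1) = - dual_exp p by rewrite /dual_exp; ring.
  by rewrite le_eqVlt; apply/orP; left; apply/eqP; apply: eq_bigr => j _; ring.
have lb : normc l <= fine S `^ p^-1.
  apply/ler_addgt0Pr => e e0; have [N hN] := hl e e0.
  have -> : l = (l - \sum_(j < N) mu j * kernel_fun z j) + \sum_(j < N) mu j * kernel_fun z j by rewrite subrK.
  by apply: le_trans (normcDle _ _) _; have := hN N (leqnn N); have := bd N; lra.
rewrite SE lee_fin; have -> : fine S = (fine S `^ p^-1) `^ p.
  by rewrite -powRrM mulVf ?powRr1// gt_eqF.
by apply: powR_le_base => //; [exact: ltW|exact: normc_ge0].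
Qed.

Lemma measurable_kernel_mod j : measurable_fun setT (fun w : R2 => kernel_mod alpha (ofR2 w) j).
Proof.
apply: measurable_funX; apply: measurable_funM; first exact: measurable_cst.
have := measurable_inv_ge0 (@measurable_cden R (alpha j)) (fun x => normc_ge0 _).
by under eq_fun do rewrite cdenC.
Qed.

(** Integrate [pow_le_series] term by term, with [col_test_int]. *)
Lemma bergman_norm (f : CC -> CC) (mu : nat -> R[i]) (X : R) :
  (forall z : CC, normc z < 1 -> cdiff f z) ->
  (forall z, normc z < 1 -> cconv (fun n => \sum_(j < n) mu j * kernel_fun z j) (f z)) ->
  (forall n, \sum_(k < n) normc (mu k) `^ p * a k ^+ 2 <= X) ->
  (\int[area]_(x in [set x : R2 | disc (ofR2 x)]) (normc (f (ofR2 x)) `^ p)%:E <=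
    (row_cst p `^ (p - 1) * area_cst p * X)%:E)%E.
Proof.
move=> df cf hX; have p0 : 0 < p := lt_le_trans ltr01 p1.
pose k0 j : R := row_cst p `^ (p - 1) * (a j `^ dual_exp p * normc (mu j) `^ p).
have k00 j : 0 <= k0 j by rewrite mulr_ge0 ?powR_ge0// mulr_ge0 ?powR_ge0.
pose F j (w : R2) : R := \1_idisc w * (kernel_mod alpha (ofR2 w) j * defect (ofR2 w) `^ (- dual_exp p)).
have F0 j w : 0 <= F j w.
  rewrite /F indicE; have [wD|_] := boolP (w \in idisc); last by rewrite mul0r.
  by rewrite mul1r; apply: mulr_ge0; [exact: (kernel_mod_ge0 alpha1 j (set_mem wD))|exact: powR_ge0].
have mF j : measurable_fun setT (fun w => (F j w)%:E).
  apply/measurable_EFinP; apply: measurable_funM; first by apply: measurable_indic; exact: measurable_idisc.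
  apply: measurable_funM; first exact: measurable_kernel_mod.
  exact: (measurableT_comp (measurable_powR _) (@measurable_defect R)).
have mf := cmeas_normc (cmeas_disccut df).
have step1 : (\int[area]_(x in [set x : R2 | disc (ofR2 x)]) (normc (f (ofR2 x)) `^ p)%:E <=
    \int[area]_w \sum_(0 <= j <oo) ((k0 j)%:E * (F j w)%:E))%E.
  have -> : (\int[area]_(x in [set x : R2 | disc (ofR2 x)]) (normc (f (ofR2 x)) `^ p)%:E =
     \int[area]_x (\1_idisc x * normc (disccut f x) `^ p)%:E)%E.
    rewrite integral_mkcond; apply: eq_integral => x _; rewrite /patch indicE.
    rewrite (_ : (x \in [set x : R2 | disc (ofR2 x)]) = (x \in idisc))//.
    have [xD|_] := boolP (x \in idisc); last by rewrite mul0r.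
    by rewrite mul1r /disccut (set_mem xD : normc (ofR2 x) < 1).
  apply: ge0_le_integral; first exact: measurableT.
  - by move=> x _; rewrite lee_fin mulr_ge0 ?powR_ge0.
  - apply/measurable_EFinP; apply: measurable_funM; first by apply: measurable_indic; exact: measurable_idisc.
    exact: (measurableT_comp (measurable_powR _) mf).
  - apply: ge0_emeasurable_sum => [j w _ _|j _]; first by rewrite -EFinM lee_fin mulr_ge0.
    by apply: emeasurable_funM => //; exact: measurable_cst.
  move=> w _; have [wD|nD] := boolP (w \in idisc); last first.
    rewrite indicE (negbTE nD) mul0r; apply: nneseries_ge0 => j _ _.
    by rewrite -EFinM lee_fin mulr_ge0.
  have w1 : normc (ofR2 w) < 1 := set_mem wD.
  rewrite indicE wD mul1r /disccut w1; apply: le_trans (pow_le_series w1 (cf _ w1)) _.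
  apply: lee_nneseries => [j _ _|j _].
    by rewrite lee_fin; apply: mulr_ge0; [exact: k00|rewrite mulr_ge0 ?powR_ge0// kernel_mod_ge0].
  by rewrite -EFinM lee_fin /F indicE wD mul1r.
apply: le_trans step1 _; rewrite integral_nneseries; last 3 first.
- exact: measurableT.
- by move=> j; apply: emeasurable_funM => //; exact: measurable_cst.
- by move=> j w _; rewrite -EFinM lee_fin mulr_ge0.
apply: lime_le.
  apply: is_cvg_nneseries => j _ _; apply: integral_ge0 => w _.
  by rewrite -EFinM lee_fin mulr_ge0.
apply: nearW => n; rewrite big_mkord.
have c0 : 0 <= row_cst p `^ (p - 1) * area_cst p by rewrite mulr_ge0 ?powR_ge0// ltW// area_cst_gt0.
apply: (@le_trans _ _ (\sum_(j < n) (row_cst p `^ (p - 1) * area_cst p * (normc (mu j) `^ p * a j ^+ 2))%:E)%E).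
  apply: lee_sum => j _.
  rewrite (ge0_integralZl area measurableT (mF j)); [|by move=> x _; rewrite lee_fin|by rewrite lee_fin].
  have kj : (0 <= (k0 j)%:E)%E by rewrite lee_fin.
  apply: le_trans (lee_wpmul2l kj (col_test_int alpha1 p1 j)) _.
  rewrite -EFinM lee_fin le_eqVlt; apply/orP; left; apply/eqP; rewrite /k0 -/(a j).
  have -> : a j ^+ 2 = a j `^ dual_exp p * a j `^ (2 - dual_exp p).
    rewrite -(powR_add _ _ (a0 j)) -[LHS](powR_mulrn 2 (ltW (a0 j))); congr (_ `^ _); ring.
  ring.
by rewrite sumEFin lee_fin -mulr_sumr ler_wpM2l.
Qed.

(** Separation by a small eta makes the matrix of [coefficients] a
    contraction; the constant depends on p only. *)
Lemma bergman_interpolation : Ap_interpolating_with p alpha bergman_cst.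
Proof.
move=> lam lfin; have p0 : 0 < p := lt_le_trans ltr01 p1.
have pi0 : 0 <= p^-1 by rewrite invr_ge0 ltW.
pose t k : \bar R := (normc (lam k) `^ p * (1 - normc (alpha k) ^+ 2) ^+ 2)%:E.
have t0 k : (0 <= t k)%E by rewrite lee_fin mulr_ge0 ?powR_ge0 ?sqr_ge0.
pose S : \bar R := (\sum_(0 <= k <oo) t k)%E.
have S0 : (0 <= S)%E by apply: nneseries_ge0.
have Sf : (S < +oo)%E.
  rewrite ltey; apply/eqP => SE; move: lfin; rewrite /seqA_norm -/S SE poweRyr ?ltxx//.
  by rewrite invr_eq0 gt_eqF.
pose La := fine S; have SE : S = La%:E by rewrite fineK// ge0_fin_numE.
have hl n : \sum_(k < n) normc (lam k) `^ p * a k ^+ 2 <= La.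
  rewrite -lee_fin -SE -sumEFin; apply: le_trans (nneseries_lim_ge n _); last by move=> k _ _; exact: t0.
  by rewrite big_mkord.
have [mu [mu1 mu2]] := coefficients hl.
have [B hB] := coef_bound mu1.
have [f [df cf]] := @kernel_series R alpha alpha1 (fun j => mu j * (a j ^+ 3)%:C) B hB.
have cf' z : normc z < 1 -> cconv (fun n => \sum_(j < n) mu j * kernel_fun z j) (f z).
  move=> z1 e e0; have [N hN] := cf z z1 e e0; exists N => n Nn.
  have := hN n Nn; rewrite (eq_bigr (fun j : 'I_n => mu j * kernel_fun z j))// => j _.
  by rewrite /kernel_fun mulrA.
have bn := bergman_norm df cf' mu1.
have nb : (Ap_norm p f <= bergman_cst%:E * seqA_norm p alpha lam)%E.
  have La0 : 0 <= La by rewrite -lee_fin -SE.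
  have c0 : 0 <= row_cst p `^ (p - 1) * area_cst p * 2 `^ p.
    by rewrite mulr_ge0 ?powR_ge0// mulr_ge0 ?powR_ge0// ltW// area_cst_gt0.
  rewrite /seqA_norm -/S SE poweR_EFin -EFinM /bergman_cst -(powRM _ c0 La0) -poweR_EFin /Ap_norm.
  rewrite -mulrA; apply: gt0_ler_poweR => //.
  - by rewrite in_itv /= leey andbT; apply: integral_ge0 => x _; rewrite lee_fin powR_ge0.
  - rewrite in_itv /= leey andbT lee_fin mulr_ge0//; last by rewrite mulr_ge0 ?powR_ge0.
    by rewrite mulr_ge0 ?powR_ge0// ltW// area_cst_gt0.
exists f; split => //; last by move=> k; exact: cconv_unique (cf' _ (alpha1 k)) (mu2 k).
split; first by move=> z z1; exact: df.
apply: le_lt_trans nb _; rewrite /seqA_norm -/S SE poweR_EFin -EFinM; exact: ltry.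
Qed.

End BergmanInterpolation.

(** * The theorem *)

Section Conclusion.
Context {R : realType}.

Lemma small_eta (p : R) : 1 <= p -> exists eta : R, [/\ 0 < eta, eta <= 1 / 2 & off_cst eta p <= 1 / 2].
Proof.
move=> p1; have /andP[d0 d4] := schur_exp_bnd p1; have /andP[k0 k4] := dual_exp_bnd p1.
set K := 4 * (sum_cst (schur_exp p / 2) + sum_cst (1 + dual_exp p - schur_exp p / 2)).
have K0 : 0 < K.
  by rewrite mulr_gt0 ?ltr0n// addr_gt0//; apply: sum_cst_gt0; move: d0 d4 k0; clear; lra.
have t0 : 0 < (2 * K)^-1 by rewrite invr_gt0 mulr_gt0// ltr0n.
set s := schur_exp p / 2; have s0 : 0 < s by rewrite divr_gt0// ltr0n.
have [u u0 us] : exists2 u : R, 0 < u & u `^ s = (2 * K)^-1.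
  exists ((2 * K)^-1 `^ s^-1); first exact: powR_gt0.
  by rewrite -powRrM mulVf ?powRr1 ?(ltW t0)// gt_eqF.
exists (Num.min (1 / 2) u).
have m0 : 0 < Num.min (1 / 2) u by rewrite lt_min u0 andbT divr_gt0// ltr0n.
have m1 : Num.min (1 / 2) u <= 1 / 2 by rewrite ge_min lexx.
have m2 : Num.min (1 / 2) u <= u by rewrite ge_min lexx orbT.
split=> //.
have h : Num.min (1 / 2) u `^ s <= (2 * K)^-1 by rewrite -us; exact: powR_le_base (ltW s0) (ltW m0) m2.
apply: le_trans (ler_wpM2r (ltW K0) h) _.
by rewrite le_eqVlt; apply/orP; left; apply/eqP; field; rewrite gt_eqF.
Qed.

Lemma bergman_cst_gt0 (p : R) : 1 <= p -> 0 < bergman_cst p.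
Proof.
move=> p1; have c2 := area_cst_gt0 p1; have p2 : 0 < 2 `^ p :> R by rewrite powR_gt0// ltr0n.
have c1 : 0 < row_cst p `^ (p - 1) := powR_gt0 _ (row_cst_gt0 p1).
exact: powR_gt0 _ (mulr_gt0 (mulr_gt0 c1 c2) p2).
Qed.

End Conclusion.

Theorem theorem1p3 (R : realType) (p : R) (hp : 1 <= p) :
  exists (a : nat -> Cplx2 R) (C : R),
    [/\ 0 < C,
        forall k, ball2 (a k),
        forall (sigma : nat -> Cplx R) (phi : Cplx R -> Cplx2 R),
          disc_through a sigma phi -> Ap_interpolating_with p sigma C
      & ~ Hp_interpolating p a].
Proof.
have [eta [eta0 eta12 epsh]] := small_eta hp.
have eta01 : 0 < eta < 1 by rewrite eta0 (le_lt_trans eta12)//; lra.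
have [a [a1 a0 sep [c c0 hc]]] := separated_net eta01.
exists a, (bergman_cst p); split.
- exact: bergman_cst_gt0 hp.
- by move=> k; apply/ball2E.
- move=> sigma phi [s1 hphi ball_phi phis].
  apply: (bergman_interpolation hp s1 eta12 _ epsh) => j k jk.
  have ball_phi' z : normc z < 1 -> nsq (phi z) < 1 by move=> z1; apply/ball2E; exact: ball_phi.
  by apply: le_trans (sep j k jk); rewrite -!phis; exact: schwarz_pick hphi ball_phi' (s1 j) (s1 k).
- exact: net_not_interpolating hp a1 a0 c0 hc.
Qed.
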